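(* Let $a>0$ and $\max(\tfrac12,\,2a-\tfrac12)<c<2a+\tfrac12$, where additionally $0<a<\tfrac12$ is required in the case $c=\tfrac12$. Let $\{a_n\}_{n\ge1}$ be a complex sequence such that for some $\delta\in[0,\pi/2)$ $$\sum_{m=1}^\infty \frac{|a_m|\,e^{-\delta m}}{|\Gamma(a+\tfrac{im}{2})|^2}<\infty,$$ and define, for $x>0$, $$f(x)=\sum_{n=1}^\infty a_n\,{}_2F_1\!\left(a+\tfrac{in}{2},\;a-\tfrac{in}{2};\;c;\;-x^2\right).$$ Then for every $n\in\mathbb{N}$, $$a_n=\frac{4^{a-c}}{\pi^2}\,\Gamma(2(c-a)+1)\left|\frac{\Gamma(a+\tfrac{in}{2})}{\Gamma(c)}\right|^2\sinh(\pi n)\int_0^\infty x^{2c-1}\,\Phi_n(x)\,f(x)\,dx,$$ where the integral converges absolutely and $$\Phi_n(x)=\int_{-\pi}^{\pi}{}_2F_1\!\left(c-a+\tfrac12,\;c-a+1;\;c;\;-\frac{x^2}{\cosh^2 u}\right)\frac{\tanh(u)\,\sin(nu)}{[\cosh u]^{2(c-a)}}\,du,\qquad x>0.$$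
   Context: ${}_2F_1(\alpha,\beta;\gamma;z)$ denotes the Gauss hypergeometric function (analytically continued to $z\in(-\infty,0]$), $\Gamma$ is Euler's gamma function, and $i$ is the imaginary unit. *)

(* Defs.v *)
From Stdlib Require Import Reals.
From Coquelicot Require Import Coquelicot.
From Stdlib Require Import Factorial.

Open Scope R_scope.

Definition cpow (r : R) (s : C) : C :=
  Cmult (RtoC (exp (Re s * ln r))) (cos (Im s * ln r), sin (Im s * ln r)).

Fixpoint cpoch (s : C) (k : nat) : C :=
  match k with
  | O => RtoC 1
  | S k' => Cmult (cpoch s k') (Cplus s (RtoC (INR k')))
  end.

Definition CSeries (u : nat -> C) : C :=
  (Series (fun k => Re (u k)), Series (fun k => Im (u k))).

Definition hyp_term (al be ga : C) (w : R) (k : nat) : C :=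
  Cmult (Cdiv (Cmult (cpoch al k) (cpoch be k))
              (Cmult (cpoch ga k) (RtoC (INR (fact k)))))
        (RtoC (w ^ k)).

(* Gauss hypergeometric function 2F1(al,be;ga;z) for real z <= 0, i.e. the
   analytic continuation of the power series to (-oo,0], given by the
   Pfaff transformation  2F1(al,be;ga;z) = (1-z)^(-al) 2F1(al,ga-be;ga;z/(z-1)),
   where z/(z-1) lies in [0,1) so the series converges. *)
Definition F21 (al be ga : C) (z : R) : C :=
  Cmult (cpow (1 - z) (Copp al))
        (CSeries (hyp_term al (Cminus ga be) ga (z / (z - 1)))).

Definition CGamma (s : C) : C :=
  RInt_gen (V := C_R_CompleteNormedModule)
    (fun t => Cmult (cpow t (Cminus s (RtoC 1))) (RtoC (exp (- t))))
    (at_right 0) (Rbar_locally p_infty).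

Definition RGamma (x : R) : R :=
  RInt_gen (fun t => Rpower t (x - 1) * exp (- t))
    (at_right 0) (Rbar_locally p_infty).

Definition fser (an : nat -> C) (a c : R) (x : R) : C :=
  CSeries (fun k => Cmult (an (S k))
     (F21 (a, INR (S k) / 2) (a, - (INR (S k) / 2)) (RtoC c) (- (x ^ 2)))).

Definition Phi (a c : R) (n : nat) (x : R) : C :=
  RInt (V := C_R_CompleteNormedModule)
    (fun u => Cmult (F21 (RtoC (c - a + 1/2)) (RtoC (c - a + 1)) (RtoC c)
                         (- (x ^ 2) / (cosh u) ^ 2))
                    (RtoC (tanh u * sin (INR n * u) / Rpower (cosh u) (2 * (c - a)))))
    (- PI) PI.

(* Main.v *)
(* Write [d = c - a] and let [u(x, p) = p^(-2d-1) F(d+1/2, d+1; c; -x^2/p^2)],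
   [v(x, q) = q^(-2a) F(a+1/2, a; c; -x^2/q^2)] and [F_m(x) = F(a+im/2, a-im/2; c; -x^2)]; then
   [Phi_n(x)] is the integral of [sin(nu) sinh(u) u(x, cosh u)] over [-pi, pi].

   1. [int x^(2c-1) u(x, p) v(x, q) dx = k / (p + q)]. By homogeneity take [p = 1]; the integral
      multiplied by [1 - q^2] has second [q]-derivative zero, because the integrand of that derivative
      is exact in [x]. An affine function is fixed by its values at [q = 1] and [q -> 0+].
   2. [int_0^oo cos(mv) v(x, cosh v) dv = beta_m F_m(x)]: both sides solve the hypergeometric
      equation in [-x^2] and agree at 0; an energy estimate gives uniqueness, and also that [F_m]
      is real and bounded by [K (1 + x^2)^(-a)] uniformly in [m].
   3. [int_0^oo cos(mv) sinh(u) / (cosh v + cosh u) dv = pi sin(mu) / sinh(pi m)], from the ordinary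
      differential equations in [u] (and in the dual angle) satisfied by the truncated integrals.
   4. Hence [int x^(2c-1) Phi_n F_m dx] is a multiple of [int_{-pi}^{pi} sin(nu) sin(mu) du], and the
      series for [f] integrates term by term: [|Gamma(a+im/2)|^2] decays like [e^(-pi m/2)] up to a
      power of [m], so the hypothesis makes [sum |a_m|] finite.
   5. The constant is evaluated from Gauss's limit for Gamma, Legendre's duplication formula and
      [|Gamma(a+ib)|^2 / Gamma(a)^2 = beta_b / beta_0], which holds since both sides obey the same
      recurrence in [a] and tend to 1. *)

Require Import Defs.
From Stdlib Require Import Reals Lra Lia Factorial.
From Coquelicot Require Import Coquelicot.
Open Scope R_scope.

(** * Parametric and improper integrals *)

(** The parameters [a + im/2] and [a - im/2] are conjugate, so the equation of [F_m] has real
    coefficients, and real-variable arguments (energy inequalities, truncation with explicit tails)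
    take the place of contour integrals and connection formulas. The kernels [u] and [v] both have
    the shape [r^(-2s) F(s + 1/2, s; c; -x^2/r^2)], which makes [v] a solution of
    [v_qq + v_xx + ((2c-1)/x) v_x = 0]: this is why the product integral collapses to an elementary
    function of [p + q], and why [p = cosh u], [q = cosh v] lead to a Poisson-type kernel. The
    behaviour of [u] and [v] at infinity enters only through limits [La], [Ld] of coefficient
    ratios; these stay abstract until Gauss's limit supplies their values. The integrals over [x]
    and over the unbounded variable [v] are exchanged by cutting [v] at [T]: the cut integral
    satisfies the hypergeometric equation up to a boundary term, the energy inequality tolerates
    such a residual, and a tail bound with decay in both [T] and [x] lets [T] grow. All bounds on
    [F_m] must be uniform in [m], because the series is integrated term by term. *)

Lemma locally_open_interval (lo hi x : R) (P : R -> Prop) :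
  lo < x < hi -> (forall y, lo < y < hi -> P y) -> locally x P.
Proof.
  intros Hx HP.
  assert (Hd : 0 < Rmin (x - lo) (hi - x)) by (apply Rmin_glb_lt; lra).
  exists (mkposreal _ Hd). intros y Hy. apply HP.
  apply (Rabs_def2 (y - x)) in Hy. simpl in Hy.
  pose proof (Rmin_l (x - lo) (hi - x)). pose proof (Rmin_r (x - lo) (hi - x)). lra.
Qed.

Lemma continuity_2d_pt_slice_r (f : R -> R -> R) (x t : R) :
  continuity_2d_pt f x t -> continuous (f x) t.
Proof.
  intros H. apply continuity_pt_filterlim. intros eps Heps.
  destruct (H (mkposreal _ Heps)) as [d Hd].
  exists d. split. apply cond_pos.
  intros y [_ Hy]. apply Hd. rewrite Rminus_diag, Rabs_R0; apply cond_pos. exact Hy.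
Qed.

Lemma continuity_2d_pt_swap (f : R -> R -> R) (x t : R) :
  continuity_2d_pt f x t -> continuity_2d_pt (fun u v => f v u) t x.
Proof.
  intros H eps. destruct (H eps) as [d Hd]. exists d. intros u v Hu Hv. now apply Hd.
Qed.

Lemma continuity_2d_pt_comp1 (g : R -> R) (f : R -> R -> R) (x t : R) :
  continuous g (f x t) -> continuity_2d_pt f x t -> continuity_2d_pt (fun u v => g (f u v)) x t.
Proof.
  intros Hg Hf. apply continuity_1d_2d_pt_comp; trivial.
  now apply continuity_pt_filterlim.
Qed.

Lemma continuity_2d_pt_fst (g : R -> R) (x t : R) :
  continuous g x -> continuity_2d_pt (fun u _ => g u) x t.
Proof. intros H. apply (continuity_2d_pt_comp1 g (fun u _ => u)); trivial. apply continuity_2d_pt_id1. Qed.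

Lemma continuity_2d_pt_snd (g : R -> R) (x t : R) :
  continuous g t -> continuity_2d_pt (fun _ v => g v) x t.
Proof. intros H. apply (continuity_2d_pt_comp1 g (fun _ v => v)); trivial. apply continuity_2d_pt_id2. Qed.

Lemma is_derive_continuous (f : R -> R) (x l : R) : is_derive f x l -> continuous f x.
Proof. intros H. apply (ex_derive_continuous f x). now exists l. Qed.

Lemma RInt_abs_le_const (f : R -> R) (a b M : R) :
  a <= b -> (forall t, a <= t <= b -> continuous f t) ->
  (forall t, a <= t <= b -> Rabs (f t) <= M) -> Rabs (RInt f a b) <= M * (b - a).
Proof.
  intros Hab Hc Hb.
  assert (E : ex_RInt f a b).
  { apply (@ex_RInt_continuous R_CompleteNormedModule).
    intros t Ht. rewrite Rmin_left, Rmax_right in Ht by lra. now apply Hc. }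
  rewrite Rmult_comm.
  apply (abs_RInt_le_const f a b M Hab E Hb).
Qed.

(** Uniform continuity near the compact [[a, b]] makes the integrands uniformly close. The
    hypotheses live on an open rectangle, so one-sided continuity at the ends never arises; the
    later parameter lemmas keep this format. *)
Lemma continuous_RInt_under (f : R -> R -> R) (a b lo hi c d x : R) :
  a <= b -> c < a -> b < d ->
  lo < x < hi ->
  (forall z t, lo < z < hi -> c < t < d -> continuity_2d_pt f z t) ->
  continuous (fun z => RInt (f z) a b) x.
Proof.
  intros Hab Hca Hbd Hx Hf.
  apply continuity_pt_filterlim. intros eps Heps.
  (* The [+ 1] keeps the quotient meaningful when [a = b]. *)
  assert (He : 0 < eps / (2 * (b - a + 1))) by (apply Rdiv_lt_0_compat; lra).
  destruct (uniform_continuity_2d_1d' f a b x) with (eps := mkposreal _ He) as [dl Hdl].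
  { intros t Ht. apply Hf; lra. }
  assert (Hm : 0 < Rmin dl (Rmin (x - lo) (hi - x))).
  { repeat apply Rmin_glb_lt; try lra. apply cond_pos. }
  exists (Rmin dl (Rmin (x - lo) (hi - x))). split; trivial.
  intros y [_ Hy]. simpl in Hy. unfold R_dist in Hy. simpl.
  pose proof (Rmin_l dl (Rmin (x - lo) (hi - x))).
  pose proof (Rmin_r dl (Rmin (x - lo) (hi - x))).
  pose proof (Rmin_l (x - lo) (hi - x)). pose proof (Rmin_r (x - lo) (hi - x)).
  apply Rabs_def2 in Hy.
  assert (Hcy : forall z t, lo < z < hi -> a <= t <= b -> continuous (f z) t).
  { intros z t Hz Ht. apply continuity_2d_pt_slice_r, Hf; lra. }
  assert (Ex : forall z, lo < z < hi -> ex_RInt (f z) a b).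
  { intros z Hz. apply (@ex_RInt_continuous R_CompleteNormedModule).
    intros t Ht. rewrite Rmin_left, Rmax_right in Ht by lra. now apply Hcy. }
  unfold R_dist. rewrite <- (RInt_minus (f y) (f x)) by (apply Ex; lra).
  apply Rle_lt_trans with (eps / (2 * (b - a + 1)) * (b - a)).
  - apply RInt_abs_le_const; trivial.
    + intros t Ht. apply (continuous_minus (V := R_NormedModule)); apply Hcy; lra.
    + intros t Ht. left. apply (Hdl t x t y); try lra.
      rewrite Rminus_diag, Rabs_R0. apply cond_pos.
  - replace (eps / (2 * (b - a + 1)) * (b - a)) with (eps * ((b - a) / (2 * (b - a + 1)))) by (field; lra).
    rewrite <- (Rmult_1_r eps) at 2. apply Rmult_lt_compat_l; trivial.
    apply Rmult_lt_reg_r with (2 * (b - a + 1)); [lra|].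
    unfold Rdiv. rewrite Rmult_assoc, Rinv_l by lra. lra.
Qed.

(** The derivative [f1] is named by the caller instead of being [Derive], so the lemma can be
    applied twice in a row to reach second derivatives of truncated integrals. *)
Lemma is_derive_RInt_under (f f1 : R -> R -> R) (a b lo hi c d x : R) :
  a <= b -> c < a -> b < d ->
  lo < x < hi ->
  (forall z t, lo < z < hi -> c < t < d -> is_derive (fun u => f u t) z (f1 z t)) ->
  (forall z t, lo < z < hi -> c < t < d -> continuity_2d_pt f1 z t) ->
  (forall z t, lo < z < hi -> a <= t <= b -> continuous (f z) t) ->
  is_derive (fun z => RInt (f z) a b) x (RInt (f1 x) a b).
Proof.
  intros Hab Hca Hbd Hx Hd Hc Hf.
  replace (RInt (f1 x) a b) with (RInt (fun t => Derive (fun u => f u t) x) a b).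
  - apply is_derive_RInt_param.
    + apply (locally_open_interval lo hi); trivial. intros y Hy t Ht.
      rewrite Rmin_left, Rmax_right in Ht by lra.
      exists (f1 y t). apply Hd; lra.
    + intros t Ht. rewrite Rmin_left, Rmax_right in Ht by lra.
      apply continuity_2d_pt_ext_loc with f1.
      * assert (Hm : 0 < Rmin (Rmin (t - c) (d - t)) (Rmin (x - lo) (hi - x))).
        { repeat apply Rmin_glb_lt; lra. }
        exists (mkposreal _ Hm). simpl. intros u v Hu Hv.
        pose proof (Rmin_l (Rmin (t - c) (d - t)) (Rmin (x - lo) (hi - x))).
        pose proof (Rmin_r (Rmin (t - c) (d - t)) (Rmin (x - lo) (hi - x))).
        pose proof (Rmin_l (x - lo) (hi - x)). pose proof (Rmin_r (x - lo) (hi - x)).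
        pose proof (Rmin_l (t - c) (d - t)). pose proof (Rmin_r (t - c) (d - t)).
        apply Rabs_def2 in Hu. apply Rabs_def2 in Hv.
        symmetry. apply is_derive_unique, Hd; lra.
      * apply Hc; lra.
    + apply (locally_open_interval lo hi); trivial. intros y Hy.
      apply (@ex_RInt_continuous R_CompleteNormedModule).
      intros t Ht. rewrite Rmin_left, Rmax_right in Ht by lra. now apply Hf.
  - apply RInt_ext. intros t Ht. rewrite Rmin_left, Rmax_right in Ht by lra.
    apply is_derive_unique, Hd; lra.
Qed.

(** As a function of the upper limit [X] in [x], the iterated integral on the right is
    differentiated under the integral in [t] and has derivative [RInt (f X) p q]; the fundamental
    theorem then gives the left side. *)
Lemma Fubini_compact (f : R -> R -> R) (a b lo hi p q c d : R) :
  a <= b -> p <= q -> lo < a -> b < hi -> c < p -> q < d ->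
  (forall x t, lo < x < hi -> c < t < d -> continuity_2d_pt f x t) ->
  RInt (fun x => RInt (f x) p q) a b = RInt (fun t => RInt (fun x => f x t) a b) p q.
Proof.
  intros Hab Hpq Ha Hb Hp Hq Hf.
  (* Primitives start strictly to the left of [a], so that they have two-sided derivatives at [a]
     itself. *)
  set (a0 := (lo + a) / 2).
  assert (Ha0 : lo < a0 < a) by (unfold a0; lra).
  assert (Cx : forall z t, lo < z < hi -> c < t < d -> continuous (fun x => f x t) z).
  { intros z t Hz Ht. apply (continuity_2d_pt_slice_r (fun v w => f w v)).
    apply continuity_2d_pt_swap, Hf; trivial. }
  assert (Ex : forall y z t, a0 <= y <= z -> z < hi -> c < t < d -> ex_RInt (fun x => f x t) y z).
  { intros y z t Hy Hz Ht. apply (@ex_RInt_continuous R_CompleteNormedModule).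
    intros u Hu. rewrite Rmin_left, Rmax_right in Hu by lra. apply Cx; lra. }
  assert (Ct : forall z t, a0 < z < hi -> c < t < d -> continuous (fun t => RInt (fun x => f x t) a0 z) t).
  { intros z t Hz Ht.
    apply (continuous_RInt_under (fun t x => f x t) a0 z c d lo hi); try lra.
    intros u v Hu Hv. apply continuity_2d_pt_swap, Hf; trivial. }
  assert (D : forall X, a0 < X < hi ->
    is_derive (fun X => RInt (fun t => RInt (fun x => f x t) a0 X) p q) X (RInt (f X) p q)).
  { intros X HX.
    apply (is_derive_RInt_under (fun X t => RInt (fun x => f x t) a0 X) f p q a0 hi c d); trivial.
    - intros z t Hz Ht. apply (is_derive_RInt (V := R_NormedModule) (fun x => f x t) (fun y => RInt (fun x => f x t) a0 y) a0 z); [|apply Cx; lra].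
      apply (locally_open_interval a0 hi); trivial. intros y Hy.
      apply (RInt_correct (V := R_CompleteNormedModule)), Ex; trivial; lra.
    - intros z t Hz Ht. apply Hf; lra.
    - intros z t Hz Ht. apply Ct; lra. }
  assert (Ei : forall z, a0 < z < hi -> ex_RInt (fun t => RInt (fun x => f x t) a0 z) p q).
  { intros z Hz. apply (@ex_RInt_continuous R_CompleteNormedModule).
    intros u Hu. rewrite Rmin_left, Rmax_right in Hu by lra. apply Ct; lra. }
  rewrite (is_RInt_unique _ _ _ _
    (is_RInt_derive (V := R_CompleteNormedModule) _ (fun x => RInt (f x) p q) a b
      ltac:(intros x Hx; rewrite Rmin_left, Rmax_right in Hx by lra; apply D; lra)
      ltac:(intros x Hx; rewrite Rmin_left, Rmax_right in Hx by lra;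
            apply (continuous_RInt_under f p q lo hi c d); trivial; lra))).
  cbv beta. rewrite <- (RInt_minus (V := R_CompleteNormedModule)) by (apply Ei; lra).
  apply RInt_ext. intros t Ht. rewrite Rmin_left, Rmax_right in Ht by lra.
  rewrite <- (RInt_Chasles (V := R_CompleteNormedModule) (fun x => f x t) a0 a b) by (apply Ex; lra).
  unfold minus, plus, opp; simpl. ring.
Qed.

(** * Integrals over the half-line with an explicit majorant *)

Notation is_pint f l := (is_RInt_gen f (at_right 0) (Rbar_locally p_infty) l).

(** A sequential exhaustion of [(0, oo)]: improper integrals become limits of sequences, to which
    comparison and derivative lemmas apply. *)
Definition truncated (f : R -> R) (N : nat) : R := RInt f (/ INR (S N)) (INR (S N)).

(* An integrable majorant [g] on (0, oo), given by a primitive [H] with limits at both ends. *)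
Record dominator (g H : R -> R) (h0 h1 : R) : Prop := {
  dom_derive : forall x, 0 < x -> is_derive H x (g x);
  dom_cont : forall x, 0 < x -> continuous g x;
  dom_pos : forall x, 0 < x -> 0 <= g x;
  dom_zero : filterlim H (at_right 0) (locally h0);
  dom_infty : filterlim H (Rbar_locally p_infty) (locally h1) }.

Lemma ex_RInt_pos (f : R -> R) (e X : R) :
  (forall x, 0 < x -> continuous f x) -> 0 < e -> 0 < X -> ex_RInt f e X.
Proof.
  intros Hf He HX. apply (@ex_RInt_continuous R_CompleteNormedModule).
  intros x [Hx _]. apply Hf. apply Rlt_le_trans with (Rmin e X); trivial. now apply Rmin_glb_lt.
Qed.

(** Continuity on the open half-line gives integrability on every compact part, so convergence can
    be phrased with values of [RInt] and no filters. *)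
Lemma is_RInt_gen_pos_eps (f : R -> R) (l : R) :
  (forall x, 0 < x -> continuous f x) ->
  is_pint f l <->
  forall eps, 0 < eps -> exists d Y, 0 < d /\ 0 < Y /\
    forall e X, 0 < e < d -> Y < X -> Rabs (RInt f e X - l) < eps.
Proof.
  intros Hf. split.
  - intros H eps Heps.
    destruct (H (ball l (mkposreal _ Heps)) (locally_ball l (mkposreal _ Heps))) as [Q S HQ HS HQS].
    destruct HQ as [d Hd]. destruct HS as [Y HY].
    exists d, (Rmax Y 1). repeat split.
    + apply cond_pos.
    + apply Rlt_le_trans with 1; [lra|apply Rmax_r].
    + intros e X He HX. pose proof (Rmax_l Y 1).
      destruct (HQS e X) as [y [Hy1 Hy2]].
      * apply Hd; [|lra]. unfold ball; simpl; unfold AbsRing_ball; simpl.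
        unfold abs, minus, plus, opp; simpl. rewrite Rabs_pos_eq; lra.
      * apply HY; lra.
      * simpl in Hy1. rewrite (is_RInt_unique _ _ _ _ Hy1). exact Hy2.
  - intros H P [eps HP].
    destruct (H eps (cond_pos eps)) as [d [Y [Hd [HY HdY]]]].
    apply (Filter_prod _ _ _ (fun e => 0 < e < d) (fun X => Y < X)).
    + exists (mkposreal _ Hd). intros y Hy Hy0. split; trivial.
      unfold ball in Hy; simpl in Hy; unfold AbsRing_ball in Hy; simpl in Hy.
      unfold abs, minus, plus, opp in Hy; simpl in Hy. rewrite Rabs_pos_eq in Hy; lra.
    + now exists Y.
    + intros e X He HX. exists (RInt f e X). split.
      * apply (RInt_correct (V := R_CompleteNormedModule)), ex_RInt_pos; trivial; simpl; lra.
      * apply HP. now apply HdY.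
Qed.

Lemma is_lim_seq_truncated (f : R -> R) (l : R) :
  (forall x, 0 < x -> continuous f x) -> is_pint f l -> is_lim_seq (truncated f) l.
Proof.
  intros Hf H. rewrite is_RInt_gen_pos_eps in H; trivial.
  apply is_lim_seq_spec. intros eps.
  destruct (H eps (cond_pos eps)) as [d [Y [Hd [HY HdY]]]].
  destruct (nfloor_ex (Rmax (/ d) Y)) as [n [_ Hn]].
  { apply Rle_trans with Y; [lra|apply Rmax_r]. }
  exists n. intros m Hm. apply HdY.
  - assert (Hl : / d < INR (S m)).
    { rewrite S_INR. apply le_INR in Hm. pose proof (Rmax_l (/ d) Y). lra. }
    assert (0 < / d) by now apply Rinv_0_lt_compat.
    split; [apply Rinv_0_lt_compat; lra|].
    rewrite <- (Rinv_inv d). apply Rinv_lt_contravar; trivial. apply Rmult_lt_0_compat; lra.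
  - rewrite S_INR. apply le_INR in Hm. pose proof (Rmax_r (/ d) Y). lra.
Qed.

Lemma dominated_RInt (f g H : R -> R) (h0 h1 M e X : R) :
  dominator g H h0 h1 -> (forall x, 0 < x -> continuous f x) ->
  (forall x, 0 < x -> Rabs (f x) <= M * g x) -> 0 < e <= X ->
  Rabs (RInt f e X) <= M * (H X - H e).
Proof.
  intros D Hf Hb He.
  assert (Eg : is_RInt g e X (H X - H e)).
  { apply (is_RInt_derive (V := R_CompleteNormedModule) H g); intros x Hx;
    rewrite Rmin_left, Rmax_right in Hx by lra; [apply (dom_derive _ _ _ _ D)|apply (dom_cont _ _ _ _ D)]; lra. }
  assert (EMg : is_RInt (fun x => M * g x) e X (M * (H X - H e))).
  { exact (is_RInt_scal (V := R_NormedModule) g e X M _ Eg). }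
  apply (norm_RInt_le (V := R_NormedModule) f (fun x => M * g x) e X); try lra.
  - intros x Hx. apply Hb; lra.
  - apply (RInt_correct (V := R_CompleteNormedModule)), ex_RInt_pos; trivial; lra.
  - trivial.
Qed.

Lemma dominator_incr (g H : R -> R) (h0 h1 u v : R) :
  dominator g H h0 h1 -> 0 < u <= v -> H u <= H v.
Proof.
  intros D Huv. apply Rminus_le_0.
  assert (Eg : is_RInt g u v (H v - H u)).
  { apply (is_RInt_derive (V := R_CompleteNormedModule) H g); intros y Hy;
    rewrite Rmin_left, Rmax_right in Hy by lra; [apply (dom_derive _ _ _ _ D)|apply (dom_cont _ _ _ _ D)]; lra. }
  rewrite <- (is_RInt_unique _ _ _ _ Eg). apply RInt_ge_0; try lra. now exists (H v - H u).
  intros y Hy. apply (dom_pos _ _ _ _ D); lra.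
Qed.

Lemma dominator_between (g H : R -> R) (h0 h1 x : R) :
  dominator g H h0 h1 -> 0 < x -> h0 <= H x <= h1.
Proof.
  intros D Hx.
  assert (Mon : forall u v, 0 < u <= v -> H u <= H v) by (intros u v; now apply (dominator_incr g H h0 h1)).
  split.
  - apply (filterlim_le (F := at_right 0) H (fun _ => H x) h0 (H x)).
    + exists (mkposreal _ Hx). intros y Hy Hy0. apply Mon.
      unfold ball in Hy; simpl in Hy; unfold AbsRing_ball in Hy; simpl in Hy.
      unfold abs, minus, plus, opp in Hy; simpl in Hy. rewrite Rabs_pos_eq in Hy; lra.
    + apply (dom_zero _ _ _ _ D).
    + apply filterlim_const.
  - apply (filterlim_le (F := Rbar_locally p_infty) (fun _ => H x) H (H x) h1).
    + exists x. intros y Hy. apply Mon; lra.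
    + apply filterlim_const.
    + apply (dom_infty _ _ _ _ D).
Qed.

(** The two integrals differ by the pieces between [e], [e'] and between [X], [X'], each controlled
    by an increment of the primitive [H]. *)
Lemma dominated_tail (f g H : R -> R) (h0 h1 M : R) :
  0 <= M -> dominator g H h0 h1 -> (forall x, 0 < x -> continuous f x) ->
  (forall x, 0 < x -> Rabs (f x) <= M * g x) ->
  forall e e' X X', 0 < e <= X -> 0 < e' <= X' ->
  Rabs (RInt f e X - RInt f e' X') <= M * (Rabs (H e - H e') + Rabs (H X - H X')).
Proof.
  intros HM D Hf Hb e e' X X' He He'.
  assert (Gen : forall u v, 0 < u -> 0 < v -> Rabs (RInt f u v) <= M * Rabs (H u - H v)).
  { assert (G1 : forall u v, 0 < u <= v -> Rabs (RInt f u v) <= M * Rabs (H u - H v)).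
    { intros u v Huv. apply Rle_trans with (M * (H v - H u)).
      - eapply dominated_RInt; eassumption.
      - apply Rmult_le_compat_l; trivial. rewrite Rabs_minus_sym. apply Rle_abs. }
    intros u v Hu Hv. destruct (Rle_dec u v); [apply G1; lra|].
    rewrite <- (opp_RInt_swap (V := R_CompleteNormedModule) f v u) by (apply ex_RInt_pos; trivial).
    unfold opp; simpl. rewrite Rabs_Ropp, Rabs_minus_sym. apply G1; lra. }
  assert (E : forall u v, 0 < u -> 0 < v -> ex_RInt f u v) by (intros; now apply ex_RInt_pos).
  replace (RInt f e X - RInt f e' X') with (RInt f e e' - RInt f X X').
  - apply Rle_trans with (1 := Rabs_triang _ _). rewrite Rabs_Ropp, Rmult_plus_distr_l.
    apply Rplus_le_compat; apply Gen; lra.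
  - pose proof (RInt_Chasles (V := R_CompleteNormedModule) f e e' X' (E e e' ltac:(lra) ltac:(lra)) (E e' X' ltac:(lra) ltac:(lra))) as C1.
    pose proof (RInt_Chasles (V := R_CompleteNormedModule) f e X X' (E e X ltac:(lra) ltac:(lra)) (E X X' ltac:(lra) ltac:(lra))) as C2.
    unfold plus in *; simpl in *. lra.
Qed.

Lemma at_right_eps (P : R -> Prop) : at_right 0 P -> exists d, 0 < d /\ forall x, 0 < x < d -> P x.
Proof.
  intros [d Hd]. exists d. split. apply cond_pos. intros x Hx. apply Hd; [|lra].
  unfold ball; simpl; unfold AbsRing_ball; simpl.
  unfold abs, minus, plus, opp; simpl. rewrite Rabs_pos_eq; lra.
Qed.

Lemma dominator_near_zero (g H : R -> R) (h0 h1 : R) : dominator g H h0 h1 ->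
  forall eps, 0 < eps -> exists d, 0 < d /\ forall x, 0 < x < d -> Rabs (H x - h0) < eps.
Proof.
  intros D eps Heps. apply at_right_eps.
  apply (dom_zero _ _ _ _ D (fun y => Rabs (y - h0) < eps)). apply (locally_ball h0 (mkposreal _ Heps)).
Qed.

Lemma dominator_near_infty (g H : R -> R) (h0 h1 : R) : dominator g H h0 h1 ->
  forall eps, 0 < eps -> exists Y, 0 < Y /\ forall x, Y < x -> Rabs (H x - h1) < eps.
Proof.
  intros D eps Heps.
  destruct (dom_infty _ _ _ _ D (ball h1 (mkposreal _ Heps)) (locally_ball h1 (mkposreal _ Heps))) as [Y HY].
  exists (Rmax Y 1). split. apply Rlt_le_trans with 1; [lra|apply Rmax_r].
  intros x Hx. apply HY. pose proof (Rmax_l Y 1). lra.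
Qed.

Lemma dominated_ex_pint (f g H : R -> R) (h0 h1 M : R) :
  0 <= M -> dominator g H h0 h1 -> (forall x, 0 < x -> continuous f x) ->
  (forall x, 0 < x -> Rabs (f x) <= M * g x) ->
  exists l, is_pint f l.
Proof.
  intros HM D Hf Hb.
  assert (Cau : forall eps, 0 < eps -> exists d Y, 0 < d /\ 0 < Y /\ d <= Y /\
    forall e e' X X', 0 < e < d -> 0 < e' < d -> Y < X -> Y < X' -> Rabs (RInt f e X - RInt f e' X') < eps).
  { intros eps Heps.
    (* The two increments of [H] in the tail bound total at most four times this quantity; [M + 1]
       covers the case [M = 0]. *)
    assert (Hk : 0 < eps / (4 * (M + 1))) by (apply Rdiv_lt_0_compat; lra).
    destruct (dominator_near_zero _ _ _ _ D _ Hk) as [d [Hd HdH]].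
    destruct (dominator_near_infty _ _ _ _ D _ Hk) as [Y [HY HYH]].
    exists (Rmin d Y), Y. repeat split; trivial. now apply Rmin_glb_lt. apply Rmin_r.
    intros e e' X X' He He' HX HX'. pose proof (Rmin_l d Y). pose proof (Rmin_r d Y).
    eapply Rle_lt_trans. { eapply (dominated_tail f g H h0 h1 M); try eassumption; lra. }
    pose proof (HdH e ltac:(lra)) as A1. pose proof (HdH e' ltac:(lra)) as A2.
    pose proof (HYH X ltac:(lra)) as A3. pose proof (HYH X' ltac:(lra)) as A4.
    set (k := eps / (4 * (M + 1))) in *.
    assert (Ek : eps = 4 * (M + 1) * k) by (unfold k; field; lra).
    assert (S : Rabs (H e - H e') + Rabs (H X - H X') <= 4 * k).
    { apply Rabs_def2 in A1. apply Rabs_def2 in A2. apply Rabs_def2 in A3. apply Rabs_def2 in A4.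
      assert (Rabs (H e - H e') <= 2 * k) by (apply Rabs_le; lra).
      assert (Rabs (H X - H X') <= 2 * k) by (apply Rabs_le; lra). lra. }
    apply Rle_lt_trans with (M * (4 * k)). now apply Rmult_le_compat_l. nra. }
  destruct (proj1 (filterlim_locally_cauchy (U := R_CompleteSpace) (F := filter_prod (at_right 0) (Rbar_locally p_infty)) (fun ab => RInt f (fst ab) (snd ab)))) as [l Hl].
  { intros eps. destruct (Cau eps (cond_pos eps)) as [d [Y [Hd [HY [HdY HC]]]]].
    exists (fun ab => 0 < fst ab < d /\ Y < snd ab). split.
    - apply (Filter_prod _ _ _ (fun e => 0 < e < d) (fun X => Y < X)); [| now exists Y|tauto].
      exists (mkposreal _ Hd). intros y Hy Hy0. split; trivial.
      unfold ball in Hy; simpl in Hy; unfold AbsRing_ball in Hy; simpl in Hy.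
      unfold abs, minus, plus, opp in Hy; simpl in Hy. rewrite Rabs_pos_eq in Hy; lra.
    - intros u v Hu Hv. apply (HC (fst v) (fst u) (snd v) (snd u)); tauto. }
  exists l. apply is_RInt_gen_pos_eps; trivial. intros eps Heps.
  destruct (Hl (ball l (mkposreal _ Heps)) (locally_ball l (mkposreal _ Heps))) as [Q S HQ HS HQS].
  destruct (at_right_eps _ HQ) as [d [Hd HdQ]]. destruct HS as [Y HY].
  exists d, (Rmax Y 1). repeat split; trivial.
  - apply Rlt_le_trans with 1; [lra|apply Rmax_r].
  - intros e X He HX. pose proof (Rmax_l Y 1). apply (HQS e X). now apply HdQ. apply HY; lra.
Qed.

(** Lets a bound valid on all sufficiently large compact intervals pass to the improper integral. *)
Lemma pint_approx (f : R -> R) (l B : R) :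
  (forall x, 0 < x -> continuous f x) -> is_pint f l ->
  (exists d Y, 0 < d /\ 0 < Y /\ forall e X, 0 < e < d -> Y < X -> Rabs (RInt f e X) <= B) -> Rabs l <= B.
Proof.
  intros Hf Hl [d0 [Y0 [Hd0 [HY0 HB]]]]. rewrite is_RInt_gen_pos_eps in Hl by trivial.
  apply le_epsilon. intros eps Heps.
  destruct (Hl eps Heps) as [d [Y [Hd [HY HdY]]]].
  assert (Hm : 0 < Rmin d d0) by now apply Rmin_glb_lt.
  pose proof (Rmin_l d d0). pose proof (Rmin_r d d0). pose proof (Rmax_l Y Y0). pose proof (Rmax_r Y Y0).
  pose proof (HdY (Rmin d d0 / 2) (Rmax Y Y0 + 1) ltac:(lra) ltac:(lra)) as A.
  pose proof (HB (Rmin d d0 / 2) (Rmax Y Y0 + 1) ltac:(lra) ltac:(lra)) as B0.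
  pose proof (Rabs_triang_inv l (RInt f (Rmin d d0 / 2) (Rmax Y Y0 + 1))).
  rewrite Rabs_minus_sym in A. lra.
Qed.

Lemma dominated_pint_le (f g H : R -> R) (h0 h1 M l : R) :
  0 <= M -> dominator g H h0 h1 -> (forall x, 0 < x -> continuous f x) ->
  (forall x, 0 < x -> Rabs (f x) <= M * g x) -> is_pint f l ->
  Rabs l <= M * (h1 - h0).
Proof.
  intros HM D Hf Hb Hl. apply (pint_approx f); trivial.
  exists 1, 1. repeat split; try lra. intros e X He HX.
  apply Rle_trans with (M * (H X - H e)).
  - apply (dominated_RInt f g H h0 h1); trivial; lra.
  - pose proof (dominator_between _ _ _ _ e D ltac:(lra)).
    pose proof (dominator_between _ _ _ _ X D ltac:(lra)).
    apply Rmult_le_compat_l; lra.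
Qed.

(** The error depends on [f] only through [M]. This uniformity over a family of integrands is what
    justifies Fubini and continuity in a parameter on the half-line. *)
Lemma dominated_truncation_error (f g H : R -> R) (h0 h1 M l e X : R) :
  0 <= M -> dominator g H h0 h1 -> (forall x, 0 < x -> continuous f x) ->
  (forall x, 0 < x -> Rabs (f x) <= M * g x) -> is_pint f l -> 0 < e <= X ->
  Rabs (RInt f e X - l) <= M * ((H e - h0) + (h1 - H X)).
Proof.
  intros HM D Hf Hb Hl He. rewrite is_RInt_gen_pos_eps in Hl by trivial.
  apply le_epsilon. intros eps Heps.
  destruct (Hl eps Heps) as [d [Y [Hd [HY HdY]]]].
  assert (Hm : 0 < Rmin d e) by (apply Rmin_glb_lt; lra).
  pose proof (Rmin_l d e). pose proof (Rmin_r d e). pose proof (Rmax_l Y X). pose proof (Rmax_r Y X).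
  set (e' := Rmin d e / 2). set (X' := Rmax Y X + 1).
  pose proof (HdY e' X' ltac:(unfold e'; lra) ltac:(unfold X'; lra)) as A.
  pose proof (dominated_tail f g H h0 h1 M HM D Hf Hb e e' X X' He ltac:(unfold e', X'; lra)) as T.
  assert (Mon : forall u v, 0 < u <= v -> H u <= H v) by (intros u v; now apply (dominator_incr g H h0 h1)).
  pose proof (dominator_between _ _ _ _ e' D ltac:(unfold e'; lra)) as B1.
  pose proof (dominator_between _ _ _ _ X' D ltac:(unfold X'; lra)) as B2.
  pose proof (Mon e' e ltac:(unfold e'; lra)). pose proof (Mon X X' ltac:(unfold X'; lra)).
  rewrite (Rabs_pos_eq (H e - H e')) in T by lra.
  rewrite (Rabs_left1 (H X - H X')) in T by lra.
  assert (M * (H e - H e' + - (H X - H X')) <= M * (H e - h0 + (h1 - H X))) by (apply Rmult_le_compat_l; lra).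
  pose proof (Rabs_triang (RInt f e X - RInt f e' X') (RInt f e' X' - l)) as Tr.
  replace (RInt f e X - RInt f e' X' + (RInt f e' X' - l)) with (RInt f e X - l) in Tr by ring. lra.
Qed.

Lemma pint_unique (f : R -> R) (l l' : R) : is_pint f l -> is_pint f l' -> l = l'.
Proof.
  intros H H'. rewrite <- (is_RInt_gen_unique (V := R_CompleteNormedModule) f l H).
  now apply (is_RInt_gen_unique (V := R_CompleteNormedModule)).
Qed.

Lemma filter_pos : filter_prod (at_right 0) (Rbar_locally p_infty)
  (fun ab => 0 < fst ab < snd ab).
Proof.
  apply (Filter_prod _ _ _ (fun e => 0 < e < 1) (fun X => 1 < X)).
  - exists (mkposreal 1 Rlt_0_1). intros y Hy Hy0. split; trivial.
    unfold ball in Hy; simpl in Hy; unfold AbsRing_ball in Hy; simpl in Hy.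
    unfold abs, minus, plus, opp in Hy; simpl in Hy. rewrite Rabs_pos_eq in Hy; lra.
  - now exists 1.
  - simpl; intros; lra.
Qed.

Lemma pint_ext (f g : R -> R) (l : R) :
  (forall x, 0 < x -> f x = g x) -> is_pint f l -> is_pint g l.
Proof.
  intros H. apply is_RInt_gen_ext. generalize filter_pos. apply filter_imp.
  intros [e X]; simpl; intros Hp x Hx. rewrite Rmin_left, Rmax_right in Hx by lra. apply H; lra.
Qed.

Lemma pint_derive (F f : R -> R) (l0 l1 : R) :
  (forall x, 0 < x -> is_derive F x (f x)) -> (forall x, 0 < x -> continuous f x) ->
  filterlim F (at_right 0) (locally l0) -> filterlim F (Rbar_locally p_infty) (locally l1) ->
  is_pint f (l1 - l0).
Proof.
  intros Hd Hc H0 H1. apply pint_ext with (Derive F).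
  { intros x Hx. now apply is_derive_unique, Hd. }
  apply is_RInt_gen_Derive; trivial.
  - generalize filter_pos. apply filter_imp. intros [e X]; simpl; intros Hp x Hx.
    rewrite Rmin_left, Rmax_right in Hx by lra. exists (f x). apply Hd; lra.
  - generalize filter_pos. apply filter_imp. intros [e X]; simpl; intros Hp x Hx.
    rewrite Rmin_left, Rmax_right in Hx by lra.
    apply continuous_ext_loc with f; [|apply Hc; lra].
    apply (locally_open_interval 0 (x + 1)); try lra. intros y Hy. symmetry. now apply is_derive_unique, Hd.
Qed.

(** Compact Fubini applies on [[e, X]]; the inner truncation errors are then bounded uniformly in
    [t], and integrating them over [[p, q]] costs only the factor [q - p]. *)
Lemma pint_Fubini (f : R -> R -> R) (l g H : R -> R) (h0 h1 M p q c d : R) :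
  0 <= M -> dominator g H h0 h1 -> p <= q -> c < p -> q < d ->
  (forall x t, 0 < x -> c < t < d -> continuity_2d_pt f x t) ->
  (forall x t, 0 < x -> c < t < d -> Rabs (f x t) <= M * g x) ->
  (forall t, p <= t <= q -> is_pint (fun x => f x t) (l t)) -> ex_RInt l p q ->
  is_pint (fun x => RInt (f x) p q) (RInt l p q).
Proof.
  intros HM D Hpq Hc Hd Hf Hb Hl El.
  assert (Cx : forall x t, 0 < x -> c < t < d -> continuous (fun x => f x t) x).
  { intros x t Hx Ht. apply (continuity_2d_pt_slice_r (fun v w => f w v)).
    apply continuity_2d_pt_swap, Hf; trivial. }
  assert (CI : forall x, 0 < x -> continuous (fun x => RInt (f x) p q) x).
  { intros x Hx. apply (continuous_RInt_under f p q 0 (x + 1) c d); trivial; try lra.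
    intros z t Hz Ht. apply Hf; lra. }
  apply is_RInt_gen_pos_eps; trivial. intros eps Heps.
  assert (Hk : 0 < eps / (2 * (M + 1) * (q - p + 1))).
  { apply Rdiv_lt_0_compat; trivial. apply Rmult_lt_0_compat; lra. }
  destruct (dominator_near_zero _ _ _ _ D _ Hk) as [de [Hde HdH]].
  destruct (dominator_near_infty _ _ _ _ D _ Hk) as [Y [HY HYH]].
  exists (Rmin de Y), Y. repeat split; trivial. now apply Rmin_glb_lt.
  intros e X He HX. pose proof (Rmin_l de Y). pose proof (Rmin_r de Y).
  rewrite (Fubini_compact f e X 0 (X + 1) p q c d); try lra.
  2:{ intros x t Hx Ht. apply Hf; lra. }
  assert (Ei : ex_RInt (fun t => RInt (fun x => f x t) e X) p q).
  { apply (@ex_RInt_continuous R_CompleteNormedModule). intros t Ht.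
    rewrite Rmin_left, Rmax_right in Ht by lra.
    apply (continuous_RInt_under (fun t x => f x t) e X c d 0 (X + 1)); try lra.
    intros u v Hu Hv. apply continuity_2d_pt_swap, Hf; lra. }
  rewrite <- (RInt_minus (V := R_CompleteNormedModule)) by trivial.
  set (k := eps / (2 * (M + 1) * (q - p + 1))) in *.
  assert (Ek : eps = k * (2 * (M + 1) * (q - p + 1))) by (unfold k; field; lra).
  apply Rle_lt_trans with ((q - p) * (M * (2 * k))).
  - apply abs_RInt_le_const; trivial.
    + now apply (ex_RInt_minus (V := R_NormedModule)).
    + intros t Ht. unfold minus, plus, opp; simpl.
      eapply Rle_trans.
      { apply (dominated_truncation_error (fun x => f x t) g H h0 h1 M (l t) e X); trivial; try lra.
        - intros x Hx. apply Cx; lra.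
        - intros x Hx. apply Hb; lra.
        - now apply Hl. }
      pose proof (HdH e ltac:(lra)) as A1. pose proof (HYH X ltac:(lra)) as A2.
      apply Rabs_def2 in A1. apply Rabs_def2 in A2. apply Rmult_le_compat_l; lra.
  - rewrite Ek.
    assert (0 <= M * k) by (apply Rmult_le_pos; lra).
    assert (0 < k * (q - p + 1)) by (apply Rmult_lt_0_compat; lra). nra.
Qed.

(** * The hypergeometric equation for complex parameters *)

Lemma is_derive_eq (f : R -> R) (x l l' : R) : is_derive f x l -> l = l' -> is_derive f x l'.
Proof. now intros H <-. Qed.

(** Differentiation by components: the energy estimates act on real and imaginary parts
    separately. *)
Definition is_Cderive (f : R -> C) (x : R) (l : C) : Prop :=
  is_derive (fun t => Re (f t)) x (Re l) /\ is_derive (fun t => Im (f t)) x (Im l).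

Lemma is_Cderive_eq (f : R -> C) (x : R) (l l' : C) : is_Cderive f x l -> l = l' -> is_Cderive f x l'.
Proof. now intros H <-. Qed.

Lemma is_Cderive_RtoC (f : R -> R) (x l : R) : is_derive f x l -> is_Cderive (fun t => RtoC (f t)) x (RtoC l).
Proof. intros H. split; simpl. exact H. apply (is_derive_const (V := R_NormedModule) 0). Qed.

Lemma is_Cderive_const (k : C) (x : R) : is_Cderive (fun _ => k) x (RtoC 0).
Proof. split; simpl; apply (is_derive_const (V := R_NormedModule)). Qed.

Lemma is_Cderive_plus (f g : R -> C) (x : R) (l m : C) :
  is_Cderive f x l -> is_Cderive g x m -> is_Cderive (fun t => Cplus (f t) (g t)) x (Cplus l m).
Proof.
  intros [A B] [A' B']. split; simpl.
  - exact (is_derive_plus (V := R_NormedModule) _ _ x _ _ A A').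
  - exact (is_derive_plus (V := R_NormedModule) _ _ x _ _ B B').
Qed.

Lemma is_Cderive_mult (f g : R -> C) (x : R) (l m : C) :
  is_Cderive f x l -> is_Cderive g x m -> is_Cderive (fun t => Cmult (f t) (g t)) x (Cplus (Cmult l (g x)) (Cmult (f x) m)).
Proof.
  intros [A B] [A' B']. unfold Re, Im in *. split; simpl.
  - eapply is_derive_eq.
    + apply (is_derive_minus (V := R_NormedModule) (fun t => fst (f t) * fst (g t)) (fun t => snd (f t) * snd (g t))).
      * apply (is_derive_mult (fun t => fst (f t)) (fun t => fst (g t)) x _ _ A A' Rmult_comm).
      * apply (is_derive_mult (fun t => snd (f t)) (fun t => snd (g t)) x _ _ B B' Rmult_comm).
    + unfold minus, plus, opp, mult; simpl. ring.
  - eapply is_derive_eq.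
    + apply (is_derive_plus (V := R_NormedModule) (fun t => fst (f t) * snd (g t)) (fun t => snd (f t) * fst (g t))).
      * apply (is_derive_mult (fun t => fst (f t)) (fun t => snd (g t)) x _ _ A B' Rmult_comm).
      * apply (is_derive_mult (fun t => snd (f t)) (fun t => fst (g t)) x _ _ B A' Rmult_comm).
    + unfold minus, plus, opp, mult; simpl. ring.
Qed.

Lemma is_Cderive_comp (f : R -> C) (h : R -> R) (x h' : R) (l : C) :
  is_Cderive f (h x) l -> is_derive h x h' -> is_Cderive (fun t => f (h t)) x (Cmult (RtoC h') l).
Proof.
  intros [A B] H. split; simpl.
  - eapply is_derive_eq.
    + apply (is_derive_comp (V := R_NormedModule) (fun t => Re (f t)) h x _ _ A H).
    + unfold scal; simpl; unfold mult; simpl. unfold Re. ring.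
  - eapply is_derive_eq.
    + apply (is_derive_comp (V := R_NormedModule) (fun t => Im (f t)) h x _ _ B H).
    + unfold scal; simpl; unfold mult; simpl. unfold Im. ring.
Qed.

Lemma is_Cderive_cpow (r : R) (s : C) : 0 < r ->
  is_Cderive (fun t => cpow t s) r (Cmult (Cmult s (RtoC (/ r))) (cpow r s)).
Proof.
  intros Hr. split; unfold cpow, Re, Im; simpl.
  - auto_derive. lra. field. lra.
  - auto_derive. lra. field. lra.
Qed.

(** The argument stays real throughout, so a power series with complex coefficients is a pair of
    real ones and the real theory of radii applies. *)
Definition CPS (T : nat -> C) (w : R) : C :=
  (PSeries (fun k => Re (T k)) w, PSeries (fun k => Im (T k)) w).

Definition Cderiv (T : nat -> C) (k : nat) : C := Cmult (RtoC (INR (S k))) (T (S k)).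

Definition Cdisk (T : nat -> C) (w : R) : Prop :=
  Rbar_lt (Rabs w) (CV_radius (fun k => Re (T k))) /\ Rbar_lt (Rabs w) (CV_radius (fun k => Im (T k))).

Lemma Re_Cderiv (T : nat -> C) (k : nat) : Re (Cderiv T k) = PS_derive (fun k => Re (T k)) k.
Proof. unfold Cderiv, PS_derive, Re. simpl. ring. Qed.

Lemma Im_Cderiv (T : nat -> C) (k : nat) : Im (Cderiv T k) = PS_derive (fun k => Im (T k)) k.
Proof. unfold Cderiv, PS_derive, Im. simpl. ring. Qed.

Lemma is_Cderive_CPS (T : nat -> C) (w : R) : Cdisk T w -> is_Cderive (CPS T) w (CPS (Cderiv T) w).
Proof.
  intros [H1 H2]. split.
  - change (is_derive (PSeries (fun k => Re (T k))) w (PSeries (fun k => Re (Cderiv T k)) w)).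
    rewrite (PSeries_ext _ _ w (Re_Cderiv T)). now apply is_derive_PSeries.
  - change (is_derive (PSeries (fun k => Im (T k))) w (PSeries (fun k => Im (Cderiv T k)) w)).
    rewrite (PSeries_ext _ _ w (Im_Cderiv T)). now apply is_derive_PSeries.
Qed.

Lemma Cdisk_Cderiv (T : nat -> C) (w : R) : Cdisk T w -> Cdisk (Cderiv T) w.
Proof.
  intros [H1 H2]. split.
  - rewrite (CV_radius_ext _ _ (Re_Cderiv T)), CV_radius_derive. exact H1.
  - rewrite (CV_radius_ext _ _ (Im_Cderiv T)), CV_radius_derive. exact H2.
Qed.

(** The Euler operator [w d/dw] multiplies the coefficient of index [k] by [k]; it converts a
    recurrence polynomial in [k] into a differential equation. *)
Lemma is_pseries_euler (u : nat -> R) (w : R) : Rbar_lt (Rabs w) (CV_radius u) ->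
  is_pseries (fun k => INR k * u k) w (w * PSeries (PS_derive u) w).
Proof.
  intros H. apply is_pseries_ext with (PS_incr_1 (PS_derive u)).
  - intros [|k]; unfold PS_incr_1, PS_derive; simpl; [|reflexivity].
    unfold zero; simpl. ring.
  - apply (is_pseries_incr_1 (PS_derive u) w). apply PSeries_correct. now apply ex_pseries_derive.
Qed.

Lemma CV_radius_euler (u : nat -> R) : CV_radius (fun k => INR k * u k) = CV_radius u.
Proof.
  rewrite <- (CV_radius_derive u), <- (CV_radius_incr_1 (PS_derive u)).
  apply CV_radius_ext. intros [|k]; unfold PS_incr_1, PS_derive; simpl; [|reflexivity].
  unfold zero; simpl. ring.
Qed.

(** Real part of the hypergeometric equation for coefficients [u + iv], where [p + iq] and [r + is]
    are the sum and the product of the numerator parameters. The complex products couple [u] to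
    [v]. *)
Lemma hypergeometric_recurrence_ode (u v : nat -> R) (c p q r s w : R) :
  Rbar_lt (Rabs w) (CV_radius u) -> Rbar_lt (Rabs w) (CV_radius v) ->
  (forall k, (c + INR k) * (INR k + 1) * u (S k) =
     (INR k * INR k + p * INR k + r) * u k - (q * INR k + s) * v k) ->
  w * (1 - w) * PSeries (PS_derive (PS_derive u)) w
    + (c - (p + 1) * w) * PSeries (PS_derive u) w - r * PSeries u w
    + q * (w * PSeries (PS_derive v) w) + s * PSeries v w = 0.
Proof.
  intros Hu Hv Hrec.
  assert (Hu' : Rbar_lt (Rabs w) (CV_radius (PS_derive u))) by now rewrite CV_radius_derive.
  assert (Hk : Rbar_lt (Rabs w) (CV_radius (fun k => INR k * u k))) by now rewrite CV_radius_euler.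
  pose proof (is_pseries_euler u w Hu) as E1.
  pose proof (is_pseries_euler v w Hv) as E2.
  pose proof (is_pseries_euler (PS_derive u) w Hu') as E3.
  pose proof (is_pseries_euler _ w Hk) as E4.
  pose proof (PSeries_correct _ w (CV_radius_inside u w Hu)) as F1.
  pose proof (PSeries_correct _ w (CV_radius_inside v w Hv)) as F2.
  pose proof (PSeries_correct _ w (CV_radius_inside _ w Hu')) as F3.
  assert (E5 : PSeries (PS_derive (fun k => INR k * u k)) w
     = w * PSeries (PS_derive (PS_derive u)) w + PSeries (PS_derive u) w).
  { apply is_pseries_unique.
    apply is_pseries_ext with (PS_plus (fun k => INR k * PS_derive u k) (PS_derive u)).
    - intros k. change (INR k * (INR (S k) * u (S k)) + INR (S k) * u (S k) = INR (S k) * (INR (S k) * u (S k))).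
      rewrite S_INR. ring.
    - now apply (is_pseries_plus (V := R_NormedModule)). }
  rewrite E5 in E4.
  (* One coefficient sequence is summed in two ways: [Z] produces the left side of the equation
     through Euler operators, [Z0] produces zero through the recurrence. *)
  assert (Z : is_pseries (PS_plus (PS_plus (PS_plus (fun k => INR k * PS_derive u k) (PS_scal c (PS_derive u)))
       (PS_plus (PS_opp (fun k => INR k * (INR k * u k))) (PS_scal (- p) (fun k => INR k * u k))))
       (PS_plus (PS_scal (- r) u) (PS_plus (PS_scal q (fun k => INR k * v k)) (PS_scal s v)))) w
    ((w * PSeries (PS_derive (PS_derive u)) w + c * PSeries (PS_derive u) w
      + (- (w * (w * PSeries (PS_derive (PS_derive u)) w + PSeries (PS_derive u) w))
      + - p * (w * PSeries (PS_derive u) w)))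
     + (- r * PSeries u w + (q * (w * PSeries (PS_derive v) w) + s * PSeries v w)))).
  { pose proof (fun k a l (H : is_pseries a w l) => is_pseries_scal (V := R_NormedModule) k a w l (Rmult_comm _ _) H) as Sc.
    pose proof (fun a b l m (H : is_pseries a w l) (H' : is_pseries b w m) =>
      is_pseries_plus (V := R_NormedModule) a b w l m H H') as Pl.
    exact (Pl _ _ _ _ (Pl _ _ _ _ (Pl _ _ _ _ E3 (Sc c _ _ F3))
        (Pl _ _ _ _ (is_pseries_opp (V := R_NormedModule) _ _ _ E4) (Sc (- p) _ _ E1)))
      (Pl _ _ _ _ (Sc (- r) _ _ F1) (Pl _ _ _ _ (Sc q _ _ E2) (Sc s _ _ F2)))). }
  assert (Z0 : is_pseries (PS_plus (PS_plus (PS_plus (fun k => INR k * PS_derive u k) (PS_scal c (PS_derive u)))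
       (PS_plus (PS_opp (fun k => INR k * (INR k * u k))) (PS_scal (- p) (fun k => INR k * u k))))
       (PS_plus (PS_scal (- r) u) (PS_plus (PS_scal q (fun k => INR k * v k)) (PS_scal s v)))) w 0).
  { apply is_pseries_ext with (fun _ => 0).
    - intros k. specialize (Hrec k).
      change (0 = INR k * (INR (S k) * u (S k)) + c * (INR (S k) * u (S k))
        + (- (INR k * (INR k * u k)) + - p * (INR k * u k)) + (- r * u k + (q * (INR k * v k) + s * v k))).
      rewrite S_INR. lra.
    - apply filterlim_ext with (fun _ => 0).
      + intros n. symmetry. induction n as [|n IH].
        * rewrite sum_O. unfold scal; simpl; unfold mult; simpl. ring.
        * rewrite sum_Sn, IH. unfold scal, plus; simpl; unfold mult; simpl. ring.
      + apply filterlim_const. }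
  apply is_pseries_unique in Z. apply is_pseries_unique in Z0. rewrite Z0 in Z. lra.
Qed.

(** The imaginary part is the same real statement with the two series exchanged and [q], [s]
    negated. *)
Lemma CPS_ode (T : nat -> C) (c : R) (sg pi : C) (w : R) :
  Cdisk T w ->
  (forall k, Cmult (RtoC ((c + INR k) * (INR k + 1))) (T (S k)) =
     Cmult (Cplus (Cplus (RtoC (INR k * INR k)) (Cmult sg (RtoC (INR k)))) pi) (T k)) ->
  (RtoC (w * (1 - w)) * CPS (Cderiv (Cderiv T)) w
    + (RtoC c - (sg + RtoC 1) * RtoC w) * CPS (Cderiv T) w - pi * CPS T w = RtoC 0)%C.
Proof.
  intros [H1 H2] Hrec.
  assert (R1 : forall k, (c + INR k) * (INR k + 1) * Re (T (S k)) =
     (INR k * INR k + Re sg * INR k + Re pi) * Re (T k) - (Im sg * INR k + Im pi) * Im (T k)).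
  { intros k. specialize (Hrec k). apply (f_equal Re) in Hrec. unfold Re, Im in *; simpl in Hrec. lra. }
  assert (R2 : forall k, (c + INR k) * (INR k + 1) * Im (T (S k)) =
     (INR k * INR k + Re sg * INR k + Re pi) * Im (T k) - (- Im sg * INR k + - Im pi) * Re (T k)).
  { intros k. specialize (Hrec k). apply (f_equal Im) in Hrec. unfold Re, Im in *; simpl in Hrec. lra. }
  pose proof (hypergeometric_recurrence_ode _ _ c _ _ _ _ w H1 H2 R1) as O1.
  pose proof (hypergeometric_recurrence_ode _ _ c _ _ _ _ w H2 H1 R2) as O2.
  unfold CPS.
  rewrite (PSeries_ext (fun k => Re (Cderiv (Cderiv T) k)) (PS_derive (PS_derive (fun k => Re (T k))))).
  2:{ intros k. rewrite Re_Cderiv. unfold PS_derive at 1 2. now rewrite Re_Cderiv. }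
  rewrite (PSeries_ext (fun k => Im (Cderiv (Cderiv T) k)) (PS_derive (PS_derive (fun k => Im (T k))))).
  2:{ intros k. rewrite Im_Cderiv. unfold PS_derive at 1 2. now rewrite Im_Cderiv. }
  rewrite (PSeries_ext _ _ w (Re_Cderiv T)), (PSeries_ext _ _ w (Im_Cderiv T)).
  unfold Re, Im in *.
  apply injective_projections; simpl; lra.
Qed.

(** For [r < 1] the ratio bound makes [Cmod (T n) * r ^ n] eventually decreasing, hence bounded, so
    both real radii are at least [r]. Vanishing coefficients do no harm, unlike in a ratio test. *)
Lemma Cdisk_ratio (T : nat -> C) (c s p w : R) :
  0 < c -> 0 <= s -> 0 <= p -> Rabs w < 1 ->
  (forall k, (c + INR k) * (INR k + 1) * Cmod (T (S k)) <= (INR k * INR k + s * INR k + p) * Cmod (T k)) ->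
  Cdisk T w.
Proof.
  intros Hc Hs Hp Hw Hr.
  set (r := (1 + Rabs w) / 2).
  assert (Hr0 : 0 < r < 1) by (unfold r; pose proof (Rabs_pos w); lra).
  assert (Hwr : Rabs w < r) by (unfold r; lra).
  assert (HB : exists M, forall n, Cmod (T n) * r ^ n <= M).
  (* Beyond this index [(s + p) * r <= (1 - r) * k] and [k >= 1], which together give
     [(k^2 + s k + p) r <= k^2]. *)
  { destruct (nfloor_ex (Rmax 1 ((s + p) * r / (1 - r)))) as [N [_ HN]].
    { apply Rle_trans with 1; [lra|apply Rmax_l]. }
    assert (Dec : forall n, (N < n)%nat -> Cmod (T (S n)) * r ^ S n <= Cmod (T n) * r ^ n).
    { intros n Hn. assert (Hn' : Rmax 1 ((s + p) * r / (1 - r)) < INR n).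
      { apply Rlt_le_trans with (1 := HN). rewrite <- S_INR. apply le_INR. lia. }
      pose proof (Rmax_l 1 ((s + p) * r / (1 - r))). pose proof (Rmax_r 1 ((s + p) * r / (1 - r))).
      assert (Hk : (s + p) * r <= (1 - r) * INR n).
      { apply Rmult_le_reg_r with (/ (1 - r)). apply Rinv_0_lt_compat; lra.
        replace ((1 - r) * INR n * / (1 - r)) with (INR n) by (field; lra). unfold Rdiv in *; lra. }
      set (k := INR n) in *. pose proof (Hr n) as Hrn. fold k in Hrn.
      simpl. rewrite <- Rmult_assoc. apply Rmult_le_compat_r. apply pow_le; lra.
      pose proof (Cmod_ge_0 (T n)). pose proof (Cmod_ge_0 (T (S n))).
      assert (Hden : 0 < (c + k) * (k + 1)) by (apply Rmult_lt_0_compat; lra).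
      apply Rmult_le_reg_l with ((c + k) * (k + 1)); trivial.
      apply Rle_trans with ((k * k + s * k + p) * Cmod (T n) * r).
      - rewrite <- Rmult_assoc. apply Rmult_le_compat_r; lra.
      - replace ((k * k + s * k + p) * Cmod (T n) * r) with (((k * k + s * k + p) * r) * Cmod (T n)) by ring.
        apply Rmult_le_compat_r; trivial.
        assert (k * ((s + p) * r) <= k * ((1 - r) * k)) by (apply Rmult_le_compat_l; lra).
        assert (p * r <= p * r * k) by (assert (0 <= p * r) by (apply Rmult_le_pos; lra); nra).
        assert (0 <= c * (k + 1)) by (apply Rmult_le_pos; lra). nra. }
    assert (Fin : forall m, exists M, forall n, (n <= m)%nat -> Cmod (T n) * r ^ n <= M).
    { induction m as [|m [M HM]].
      - exists (Cmod (T 0%nat) * r ^ 0). intros n Hn. replace n with 0%nat by lia. lra.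
      - exists (Rmax M (Cmod (T (S m)) * r ^ S m)). intros n Hn.
        destruct (Nat.eq_dec n (S m)) as [->|Hne]; [apply Rmax_r|].
        apply Rle_trans with M; [apply HM; lia|apply Rmax_l]. }
    destruct (Fin (S N)) as [M HM]. exists M. intros n.
    destruct (Nat.le_gt_cases n (S N)) as [Hn|Hn]; [now apply HM|].
    induction n as [|n IH]; [lia|].
    destruct (Nat.eq_dec n (S N)) as [->|Hne].
    - apply Rle_trans with (1 := Dec (S N) ltac:(lia)). now apply HM.
    - apply Rle_trans with (1 := Dec n ltac:(lia)). apply IH. lia. }
  destruct HB as [M HM].
  assert (Gen : forall u : nat -> R, (forall n, Rabs (u n) <= Cmod (T n)) -> Rbar_lt (Rabs w) (CV_radius u)).
  { intros u Hu. apply Rbar_lt_le_trans with r; trivial.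
    destruct (CV_radius_bounded u) as [H _]. apply (H r).
    exists M. intros n. rewrite Rabs_mult, (Rabs_pos_eq (r ^ n)) by (apply pow_le; lra).
    apply Rle_trans with (2 := HM n). apply Rmult_le_compat_r; [apply pow_le; lra|apply Hu]. }
  split; apply Gen; intros n.
  - apply (Rle_trans _ _ _ (Rmax_l _ _) (Rmax_Cmod (T n))).
  - apply (Rle_trans _ _ _ (Rmax_r _ _) (Rmax_Cmod (T n))).
Qed.

(** * Hypergeometric coefficients and Pfaff's form of the function *)

Fixpoint poch (x : R) (k : nat) : R :=
  match k with O => 1 | S k' => poch x k' * (x + INR k') end.

Lemma poch_pos (x : R) (k : nat) : 0 < x -> 0 < poch x k.
Proof.
  intros Hx. induction k as [|k IH]; simpl; [lra|].
  apply Rmult_lt_0_compat; trivial. pose proof (pos_INR k). lra.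
Qed.

Lemma cpoch_RtoC (x : R) (k : nat) : cpoch (RtoC x) k = RtoC (poch x k).
Proof. induction k as [|k IH]; simpl; trivial. now rewrite IH, <- RtoC_plus, <- RtoC_mult. Qed.

Lemma RtoC_neq0 (x : R) : x <> 0 -> RtoC x <> RtoC 0.
Proof. intros H E. apply H. now apply RtoC_inj. Qed.

Definition hcoef (A B : C) (c : R) (k : nat) : C :=
  Cdiv (Cmult (cpoch A k) (cpoch B k)) (Cmult (cpoch (RtoC c) k) (RtoC (INR (fact k)))).

Lemma hcoef_rec (A B : C) (c : R) (k : nat) : 0 < c ->
  Cmult (RtoC ((c + INR k) * (INR k + 1))) (hcoef A B c (S k)) =
  Cmult (Cplus (Cplus (RtoC (INR k * INR k)) (Cmult (Cplus A B) (RtoC (INR k)))) (Cmult A B)) (hcoef A B c k).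
Proof.
  intros Hc. unfold hcoef.
  change (fact (S k)) with (S k * fact k)%nat. rewrite mult_INR, S_INR. simpl cpoch.
  rewrite !cpoch_RtoC, !RtoC_mult, !RtoC_plus.
  pose proof (poch_pos c k Hc). pose proof (pos_INR k). pose proof (INR_fact_neq_0 k).
  assert (N1 : RtoC (poch c k) <> RtoC 0) by (apply RtoC_neq0; lra).
  assert (N2 : RtoC (INR (fact k)) <> RtoC 0) by (apply RtoC_neq0; lra).
  assert (N3 : (RtoC c + RtoC (INR k))%C <> RtoC 0) by (rewrite <- RtoC_plus; apply RtoC_neq0; lra).
  assert (N4 : (RtoC (INR k) + RtoC 1)%C <> RtoC 0) by (rewrite <- RtoC_plus; apply RtoC_neq0; lra).
  field. repeat split; trivial.
Qed.

(** The triangle inequality in the recurrence bounds the ratio of moduli by one with [Cmod (A + B)]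
    and [Cmod (A B)]. *)
Lemma hcoef_disk (A B : C) (c w : R) : 0 < c -> Rabs w < 1 -> Cdisk (hcoef A B c) w.
Proof.
  intros Hc Hw.
  apply Cdisk_ratio with c (Cmod (Cplus A B)) (Cmod (Cmult A B)); trivial; try apply Cmod_ge_0.
  intros k. pose proof (f_equal Cmod (hcoef_rec A B c k Hc)) as E.
  rewrite !Cmod_mult in E. pose proof (pos_INR k).
  rewrite Cmod_R, Rabs_pos_eq in E by (apply Rmult_le_pos; lra).
  rewrite E. apply Rmult_le_compat_r. apply Cmod_ge_0.
  eapply Rle_trans; [apply Cmod_triangle|]. apply Rplus_le_compat; [|rewrite Cmod_mult; apply Rle_refl].
  eapply Rle_trans; [apply Cmod_triangle|]. rewrite Cmod_mult, !Cmod_R.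
  rewrite !Rabs_pos_eq; try lra. apply Rmult_le_pos; lra.
Qed.

(** In Pfaff's variable [z / (1 + z)] the interval of convergence is the half-line [z > -1/2]. This
    open neighbourhood of [[0, oo)] is the domain of the derivatives below, so that [z = 0] is an
    interior point. *)
Lemma ratio_disk (z : R) : - (1/2) < z -> Rabs (z / (1 + z)) < 1.
Proof.
  intros Hz. apply Rabs_def1.
  - apply Rmult_lt_reg_r with (1 + z); [lra|]. unfold Rdiv. rewrite Rmult_assoc, Rinv_l; lra.
  - apply Rmult_lt_reg_r with (1 + z); [lra|]. unfold Rdiv. rewrite Rmult_assoc, Rinv_l; lra.
Qed.

(** The sign is moved into the argument so that the relevant half-line is [z >= 0]. [HF1] and [HF2]
    are the first two derivatives in [z], written out through the Pfaff series. *)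
Definition HF (A B : C) (c z : R) : C := F21 A B (RtoC c) (- z).

Definition HF1 (A B : C) (c z : R) : C :=
  let T := hcoef A (Cminus (RtoC c) B) c in
  Cmult (cpow (1 + z) (Copp A))
   (Cplus (Cmult (Cmult (Copp A) (RtoC (/ (1 + z)))) (CPS T (z / (1 + z))))
          (Cmult (RtoC (/ (1 + z) ^ 2)) (CPS (Cderiv T) (z / (1 + z))))).

Definition HF2 (A B : C) (c z : R) : C :=
  let T := hcoef A (Cminus (RtoC c) B) c in
  Cmult (cpow (1 + z) (Copp A))
   (Cplus (Cplus (Cmult (Cmult (Cmult A (Cplus A (RtoC 1))) (RtoC (/ (1 + z) ^ 2))) (CPS T (z / (1 + z))))
      (Cmult (Cmult (Copp (Cmult (RtoC 2) (Cplus A (RtoC 1)))) (RtoC (/ (1 + z) ^ 3))) (CPS (Cderiv T) (z / (1 + z)))))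
      (Cmult (RtoC (/ (1 + z) ^ 4)) (CPS (Cderiv (Cderiv T)) (z / (1 + z))))).

Lemma HF_eq (A B : C) (c z : R) : - (1/2) < z ->
  HF A B c z = Cmult (cpow (1 + z) (Copp A)) (CPS (hcoef A (Cminus (RtoC c) B) c) (z / (1 + z))).
Proof.
  intros Hz. unfold HF, F21. f_equal.
  - f_equal. ring.
  - replace (- z / (- z - 1)) with (z / (1 + z)) by (field; lra).
    unfold CSeries, CPS, PSeries. f_equal; apply Series_ext; intros k; unfold hyp_term; fold (hcoef A (Cminus (RtoC c) B) c k);
    unfold Re, Im; simpl; ring.
Qed.

Lemma is_Cderive_cpow_shift (A : C) (z : R) : - (1/2) < z ->
  is_Cderive (fun z => cpow (1 + z) (Copp A)) z (Cmult (Cmult (Copp A) (RtoC (/ (1 + z)))) (cpow (1 + z) (Copp A))).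
Proof.
  intros Hz. eapply is_Cderive_eq.
  - apply (is_Cderive_comp (fun r => cpow r (Copp A)) (fun z => 1 + z) z 1).
    + apply is_Cderive_cpow. lra.
    + auto_derive; trivial; ring.
  - ring.
Qed.

Lemma is_Cderive_CPS_ratio (U : nat -> C) (z : R) : - (1/2) < z -> Cdisk U (z / (1 + z)) ->
  is_Cderive (fun z => CPS U (z / (1 + z))) z (Cmult (RtoC (/ (1 + z) ^ 2)) (CPS (Cderiv U) (z / (1 + z)))).
Proof.
  intros Hz HU. apply (is_Cderive_comp (CPS U) (fun z => z / (1 + z))).
  - now apply is_Cderive_CPS.
  - auto_derive; [lra|field; lra].
Qed.

Lemma is_Cderive_HF (A B : C) (c z : R) : 0 < c -> - (1/2) < z -> is_Cderive (HF A B c) z (HF1 A B c z).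
Proof.
  intros Hc Hz. set (T := hcoef A (Cminus (RtoC c) B) c).
  assert (HT : Cdisk T (z / (1 + z))) by (apply hcoef_disk, ratio_disk; trivial).
  assert (H : is_Cderive (fun z => Cmult (cpow (1 + z) (Copp A)) (CPS T (z / (1 + z)))) z (HF1 A B c z)).
  { eapply is_Cderive_eq.
    - apply is_Cderive_mult. now apply is_Cderive_cpow_shift. now apply is_Cderive_CPS_ratio.
    - unfold HF1; fold T; cbv zeta. ring. }
  destruct H as [H1 H2].
  split; [revert H1|revert H2]; apply is_derive_ext_loc;
    apply (locally_open_interval (-(1/2)) (z + 1)); try lra; intros y Hy; rewrite HF_eq; trivial; lra.
Qed.

Lemma is_Cderive_HF1 (A B : C) (c z : R) : 0 < c -> - (1/2) < z -> is_Cderive (HF1 A B c) z (HF2 A B c z).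
Proof.
  intros Hc Hz. set (T := hcoef A (Cminus (RtoC c) B) c).
  assert (HT : Cdisk T (z / (1 + z))) by (apply hcoef_disk, ratio_disk; trivial).
  assert (HT1 : Cdisk (Cderiv T) (z / (1 + z))) by now apply Cdisk_Cderiv.
  unfold HF1; fold T; cbv zeta. eapply is_Cderive_eq.
  - apply is_Cderive_mult. now apply is_Cderive_cpow_shift.
    apply is_Cderive_plus; apply is_Cderive_mult.
    + apply is_Cderive_mult. apply is_Cderive_const. apply (is_Cderive_RtoC (fun z => / (1 + z)) z (- / (1 + z) ^ 2)).
      auto_derive; [lra|field; lra].
    + now apply is_Cderive_CPS_ratio.
    + apply (is_Cderive_RtoC (fun z => / (1 + z) ^ 2) z (- 2 * / (1 + z) ^ 3)).
      auto_derive; [apply Rmult_integral_contrapositive_currified; lra|field; lra].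
    + now apply is_Cderive_CPS_ratio.
  - unfold HF2; fold T; cbv zeta.
    rewrite !RtoC_mult, !RtoC_opp, !RtoC_inv by (try apply pow_nonzero; lra).
    rewrite !RtoC_pow.
    assert (N : RtoC (1 + z) <> RtoC 0) by (apply RtoC_neq0; lra).
    field. trivial.
Qed.

(** The series with parameters [A], [c - B] satisfies its own equation in [w = z / (1 + z)];
    inserting the prefactor and the change of variable turns that equation into the one with
    parameters [A], [B] in [-z]. *)
Lemma HF_ode (A B : C) (c z : R) : 0 < c -> - (1/2) < z ->
  (RtoC (z * (1 + z)) * HF2 A B c z + (RtoC c + (A + B + RtoC 1) * RtoC z) * HF1 A B c z
    + A * B * HF A B c z = RtoC 0)%C.
Proof.
  intros Hc Hz. set (T := hcoef A (Cminus (RtoC c) B) c).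
  assert (HT : Cdisk T (z / (1 + z))) by (apply hcoef_disk, ratio_disk; trivial).
  pose proof (CPS_ode T c (Cplus A (Cminus (RtoC c) B)) (Cmult A (Cminus (RtoC c) B)) _ HT (fun k => hcoef_rec _ _ c k Hc)) as O.
  rewrite HF_eq by trivial. unfold HF1, HF2; fold T; cbv zeta.
  assert (N : RtoC (1 + z) <> RtoC 0) by (apply RtoC_neq0; lra).
  assert (N1 : (RtoC 1 + RtoC z)%C <> RtoC 0) by (rewrite <- RtoC_plus; trivial).
  set (S0 := CPS T (z / (1 + z))) in *. set (S1 := CPS (Cderiv T) (z / (1 + z))) in *.
  set (S2 := CPS (Cderiv (Cderiv T)) (z / (1 + z))) in *.
  replace (z / (1 + z) * (1 - z / (1 + z))) with (z / (1 + z) ^ 2) in O by (field; lra).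
  rewrite !RtoC_div in O by (try apply pow_nonzero; lra).
  rewrite RtoC_pow in O.
  rewrite !RtoC_inv by (try apply pow_nonzero; lra). rewrite !RtoC_pow.
  rewrite RtoC_mult. rewrite RtoC_plus in *.
  (* The two equations differ by the factor [(1 + z)^(-A) / (1 + z)]. *)
  match type of O with ?l = _ => transitivity (cpow (1 + z) (- A) * / (RtoC 1 + RtoC z) * l)%C;
    [|rewrite O; ring] end.
  field. trivial.
Qed.

(** * Energy estimates *)

Lemma Rmult_sqr_ge_0 (u v : R) : 0 <= u -> 0 <= u * v ^ 2.
Proof. intros Hu. apply Rmult_le_pos; trivial. apply pow2_ge_0. Qed.

Lemma derive_le0_decr (f f' : R -> R) (u v : R) : u <= v ->
  (forall t, u <= t <= v -> is_derive f t (f' t)) -> (forall t, u <= t <= v -> f' t <= 0) -> f v <= f u.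
Proof.
  intros Huv Hd Hn.
  destruct (MVT_gen f u v f') as [t [Ht E]].
  - intros t Ht. rewrite Rmin_left, Rmax_right in Ht by lra. apply Hd; lra.
  - intros t Ht. rewrite Rmin_left, Rmax_right in Ht by lra.
    apply continuity_pt_filterlim. apply (is_derive_continuous f t (f' t)). now apply Hd.
  - rewrite Rmin_left, Rmax_right in Ht by lra. pose proof (Hn t Ht). nra.
Qed.

(** Hypergeometric equation in [-z] with parameter sum [s] and product [P]. Both are real for
    conjugate parameters, so real and imaginary parts of a solution satisfy it separately. *)
Record hyp_solution (c s P : R) (y y1 y2 : R -> R) : Prop := {
  hyp_d1 : forall z, 0 <= z -> is_derive y z (y1 z);
  hyp_d2 : forall z, 0 <= z -> is_derive y1 z (y2 z);
  hyp_eq : forall z, 0 <= z -> z * (1 + z) * y2 z + (c + (s + 1) * z) * y1 z + P * y z = 0 }.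

(** Along an exact solution the energy [z (1 + z) y'^2 + P y^2] has derivative
    [-(2c - 1 + 2 s z) y'^2], which is non-positive for [c > 1/2]. A residual [e] adds [2 y' e];
    completing the square absorbs it at the price [eps^2 / (2c - 1)] per unit length. Residuals
    occur because integrals cut at [T] solve the equation only up to a boundary term. *)
Lemma hyp_energy (c s P eps z : R) (y y1 y2 : R -> R) :
  1/2 < c -> 0 <= s -> 0 <= z ->
  (forall t, 0 <= t <= z -> is_derive y t (y1 t)) -> (forall t, 0 <= t <= z -> is_derive y1 t (y2 t)) ->
  (forall t, 0 <= t <= z -> Rabs (t * (1 + t) * y2 t + (c + (s + 1) * t) * y1 t + P * y t) <= eps) ->
  z * (1 + z) * y1 z ^ 2 + P * y z ^ 2 <= P * y 0 ^ 2 + eps ^ 2 * z / (2 * c - 1).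
Proof.
  intros Hc Hs Hz D1 D2 Hr.
  set (k := 2 * c - 1). assert (Hk : 0 < k) by (unfold k; lra).
  pose proof (derive_le0_decr (fun t => t * (1 + t) * y1 t ^ 2 + P * y t ^ 2 - eps ^ 2 * t / k)
    (fun t => (1 + 2 * t) * y1 t ^ 2 + 2 * (t * (1 + t)) * y1 t * y2 t + 2 * P * y t * y1 t - eps ^ 2 / k)
    0 z Hz) as H.
  cut (z * (1 + z) * y1 z ^ 2 + P * y z ^ 2 - eps ^ 2 * z / k <= 0 * (1 + 0) * y1 0 ^ 2 + P * y 0 ^ 2 - eps ^ 2 * 0 / k).
  { replace (eps ^ 2 * 0 / k) with 0 by (field; lra). lra. }
  apply H; clear H; intros t Ht.
  - auto_derive.
    + repeat split; trivial; try (exists (y1 t); exact (D1 t Ht)); exists (y2 t); exact (D2 t Ht).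
    + replace (Derive (fun x => y x) t) with (y1 t) by (symmetry; apply is_derive_unique; exact (D1 t Ht)).
      replace (Derive (fun x => y1 x) t) with (y2 t) by (symmetry; apply is_derive_unique; exact (D2 t Ht)).
      field. lra.
  - specialize (Hr t Ht). set (e := t * (1 + t) * y2 t + (c + (s + 1) * t) * y1 t + P * y t) in *.
    replace ((1 + 2 * t) * y1 t ^ 2 + 2 * (t * (1 + t)) * y1 t * y2 t + 2 * P * y t * y1 t - eps ^ 2 / k)
      with (- (2 * s * t * y1 t ^ 2) - (k * y1 t ^ 2 - 2 * y1 t * e + eps ^ 2 / k)) by (unfold e, k; field; lra).
    assert (He : e ^ 2 <= eps ^ 2).
    { rewrite <- (pow2_abs e). apply pow_incr. split; [apply Rabs_pos|trivial]. }
    assert (0 <= k * y1 t ^ 2 - 2 * y1 t * e + eps ^ 2 / k).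
    { replace (k * y1 t ^ 2 - 2 * y1 t * e + eps ^ 2 / k) with (((k * y1 t - e) ^ 2 + (eps ^ 2 - e ^ 2)) / k) by (field; lra).
      apply Rdiv_le_0_compat; trivial. pose proof (pow2_ge_0 (k * y1 t - e)). lra. }
    assert (0 <= s * t * y1 t ^ 2) by (apply Rmult_sqr_ge_0; repeat apply Rmult_le_pos; lra). lra.
Qed.

Lemma hyp_solution_energy (c s P z : R) (y y1 y2 : R -> R) :
  1/2 < c -> 0 <= s -> 0 <= z -> hyp_solution c s P y y1 y2 ->
  z * (1 + z) * y1 z ^ 2 + P * y z ^ 2 <= P * y 0 ^ 2.
Proof.
  intros Hc Hs Hz [D1 D2 E].
  pose proof (hyp_energy c s P 0 z y y1 y2 Hc Hs Hz) as H.
  replace (0 ^ 2 * z / (2 * c - 1)) with 0 in H by (field; lra). rewrite Rplus_0_r in H. apply H.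
  - intros; apply D1; lra.
  - intros; apply D2; lra.
  - intros t Ht. rewrite E by lra. rewrite Rabs_R0. lra.
Qed.

(** At [z = 0] the energy sees [y] but not [y'], so a solution regular at 0 is determined by its
    value there. *)
Lemma hyp_solution_zero (c s P z : R) (y y1 y2 : R -> R) :
  1/2 < c -> 0 <= s -> 0 < P -> 0 <= z -> hyp_solution c s P y y1 y2 -> y 0 = 0 -> y z = 0.
Proof.
  intros Hc Hs HP Hz Hy H0. pose proof (hyp_solution_energy c s P z y y1 y2 Hc Hs Hz Hy) as H.
  rewrite H0 in H. replace (P * 0 ^ 2) with 0 in H by ring.
  assert (0 <= z * (1 + z) * y1 z ^ 2) by (apply Rmult_sqr_ge_0; repeat apply Rmult_le_pos; lra).
  assert (H2 : P * y z ^ 2 = 0).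
  { apply Rle_antisym; [lra|]. apply Rmult_le_pos; [lra|apply pow2_ge_0]. }
  destruct (Rmult_integral _ _ H2) as [G|G]; [lra|]. rewrite <- Rsqr_pow2 in G. now apply Rsqr_0_uniq.
Qed.

Lemma HF_0 (A B : C) (c : R) : HF A B c 0 = RtoC 1.
Proof.
  rewrite HF_eq by lra. unfold CPS.
  replace (0 / (1 + 0)) with 0 by field. rewrite !PSeries_0.
  unfold hcoef; simpl. unfold cpow. rewrite Rplus_0_r, ln_1, !Rmult_0_r, exp_0, cos_0, sin_0.
  apply injective_projections; simpl; field.
Qed.

Lemma HF_solution (A B : C) (c s P : R) : 0 < c -> Cplus A B = RtoC s -> Cmult A B = RtoC P ->
  hyp_solution c s P (fun z => Re (HF A B c z)) (fun z => Re (HF1 A B c z)) (fun z => Re (HF2 A B c z)) /\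
  hyp_solution c s P (fun z => Im (HF A B c z)) (fun z => Im (HF1 A B c z)) (fun z => Im (HF2 A B c z)).
Proof.
  intros Hc HS HP.
  assert (O : forall z, 0 <= z -> (RtoC (z * (1 + z)) * HF2 A B c z + (RtoC c + (RtoC s + RtoC 1) * RtoC z) * HF1 A B c z
    + RtoC P * HF A B c z = RtoC 0)%C).
  { intros z Hz. pose proof (HF_ode A B c z Hc ltac:(lra)) as O. now rewrite HS, HP in O. }
  split; constructor; intros z Hz.
  - apply (is_Cderive_HF A B c z); lra.
  - apply (is_Cderive_HF1 A B c z); lra.
  - specialize (O z Hz). revert O. generalize (HF A B c z) (HF1 A B c z) (HF2 A B c z).
    intros f f1 f2 O. apply (f_equal Re) in O. unfold Re, Im in *; simpl in O. lra.
  - apply (is_Cderive_HF A B c z); lra.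
  - apply (is_Cderive_HF1 A B c z); lra.
  - specialize (O z Hz). revert O. generalize (HF A B c z) (HF1 A B c z) (HF2 A B c z).
    intros f f1 f2 O. apply (f_equal Im) in O. unfold Re, Im in *; simpl in O. lra.
Qed.

(** The imaginary part solves the same real equation and vanishes at 0. *)
Lemma HF_real (A B : C) (c s P z : R) : 1/2 < c -> Cplus A B = RtoC s -> Cmult A B = RtoC P ->
  0 <= s -> 0 < P -> 0 <= z -> HF A B c z = RtoC (Re (HF A B c z)).
Proof.
  intros Hc HS HP Hs HP0 Hz.
  destruct (HF_solution A B c s P ltac:(lra) HS HP) as [_ HI].
  apply injective_projections; simpl; trivial.
  apply (hyp_solution_zero c s P z _ _ _ Hc Hs HP0 Hz HI).
  now rewrite HF_0.
Qed.

(** At infinity [z^a y] oscillates in [b ln z], so the suitable quantity [E2] is the energy of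
    [z^a y] for the operator [z d/dz]. [K] must not depend on [b], since one bound serves all modes;
    [b >= 1/2] is the range [b = m/2] with [m >= 1]. *)
Lemma hyp_solution_decay (a c : R) : 0 < a -> 1/2 < c ->
  exists K, 0 < K /\ forall b y y1 y2, 1/2 <= b -> hyp_solution c (2 * a) (a ^ 2 + b ^ 2) y y1 y2 -> y 0 = 1 ->
    forall z, 0 <= z -> Rabs (y z) <= K * Rpower (1 + z) (- a).
Proof.
  intros Ha Hc.
  (* [ka] and [K0] come from differentiating the weighted energy [E2]: its derivative is at most
     [K0 * E2 / z^2]. *)
  set (ka := 1 + a - c).
  set (K0 := Rabs (2 * a - 1 + 2 * ka) + 5 * Rabs ka * a).
  assert (HK0 : 0 <= K0).
  { unfold K0. pose proof (Rabs_pos (2 * a - 1 + 2 * ka)).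
    assert (0 <= Rabs ka * a) by (apply Rmult_le_pos; [apply Rabs_pos|lra]). lra. }
  (* [E2 1 <= 6 a^2 + 3 b^2 <= b^2 (24 a^2 + 3)] for [b >= 1/2], and [exp K0] is the loss between 1
     and infinity. Dividing by [b^2] leaves a bound free of [b]. *)
  set (Q := exp K0 * (24 * a ^ 2 + 3)).
  assert (HQ : 1 <= Q).
  { unfold Q. assert (1 <= exp K0) by (rewrite <- exp_0; destruct HK0 as [H|H]; [left; now apply exp_increasing|rewrite <- H; lra]).
    pose proof (pow2_ge_0 a). nra. }
  exists (Q * Rpower 2 a). split.
  { apply Rmult_lt_0_compat; [lra|apply exp_pos]. }
  intros b y y1 y2 Hb Hy Y0 z Hz.
  assert (Hp2 : 0 < Rpower 2 a) by apply exp_pos.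
  assert (En : forall z, 0 <= z -> z * (1 + z) * y1 z ^ 2 + (a ^ 2 + b ^ 2) * y z ^ 2 <= (a ^ 2 + b ^ 2)).
  { intros t Ht. pose proof (hyp_solution_energy c (2 * a) (a ^ 2 + b ^ 2) t y y1 y2 Hc ltac:(lra) Ht Hy) as H.
    rewrite Y0 in H. lra. }
  assert (Hab : 0 < a ^ 2 + b ^ 2) by nra.
  assert (Y1 : forall z, 0 <= z -> y z ^ 2 <= 1).
  { intros t Ht. specialize (En t Ht).
    assert (0 <= t * (1 + t) * y1 t ^ 2) by (apply Rmult_sqr_ge_0; repeat apply Rmult_le_pos; lra). nra. }
  assert (Main : forall z, 1 <= z -> Rpower z (2 * a) * y z ^ 2 <= Q).
  { intros t Ht.
    set (E2 := fun z => exp (2 * a * ln z) * ((1 + / z) * (z * y1 z + a * y z) ^ 2 + b ^ 2 * y z ^ 2)).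
    set (E2' := fun z => exp (2 * a * ln z) * ((2 * a - 1 + 2 * ka) * (z * y1 z + a * y z) ^ 2
           - 2 * ka * a * (z * y1 z + a * y z) * y z) * / z ^ 2).
    assert (D : forall z, 1 <= z -> is_derive E2 z (E2' z)).
    { intros x Hx. unfold E2, E2'.
      assert (X1 : is_derive y x (y1 x)) by (apply (hyp_d1 _ _ _ _ _ _ Hy); lra).
      assert (X2 : is_derive y1 x (y2 x)) by (apply (hyp_d2 _ _ _ _ _ _ Hy); lra).
      assert (X3 : y2 x = (- (c + (2 * a + 1) * x) * y1 x - (a ^ 2 + b ^ 2) * y x) / (x * (1 + x))).
      { pose proof (hyp_eq _ _ _ _ _ _ Hy x ltac:(lra)) as E. apply Rmult_eq_reg_l with (x * (1 + x)).
        - field_simplify; [|lra]. lra.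
        - apply Rmult_integral_contrapositive_currified; lra. }
      auto_derive.
      - repeat split; try lra; try (exists (y1 x); exact X1); try (exists (y2 x); exact X2).
      - replace (Derive (fun x => y x) x) with (y1 x) by (symmetry; apply is_derive_unique; exact X1).
        replace (Derive (fun x => y1 x) x) with (y2 x) by (symmetry; apply is_derive_unique; exact X2).
        rewrite X3. unfold ka. field. lra. }
    (* The factor [exp (K0 / z)] integrates the relative error [K0 / z^2], so the product decreases
       on [[1, oo)]. *)
    assert (Dec : E2 t * exp (K0 * / t) <= E2 1 * exp (K0 * / 1)).
    { apply (derive_le0_decr (fun z => E2 z * exp (K0 * / z)) (fun z => (E2' z - K0 * / z ^ 2 * E2 z) * exp (K0 * / z))); trivial.
      - intros x Hx. eapply is_derive_eq.
        + apply (is_derive_mult E2 (fun z => exp (K0 * / z)) x (E2' x) (- K0 * / x ^ 2 * exp (K0 * / x))).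
          * apply D; lra.
          * auto_derive; [lra|field; lra].
          * apply Rmult_comm.
        + unfold plus, mult; simpl. ring.
      - intros x Hx. rewrite <- (Rmult_0_l (exp (K0 * / x))). apply Rmult_le_compat_r; [left; apply exp_pos|].
        unfold E2, E2'. set (u := x * y1 x + a * y x). set (v := y x).
        assert (P1 : 0 < exp (2 * a * ln x)) by apply exp_pos.
        assert (P2 : 0 < / x ^ 2) by (apply Rinv_0_lt_compat, pow_lt; lra).
        assert (P3 : 0 < / x) by (apply Rinv_0_lt_compat; lra).
        set (EX := exp (2 * a * ln x)) in *.
        replace (EX * ((2 * a - 1 + 2 * ka) * u ^ 2 - 2 * ka * a * u * v) * / x ^ 2 - K0 * / x ^ 2 * (EX * ((1 + / x) * u ^ 2 + b ^ 2 * v ^ 2)))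
          with (- (EX * / x ^ 2 * (K0 * ((1 + / x) * u ^ 2 + b ^ 2 * v ^ 2) - ((2 * a - 1 + 2 * ka) * u ^ 2 - 2 * ka * a * u * v)))) by ring.
        apply Ropp_le_cancel. rewrite Ropp_involutive, Ropp_0.
        apply Rmult_le_pos. left; now apply Rmult_lt_0_compat.
        assert (L1 : K0 * (u ^ 2 + b ^ 2 * v ^ 2) <= K0 * ((1 + / x) * u ^ 2 + b ^ 2 * v ^ 2)).
        { apply Rmult_le_compat_l; trivial. pose proof (pow2_ge_0 u). nra. }
        assert (L2 : (2 * a - 1 + 2 * ka) * u ^ 2 <= Rabs (2 * a - 1 + 2 * ka) * u ^ 2).
        { apply Rmult_le_compat_r; [apply pow2_ge_0|apply Rle_abs]. }
        assert (L3 : - (2 * ka * a * u * v) <= Rabs ka * a * (u ^ 2 + v ^ 2)).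
        { pose proof (Rle_abs ka). pose proof (Rle_abs (- ka)). rewrite Rabs_Ropp in *.
          assert (0 <= (Rabs ka - ka) * a * (u - v) ^ 2) by (apply Rmult_sqr_ge_0; repeat apply Rmult_le_pos; lra).
          assert (0 <= (Rabs ka + ka) * a * (u + v) ^ 2) by (apply Rmult_sqr_ge_0; repeat apply Rmult_le_pos; lra).
          nra. }
        (* Here [b >= 1/2] lets the energy absorb the [v^2] of the cross term. *)
        assert (L4 : v ^ 2 <= 4 * b ^ 2 * v ^ 2).
        { pose proof (pow2_ge_0 v). assert (1 <= 4 * b ^ 2) by nra. nra. }
        assert (L5 : 0 <= Rabs ka * a) by (apply Rmult_le_pos; [apply Rabs_pos|lra]).
        assert (L6 : Rabs ka * a * (u ^ 2 + v ^ 2) <= Rabs ka * a * (u ^ 2 + 4 * b ^ 2 * v ^ 2)) by (apply Rmult_le_compat_l; lra).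
        pose proof (Rabs_pos (2 * a - 1 + 2 * ka)). pose proof (pow2_ge_0 u). pose proof (pow2_ge_0 v).
        assert (0 <= b ^ 2 * v ^ 2) by (apply Rmult_le_pos; trivial; apply pow2_ge_0).
        unfold K0 in L1 |- *. nra. }
    assert (E1 : E2 1 <= 6 * a ^ 2 + 3 * b ^ 2).
    { unfold E2. rewrite ln_1, Rmult_0_r, exp_0. pose proof (En 1 ltac:(lra)) as H. pose proof (Y1 1 ltac:(lra)) as H'.
      rewrite Rinv_1.
      assert (0 <= a ^ 2 * y 1 ^ 2) by (apply Rmult_le_pos; apply pow2_ge_0).
      assert (0 <= b ^ 2 * y 1 ^ 2) by (apply Rmult_le_pos; apply pow2_ge_0).
      assert (a ^ 2 * y 1 ^ 2 <= a ^ 2) by (pose proof (pow2_ge_0 a); nra).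
      assert (b ^ 2 * y 1 ^ 2 <= b ^ 2) by (pose proof (pow2_ge_0 b); nra).
      pose proof (pow2_ge_0 (1 * y1 1 - a * y 1)). nra. }
    assert (E3 : b ^ 2 * (Rpower t (2 * a) * y t ^ 2) <= E2 t).
    { unfold E2, Rpower. assert (0 < exp (2 * a * ln t)) by apply exp_pos.
      assert (0 < / t) by (apply Rinv_0_lt_compat; lra).
      assert (0 <= (1 + / t) * (t * y1 t + a * y t) ^ 2) by (apply Rmult_le_pos; [lra|apply pow2_ge_0]). nra. }
    assert (E4 : E2 t <= E2 t * exp (K0 * / t)).
    { assert (0 <= E2 t).
      { apply Rle_trans with (2 := E3). apply Rmult_le_pos; [apply pow2_ge_0|]. apply Rmult_le_pos; [left; apply exp_pos|apply pow2_ge_0]. }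
      assert (1 <= exp (K0 * / t)).
      { rewrite <- exp_0. assert (G : 0 <= K0 * / t) by (apply Rmult_le_pos; trivial; left; apply Rinv_0_lt_compat; lra).
        destruct G as [G|G]; [left; now apply exp_increasing|rewrite <- G; lra]. }
      nra. }
    rewrite Rinv_1, Rmult_1_r in Dec.
    assert (E5 : b ^ 2 * (Rpower t (2 * a) * y t ^ 2) <= b ^ 2 * Q).
    { apply Rle_trans with ((6 * a ^ 2 + 3 * b ^ 2) * exp K0).
      - apply Rle_trans with (1 := E3), Rle_trans with (1 := E4), Rle_trans with (1 := Dec).
        apply Rmult_le_compat_r; trivial. left; apply exp_pos.
      - unfold Q. assert (0 < exp K0) by apply exp_pos.
        assert (6 * a ^ 2 + 3 * b ^ 2 <= b ^ 2 * (24 * a ^ 2 + 3)).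
        { assert (6 * a ^ 2 <= 24 * a ^ 2 * b ^ 2) by (assert (1 <= 4 * b ^ 2) by nra; pose proof (pow2_ge_0 a); nra). lra. }
        nra. }
    apply Rmult_le_reg_l with (b ^ 2); trivial. nra. }
  assert (Sq : forall q r, 0 <= r -> q ^ 2 <= r ^ 2 -> Rabs q <= r).
  { intros q r Hr Hqr. rewrite <- (Rabs_pos_eq r Hr). apply Rsqr_le_abs_0. unfold Rsqr. simpl in Hqr. lra. }
  (* The factor [Rpower 2 a] serves both ranges: [1 + z <= 2] up to 1, and [1 + z <= 2 z] beyond. *)
  destruct (Rle_dec z 1) as [Hz1|Hz1].
  - apply Rle_trans with 1.
    + apply Sq; [lra|]. specialize (Y1 z Hz). lra.
    + assert (1 <= Rpower 2 a * Rpower (1 + z) (- a)).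
      { rewrite Rpower_Ropp. assert (0 < Rpower (1 + z) a) by apply exp_pos.
        apply Rmult_le_reg_r with (Rpower (1 + z) a); trivial.
        rewrite Rmult_assoc, Rinv_l by lra. rewrite Rmult_1_l, Rmult_1_r.
        apply Rle_Rpower_l; lra. }
      rewrite Rmult_assoc. nra.
  - assert (Hz' : 1 <= z) by lra. specialize (Main z Hz').
    assert (G : Rabs (y z) <= Q * Rpower z (- a)).
    { apply Sq. apply Rmult_le_pos; [lra|left; apply exp_pos].
      rewrite Rpow_mult_distr. replace (Rpower z (- a) ^ 2) with (/ Rpower z (2 * a)).
      - assert (0 < Rpower z (2 * a)) by apply exp_pos.
        apply Rmult_le_reg_l with (Rpower z (2 * a)); trivial.
        replace (Rpower z (2 * a) * (Q ^ 2 * / Rpower z (2 * a))) with (Q ^ 2) by (field; lra). nra.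
      - rewrite <- Rpower_Ropp. simpl. rewrite Rmult_1_r, <- Rpower_plus. f_equal. ring. }
    apply Rle_trans with (1 := G). rewrite Rmult_assoc. apply Rmult_le_compat_l; [lra|].
    rewrite !Rpower_Ropp.
    assert (0 < Rpower z a) by apply exp_pos. assert (0 < Rpower (1 + z) a) by apply exp_pos.
    apply Rmult_le_reg_l with (Rpower z a); trivial. apply Rmult_le_reg_r with (Rpower (1 + z) a); trivial.
    replace (Rpower z a * / Rpower z a * Rpower (1 + z) a) with (Rpower (1 + z) a) by (field; lra).
    replace (Rpower z a * (Rpower 2 a * / Rpower (1 + z) a) * Rpower (1 + z) a) with (Rpower z a * Rpower 2 a) by (field; lra).
    rewrite Rpower_mult_distr by lra. apply Rle_Rpower_l; lra.
Qed.

(** * Real parameters: bounds and asymptotics *)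

Lemma poch_shift (x : R) (k : nat) : poch x (S k) = x * poch (x + 1) k.
Proof.
  induction k as [|k IH]; [simpl; ring|].
  change (poch x (S (S k))) with (poch x (S k) * (x + INR (S k))). rewrite IH.
  change (poch (x + 1) (S k)) with (poch (x + 1) k * (x + 1 + INR k)). rewrite S_INR. ring.
Qed.

(** Coefficients of [(1 - w)^(-1/2)], the scale against which the Pfaff series of the kernels are
    measured near [w = 1]. *)
Definition bincoef (k : nat) : R := poch (1/2) k / INR (fact k).

Lemma fact_S_INR (k : nat) : INR (fact (S k)) = (INR k + 1) * INR (fact k).
Proof. change (fact (S k)) with (S k * fact k)%nat. now rewrite mult_INR, S_INR. Qed.

Lemma INR_fact_pos (k : nat) : 0 < INR (fact k).
Proof. apply lt_0_INR, lt_O_fact. Qed.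

Lemma bincoef_pos (k : nat) : 0 < bincoef k.
Proof. apply Rdiv_lt_0_compat; [apply poch_pos; lra|apply INR_fact_pos]. Qed.

Lemma bincoef_S (k : nat) : (INR k + 1) * bincoef (S k) = (INR k + 1/2) * bincoef k.
Proof.
  unfold bincoef. rewrite fact_S_INR. simpl poch.
  pose proof (INR_fact_pos k). pose proof (pos_INR k). field. split; lra.
Qed.

Lemma bincoef_decr (k : nat) : bincoef (S k) <= bincoef k.
Proof.
  pose proof (bincoef_S k). pose proof (bincoef_pos k). pose proof (pos_INR k).
  apply Rmult_le_reg_l with (INR k + 1); nra.
Qed.

Lemma bincoef_le_1 (k : nat) : bincoef k <= 1.
Proof.
  induction k as [|k IH].
  - unfold bincoef; simpl. lra.
  - apply Rle_trans with (2 := IH). apply bincoef_decr.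
Qed.

Lemma CV_radius_dominated (u : nat -> R) (K w : R) :
  (forall k, Rabs (u k) <= K) -> Rabs w < 1 -> Rbar_lt (Rabs w) (CV_radius u).
Proof.
  intros Hu Hw. apply Rbar_lt_le_trans with 1; [exact Hw|].
  destruct (CV_radius_bounded u) as [H _]. apply (H 1).
  exists K. intros n. rewrite pow1, Rmult_1_r. apply Hu.
Qed.

Lemma PSeries_Rabs_le (u v : nat -> R) (w : R) : 0 <= w -> Rbar_lt (Rabs w) (CV_radius v) ->
  (forall k, Rabs (u k) <= v k) -> Rabs (PSeries u w) <= PSeries v w.
Proof.
  intros Hw Hv Huv. unfold PSeries.
  assert (E : ex_series (fun k => v k * w ^ k)).
  { apply ex_pseries_R. now apply CV_radius_inside. }
  assert (L : forall k, 0 <= Rabs (u k * w ^ k) <= v k * w ^ k).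
  { intros k. split; [apply Rabs_pos|]. rewrite Rabs_mult, (Rabs_pos_eq (w ^ k)) by now apply pow_le.
    apply Rmult_le_compat_r; [now apply pow_le|apply Huv]. }
  apply Rle_trans with (Series (fun k => Rabs (u k * w ^ k))).
  - apply Series_Rabs. apply (ex_series_le (V := R_CompleteNormedModule)) with (2 := E).
    intros k. unfold norm; simpl. unfold abs; simpl. rewrite Rabs_Rabsolu. apply L.
  - now apply Series_le.
Qed.

Lemma PSeries_bincoef_derive (w : R) : Rabs w < 1 ->
  (1 - w) * PSeries (PS_derive bincoef) w = / 2 * PSeries bincoef w.
Proof.
  intros Hw.
  assert (Hr : Rbar_lt (Rabs w) (CV_radius bincoef)).
  { apply CV_radius_dominated with 1; trivial. intros k. rewrite Rabs_pos_eq; [apply bincoef_le_1|left; apply bincoef_pos]. }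
  assert (E : PSeries (PS_derive bincoef) w = w * PSeries (PS_derive bincoef) w + / 2 * PSeries bincoef w).
  { apply is_pseries_unique.
    apply is_pseries_ext with (PS_plus (fun k => INR k * bincoef k) (PS_scal (/ 2) bincoef)).
    - intros k. change (INR k * bincoef k + / 2 * bincoef k = INR (S k) * bincoef (S k)).
      rewrite S_INR, bincoef_S. lra.
    - apply (is_pseries_plus (V := R_NormedModule)).
      + now apply is_pseries_euler.
      + apply (is_pseries_scal (V := R_NormedModule)); [apply Rmult_comm|]. now apply PSeries_correct, CV_radius_inside. }
  lra.
Qed.

(** The equation [(1 - w) y' = y / 2] makes [sqrt (1 - w) * y] constant. *)
Lemma PSeries_bincoef (w : R) : 0 <= w < 1 -> PSeries bincoef w = / sqrt (1 - w).
Proof.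
  intros Hw.
  assert (Hr : forall t, 0 <= t < 1 -> Rbar_lt (Rabs t) (CV_radius bincoef)).
  { intros t Ht. apply CV_radius_dominated with 1; [|apply Rabs_def1; lra].
    intros k. rewrite Rabs_pos_eq; [apply bincoef_le_1|left; apply bincoef_pos]. }
  assert (D : forall t, 0 <= t <= w -> is_derive (fun t => sqrt (1 - t) * PSeries bincoef t) t 0).
  { intros t Ht. eapply is_derive_eq.
    - apply (is_derive_mult (fun t => sqrt (1 - t)) (PSeries bincoef) t (- / (2 * sqrt (1 - t))) (PSeries (PS_derive bincoef) t)).
      + auto_derive; [lra|]. replace (1 + - t) with (1 - t) by ring. field. apply Rgt_not_eq, sqrt_lt_R0; lra.
      + apply is_derive_PSeries, Hr; lra.
      + apply Rmult_comm.
    - pose proof (PSeries_bincoef_derive t ltac:(apply Rabs_def1; lra)) as E.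
      assert (Hs : 0 < sqrt (1 - t)) by (apply sqrt_lt_R0; lra).
      unfold plus, mult; simpl. unfold mult; simpl.
      apply Rmult_eq_reg_r with (sqrt (1 - t)); [|lra].
      replace ((- / (2 * sqrt (1 - t)) * PSeries bincoef t + sqrt (1 - t) * PSeries (PS_derive bincoef) t) * sqrt (1 - t))
       with (sqrt (1 - t) * sqrt (1 - t) * PSeries (PS_derive bincoef) t - / 2 * PSeries bincoef t) by (field; lra).
      rewrite sqrt_sqrt by lra. lra. }
  assert (L1 := derive_le0_decr _ _ 0 w (proj1 Hw) D (fun _ _ => Rle_refl 0)).
  (* Constancy is obtained by applying the monotonicity lemma to the function and to its
     opposite. *)
  assert (L2 : - (sqrt (1 - w) * PSeries bincoef w) <= - (sqrt (1 - 0) * PSeries bincoef 0)).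
  { apply (derive_le0_decr (fun t => - (sqrt (1 - t) * PSeries bincoef t)) (fun _ => -0) 0 w); try lra.
    - intros t Ht. apply (is_derive_opp (V := R_NormedModule)). now apply D.
    - intros; lra. }
  cbv beta in L1, L2.
  rewrite PSeries_0, Rminus_0_r, sqrt_1 in L1, L2. unfold bincoef at 2 in L1. unfold bincoef at 2 in L2. simpl in L1, L2.
  assert (Hs : 0 < sqrt (1 - w)) by (apply sqrt_lt_R0; lra).
  apply Rmult_eq_reg_l with (sqrt (1 - w)); [|lra]. rewrite Rinv_r by lra. lra.
Qed.

Lemma PSeries_bincoef_derive' (w : R) : 0 <= w < 1 ->
  PSeries (PS_derive bincoef) w = / (2 * (1 - w) * sqrt (1 - w)).
Proof.
  intros Hw. pose proof (PSeries_bincoef_derive w ltac:(apply Rabs_def1; lra)) as E.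
  rewrite PSeries_bincoef in E by lra. assert (0 < sqrt (1 - w)) by (apply sqrt_lt_R0; lra).
  apply Rmult_eq_reg_l with (1 - w); [|lra]. rewrite E. field. lra.
Qed.

Lemma bincoef_disk (K w : R) : 0 <= K -> Rabs w < 1 -> Rbar_lt (Rabs w) (CV_radius (fun k => K * bincoef k)).
Proof.
  intros HK Hw. apply CV_radius_dominated with K; trivial. intros k.
  pose proof (bincoef_pos k). pose proof (bincoef_le_1 k). rewrite Rabs_pos_eq by nra. nra.
Qed.

Lemma PSeries_le_bincoef (u : nat -> R) (K w : R) : 0 <= K -> 0 <= w < 1 ->
  (forall k, Rabs (u k) <= K * bincoef k) -> Rabs (PSeries u w) <= K / sqrt (1 - w).
Proof.
  intros HK Hw Hu. eapply Rle_trans.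
  - apply (PSeries_Rabs_le u (fun k => K * bincoef k)); try lra; trivial.
    apply bincoef_disk; trivial. apply Rabs_def1; lra.
  - right. change (fun k => K * bincoef k) with (PS_scal (V := R_NormedModule) K bincoef).
    rewrite PSeries_scal, PSeries_bincoef by lra. reflexivity.
Qed.

Lemma PSeries_derive_le_bincoef (u : nat -> R) (K w : R) : 0 <= K -> 0 <= w < 1 ->
  (forall k, Rabs (u k) <= K * bincoef k) ->
  Rabs (PSeries (PS_derive u) w) <= K / ((1 - w) * sqrt (1 - w)).
Proof.
  intros HK Hw Hu. eapply Rle_trans.
  - apply (PSeries_Rabs_le _ (PS_derive (fun k => K * bincoef k))); try lra.
    + rewrite CV_radius_derive. apply bincoef_disk; trivial. apply Rabs_def1; lra.
    + intros k. unfold PS_derive. rewrite Rabs_mult, Rabs_pos_eq by apply pos_INR.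
      apply Rmult_le_compat_l; [apply pos_INR|apply Hu].
  - rewrite (PSeries_ext _ (PS_scal (V := R_NormedModule) K (PS_derive bincoef))).
    2:{ intros k. unfold PS_derive, PS_scal, scal; simpl. unfold mult; simpl. ring. }
    rewrite PSeries_scal, PSeries_bincoef_derive' by lra.
    assert (0 < sqrt (1 - w)) by (apply sqrt_lt_R0; lra).
    replace (K / ((1 - w) * sqrt (1 - w))) with (2 * (K * / (2 * (1 - w) * sqrt (1 - w)))) by (field; lra).
    assert (0 <= K * / (2 * (1 - w) * sqrt (1 - w))).
    { apply Rmult_le_pos; trivial. left. apply Rinv_0_lt_compat. repeat apply Rmult_lt_0_compat; lra. }
    lra.
Qed.

(** The majorant telescopes: [bincoef k / (k + 1) = 2 (bincoef k - bincoef (k + 1))], so its partial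
    sums stay below [2 * bincoef 0 = 2], uniformly up to [w = 1]. *)
Lemma PSeries_le_const (u : nat -> R) (K w : R) : 0 <= K -> 0 <= w < 1 ->
  (forall k, Rabs (u k) <= K * (bincoef k / (INR k + 1))) -> Rabs (PSeries u w) <= 2 * K.
Proof.
  intros HK Hw Hu.
  assert (Hb : forall k, 0 <= bincoef k / (INR k + 1) <= bincoef k).
  { intros k. pose proof (bincoef_pos k). pose proof (pos_INR k). split.
    - apply Rdiv_le_0_compat; lra.
    - apply Rmult_le_reg_r with (INR k + 1); [lra|]. unfold Rdiv. rewrite Rmult_assoc, Rinv_l by lra. nra. }
  assert (Hr : Rbar_lt (Rabs w) (CV_radius (fun k => K * (bincoef k / (INR k + 1))))).
  { apply CV_radius_dominated with K; [|apply Rabs_def1; lra]. intros k.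
    pose proof (Hb k). pose proof (bincoef_le_1 k). rewrite Rabs_pos_eq by nra. nra. }
  eapply Rle_trans; [apply (PSeries_Rabs_le u _ w (proj1 Hw) Hr Hu)|].
  unfold PSeries.
  assert (E : ex_series (fun k => K * (bincoef k / (INR k + 1)) * w ^ k)).
  { apply ex_pseries_R. now apply CV_radius_inside. }
  apply (is_lim_seq_le (fun n => sum_n (fun k => K * (bincoef k / (INR k + 1)) * w ^ k) n) (fun _ => 2 * K)
    (Series (fun k => K * (bincoef k / (INR k + 1)) * w ^ k)) (2 * K)).
  - intros n. apply Rle_trans with (2 * K * (1 - bincoef (S n))).
    + induction n as [|n IH].
      * rewrite sum_O. unfold bincoef; simpl. lra.
      * rewrite sum_Sn.
        assert (X : K * (bincoef (S n) / (INR (S n) + 1)) * w ^ S n <= K * (2 * (bincoef (S n) - bincoef (S (S n))))).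
        { pose proof (Hb (S n)) as H. pose proof (pow_le w (S n) (proj1 Hw)).
          assert (w ^ S n <= 1) by (rewrite <- (pow1 (S n)); apply pow_incr; lra).
          assert (2 * (bincoef (S n) - bincoef (S (S n))) = bincoef (S n) / (INR (S n) + 1)).
          { pose proof (bincoef_S (S n)) as B. pose proof (pos_INR (S n)).
            apply Rmult_eq_reg_l with (INR (S n) + 1); [|lra]. field_simplify; [|lra]. lra. }
          rewrite H2. rewrite Rmult_assoc. apply Rmult_le_compat_l; trivial. nra. }
        match goal with |- plus ?u ?v <= _ => change (u + v <= 2 * K * (1 - bincoef (S (S n)))) end. lra.
    + pose proof (bincoef_pos (S n)). nra.
  - apply Series_correct in E. exact E.
  - apply is_lim_seq_const.
Qed.

(** Unlike [hyp_solution] this holds on a neighbourhood of [[0, oo)] and includes continuity of the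
    second derivative: the kernels built on such functions are differentiated twice under an
    integral. *)
Record hyp_fun (c s P : R) (y y1 y2 : R -> R) : Prop := {
  hf_d1 : forall z, - (1/2) < z -> is_derive y z (y1 z);
  hf_d2 : forall z, - (1/2) < z -> is_derive y1 z (y2 z);
  hf_c2 : forall z, - (1/2) < z -> continuous y2 z;
  hf_eq : forall z, - (1/2) < z -> z * (1 + z) * y2 z + (c + (s + 1) * z) * y1 z + P * y z = 0 }.

Lemma HF2_continuous (A B : C) (c z : R) : 0 < c -> - (1/2) < z -> continuous (fun z => Re (HF2 A B c z)) z.
Proof.
  intros Hc Hz. assert (HT : Cdisk (hcoef A (Cminus (RtoC c) B) c) (z / (1 + z))) by (apply hcoef_disk, ratio_disk; trivial).
  set (T := hcoef A (Cminus (RtoC c) B) c) in *.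
  assert (HT1 : Cdisk (Cderiv T) (z / (1 + z))) by now apply Cdisk_Cderiv.
  assert (HT2 : Cdisk (Cderiv (Cderiv T)) (z / (1 + z))) by now apply Cdisk_Cderiv.
  assert (E : exists l, is_Cderive (HF2 A B c) z l).
  { eexists. unfold HF2. fold T. cbv zeta.
    assert (Hp : forall n, is_Cderive (fun z => RtoC (/ (1 + z) ^ n)) z (RtoC (- INR n * / (1 + z) ^ S n))).
    { intros n. apply is_Cderive_RtoC. eapply is_derive_eq.
      - apply (is_derive_inv (fun z => (1 + z) ^ n) z (INR n * 1 * (1 + z) ^ pred n)).
        + apply (is_derive_pow (fun z => 1 + z) n z 1). auto_derive; trivial; ring.
        + apply pow_nonzero; lra.
      - destruct n as [|n].
        + change (INR 0) with 0. unfold Rdiv. ring.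
        + change (pred (S n)) with n. change ((1 + z) ^ S (S n)) with ((1 + z) * ((1 + z) * (1 + z) ^ n)).
          change ((1 + z) ^ S n) with ((1 + z) * (1 + z) ^ n). field. split; try apply pow_nonzero; lra. }
    apply is_Cderive_mult; [now apply is_Cderive_cpow_shift|]. apply is_Cderive_plus; [apply is_Cderive_plus|].
    - apply is_Cderive_mult; [|now apply is_Cderive_CPS_ratio]. apply is_Cderive_mult; [apply is_Cderive_const|apply Hp].
    - apply is_Cderive_mult; [|now apply is_Cderive_CPS_ratio]. apply is_Cderive_mult; [apply is_Cderive_const|apply Hp].
    - apply is_Cderive_mult; [apply Hp|now apply is_Cderive_CPS_ratio]. }
  destruct E as [l [H _]]. exact (is_derive_continuous _ _ _ H).
Qed.

Lemma HF_hyp_fun (A B : C) (c s P : R) : 0 < c -> Cplus A B = RtoC s -> Cmult A B = RtoC P ->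
  hyp_fun c s P (fun z => Re (HF A B c z)) (fun z => Re (HF1 A B c z)) (fun z => Re (HF2 A B c z)).
Proof.
  intros Hc HS HP. constructor; intros z Hz.
  - now apply (is_Cderive_HF A B c z).
  - now apply (is_Cderive_HF1 A B c z).
  - now apply HF2_continuous.
  - pose proof (HF_ode A B c z Hc Hz) as O. rewrite HS, HP in O.
    revert O. generalize (HF A B c z) (HF1 A B c z) (HF2 A B c z).
    intros f f1 f2 O. apply (f_equal Re) in O. unfold Re, Im in *; simpl in O. lra.
Qed.

Definition rcoef (A B c : R) (k : nat) : R := poch A k * poch B k / (poch c k * INR (fact k)).

Definition pfaff (A : R) (u : nat -> R) (z : R) : R := Rpower (1 + z) (- A) * PSeries u (z / (1 + z)).

Definition pfaff1 (A : R) (u : nat -> R) (z : R) : R :=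
  Rpower (1 + z) (- A) * (- A * / (1 + z) * PSeries u (z / (1 + z))
    + / (1 + z) ^ 2 * PSeries (PS_derive u) (z / (1 + z))).

Lemma hcoef_RtoC (A B c : R) (k : nat) : 0 < c -> hcoef (RtoC A) (RtoC B) c k = RtoC (rcoef A B c k).
Proof.
  intros Hc. unfold hcoef, rcoef. rewrite !cpoch_RtoC, <- !RtoC_mult, <- RtoC_div; trivial.
  apply Rmult_integral_contrapositive_currified.
  - apply Rgt_not_eq, poch_pos, Hc.
  - apply INR_fact_neq_0.
Qed.

Lemma PSeries_zero (w : R) : PSeries (fun _ => 0) w = 0.
Proof.
  transitivity (0 * PSeries (fun _ => 0) w); [|ring].
  rewrite <- (PSeries_scal 0 (fun _ => 0) w). apply PSeries_ext. intros n.
  unfold PS_scal, scal; simpl. unfold mult; simpl. ring.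
Qed.

Lemma CPS_RtoC (T : nat -> C) (u : nat -> R) (w : R) : (forall k, T k = RtoC (u k)) -> CPS T w = RtoC (PSeries u w).
Proof.
  intros H. unfold CPS, RtoC. f_equal.
  - apply PSeries_ext. intros k. now rewrite H.
  - rewrite <- (PSeries_zero w). apply PSeries_ext. intros k. now rewrite H.
Qed.

Lemma cpow_RtoC (r s : R) : cpow r (RtoC s) = RtoC (Rpower r s).
Proof.
  unfold cpow, Rpower. simpl. rewrite Rmult_0_l, cos_0, sin_0.
  apply injective_projections; simpl; ring.
Qed.

Lemma HF_RtoC (A B c z : R) : 0 < c -> - (1/2) < z ->
  HF (RtoC A) (RtoC B) c z = RtoC (pfaff A (rcoef A (c - B) c) z).
Proof.
  intros Hc Hz. rewrite HF_eq by trivial.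
  rewrite <- RtoC_opp, cpow_RtoC, <- RtoC_minus.
  rewrite (CPS_RtoC _ (rcoef A (c - B) c)) by (intros k; now apply hcoef_RtoC).
  now rewrite <- RtoC_mult.
Qed.

Lemma HF1_RtoC (A B c z : R) : 0 < c -> - (1/2) < z ->
  HF1 (RtoC A) (RtoC B) c z = RtoC (pfaff1 A (rcoef A (c - B) c) z).
Proof.
  intros Hc Hz. unfold HF1. cbv zeta.
  rewrite <- RtoC_opp, cpow_RtoC, <- RtoC_minus.
  rewrite (CPS_RtoC (hcoef _ _ _) (rcoef A (c - B) c)) by (intros k; now apply hcoef_RtoC).
  rewrite (CPS_RtoC (Cderiv _) (PS_derive (rcoef A (c - B) c))).
  - now rewrite <- !RtoC_mult, <- RtoC_plus, <- RtoC_mult.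
  - intros k. unfold Cderiv, PS_derive. now rewrite hcoef_RtoC, <- RtoC_mult.
Qed.

(** For real parameters the equation is read off the complex development, with [HF2] as second
    derivative. *)
Lemma pfaff_hyp_fun (A B c : R) : 0 < c ->
  exists y2, hyp_fun c (A + B) (A * B) (pfaff A (rcoef A (c - B) c)) (pfaff1 A (rcoef A (c - B) c)) y2.
Proof.
  intros Hc. exists (fun z => Re (HF2 (RtoC A) (RtoC B) c z)).
  destruct (HF_hyp_fun (RtoC A) (RtoC B) c (A + B) (A * B) Hc) as [H1 H2 H3 H4].
  { now rewrite RtoC_plus. } { now rewrite RtoC_mult. }
  constructor; intros z Hz; trivial.
  - specialize (H1 z Hz). rewrite HF1_RtoC in H1 by trivial. rewrite re_RtoC in H1.
    revert H1. apply is_derive_ext_loc.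
    apply (locally_open_interval (-(1/2)) (z + 1)); try lra; intros t Ht; cbv beta; rewrite HF_RtoC; trivial; lra.
  - specialize (H2 z Hz). revert H2. apply is_derive_ext_loc.
    apply (locally_open_interval (-(1/2)) (z + 1)); try lra; intros t Ht; cbv beta; rewrite HF1_RtoC; trivial; lra.
  - exact (H3 z Hz).
  - specialize (H4 z Hz). rewrite HF_RtoC, HF1_RtoC in H4 by trivial. exact H4.
Qed.

Lemma pfaff_0 (A B c : R) : pfaff A (rcoef A B c) 0 = 1.
Proof.
  unfold pfaff. replace (0 / (1 + 0)) with 0 by field. rewrite PSeries_0, Rplus_0_r.
  unfold rcoef, Rpower; simpl. rewrite ln_1, Rmult_0_r, exp_0. field.
Qed.

Lemma ratio_bounds (z : R) : 0 <= z -> 0 <= z / (1 + z) < 1 /\ 1 - z / (1 + z) = / (1 + z).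
Proof.
  intros Hz. assert (E : 1 - z / (1 + z) = / (1 + z)) by (field; lra).
  assert (0 < / (1 + z)) by (apply Rinv_0_lt_compat; lra).
  repeat split; trivial; [apply Rdiv_le_0_compat; lra|lra].
Qed.

Lemma sqrt_Rpower (x : R) : 0 < x -> sqrt x = Rpower x (1/2).
Proof. intros Hx. replace (1/2) with (/ 2) by lra. symmetry. now apply Rpower_sqrt. Qed.

(** Since [1 - w = 1 / (1 + z)], a series of size [(1 - w)^(-1/2)] costs a factor [(1 + z)^(1/2)];
    differentiation in [z] gains [1 / (1 + z)]. *)
Lemma pfaff_le_sqrt (A K : R) (u : nat -> R) (z : R) : 0 <= K -> 0 <= z ->
  (forall k, Rabs (u k) <= K * bincoef k) ->
  Rabs (pfaff A u z) <= K * Rpower (1 + z) (1/2 - A) /\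
  Rabs (pfaff1 A u z) <= K * (1 + Rabs A) * Rpower (1 + z) (- 1/2 - A).
Proof.
  intros HK Hz Hu. destruct (ratio_bounds z Hz) as [Hw Ew].
  pose proof (PSeries_le_bincoef u K _ HK Hw Hu) as B0.
  pose proof (PSeries_derive_le_bincoef u K _ HK Hw Hu) as B1.
  rewrite Ew in B0, B1.
  rewrite sqrt_inv in B0, B1. rewrite sqrt_Rpower in B0, B1 by lra.
  set (p := Rpower (1 + z) (1/2)) in *. assert (Hp : 0 < p) by apply exp_pos.
  assert (HA : 0 < Rpower (1 + z) (- A)) by apply exp_pos.
  assert (Hpp : p * p = 1 + z) by (unfold p; rewrite <- Rpower_plus; replace (1/2 + 1/2) with 1 by lra; apply Rpower_1; lra).
  assert (B0' : Rabs (PSeries u (z / (1 + z))) <= K * p) by (replace (K * p) with (K / / p) by (field; lra); trivial).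
  assert (B1' : Rabs (PSeries (PS_derive u) (z / (1 + z))) <= K * ((1 + z) * p)).
  { replace (K * ((1 + z) * p)) with (K / (/ (1 + z) * / p)) by (field; lra). trivial. }
  split.
  - unfold pfaff. rewrite Rabs_mult, (Rabs_pos_eq (Rpower _ _)) by lra.
    replace (1/2 - A) with (- A + 1/2) by ring. rewrite Rpower_plus. fold p. nra.
  - unfold pfaff1. rewrite Rabs_mult, (Rabs_pos_eq (Rpower _ _)) by lra.
    replace (- 1/2 - A) with (- A + - (1/2)) by field. rewrite Rpower_plus, (Rpower_Ropp _ (1/2)). fold p.
    apply Rle_trans with (Rpower (1 + z) (- A) * (K * (1 + Rabs A) * / p)); [|right; ring].
    apply Rmult_le_compat_l; [lra|].
    eapply Rle_trans; [apply Rabs_triang|]. rewrite !Rabs_mult, Rabs_Ropp.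
    assert (I1 : 0 < / (1 + z)) by (apply Rinv_0_lt_compat; lra).
    assert (I2 : 0 < / (1 + z) ^ 2) by (apply Rinv_0_lt_compat, pow_lt; lra).
    rewrite (Rabs_pos_eq (/ (1 + z))), (Rabs_pos_eq (/ (1 + z) ^ 2)) by lra.
    replace (K * (1 + Rabs A) * / p) with (Rabs A * / (1 + z) * (K * p) + / (1 + z) ^ 2 * (K * ((1 + z) * p))).
    + apply Rplus_le_compat; apply Rmult_le_compat_l; trivial; try lra.
      apply Rmult_le_pos; [apply Rabs_pos|lra].
    + rewrite <- Hpp. field. lra.
Qed.

(** Coefficients smaller by [1 / (k + 1)] give a bounded series, so the prefactor [(1 + z)^(-A)]
    keeps its full decay. *)
Lemma pfaff_le_const (A K : R) (u : nat -> R) (z : R) : 0 <= K -> 0 <= z ->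
  (forall k, Rabs (u k) <= K * (bincoef k / (INR k + 1))) ->
  Rabs (pfaff A u z) <= 2 * K * Rpower (1 + z) (- A) /\
  Rabs (pfaff1 A u z) <= 2 * K * (1 + Rabs A) * Rpower (1 + z) (- 1 - A).
Proof.
  intros HK Hz Hu. destruct (ratio_bounds z Hz) as [Hw Ew].
  pose proof (PSeries_le_const u K _ HK Hw Hu) as B0.
  assert (Hu1 : forall k, Rabs (PS_derive u k) <= K * bincoef k).
  { intros k. unfold PS_derive. rewrite Rabs_mult, Rabs_pos_eq by apply pos_INR.
    specialize (Hu (S k)). pose proof (bincoef_decr k). pose proof (bincoef_pos (S k)). pose proof (pos_INR (S k)).
    apply Rle_trans with (INR (S k) * (K * (bincoef (S k) / (INR (S k) + 1)))).
    - now apply Rmult_le_compat_l.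
    - replace (INR (S k) * (K * (bincoef (S k) / (INR (S k) + 1)))) with (K * (bincoef (S k) * (INR (S k) / (INR (S k) + 1)))) by (field; lra).
      apply Rmult_le_compat_l; trivial. apply Rle_trans with (bincoef (S k)); trivial.
      rewrite <- (Rmult_1_r (bincoef (S k))) at 2. apply Rmult_le_compat_l; [lra|].
      apply Rmult_le_reg_r with (INR (S k) + 1); [lra|]. unfold Rdiv. rewrite Rmult_assoc, Rinv_l by lra. lra. }
  pose proof (PSeries_le_bincoef _ K _ HK Hw Hu1) as B1.
  rewrite Ew in B1. rewrite sqrt_inv in B1.
  assert (Hs : 0 < sqrt (1 + z)) by (apply sqrt_lt_R0; lra).
  assert (Hs1 : sqrt (1 + z) <= 1 + z).
  { pose proof (sqrt_sqrt (1 + z) ltac:(lra)). assert (1 <= sqrt (1 + z)) by (rewrite <- sqrt_1 at 1; apply sqrt_le_1; lra). nra. }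
  assert (B1' : Rabs (PSeries (PS_derive u) (z / (1 + z))) <= K * (1 + z)).
  { apply Rle_trans with (1 := B1). unfold Rdiv. rewrite Rinv_inv. now apply Rmult_le_compat_l. }
  assert (HA : 0 < Rpower (1 + z) (- A)) by apply exp_pos.
  split.
  - unfold pfaff. rewrite Rabs_mult, (Rabs_pos_eq (Rpower _ _)) by lra. nra.
  - unfold pfaff1. rewrite Rabs_mult, (Rabs_pos_eq (Rpower _ _)) by lra.
    replace (- 1 - A) with (- A + - (1)) by ring. rewrite Rpower_plus, (Rpower_Ropp _ 1), Rpower_1 by lra.
    apply Rle_trans with (Rpower (1 + z) (- A) * (2 * K * (1 + Rabs A) * / (1 + z))); [|right; ring].
    apply Rmult_le_compat_l; [lra|].
    eapply Rle_trans; [apply Rabs_triang|]. rewrite !Rabs_mult, Rabs_Ropp.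
    assert (I1 : 0 < / (1 + z)) by (apply Rinv_0_lt_compat; lra).
    assert (I2 : 0 < / (1 + z) ^ 2) by (apply Rinv_0_lt_compat, pow_lt; lra).
    rewrite (Rabs_pos_eq (/ (1 + z))), (Rabs_pos_eq (/ (1 + z) ^ 2)) by lra.
    apply Rle_trans with (Rabs A * / (1 + z) * (2 * K) + / (1 + z) ^ 2 * (K * (1 + z))).
    + apply Rplus_le_compat; apply Rmult_le_compat_l; trivial; try lra.
      apply Rmult_le_pos; [apply Rabs_pos|lra].
    + replace (/ (1 + z) ^ 2 * (K * (1 + z))) with (K * / (1 + z)) by (field; lra).
      assert (0 <= K * / (1 + z)) by (apply Rmult_le_pos; lra). nra.
Qed.

(* [eta al c z = F(al+1/2, al; c; -z)] and [yfun al c z = F(al+1/2, al+1; c; -z)], through Pfaff's transformation. *)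
Definition eta (al c : R) : R -> R := pfaff (al + 1/2) (rcoef (al + 1/2) (c - al) c).
Definition eta1 (al c : R) : R -> R := pfaff1 (al + 1/2) (rcoef (al + 1/2) (c - al) c).
Definition yfun (al c : R) : R -> R := pfaff (al + 1/2) (rcoef (al + 1/2) (c - (al + 1)) c).
Definition yfun1 (al c : R) : R -> R := pfaff1 (al + 1/2) (rcoef (al + 1/2) (c - (al + 1)) c).

(** Coefficients of the Pfaff series of [eta] divided by [bincoef]. The limit [L] of this ratio is
    the coefficient of [z^(-al)] in the behaviour of [eta] at infinity; the lemmas below take it as
    a hypothesis, discharged by [eta_ratio_limit]. *)
Definition eta_ratio (al c : R) (k : nat) : R :=
  poch (al + 1/2) k * poch (c - al) k / (poch c k * poch (1/2) k).

Lemma rcoef_ratio (al c : R) (k : nat) : 0 < c ->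
  rcoef (al + 1/2) (c - al) c k = eta_ratio al c k * bincoef k.
Proof.
  intros Hc. unfold rcoef, eta_ratio, bincoef.
  pose proof (poch_pos c k Hc). pose proof (poch_pos (1/2) k ltac:(lra)). pose proof (INR_fact_pos k).
  field. repeat split; lra.
Qed.

Lemma eta_ratio_bounded (al c L : R) : is_lim_seq (eta_ratio al c) L ->
  exists K, 0 < K /\ forall k, Rabs (eta_ratio al c k) <= K.
Proof.
  intros H. destruct (filterlim_bounded (K := R_AbsRing) (V := R_NormedModule) (eta_ratio al c)) as [M HM].
  { now exists L. }
  exists (Rabs M + 1). split. pose proof (Rabs_pos M); lra.
  intros k. apply Rle_trans with M; [apply HM|]. pose proof (Rle_abs M). lra.
Qed.

Lemma eta_bounds (al c L : R) : 0 < al < c -> is_lim_seq (eta_ratio al c) L ->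
  exists K, 0 < K /\ forall z, 0 <= z ->
    Rabs (eta al c z) <= K * Rpower (1 + z) (- al) /\ Rabs (eta1 al c z) <= K * Rpower (1 + z) (- al - 1).
Proof.
  intros Hal HL. destruct (eta_ratio_bounded al c L HL) as [K [HK Hb]].
  exists (K * (1 + Rabs (al + 1/2))). pose proof (Rabs_pos (al + 1/2)).
  split; [apply Rmult_lt_0_compat; lra|]. intros z Hz.
  destruct (pfaff_le_sqrt (al + 1/2) K (rcoef (al + 1/2) (c - al) c) z ltac:(lra) Hz) as [B0 B1].
  { intros k. rewrite rcoef_ratio, Rabs_mult by lra. pose proof (bincoef_pos k).
    rewrite (Rabs_pos_eq (bincoef k)) by lra. apply Rmult_le_compat_r; trivial; lra. }
  replace (1/2 - (al + 1/2)) with (- al) in B0 by ring.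
  replace (- 1/2 - (al + 1/2)) with (- al - 1) in B1 by field.
  split; trivial. apply Rle_trans with (1 := B0). apply Rmult_le_compat_r; [left; apply exp_pos|]. nra.
Qed.

Lemma rcoef_yfun (al c : R) (k : nat) : 0 < al < c ->
  rcoef (al + 1/2) (c - (al + 1)) c (S k) =
  rcoef (al + 1/2) (c - al) c k * ((al + 1/2 + INR k) * (c - al - 1) / ((c + INR k) * (INR k + 1))).
Proof.
  intros Hal. unfold rcoef. rewrite (poch_shift (c - (al + 1)) k).
  replace (c - (al + 1) + 1) with (c - al) by ring. rewrite fact_S_INR. simpl poch.
  pose proof (poch_pos c k ltac:(lra)). pose proof (INR_fact_pos k). pose proof (pos_INR k).
  field. repeat split; lra.
Qed.

Lemma rcoef_eta_S (al c : R) (k : nat) : 0 < al < c ->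
  rcoef (al + 1/2) (c - al) c (S k) =
  rcoef (al + 1/2) (c - al) c k * ((al + 1/2 + INR k) * (c - al + INR k) / ((c + INR k) * (INR k + 1))).
Proof.
  intros Hal. unfold rcoef. rewrite fact_S_INR. simpl poch.
  pose proof (poch_pos c k ltac:(lra)). pose proof (INR_fact_pos k). pose proof (pos_INR k).
  field. repeat split; lra.
Qed.

(** For positive index the coefficients of [yfun] are those of [eta] times
    [(c - al - 1) / (c - al + k - 1)], where [k] is that index. The gain of one power of [k] brings
    them within reach of [pfaff_le_const]. *)
Lemma yfun_coef_bound (al c L : R) : 0 < al < c -> is_lim_seq (eta_ratio al c) L ->
  exists K, 0 < K /\ forall k, Rabs (rcoef (al + 1/2) (c - (al + 1)) c k) <= K * (bincoef k / (INR k + 1)).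
Proof.
  intros Hal HL. destruct (eta_ratio_bounded al c L HL) as [K [HK Hb]].
  set (a := c - al). assert (Ha : 0 < a) by (unfold a; lra).
  (* The 1 handles index 0, and [1 + 2 / a] bounds [(k + 2) / (a + k)]. *)
  exists (1 + K * Rabs (a - 1) * (1 + 2 / a)).
  assert (H2a : 0 < 2 / a) by (apply Rdiv_lt_0_compat; lra).
  pose proof (Rabs_pos (a - 1)) as HA.
  assert (HKA : 0 <= K * Rabs (a - 1)) by (apply Rmult_le_pos; lra).
  split; [assert (0 <= K * Rabs (a - 1) * (1 + 2 / a)) by (apply Rmult_le_pos; lra); lra|].
  intros [|k].
  - unfold rcoef, bincoef; simpl.
    assert (0 <= K * Rabs (a - 1) * (1 + 2 / a)) by (apply Rmult_le_pos; lra).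
    replace (1 * 1 / (1 * 1)) with 1 by field. rewrite Rabs_R1. lra.
  - assert (Hk := pos_INR k).
    assert (E : rcoef (al + 1/2) (c - (al + 1)) c (S k) = rcoef (al + 1/2) (c - al) c (S k) * ((a - 1) / (a + INR k))).
    { rewrite rcoef_yfun, rcoef_eta_S by trivial. unfold a. field. unfold a in *. repeat split; lra. }
    rewrite E, rcoef_ratio, !Rabs_mult by lra. rewrite Rabs_div by lra.
    pose proof (bincoef_pos (S k)) as Hp.
    rewrite (Rabs_pos_eq (bincoef (S k))), (Rabs_pos_eq (a + INR k)) by lra.
    rewrite S_INR.
    apply Rle_trans with (K * bincoef (S k) * (Rabs (a - 1) / (a + INR k))).
    + apply Rmult_le_compat_r. apply Rdiv_le_0_compat; lra.
      apply Rmult_le_compat_r; trivial; lra.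
    + apply Rle_trans with (K * Rabs (a - 1) * (1 + 2 / a) * (bincoef (S k) / (INR k + 1 + 1))).
      * replace (K * bincoef (S k) * (Rabs (a - 1) / (a + INR k))) with (K * Rabs (a - 1) * bincoef (S k) * / (a + INR k)) by (field; lra).
        replace (K * Rabs (a - 1) * (1 + 2 / a) * (bincoef (S k) / (INR k + 1 + 1))) with (K * Rabs (a - 1) * bincoef (S k) * ((1 + 2 / a) * / (INR k + 1 + 1))) by (field; lra).
        apply Rmult_le_compat_l. apply Rmult_le_pos; lra.
        apply Rmult_le_reg_r with (a + INR k); [lra|]. rewrite Rinv_l by lra.
        apply Rmult_le_reg_r with (INR k + 1 + 1); [lra|].
        replace ((1 + 2 / a) * / (INR k + 1 + 1) * (a + INR k) * (INR k + 1 + 1)) with (INR k + 2 + (a + 2 * INR k / a)) by (field; lra).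
        assert (0 <= 2 * INR k / a) by (apply Rdiv_le_0_compat; lra). lra.
      * apply Rmult_le_compat_r; [apply Rdiv_le_0_compat; lra|lra].
Qed.

Lemma yfun_bounds (al c L : R) : 0 < al < c -> is_lim_seq (eta_ratio al c) L ->
  exists K, 0 < K /\ forall z, 0 <= z ->
    Rabs (yfun al c z) <= K * Rpower (1 + z) (- (al + 1/2)) /\ Rabs (yfun1 al c z) <= K * Rpower (1 + z) (- 1 - (al + 1/2)).
Proof.
  intros Hal HL. destruct (yfun_coef_bound al c L Hal HL) as [K [HK Hb]].
  exists (2 * K * (1 + Rabs (al + 1/2))). pose proof (Rabs_pos (al + 1/2)).
  split; [apply Rmult_lt_0_compat; lra|]. intros z Hz.
  destruct (pfaff_le_const (al + 1/2) K _ z ltac:(lra) Hz Hb) as [B0 B1].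
  split; trivial. apply Rle_trans with (1 := B0). apply Rmult_le_compat_r; [left; apply exp_pos|]. nra.
Qed.

(** The operator [1 + (1/al) z d/dz] raises the numerator parameter [al] to [al + 1]. In Pfaff's
    variable [z d/dz] is [w (1 - w) d/dw], and the identity is checked on coefficients. It serves to
    recognise [x^(2d-1) yfun d c (x^2)] as an exact derivative. *)
Lemma yfun_eta (al c L z : R) : 0 < al < c -> is_lim_seq (eta_ratio al c) L -> 0 <= z ->
  yfun al c z = eta al c z + z * eta1 al c z / al.
Proof.
  intros Hal HL Hz. destruct (eta_ratio_bounded al c L HL) as [K [HK Hb]].
  destruct (ratio_bounds z Hz) as [Hw Ew]. set (w := z / (1 + z)) in *.
  set (s := rcoef (al + 1/2) (c - al) c).
  assert (Hs : Rbar_lt (Rabs w) (CV_radius s)).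
  { apply CV_radius_dominated with K; [|apply Rabs_def1; lra]. intros k. unfold s.
    rewrite rcoef_ratio, Rabs_mult by lra. pose proof (bincoef_pos k). pose proof (bincoef_le_1 k).
    rewrite (Rabs_pos_eq (bincoef k)) by lra. specialize (Hb k). pose proof (Rabs_pos (eta_ratio al c k)). nra. }
  assert (E : PSeries (rcoef (al + 1/2) (c - (al + 1)) c) w =
    PSeries s w + / al * (w * PSeries (PS_derive s) w) + - ((al + 1/2) / al) * (w * PSeries s w)
      + - / al * (w * (w * PSeries (PS_derive s) w))).
  { apply is_pseries_unique.
    pose proof (PSeries_correct _ _ (CV_radius_inside _ _ Hs)) as F0.
    pose proof (is_pseries_euler s w Hs) as F1.
    pose proof (is_pseries_incr_1 (V := R_NormedModule) _ _ _ F0) as F2.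
    pose proof (is_pseries_incr_1 (V := R_NormedModule) _ _ _ F1) as F3.
    pose proof (fun k a l (H : is_pseries a w l) => is_pseries_scal (V := R_NormedModule) k a w l (Rmult_comm _ _) H) as Sc.
    pose proof (fun a b l m (H : is_pseries a w l) (H' : is_pseries b w m) =>
      is_pseries_plus (V := R_NormedModule) a b w l m H H') as Pl.
    pose proof (Pl _ _ _ _ (Pl _ _ _ _ (Pl _ _ _ _ F0 (Sc (/ al) _ _ F1)) (Sc (- ((al + 1/2) / al)) _ _ F2)) (Sc (- / al) _ _ F3)) as G.
    revert G. apply is_pseries_ext. intros [|k].
    - unfold PS_plus, PS_scal, PS_incr_1, plus, scal, zero; simpl. unfold mult; simpl.
      unfold s, rcoef; simpl. field. lra.
    - change (s (S k) + / al * (INR (S k) * s (S k)) + - ((al + 1/2) / al) * s k + - / al * (INR k * s k)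
        = rcoef (al + 1/2) (c - (al + 1)) c (S k)).
      unfold s. rewrite rcoef_yfun, rcoef_eta_S by trivial. rewrite S_INR. pose proof (pos_INR k). field. lra. }
  unfold yfun, eta, eta1, pfaff, pfaff1. fold w. fold s. rewrite E.
  set (S0 := PSeries s w). set (S1 := PSeries (PS_derive s) w). unfold w. field. lra.
Qed.

(** Abelian argument: coefficients asymptotic to [L * bincoef] give a series asymptotic to
    [L / sqrt (1 - w)] as [w] tends to 1. *)
Lemma eta_limit (al c L : R) : 0 < al < c -> is_lim_seq (eta_ratio al c) L ->
  forall eps, 0 < eps -> exists Z, 0 < Z /\ forall z, Z < z -> Rabs (Rpower (1 + z) al * eta al c z - L) < eps.
Proof.
  intros Hal HL eps Heps.
  assert (HL' := HL). apply is_lim_seq_spec in HL'.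
  destruct (HL' (mkposreal (eps / 2) ltac:(lra))) as [N HN]. simpl in HN.
  destruct (eta_ratio_bounded al c L HL) as [K [HK Hb]].
  (* With this [M] the bound [eps / 2 + M / (k + 1)] holds for every [k], also for [k < N] where the
     limit says nothing; its second term contributes only a bounded series. *)
  set (M := (K + Rabs L) * (INR N + 1)).
  assert (HM : 0 < M).
  { unfold M. pose proof (Rabs_pos L). pose proof (pos_INR N). apply Rmult_lt_0_compat; lra. }
  assert (Hk : forall k, Rabs (eta_ratio al c k - L) <= eps / 2 + M / (INR k + 1)).
  { intros k. pose proof (pos_INR k).
    assert (0 < M / (INR k + 1)) by (apply Rdiv_lt_0_compat; lra).
    destruct (Nat.le_gt_cases N k) as [Hn|Hn].
    - specialize (HN k Hn). lra.
    - apply Rle_trans with (K + Rabs L).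
      + eapply Rle_trans; [apply Rabs_triang|]. rewrite Rabs_Ropp. pose proof (Hb k). lra.
      + assert (K + Rabs L <= M / (INR k + 1)); [|lra].
        unfold M. apply Rmult_le_reg_r with (INR k + 1); [lra|].
        replace ((K + Rabs L) * (INR N + 1) / (INR k + 1) * (INR k + 1)) with ((K + Rabs L) * (INR N + 1)) by (field; lra).
        apply Rmult_le_compat_l. pose proof (Rabs_pos L); lra. apply lt_INR in Hn. lra. }
  (* Beyond [Z] one has [sqrt (1 + z) > 4 M / eps], so the bounded part [2 M / sqrt (1 + z)] is
     below [eps / 2]. *)
  set (Z := (4 * M / eps) ^ 2).
  assert (HZ : 0 < Z) by (unfold Z; apply pow_lt, Rdiv_lt_0_compat; lra).
  exists Z. split; trivial. intros z Hz.
  destruct (ratio_bounds z ltac:(lra)) as [Hw Ew]. set (w := z / (1 + z)) in *.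
  set (s := rcoef (al + 1/2) (c - al) c).
  assert (Hws : Rabs w < 1) by (apply Rabs_def1; lra).
  assert (Hbin : Rbar_lt (Rabs w) (CV_radius bincoef)).
  { apply CV_radius_dominated with 1; trivial. intros k. rewrite Rabs_pos_eq; [apply bincoef_le_1|left; apply bincoef_pos]. }
  assert (Hs : Rbar_lt (Rabs w) (CV_radius s)).
  { apply CV_radius_dominated with K; trivial. intros k. unfold s.
    rewrite rcoef_ratio, Rabs_mult by lra. pose proof (bincoef_pos k). pose proof (bincoef_le_1 k).
    rewrite (Rabs_pos_eq (bincoef k)) by lra. specialize (Hb k). pose proof (Rabs_pos (eta_ratio al c k)). nra. }
  set (v := fun k => bincoef k / (INR k + 1)).
  assert (Hv0 : forall k, 0 <= v k <= bincoef k).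
  { intros k. unfold v. pose proof (bincoef_pos k). pose proof (pos_INR k). split.
    - apply Rdiv_le_0_compat; lra.
    - apply Rmult_le_reg_r with (INR k + 1); [lra|]. unfold Rdiv. rewrite Rmult_assoc, Rinv_l by lra. nra. }
  assert (Hv : Rbar_lt (Rabs w) (CV_radius v)).
  { apply CV_radius_dominated with 1; trivial. intros k. rewrite Rabs_pos_eq by apply Hv0.
    apply Rle_trans with (bincoef k). apply Hv0. apply bincoef_le_1. }
  assert (D : Rabs (PSeries s w - L * PSeries bincoef w) <= eps / 2 * PSeries bincoef w + M * 2).
  { rewrite <- (PSeries_scal L bincoef), <- PSeries_minus.
    2: now apply CV_radius_inside.
    2:{ apply (ex_pseries_scal (V := R_NormedModule)); [apply Rmult_comm|now apply CV_radius_inside]. }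
    eapply Rle_trans.
    - apply (PSeries_Rabs_le _ (PS_plus (PS_scal (eps / 2) bincoef) (PS_scal M v))); [lra| |].
      + apply CV_radius_dominated with (eps / 2 + M); trivial. intros k.
        unfold PS_plus, PS_scal, plus, scal; simpl; unfold mult; simpl.
        pose proof (Hv0 k). pose proof (bincoef_le_1 k). rewrite Rabs_pos_eq by nra. nra.
      + intros k. unfold PS_minus, PS_plus, PS_opp, PS_scal, minus, plus, opp, scal; simpl; unfold mult; simpl.
        unfold s. rewrite rcoef_ratio by lra.
        replace (eta_ratio al c k * bincoef k + - (L * bincoef k)) with ((eta_ratio al c k - L) * bincoef k) by ring.
        pose proof (bincoef_pos k). rewrite Rabs_mult, (Rabs_pos_eq (bincoef k)) by lra.
        apply Rle_trans with ((eps / 2 + M / (INR k + 1)) * bincoef k).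
        * apply Rmult_le_compat_r; [lra|apply Hk].
        * right. unfold v. field. pose proof (pos_INR k). lra.
    - rewrite PSeries_plus.
      2:{ apply (ex_pseries_scal (V := R_NormedModule)); [apply Rmult_comm|now apply CV_radius_inside]. }
      2:{ apply (ex_pseries_scal (V := R_NormedModule)); [apply Rmult_comm|now apply CV_radius_inside]. }
      rewrite !PSeries_scal. apply Rplus_le_compat_l, Rmult_le_compat_l; [lra|].
      pose proof (PSeries_le_const v 1 w ltac:(lra) Hw) as H. rewrite Rmult_1_r in H.
      apply Rle_trans with (1 := Rle_abs _). apply H. intros k. rewrite Rmult_1_l, Rabs_pos_eq by apply Hv0. apply Rle_refl. }
  rewrite PSeries_bincoef, Ew, sqrt_inv, Rinv_inv in D by lra.
  unfold eta, pfaff. fold w. fold s.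
  replace (- (al + 1/2)) with (- al + - (1/2)) by ring. rewrite Rpower_plus, <- Rmult_assoc, <- Rmult_assoc.
  rewrite <- Rpower_plus, Rplus_opp_r, Rpower_O, Rmult_1_l by lra.
  rewrite Rpower_Ropp, <- sqrt_Rpower by lra.
  assert (Hq : 0 < sqrt (1 + z)) by (apply sqrt_lt_R0; lra).
  set (q := sqrt (1 + z)) in *.
  replace (/ q * PSeries s w - L) with (/ q * (PSeries s w - L * q)) by (field; lra).
  rewrite Rabs_mult, (Rabs_pos_eq (/ q)) by (left; now apply Rinv_0_lt_compat).
  apply Rle_lt_trans with (/ q * (eps / 2 * q + M * 2)).
  - apply Rmult_le_compat_l; trivial. left; now apply Rinv_0_lt_compat.
  - replace (/ q * (eps / 2 * q + M * 2)) with (eps / 2 + 2 * M / q) by (field; lra).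
    assert (Hq2 : 4 * M / eps < q).
    { apply Rsqr_incrst_0.
      - unfold Rsqr. unfold q. rewrite sqrt_sqrt by lra. unfold Z in Hz. simpl in Hz. lra.
      - left; apply Rdiv_lt_0_compat; lra.
      - lra. }
    assert (2 * M / q < eps / 2); [|lra].
    apply Rmult_lt_reg_r with q; trivial. replace (2 * M / q * q) with (2 * M) by (field; lra).
    apply Rmult_lt_reg_r with (2 / eps); [apply Rdiv_lt_0_compat; lra|].
    replace (2 * M * (2 / eps)) with (4 * M / eps) by (field; lra).
    replace (eps / 2 * q * (2 / eps)) with q by (field; lra). trivial.
Qed.

Lemma is_derive_Rpower (x s : R) : 0 < x -> is_derive (fun x => Rpower x s) x (s * / x * Rpower x s).
Proof. intros Hx. unfold Rpower. auto_derive; trivial. field. lra. Qed.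

Lemma continuous_Rpower (x s : R) : 0 < x -> continuous (fun x => Rpower x s) x.
Proof. intros Hx. eapply is_derive_continuous. now apply is_derive_Rpower. Qed.

(** * The integral of the product of two kernels *)

(** Homogeneous of degree [-2a] in [(r, x)]. The definitions that follow are its partial
    derivatives, [e1] and [e2] standing for the derivatives of [e]. *)
Definition vker (a : R) (e : R -> R) (r x : R) : R := Rpower r (-2 * a) * e (x ^ 2 / r ^ 2).

Definition vker_r (a : R) (e e1 : R -> R) (r x : R) : R :=
  Rpower r (-2 * a) * (- 2 * / r * (a * e (x ^ 2 / r ^ 2) + x ^ 2 / r ^ 2 * e1 (x ^ 2 / r ^ 2))).

Definition vker_rr (a : R) (e e1 e2 : R -> R) (r x : R) : R :=
  Rpower r (-2 * a) * / r ^ 2 * (2 * a * (2 * a + 1) * e (x ^ 2 / r ^ 2)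
    + (8 * a + 6) * (x ^ 2 / r ^ 2) * e1 (x ^ 2 / r ^ 2) + 4 * (x ^ 2 / r ^ 2) ^ 2 * e2 (x ^ 2 / r ^ 2)).

Definition vker_x (a : R) (e1 : R -> R) (r x : R) : R :=
  Rpower r (-2 * a) * (2 * x / r ^ 2 * e1 (x ^ 2 / r ^ 2)).

Definition vker_xx (a : R) (e1 e2 : R -> R) (r x : R) : R :=
  Rpower r (-2 * a) * (2 / r ^ 2 * e1 (x ^ 2 / r ^ 2) + 4 * x ^ 2 / r ^ 4 * e2 (x ^ 2 / r ^ 2)).

Lemma sq_ratio_ge0 (x r : R) : 0 < r -> 0 <= x ^ 2 / r ^ 2.
Proof. intros Hr. apply Rdiv_le_0_compat; [apply pow2_ge_0|now apply pow_lt]. Qed.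

Lemma is_derive_comp_R (f g : R -> R) (x l m : R) :
  is_derive f (g x) l -> is_derive g x m -> is_derive (fun x => f (g x)) x (m * l).
Proof. intros H1 H2. exact (is_derive_comp (V := R_NormedModule) f g x l m H1 H2). Qed.

Lemma is_derive_mult_R (f g : R -> R) (x l m : R) :
  is_derive f x l -> is_derive g x m -> is_derive (fun x => f x * g x) x (l * g x + f x * m).
Proof. intros H1 H2. exact (is_derive_mult f g x l m H1 H2 Rmult_comm). Qed.

Lemma is_derive_plus_R (f g : R -> R) (x l m : R) :
  is_derive f x l -> is_derive g x m -> is_derive (fun x => f x + g x) x (l + m).
Proof. intros H1 H2. exact (is_derive_plus (V := R_NormedModule) f g x l m H1 H2). Qed.

Lemma is_derive_minus_R (f g : R -> R) (x l m : R) :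
  is_derive f x l -> is_derive g x m -> is_derive (fun x => f x - g x) x (l - m).
Proof. intros H1 H2. exact (is_derive_minus (V := R_NormedModule) f g x l m H1 H2). Qed.

Lemma is_derive_const_mult_R (k : R) (f : R -> R) (x l : R) :
  is_derive f x l -> is_derive (fun x => k * f x) x (k * l).
Proof. intros H1. exact (is_derive_scal f x k l H1). Qed.

Lemma is_derive_opp_R (f : R -> R) (x l : R) : is_derive f x l -> is_derive (fun x => - f x) x (- l).
Proof. intros H1. exact (is_derive_opp (V := R_NormedModule) f x l H1). Qed.

Lemma is_derive_id_R (x : R) : is_derive (fun x => x) x 1.
Proof. exact (is_derive_id (K := R_AbsRing) x). Qed.

Lemma is_derive_sq_ratio_r (r x : R) : 0 < r -> is_derive (fun r => x ^ 2 / r ^ 2) r (- 2 * / r * (x ^ 2 / r ^ 2)).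
Proof. intros Hr. auto_derive. apply Rmult_integral_contrapositive_currified; lra. field. lra. Qed.

Lemma is_derive_sq_ratio_x (r x : R) : 0 < r -> is_derive (fun x => x ^ 2 / r ^ 2) x (2 * x / r ^ 2).
Proof. intros Hr. auto_derive; trivial. field. lra. Qed.

Lemma is_derive_vker_r (a r x l : R) (e : R -> R) : 0 < r ->
  is_derive e (x ^ 2 / r ^ 2) l ->
  is_derive (fun r => vker a e r x) r
   (Rpower r (-2 * a) * (- 2 * / r * (a * e (x ^ 2 / r ^ 2) + x ^ 2 / r ^ 2 * l))).
Proof.
  intros Hr He. unfold vker. eapply is_derive_eq.
  - apply is_derive_mult_R. now apply is_derive_Rpower.
    apply (is_derive_comp_R e (fun r => x ^ 2 / r ^ 2)). exact He. now apply is_derive_sq_ratio_r.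
  - cbv beta. field. lra.
Qed.

Lemma is_derive_vker_rr (a r x : R) (e e1 e2 : R -> R) : 0 < r ->
  is_derive e (x ^ 2 / r ^ 2) (e1 (x ^ 2 / r ^ 2)) -> is_derive e1 (x ^ 2 / r ^ 2) (e2 (x ^ 2 / r ^ 2)) ->
  is_derive (fun r => vker_r a e e1 r x) r (vker_rr a e e1 e2 r x).
Proof.
  intros Hr He He1. unfold vker_r. eapply is_derive_eq.
  - apply is_derive_mult_R. now apply is_derive_Rpower.
    apply is_derive_mult_R.
    + apply (is_derive_const_mult_R (-2) (fun r => / r)). apply (is_derive_inv (fun r => r) r 1); [|lra].
      apply is_derive_id_R.
    + apply is_derive_plus_R.
      * apply is_derive_const_mult_R. apply (is_derive_comp_R e (fun r => x ^ 2 / r ^ 2)). exact He. now apply is_derive_sq_ratio_r.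
      * apply is_derive_mult_R. now apply is_derive_sq_ratio_r.
        apply (is_derive_comp_R e1 (fun r => x ^ 2 / r ^ 2)). exact He1. now apply is_derive_sq_ratio_r.
  - cbv beta. unfold vker_rr. field. lra.
Qed.

Lemma is_derive_vker_x (a r x : R) (e e1 : R -> R) : 0 < r ->
  is_derive e (x ^ 2 / r ^ 2) (e1 (x ^ 2 / r ^ 2)) ->
  is_derive (vker a e r) x (vker_x a e1 r x).
Proof.
  intros Hr He. unfold vker, vker_x. apply is_derive_const_mult_R.
  apply (is_derive_comp_R e (fun x => x ^ 2 / r ^ 2)). exact He. now apply is_derive_sq_ratio_x.
Qed.

Lemma is_derive_vker_xx (a r x : R) (e1 e2 : R -> R) : 0 < r ->
  is_derive e1 (x ^ 2 / r ^ 2) (e2 (x ^ 2 / r ^ 2)) ->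
  is_derive (vker_x a e1 r) x (vker_xx a e1 e2 r x).
Proof.
  intros Hr He. unfold vker_x, vker_xx. apply is_derive_const_mult_R. eapply is_derive_eq.
  - apply is_derive_mult_R.
    + instantiate (1 := 2 / r ^ 2). auto_derive; trivial. field. lra.
    + apply (is_derive_comp_R e1 (fun x => x ^ 2 / r ^ 2)). exact He. now apply is_derive_sq_ratio_x.
  - cbv beta. field. lra.
Qed.

(** Boundary term of Lagrange's identity for the operator of [y] paired with [vker], carrying the
    weight [x^(2c-1)]. *)
Definition flux (a c d : R) (y y1 e e1 : R -> R) (r x : R) : R :=
  - (Rpower x (2 * c - 1) * ((1 + x ^ 2) * (y (x ^ 2) * vker_x a e1 r x - 2 * x * y1 (x ^ 2) * vker a e r x)
     + (2 * a - 2 * d - 3) * (x * (y (x ^ 2) * vker a e r x)))).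

(* Writing [T = x d/dx], the function [V = vker a e] satisfies
   [V_rr = - (V_xx + (2c-1)/x V_x)] and [r V_r = - (T + 2a) V], so that the second
   [r]-derivative of [(1 - r^2) V] is minus the adjoint of the hypergeometric operator of [y]. *)
Lemma is_derive_flux (a c d r x : R) (y y1 y2 e e1 e2 : R -> R) :
  c = a + d -> 0 < r -> 0 < x ->
  hyp_fun c (2 * d + 3/2) ((d + 1/2) * (d + 1)) y y1 y2 ->
  hyp_fun c (2 * a + 1/2) ((a + 1/2) * a) e e1 e2 ->
  is_derive (flux a c d y y1 e e1 r) x
    (Rpower x (2 * c - 1) * y (x ^ 2) *
      ((1 - r ^ 2) * vker_rr a e e1 e2 r x - 4 * r * vker_r a e e1 r x - 2 * vker a e r x)).
Proof.
  intros Hc Hr Hx [Y1 Y2 _ YE] [E1 E2 _ EE].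
  assert (Hs : 0 <= x ^ 2 / r ^ 2) by now apply sq_ratio_ge0.
  assert (Hx2 : 0 < x ^ 2) by now apply pow_lt.
  specialize (YE (x ^ 2) ltac:(lra)). specialize (EE (x ^ 2 / r ^ 2) ltac:(lra)).
  assert (Dy : is_derive (fun x => y (x ^ 2)) x (2 * x * y1 (x ^ 2))).
  { apply (is_derive_comp_R y (fun x => x ^ 2)); [apply Y1; lra|]. auto_derive; trivial; ring. }
  assert (Dy1 : is_derive (fun x => y1 (x ^ 2)) x (2 * x * y2 (x ^ 2))).
  { apply (is_derive_comp_R y1 (fun x => x ^ 2)); [apply Y2; lra|]. auto_derive; trivial; ring. }
  pose proof (is_derive_vker_x a r x e e1 Hr (E1 (x ^ 2 / r ^ 2) ltac:(lra))) as Dv.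
  pose proof (is_derive_vker_xx a r x e1 e2 Hr (E2 (x ^ 2 / r ^ 2) ltac:(lra))) as Dv1.
  unfold flux. eapply is_derive_eq.
  - apply is_derive_opp_R, is_derive_mult_R.
    + now apply is_derive_Rpower.
    + apply is_derive_plus_R.
      * apply is_derive_mult_R. instantiate (1 := 2 * x). auto_derive; trivial; ring.
        apply is_derive_minus_R. apply is_derive_mult_R; eassumption.
        apply is_derive_mult_R; [|eassumption]. apply is_derive_mult_R; [|eassumption].
        instantiate (1 := 2). auto_derive; trivial; ring.
      * apply is_derive_const_mult_R. apply is_derive_mult_R. apply is_derive_id_R.
        apply is_derive_mult_R; eassumption.
  - cbv beta. unfold vker_rr, vker_r, vker, vker_x, vker_xx.
    (* Both second derivatives are eliminated through the two equations; a rational identity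
       remains. *)
    assert (Ey : y2 (x ^ 2) = - ((c + (2 * d + 3/2 + 1) * x ^ 2) * y1 (x ^ 2) + (d + 1/2) * (d + 1) * y (x ^ 2)) / (x ^ 2 * (1 + x ^ 2))).
    { transitivity ((x ^ 2 * (1 + x ^ 2) * y2 (x ^ 2)) / (x ^ 2 * (1 + x ^ 2))); [field; split; lra|]. f_equal. lra. }
    set (s := x ^ 2 / r ^ 2) in *.
    assert (Hs' : 0 < s) by (apply Rdiv_lt_0_compat; trivial; now apply pow_lt).
    assert (Ee : e2 s = - ((c + (2 * a + 1/2 + 1) * s) * e1 s + (a + 1/2) * a * e s) / (s * (1 + s))).
    { transitivity ((s * (1 + s) * e2 s) / (s * (1 + s))); [field; split; lra|]. f_equal. lra. }
    rewrite Ey, Ee. generalize (y (x ^ 2)) (y1 (x ^ 2)) (e s) (e1 s). intros v v1 u u1.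
    rewrite Hc. unfold s.  field.
    repeat split; try lra; try nra.
Qed.

(** Three mean values rewrite the left side as [(s - q) (q - p) (t2 - t1) f2 t3]. The estimate
    concerns values of [f] alone and therefore survives pointwise limits. *)
Lemma second_difference (f f1 f2 : R -> R) (p q s eps : R) : p < q < s ->
  (forall t, p <= t <= s -> is_derive f t (f1 t)) -> (forall t, p <= t <= s -> is_derive f1 t (f2 t)) ->
  (forall t, p <= t <= s -> Rabs (f2 t) <= eps) ->
  Rabs ((s - q) * f p + (q - p) * f s - (s - p) * f q) <= (s - q) * (q - p) * (s - p) * eps.
Proof.
  intros Hp D1 D2 B.
  assert (M : forall (g g' : R -> R) u v, u <= v -> (forall t, u <= t <= v -> is_derive g t (g' t)) ->
     exists t, u <= t <= v /\ g v - g u = g' t * (v - u)).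
  { intros g g' u v Huv Hg. destruct (MVT_gen g u v g') as [t [Ht E]].
    - intros t Ht. rewrite Rmin_left, Rmax_right in Ht by lra. apply Hg; lra.
    - intros t Ht. rewrite Rmin_left, Rmax_right in Ht by lra.
      apply continuity_pt_filterlim. apply (is_derive_continuous g t (g' t)). now apply Hg.
    - rewrite Rmin_left, Rmax_right in Ht by lra. now exists t. }
  destruct (M f f1 p q ltac:(lra) ltac:(intros; apply D1; lra)) as [t1 [Ht1 E1]].
  destruct (M f f1 q s ltac:(lra) ltac:(intros; apply D1; lra)) as [t2 [Ht2 E2]].
  destruct (M f1 f2 t1 t2 ltac:(lra) ltac:(intros; apply D2; lra)) as [t3 [Ht3 E3]].
  replace ((s - q) * f p + (q - p) * f s - (s - p) * f q) with ((s - q) * (q - p) * (t2 - t1) * f2 t3).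
  - rewrite Rabs_mult. assert (H0 : 0 <= (s - q) * (q - p)) by (apply Rmult_le_pos; lra).
    rewrite Rabs_pos_eq by (apply Rmult_le_pos; lra).
    apply Rmult_le_compat; try apply Rabs_pos; try (apply Rmult_le_pos; lra).
    + apply Rmult_le_compat_l; lra.
    + apply B; lra.
  - replace ((s - q) * (q - p) * (t2 - t1) * f2 t3) with ((s - q) * (q - p) * (f2 t3 * (t2 - t1))) by ring.
    rewrite <- E3.
    replace ((s - q) * (q - p) * (f1 t2 - f1 t1)) with ((q - p) * (f1 t2 * (s - q)) - (s - q) * (f1 t1 * (q - p))) by ring.
    rewrite <- E1, <- E2. ring.
Qed.

(** In the limit every three-point second difference vanishes, so the graph of [P] is a line,
    written here through the nodes 1 and 2. *)
Lemma affine_limit (f f1 f2 : nat -> R -> R) (P : R -> R) :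
  (forall n t, 0 < t -> is_derive (f n) t (f1 n t)) -> (forall n t, 0 < t -> is_derive (f1 n) t (f2 n t)) ->
  (forall p s, 0 < p < s -> exists eps : nat -> R, is_lim_seq eps 0 /\
     forall n t, p <= t <= s -> Rabs (f2 n t) <= eps n) ->
  (forall t, 0 < t -> is_lim_seq (fun n => f n t) (P t)) ->
  forall t, 0 < t -> P t = P 1 + (P 2 - P 1) * (t - 1).
Proof.
  intros D1 D2 B L.
  assert (Z : forall p q s, 0 < p -> p < q < s -> (s - q) * P p + (q - p) * P s = (s - p) * P q).
  { intros p q s Hp Hq. destruct (B p s ltac:(lra)) as [eps [Le He]].
    apply Rminus_diag_uniq.
    assert (H : is_lim_seq (fun n => (s - q) * f n p + (q - p) * f n s - (s - p) * f n q) 0).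
    { apply is_lim_seq_abs_0.
      apply is_lim_seq_le_le with (fun _ => 0) (fun n => (s - q) * (q - p) * (s - p) * eps n).
      - intros n. split; [apply Rabs_pos|]. apply (second_difference (f n) (f1 n) (f2 n)); trivial.
        + intros; apply D1; lra.
        + intros; apply D2; lra.
        + intros; apply He; lra.
      - apply is_lim_seq_const.
      - replace (Finite 0) with (Rbar_mult ((s - q) * (q - p) * (s - p)) 0).
        now apply is_lim_seq_scal_l. simpl. f_equal. ring. }
    assert (H' : is_lim_seq (fun n => (s - q) * f n p + (q - p) * f n s - (s - p) * f n q)
       ((s - q) * P p + (q - p) * P s - (s - p) * P q)).
    { apply is_lim_seq_minus'; [apply is_lim_seq_plus'|];
      apply (is_lim_seq_scal_l _ _ (Finite _)); apply L; lra. }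
    apply is_lim_seq_unique in H. apply is_lim_seq_unique in H'. rewrite H in H'. now injection H'. }
  intros t Ht.
  destruct (Rtotal_order t 1) as [H|[->|H]].
  - pose proof (Z t 1 2 Ht ltac:(lra)). lra.
  - ring.
  - destruct (Rtotal_order t 2) as [H'|[->|H']].
    + pose proof (Z 1 t 2 ltac:(lra) ltac:(lra)). lra.
    + ring.
    + pose proof (Z 1 2 t ltac:(lra) ltac:(lra)). lra.
Qed.

Lemma continuity_2d_ratio (r x : R) : 0 < r -> continuity_2d_pt (fun r x => x ^ 2 / r ^ 2) r x.
Proof.
  intros Hr. apply continuity_2d_pt_mult.
  - apply (continuity_2d_pt_snd (fun x => x ^ 2)).
    apply (ex_derive_continuous (K := R_AbsRing) (V := R_NormedModule)). auto_derive. trivial.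
  - apply continuity_2d_pt_inv; [|apply pow_nonzero; lra]. apply (continuity_2d_pt_fst (fun r => r ^ 2)).
    apply (ex_derive_continuous (K := R_AbsRing) (V := R_NormedModule)). auto_derive. trivial.
Qed.

Lemma continuity_2d_comp_ratio (e : R -> R) (r x : R) : 0 < r -> continuous e (x ^ 2 / r ^ 2) ->
  continuity_2d_pt (fun r x => e (x ^ 2 / r ^ 2)) r x.
Proof.
  intros Hr He. apply (continuity_2d_pt_comp1 e (fun r x => x ^ 2 / r ^ 2)); trivial.
  now apply continuity_2d_ratio.
Qed.

Lemma continuity_2d_Rinv_fst (r x : R) : 0 < r -> continuity_2d_pt (fun r _ => / r) r x.
Proof. intros Hr. apply continuity_2d_pt_inv; [apply continuity_2d_pt_id1|lra]. Qed.

Ltac continuity_2d_tac := repeat first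
  [ apply continuity_2d_pt_const | apply continuity_2d_pt_id1 | apply continuity_2d_pt_id2
  | apply continuity_2d_pt_plus | apply continuity_2d_pt_minus | apply continuity_2d_pt_opp
  | apply continuity_2d_pt_mult ].

Lemma continuity_2d_vker (a r x : R) (e : R -> R) : 0 < r -> continuous e (x ^ 2 / r ^ 2) ->
  continuity_2d_pt (fun r x => vker a e r x) r x.
Proof.
  intros Hr He. unfold vker. apply continuity_2d_pt_mult.
  - now apply (continuity_2d_pt_fst (fun r => Rpower r (-2 * a))), continuous_Rpower.
  - now apply continuity_2d_comp_ratio.
Qed.

Lemma continuity_2d_vker_r (a r x : R) (e e1 : R -> R) : 0 < r ->
  continuous e (x ^ 2 / r ^ 2) -> continuous e1 (x ^ 2 / r ^ 2) ->
  continuity_2d_pt (fun r x => vker_r a e e1 r x) r x.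
Proof.
  intros Hr He He1. unfold vker_r. apply continuity_2d_pt_mult.
  - now apply (continuity_2d_pt_fst (fun r => Rpower r (-2 * a))), continuous_Rpower.
  - apply continuity_2d_pt_mult; [apply continuity_2d_pt_mult; [continuity_2d_tac|now apply continuity_2d_Rinv_fst]|].
    apply continuity_2d_pt_plus; apply continuity_2d_pt_mult.
    + continuity_2d_tac.
    + now apply continuity_2d_comp_ratio.
    + now apply continuity_2d_ratio.
    + now apply continuity_2d_comp_ratio.
Qed.

Lemma continuity_2d_vker_rr (a r x : R) (e e1 e2 : R -> R) : 0 < r ->
  continuous e (x ^ 2 / r ^ 2) -> continuous e1 (x ^ 2 / r ^ 2) -> continuous e2 (x ^ 2 / r ^ 2) ->
  continuity_2d_pt (fun r x => vker_rr a e e1 e2 r x) r x.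
Proof.
  intros Hr He He1 He2. unfold vker_rr. apply continuity_2d_pt_mult.
  - apply continuity_2d_pt_mult.
    + now apply (continuity_2d_pt_fst (fun r => Rpower r (-2 * a))), continuous_Rpower.
    + apply continuity_2d_pt_inv; [|apply pow_nonzero; lra].
      apply (continuity_2d_pt_fst (fun r => r ^ 2)).
      apply (ex_derive_continuous (K := R_AbsRing) (V := R_NormedModule)). auto_derive. trivial.
  - apply continuity_2d_pt_plus; [apply continuity_2d_pt_plus|]; apply continuity_2d_pt_mult;
      try now apply continuity_2d_comp_ratio.
    + continuity_2d_tac.
    + apply continuity_2d_pt_mult; [continuity_2d_tac|now apply continuity_2d_ratio].
    + apply continuity_2d_pt_mult; [continuity_2d_tac|].
      apply (continuity_2d_pt_comp1 (fun t => t ^ 2) (fun r x => x ^ 2 / r ^ 2)); [|now apply continuity_2d_ratio].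
      apply (ex_derive_continuous (K := R_AbsRing) (V := R_NormedModule)). auto_derive. trivial.
Qed.

(** The function [(1 + x)^(-3/2)], whose primitive is elementary: common majorant for integrands
    that are bounded at 0 and decay at least like [(1 + x^2)^(-3/4)]. *)
Definition tail_weight (x : R) : R := / ((1 + x) * sqrt (1 + x)).

Lemma tail_weight_dominator : dominator tail_weight (fun x => - 2 / sqrt (1 + x)) (- 2) 0.
Proof.
  assert (Hs : forall x, 0 < x -> 0 < sqrt (1 + x)) by (intros; apply sqrt_lt_R0; lra).
  constructor.
  - intros x Hx. specialize (Hs x Hx). unfold tail_weight. auto_derive; [lra|].
    rewrite <- (sqrt_sqrt (1 + x)) at 4 by lra. field. lra.
  - intros x Hx. specialize (Hs x Hx). unfold tail_weight.
    apply (ex_derive_continuous (K := R_AbsRing) (V := R_NormedModule)). auto_derive. repeat split; try lra; apply Rgt_not_eq, Rmult_lt_0_compat; lra.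
  - intros x Hx. specialize (Hs x Hx). unfold tail_weight. left. apply Rinv_0_lt_compat. nra.
  - assert (Cx : continuous (fun x => - 2 / sqrt (1 + x)) 0).
    { apply (ex_derive_continuous (K := R_AbsRing) (V := R_NormedModule)). auto_derive.
      rewrite Rplus_0_r, sqrt_1. lra. }
    unfold continuous in Cx. rewrite Rplus_0_r, sqrt_1 in Cx. replace (-2 / 1) with (-2) in Cx by field.
    intros P HP. apply (filter_le_within (F := locally 0)). now apply Cx.
  - intros P [eps HP].
    exists (Rmax 1 ((4 / eps) ^ 2)). intros x Hx. apply HP.
    pose proof (Rmax_l 1 ((4 / eps) ^ 2)). pose proof (Rmax_r 1 ((4 / eps) ^ 2)).
    specialize (Hs x ltac:(lra)). pose proof (cond_pos eps).
    unfold ball; simpl; unfold AbsRing_ball; simpl. unfold abs, minus, plus, opp; simpl.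
    replace (-2 / sqrt (1 + x) + - 0) with (- (2 / sqrt (1 + x))) by (field; lra).
    rewrite Rabs_Ropp, Rabs_pos_eq by (left; apply Rdiv_lt_0_compat; lra).
    assert (Hq : 4 / eps < sqrt (1 + x)).
    { apply Rsqr_incrst_0.
      - unfold Rsqr. rewrite sqrt_sqrt by lra. simpl in *. lra.
      - left. apply Rdiv_lt_0_compat; lra.
      - lra. }
    apply Rmult_lt_reg_r with (sqrt (1 + x)); trivial. unfold Rdiv at 1. rewrite Rmult_assoc, Rinv_l by lra.
    assert (eps * (4 / eps) < eps * sqrt (1 + x)) by (apply Rmult_lt_compat_l; lra).
    replace (eps * (4 / eps)) with 4 in * by (field; lra). lra.
Qed.

Lemma Rpower_le_base1 (x s t : R) : 1 <= x -> s <= t -> Rpower x s <= Rpower x t.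
Proof.
  intros Hx Hst. destruct Hx as [Hx|<-].
  - apply Rle_Rpower; lra.
  - unfold Rpower. rewrite ln_1, !Rmult_0_r. lra.
Qed.

(** From [(1 + x)^2 <= 2 (1 + x^2)]; the factor 2 exceeds [2^(3/4)]. *)
Lemma Rpower_le_tail_weight (x s : R) : 0 < x -> s <= - 3/4 -> Rpower (1 + x ^ 2) s <= 2 * tail_weight x.
Proof.
  intros Hx Hs.
  assert (Hx2 : 0 < x ^ 2) by now apply pow_lt.
  apply Rle_trans with (Rpower (1 + x ^ 2) (- (3/4))); [apply Rpower_le_base1; lra|].
  assert (E : tail_weight x = Rpower ((1 + x) ^ 2) (- (3/4))).
  { unfold tail_weight. rewrite sqrt_Rpower by lra. rewrite <- (Rpower_1 (1 + x)) at 1 by lra.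
    rewrite <- Rpower_plus, <- Rpower_Ropp. rewrite <- (Rpower_pow 2) by lra. rewrite Rpower_mult. f_equal. simpl; lra. }
  rewrite E.
  assert (L : Rpower (2 * (1 + x ^ 2)) (- (3/4)) <= Rpower ((1 + x) ^ 2) (- (3/4))).
  { rewrite !Rpower_Ropp. apply Rinv_le_contravar. apply exp_pos. apply Rle_Rpower_l; [lra|]. split; [apply pow_lt; lra|]. pose proof (pow2_ge_0 (1 - x)). nra. }
  rewrite <- Rpower_mult_distr in L by lra.
  assert (H2 : / 2 <= Rpower 2 (- (3/4))).
  { rewrite Rpower_Ropp. apply Rinv_le_contravar. apply exp_pos. apply Rle_trans with (Rpower 2 1); [apply Rle_Rpower; lra|rewrite Rpower_1; lra]. }
  assert (0 < Rpower (1 + x ^ 2) (- (3/4))) by apply exp_pos. nra.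
Qed.

Lemma Rpower_x_le (x s : R) : 0 < x -> 0 <= s -> Rpower x s <= Rpower (1 + x ^ 2) (s / 2).
Proof.
  intros Hx Hs. replace (Rpower x s) with (Rpower (x ^ 2) (s / 2)).
  - apply Rle_Rpower_l; [lra|]. split; [now apply pow_lt|lra].
  - rewrite <- (Rpower_pow 2) by lra. rewrite Rpower_mult. f_equal. simpl; lra.
Qed.

Lemma pint_scal (k l : R) (f : R -> R) : is_pint f l -> is_pint (fun x => k * f x) (k * l).
Proof. intros H. exact (is_RInt_gen_scal (V := R_NormedModule) f k l H). Qed.

Lemma pint_minus (f g : R -> R) (l m : R) : is_pint f l -> is_pint g m -> is_pint (fun x => f x - g x) (l - m).
Proof. intros H H'. exact (is_RInt_gen_minus (V := R_NormedModule) f g l m H H'). Qed.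

Lemma pint_plus (f g : R -> R) (l m : R) : is_pint f l -> is_pint g m -> is_pint (fun x => f x + g x) (l + m).
Proof. intros H H'. exact (is_RInt_gen_plus (V := R_NormedModule) f g l m H H'). Qed.

Lemma dominator_lin (A B : R) (g1 H1 g2 H2 : R -> R) (p1 q1 p2 q2 : R) : 0 <= A -> 0 <= B ->
  dominator g1 H1 p1 q1 -> dominator g2 H2 p2 q2 ->
  dominator (fun x => A * g1 x + B * g2 x) (fun x => A * H1 x + B * H2 x) (A * p1 + B * p2) (A * q1 + B * q2).
Proof.
  intros HA HB [D1 C1 P1 Z1 I1] [D2 C2 P2 Z2 I2].
  assert (Cst : forall (F : (R -> Prop) -> Prop) {FF : Filter F} (k : R) (f : R -> R) (l : R),
    filterlim f F (locally l) -> filterlim (fun x => k * f x) F (locally (k * l))).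
  { intros F FF k f l Hf. eapply filterlim_comp. exact Hf. exact (filterlim_scal_r (V := R_NormedModule) k l). }
  constructor.
  - intros x Hx. apply is_derive_plus_R; apply is_derive_const_mult_R; auto.
  - intros x Hx. apply (continuous_plus (V := R_NormedModule));
      apply (continuous_scal_r (V := R_NormedModule)); auto.
  - intros x Hx. specialize (P1 x Hx). specialize (P2 x Hx).
    apply Rplus_le_le_0_compat; now apply Rmult_le_pos.
  - eapply filterlim_comp_2; [apply Cst; [apply _|exact Z1]|apply Cst; [apply _|exact Z2]|].
    exact (filterlim_plus (V := R_NormedModule) (A * p1) (B * p2)).
  - eapply filterlim_comp_2; [apply Cst; [apply _|exact I1]|apply Cst; [apply _|exact I2]|].
    exact (filterlim_plus (V := R_NormedModule) (A * q1) (B * q2)).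
Qed.

Lemma Rpower_lim_zero (s : R) : 0 < s -> filterlim (fun x => Rpower x s) (at_right 0) (locally 0).
Proof.
  intros Hs P [eps HP].
  exists (mkposreal _ (exp_pos (ln eps / s))). intros x Hx Hx0. apply HP.
  unfold ball in *; simpl in *; unfold AbsRing_ball in *; simpl in *. unfold abs, minus, plus, opp in *; simpl in *.
  rewrite Ropp_0, Rplus_0_r in *. rewrite Rabs_pos_eq in * by (try lra; left; apply exp_pos).
  assert (L : ln x < ln eps / s) by (rewrite <- (ln_exp (ln eps / s)); apply ln_increasing; lra).
  rewrite <- (exp_ln eps) by apply cond_pos. unfold Rpower. apply exp_increasing.
  apply Rmult_lt_reg_r with (/ s). now apply Rinv_0_lt_compat.
  replace (s * ln x * / s) with (ln x) by (field; lra). exact L.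
Qed.

(** Majorant for integrands singular like [x^(s-1)] at 0; the exponent [-s - 1] is chosen so that
    [(x / (1 + x))^s / s] is a primitive. *)
Definition beta_weight (s : R) (x : R) : R := Rpower x (s - 1) * Rpower (1 + x) (- s - 1).

Lemma beta_weight_dominator (s : R) : 0 < s -> dominator (beta_weight s) (fun x => / s * Rpower (x / (1 + x)) s) 0 (/ s).
Proof.
  intros Hs.
  assert (Cont : forall x, 0 < x -> continuous (beta_weight s) x).
  { intros x Hx. unfold beta_weight. apply (continuous_mult (K := R_AbsRing)); [now apply continuous_Rpower|].
    apply (continuous_comp (fun x => 1 + x) (fun x => Rpower x (- s - 1))).
    - apply (ex_derive_continuous (K := R_AbsRing) (V := R_NormedModule)). auto_derive. trivial.
    - apply continuous_Rpower; lra. }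
  constructor; trivial.
  - intros x Hx. assert (Hr : 0 < x / (1 + x)) by (apply Rdiv_lt_0_compat; lra).
    eapply is_derive_eq.
    + apply is_derive_const_mult_R. apply (is_derive_comp_R (fun x => Rpower x s) (fun x => x / (1 + x))).
      * now apply is_derive_Rpower.
      * instantiate (1 := / (1 + x) ^ 2). auto_derive; [lra|field; lra].
    + unfold beta_weight. unfold Rdiv at 2. rewrite <- Rpower_mult_distr; [|lra|apply Rinv_0_lt_compat; lra].
      replace (Rpower (/ (1 + x)) s) with (Rpower (1 + x) (- s)).
      2:{ unfold Rpower. rewrite ln_Rinv by lra. f_equal. ring. }
      replace (Rpower x s) with (Rpower x (s - 1) * x).
      2:{ rewrite <- (Rpower_1 x) at 2 by lra. rewrite <- Rpower_plus. f_equal. ring. }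
      replace (Rpower (1 + x) (- s)) with (Rpower (1 + x) (- s - 1) * (1 + x)).
      2:{ rewrite <- (Rpower_1 (1 + x)) at 2 by lra. rewrite <- Rpower_plus. f_equal. ring. }
      field. lra.
  - intros x Hx. unfold beta_weight. apply Rmult_le_pos; left; apply exp_pos.
  - intros P [eps HP]. destruct (Rpower_lim_zero s Hs (ball 0 (s * eps))) as [d Hd].
    { exists (mkposreal _ (Rmult_lt_0_compat _ _ Hs (cond_pos eps))). intros y Hy; exact Hy. }
    exists d. intros x Hx Hx0. apply HP. specialize (Hd x Hx Hx0).
    unfold ball in *; simpl in *; unfold AbsRing_ball in *; simpl in *. unfold abs, minus, plus, opp in *; simpl in *.
    rewrite Ropp_0, Rplus_0_r in *.
    assert (Hr : 0 < x / (1 + x)) by (apply Rdiv_lt_0_compat; lra).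
    assert (Hle : Rpower (x / (1 + x)) s <= Rpower x s).
    { apply Rle_Rpower_l; [lra|]. split; trivial. apply Rmult_le_reg_r with (1 + x); [lra|].
      unfold Rdiv. rewrite Rmult_assoc, Rinv_l by lra. nra. }
    assert (0 < Rpower (x / (1 + x)) s) by apply exp_pos.
    assert (0 < / s) by now apply Rinv_0_lt_compat.
    rewrite Rabs_pos_eq in * by nra.
    apply Rmult_lt_reg_l with s; trivial. rewrite <- Rmult_assoc, Rinv_r, Rmult_1_l by lra. lra.
  - assert (L1 : filterlim (fun x => x / (1 + x)) (Rbar_locally p_infty) (locally 1)).
    { intros P [eps HP]. exists (Rmax 1 (/ eps)). intros x Hx. apply HP.
      pose proof (Rmax_l 1 (/ eps)). pose proof (Rmax_r 1 (/ eps)). pose proof (cond_pos eps).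
      unfold ball; simpl; unfold AbsRing_ball; simpl. unfold abs, minus, plus, opp; simpl.
      match goal with |- Rabs ?t < _ => replace t with (- / (1 + x)) by (field; lra) end.
      rewrite Rabs_Ropp, Rabs_pos_eq by (left; apply Rinv_0_lt_compat; lra).
      rewrite <- (Rinv_inv eps). apply Rinv_lt_contravar; [|lra].
      apply Rmult_lt_0_compat; [apply Rinv_0_lt_compat|]; lra. }
    assert (E : / s = / s * Rpower 1 s) by (unfold Rpower; rewrite ln_1, Rmult_0_r, exp_0; ring).
    cut (filterlim (fun x => / s * Rpower (x / (1 + x)) s) (Rbar_locally p_infty) (locally (/ s * Rpower 1 s))).
    { rewrite <- E. trivial. }
    apply (filterlim_comp _ _ _ (fun x => x / (1 + x)) (fun t => / s * Rpower t s) _ (locally 1)); [exact L1|].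
    apply (continuous_scal_r (V := R_NormedModule) (/ s) (fun x => Rpower x s)). apply continuous_Rpower; lra.
Qed.

(** Over a compact [[e, X]] the integral is continuous in the parameter, and the truncation error is
    uniform in it. *)
Lemma pint_continuous (f : R -> R -> R) (l g H : R -> R) (h0 h1 M lo hi : R) :
  0 <= M -> dominator g H h0 h1 ->
  (forall r x, lo < r < hi -> 0 < x -> continuity_2d_pt f r x) ->
  (forall r x, lo < r < hi -> 0 < x -> Rabs (f r x) <= M * g x) ->
  (forall r, lo < r < hi -> is_pint (f r) (l r)) ->
  forall r, lo < r < hi -> continuous l r.
Proof.
  intros HM D Hf Hb Hl r Hr. apply continuity_pt_filterlim. intros eps Heps.
  assert (Hk : 0 < eps / (8 * (M + 1))) by (apply Rdiv_lt_0_compat; lra).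
  destruct (dominator_near_zero _ _ _ _ D _ Hk) as [de [Hde HdH]].
  destruct (dominator_near_infty _ _ _ _ D _ Hk) as [Y [HY HYH]].
  set (e := Rmin de Y / 2). set (X := 2 * Y).
  assert (He : 0 < e /\ e < de /\ e < X).
  { unfold e, X. pose proof (Rmin_l de Y). pose proof (Rmin_r de Y).
    assert (0 < Rmin de Y) by now apply Rmin_glb_lt. lra. }
  assert (CI : continuous (fun r => RInt (f r) e X) r).
  { apply (continuous_RInt_under f e X lo hi 0 (X + 1)); try lra. intros z t Hz Ht. apply Hf; lra. }
  apply continuity_pt_filterlim in CI.
  destruct (CI (eps / 2) ltac:(lra)) as [dl [Hdl HdI]].
  exists (Rmin dl (Rmin (r - lo) (hi - r))). split.
  { repeat apply Rmin_glb_lt; lra. }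
  intros y [Hy1 Hy2]. simpl in *. unfold R_dist in *.
  pose proof (Rmin_l dl (Rmin (r - lo) (hi - r))). pose proof (Rmin_r dl (Rmin (r - lo) (hi - r))).
  pose proof (Rmin_l (r - lo) (hi - r)). pose proof (Rmin_r (r - lo) (hi - r)).
  assert (Hy3 := Hy2). apply Rabs_def2 in Hy3.
  assert (T : forall z, lo < z < hi -> Rabs (RInt (f z) e X - l z) <= M * (2 * (eps / (8 * (M + 1))))).
  { intros z Hz. eapply Rle_trans.
    - apply (dominated_truncation_error (f z) g H h0 h1 M (l z) e X); trivial; try lra.
      + intros x Hx. apply continuity_2d_pt_slice_r, Hf; trivial.
      + intros x Hx. now apply Hb.
      + now apply Hl.
    - pose proof (HdH e ltac:(lra)) as A1. pose proof (HYH X ltac:(unfold X; lra)) as A2.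
      apply Rabs_def2 in A1. apply Rabs_def2 in A2. apply Rmult_le_compat_l; lra. }
  assert (E : M * (2 * (eps / (8 * (M + 1)))) < eps / 4).
  { replace (eps / 4) with ((M + 1) * (2 * (eps / (8 * (M + 1))))) by (field; lra).
    apply Rmult_lt_compat_r; lra. }
  pose proof (T y ltac:(lra)) as T1. pose proof (T r Hr) as T2.
  assert (HI : Rabs (RInt (f y) e X - RInt (f r) e X) < eps / 2).
  { apply HdI. split; trivial. lra. }
  pose proof (Rabs_triang (l y - RInt (f y) e X) (RInt (f y) e X - RInt (f r) e X + (RInt (f r) e X - l r))) as R1.
  pose proof (Rabs_triang (RInt (f y) e X - RInt (f r) e X) (RInt (f r) e X - l r)) as R2.
  replace (l y - RInt (f y) e X + (RInt (f y) e X - RInt (f r) e X + (RInt (f r) e X - l r))) with (l y - l r) in R1 by ring.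
  rewrite Rabs_minus_sym in T1. lra.
Qed.

Lemma pint_scale (f : R -> R) (p l : R) : 0 < p -> (forall x, 0 < x -> continuous f x) ->
  is_pint f l -> is_pint (fun x => f (x / p)) (p * l).
Proof.
  intros Hp Hf H. rewrite is_RInt_gen_pos_eps in H by trivial.
  assert (Hg : forall x, 0 < x -> continuous (fun x => f (x / p)) x).
  { intros x Hx. apply (continuous_comp (fun x => x / p) f).
    - apply (ex_derive_continuous (K := R_AbsRing) (V := R_NormedModule)). auto_derive; trivial.
    - apply Hf. now apply Rdiv_lt_0_compat. }
  apply is_RInt_gen_pos_eps; trivial. intros eps Heps.
  destruct (H (eps / p)) as [d [Y [Hd [HY HdY]]]]; [now apply Rdiv_lt_0_compat|].
  exists (d * p), (Y * p). repeat split; try now apply Rmult_lt_0_compat.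
  intros e X He HX.
  assert (E : RInt (fun x => f (x / p)) e X = p * RInt f (e / p) (X / p)).
  { assert (Hp' : 0 < / p) by now apply Rinv_0_lt_compat.
    assert (Hex : ex_RInt f (/ p * e + 0) (/ p * X + 0)).
    { apply ex_RInt_pos; trivial; rewrite Rplus_0_r; apply Rmult_lt_0_compat; trivial; nra. }
    pose proof (RInt_comp_lin (V := R_CompleteNormedModule) f (/ p) 0 e X Hex) as L.
    rewrite !Rplus_0_r in L.
    replace (e / p) with (/ p * e) by (field; lra). replace (X / p) with (/ p * X) by (field; lra).
    rewrite <- L.
    rewrite (RInt_scal (V := R_CompleteNormedModule) (fun y => f (/ p * y + 0)) e X (/ p)).
    - unfold scal; simpl; unfold mult; simpl. rewrite <- Rmult_assoc, Rinv_r, Rmult_1_l by lra.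
      apply RInt_ext. intros x Hx. f_equal. field. lra.
    - apply (ex_RInt_ext (fun x => f (x / p))).
      + intros x Hx. f_equal. field. lra.
      + apply ex_RInt_pos; trivial; nra. }
  rewrite E. replace (p * RInt f (e / p) (X / p) - p * l) with (p * (RInt f (e / p) (X / p) - l)) by ring.
  rewrite Rabs_mult, (Rabs_pos_eq p) by lra.
  replace eps with (p * (eps / p)) by (field; lra). apply Rmult_lt_compat_l; trivial.
  apply HdY.
  - split; [apply Rdiv_lt_0_compat; lra|]. apply Rmult_lt_reg_r with p; trivial.
    unfold Rdiv. rewrite Rmult_assoc, Rinv_l by lra. lra.
  - apply Rmult_lt_reg_r with p; trivial. unfold Rdiv. rewrite Rmult_assoc, Rinv_l by lra. lra.
Qed.

(** Replaces [1 + z] by [z] in [eta_limit], the form suited to [z = x^2 / r^2]. The correcting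
    factor [(z / (1 + z))^al] lies between [1 - al / z] and 1. *)
Lemma eta_limit_pow (al c L : R) : 0 < al < c -> is_lim_seq (eta_ratio al c) L ->
  forall eps, 0 < eps -> exists Z, 0 < Z /\ forall z, Z < z -> Rabs (Rpower z al * eta al c z - L) < eps.
Proof.
  intros Hal HL eps Heps.
  destruct (eta_limit al c L Hal HL (eps / 2) ltac:(lra)) as [Z [HZ HZe]].
  destruct (eta_bounds al c L Hal HL) as [K [HK Hb]].
  exists (Rmax Z (2 * al * K / eps)). split; [apply Rlt_le_trans with Z; trivial; apply Rmax_l|].
  intros z Hz. pose proof (Rmax_l Z (2 * al * K / eps)). pose proof (Rmax_r Z (2 * al * K / eps)).
  specialize (HZe z ltac:(lra)). destruct (Hb z ltac:(lra)) as [B _].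
  assert (H1 : 0 < Rpower (1 + z) al) by apply exp_pos.
  set (g := Rpower (1 + z) al * eta al c z) in *.
  assert (Hg : Rabs g <= K).
  { unfold g. rewrite Rabs_mult, Rabs_pos_eq by lra. rewrite Rpower_Ropp in B.
    replace K with (Rpower (1 + z) al * (K * / Rpower (1 + z) al)) by (field; lra).
    apply Rmult_le_compat_l; lra. }
  assert (Hr : Rpower z al * eta al c z = Rpower (z / (1 + z)) al * g).
  { unfold g. rewrite <- Rmult_assoc, Rpower_mult_distr; try lra; [|apply Rdiv_lt_0_compat; lra].
    do 2 f_equal. field. lra. }
  rewrite Hr.
  assert (Hz1 : 1 - al / z <= Rpower (z / (1 + z)) al <= 1).
  { split.
    - unfold Rpower. pose proof (exp_ineq1_le (al * ln (z / (1 + z)))) as X.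
      assert (Y : - / z <= ln (z / (1 + z))).
      { replace (z / (1 + z)) with (/ (1 + / z)) by (field; lra).
        assert (0 < / z) by (apply Rinv_0_lt_compat; lra).
        rewrite ln_Rinv by lra. apply Ropp_le_contravar.
        pose proof (exp_ineq1_le (/ z)). apply Rle_trans with (ln (exp (/ z))); [|rewrite ln_exp; lra].
        apply ln_le; lra. }
      assert (al * (- / z) <= al * ln (z / (1 + z))) by (apply Rmult_le_compat_l; lra).
      unfold Rdiv in *. lra.
    - unfold Rpower. apply Rle_trans with (exp 0); [|rewrite exp_0; lra].
      assert (ln (z / (1 + z)) <= 0).
      { rewrite <- ln_1. apply ln_le; [apply Rdiv_lt_0_compat; lra|].
        apply Rmult_le_reg_r with (1 + z); [lra|]. unfold Rdiv. rewrite Rmult_assoc, Rinv_l; lra. }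
      assert (HL0 : al * ln (z / (1 + z)) <= 0) by nra.
      destruct HL0 as [G|G]; [left; now apply exp_increasing|rewrite G; lra]. }
  set (t := Rpower (z / (1 + z)) al) in *.
  replace (t * g - L) with ((g - L) - (1 - t) * g) by ring.
  apply Rle_lt_trans with (Rabs (g - L) + (1 - t) * Rabs g).
  - eapply Rle_trans; [apply Rabs_triang|]. rewrite Rabs_Ropp, Rabs_mult, (Rabs_pos_eq (1 - t)) by lra. lra.
  - assert ((1 - t) * Rabs g <= al / z * K).
    { apply Rmult_le_compat; try lra. apply Rabs_pos. }
    assert (al / z * K < eps / 2); [|lra].
    apply Rmult_lt_reg_r with z; [lra|]. replace (al / z * K * z) with (al * K) by (field; lra).
    assert (2 * al * K / eps * eps < z * eps) by (apply Rmult_lt_compat_r; lra).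
    replace (2 * al * K / eps * eps) with (2 * al * K) in * by (field; lra). lra.
Qed.

Lemma Rpower_sq_ratio (r x s : R) : 0 < r ->
  Rpower r (2 * s) * Rpower (1 + x ^ 2 / r ^ 2) s = Rpower (r ^ 2 + x ^ 2) s.
Proof.
  intros Hr. assert (H2 : 0 < r ^ 2) by now apply pow_lt. pose proof (sq_ratio_ge0 x r Hr).
  replace (Rpower r (2 * s)) with (Rpower (r ^ 2) s).
  - rewrite Rpower_mult_distr by lra. f_equal. field. lra.
  - rewrite <- (Rpower_pow 2) by lra. rewrite Rpower_mult. f_equal.
Qed.

Lemma vker_bound (a c K r x : R) : 0 < r ->
  (forall z, 0 <= z -> Rabs (eta a c z) <= K * Rpower (1 + z) (- a) /\ Rabs (eta1 a c z) <= K * Rpower (1 + z) (- a - 1)) ->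
  Rabs (vker a (eta a c) r x) <= K * Rpower (r ^ 2 + x ^ 2) (- a) /\
  Rabs (vker_x a (eta1 a c) r x) <= K * (2 * Rabs x * Rpower (r ^ 2 + x ^ 2) (- a - 1)).
Proof.
  intros Hr Hb. destruct (Hb _ (sq_ratio_ge0 x r Hr)) as [B0 B1].
  assert (Hp : 0 < Rpower r (-2 * a)) by apply exp_pos.
  unfold vker, vker_x. rewrite !Rabs_mult. rewrite (Rabs_pos_eq (Rpower r (-2 * a))) by lra.
  rewrite <- !Rpower_sq_ratio by trivial. replace (2 * - a) with (-2 * a) by ring.
  replace (2 * (- a - 1)) with (-2 * a + -2) by ring. rewrite Rpower_plus.
  assert (E : Rpower r (-2) = / r ^ 2).
  { rewrite <- (Rpower_pow 2) by lra. rewrite <- Rpower_Ropp. f_equal. }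
  assert (0 < r ^ 2) by now apply pow_lt.
  rewrite E. rewrite Rabs_div, !Rabs_mult, (Rabs_pos_eq 2), (Rabs_pos_eq (r ^ 2)) by lra.
  split.
  - apply Rle_trans with (Rpower r (-2 * a) * (K * Rpower (1 + x ^ 2 / r ^ 2) (- a))); [apply Rmult_le_compat_l; lra|right; ring].
  - apply Rle_trans with (Rpower r (-2 * a) * (2 * Rabs x / r ^ 2 * (K * Rpower (1 + x ^ 2 / r ^ 2) (- a - 1)))).
    + apply Rmult_le_compat_l; [lra|]. apply Rmult_le_compat_l; trivial.
      apply Rdiv_le_0_compat; trivial. pose proof (Rabs_pos x). lra.
    + right. unfold Rdiv. ring.
Qed.

(** Since [r^2 + x^2 >= min(1, p^2) (1 + x^2)], bounds on the kernels become uniform for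
    [r >= p]. *)
Lemma Rpower_sum_sq_le (p r x s : R) : 0 < p <= r -> 0 <= s ->
  Rpower (r ^ 2 + x ^ 2) (- s) <= Rpower (Rmin 1 (p ^ 2)) (- s) * Rpower (1 + x ^ 2) (- s).
Proof.
  intros Hp Hs. assert (H2 : 0 < p ^ 2) by (apply pow_lt; lra).
  assert (Hm : 0 < Rmin 1 (p ^ 2)) by (apply Rmin_glb_lt; lra).
  pose proof (pow2_ge_0 x). pose proof (Rmin_l 1 (p ^ 2)). pose proof (Rmin_r 1 (p ^ 2)).
  rewrite Rpower_mult_distr by lra. rewrite !Rpower_Ropp.
  apply Rinv_le_contravar. apply exp_pos. apply Rle_Rpower_l; trivial. split; [nra|].
  assert (p ^ 2 <= r ^ 2) by (apply pow_incr; lra). nra.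
Qed.

Definition kint (a c d r x : R) : R :=
  Rpower x (2 * c - 1) * yfun d c (x ^ 2) * vker a (eta a c) r x.

(** The bound [x^(2c) (1 + x^2)^(-c-1/2)] behaves like [x^(2c)] at 0 and like [1/x] at infinity: the
    flux vanishes at both ends, uniformly for [r >= p]. *)
Lemma flux_bound (a c d La Ld p : R) : 0 < a -> 0 < d -> c = a + d -> 0 < p ->
  is_lim_seq (eta_ratio a c) La -> is_lim_seq (eta_ratio d c) Ld ->
  exists M, 0 <= M /\ forall r x, p <= r -> 0 < x ->
    Rabs (flux a c d (yfun d c) (yfun1 d c) (eta a c) (eta1 a c) r x) <= M * (Rpower x (2 * c) * Rpower (1 + x ^ 2) (- c - 1/2)).
Proof.
  intros Ha Hd Hc Hp HLa HLd.
  destruct (eta_bounds a c La ltac:(lra) HLa) as [K1 [HK1 B1]].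
  destruct (yfun_bounds d c Ld ltac:(lra) HLd) as [K2 [HK2 B2]].
  set (m := Rmin 1 (p ^ 2)).
  set (m0 := Rpower m (- a)). set (m1 := Rpower m (- (a + 1))).
  assert (Hm0 : 0 < m0) by apply exp_pos. assert (Hm1 : 0 < m1) by apply exp_pos.
  exists (K1 * K2 * (2 * m1 + 2 * m0 + Rabs (2 * a - 2 * d - 3) * m0)).
  assert (HKK : 0 < K1 * K2) by now apply Rmult_lt_0_compat.
  pose proof (Rabs_pos (2 * a - 2 * d - 3)) as HA.
  split. { apply Rmult_le_pos; [lra|]. assert (0 <= Rabs (2 * a - 2 * d - 3) * m0) by (apply Rmult_le_pos; lra). lra. }
  intros r x Hr Hx.
  destruct (vker_bound a c K1 r x ltac:(lra) B1) as [V0 V1].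
  pose proof (Rpower_sum_sq_le p r x a ltac:(lra) ltac:(lra)) as S0.
  pose proof (Rpower_sum_sq_le p r x (a + 1) ltac:(lra) ltac:(lra)) as S1.
  fold m in S0, S1. fold m0 in S0. fold m1 in S1.
  assert (Hx2 : 0 < x ^ 2) by now apply pow_lt.
  destruct (B2 (x ^ 2) ltac:(lra)) as [Y0 Y1].
  set (w := Rpower (1 + x ^ 2) (- c - 1/2)) in *.
  assert (Hw : 0 < w) by apply exp_pos.
  assert (W1 : Rpower (1 + x ^ 2) (- (d + 1/2)) * Rpower (1 + x ^ 2) (- (a + 1)) * (1 + x ^ 2) = w).
  { unfold w. rewrite <- (Rpower_1 (1 + x ^ 2)) at 3 by lra. rewrite <- !Rpower_plus. f_equal. rewrite Hc. lra. }
  assert (W2 : Rpower (1 + x ^ 2) (- 1 - (d + 1/2)) * Rpower (1 + x ^ 2) (- a) * (1 + x ^ 2) = w).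
  { unfold w. rewrite <- (Rpower_1 (1 + x ^ 2)) at 3 by lra. rewrite <- !Rpower_plus. f_equal. rewrite Hc. lra. }
  assert (W3 : Rpower (1 + x ^ 2) (- (d + 1/2)) * Rpower (1 + x ^ 2) (- a) = w).
  { unfold w. rewrite <- !Rpower_plus. f_equal. rewrite Hc. lra. }
  replace (- (a + 1)) with (- a - 1) in * by ring.
  unfold flux. rewrite Rabs_Ropp, Rabs_mult.
  rewrite (Rabs_pos_eq (Rpower x (2 * c - 1))) by (left; apply exp_pos).
  replace (Rpower x (2 * c)) with (Rpower x (2 * c - 1) * x).
  2:{ rewrite <- (Rpower_1 x) at 2 by lra. rewrite <- Rpower_plus. f_equal. ring. }
  match goal with |- ?P * Rabs ?T <= ?Q => replace Q with (P * (K1 * K2 * (2 * m1 + 2 * m0 + Rabs (2 * a - 2 * d - 3) * m0) * x * w)) by ring end.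
  apply Rmult_le_compat_l; [left; apply exp_pos|].
  set (V := vker a (eta a c) r x) in *. set (Vx := vker_x a (eta1 a c) r x) in *.
  set (y := yfun d c (x ^ 2)) in *. set (y1 := yfun1 d c (x ^ 2)) in *.
  rewrite (Rabs_pos_eq x) in V1 by lra.
  set (p0 := Rpower (1 + x ^ 2) (- a)) in *. set (p1 := Rpower (1 + x ^ 2) (- a - 1)) in *.
  set (q0 := Rpower (1 + x ^ 2) (- (d + 1/2))) in *. set (q1 := Rpower (1 + x ^ 2) (- 1 - (d + 1/2))) in *.
  assert (P0 : 0 < p0) by apply exp_pos. assert (P1 : 0 < p1) by apply exp_pos.
  assert (Q0 : 0 < q0) by apply exp_pos. assert (Q1 : 0 < q1) by apply exp_pos.
  assert (V0' : Rabs V <= K1 * (m0 * p0)) by (apply Rle_trans with (1 := V0); apply Rmult_le_compat_l; lra).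
  assert (V1' : Rabs Vx <= K1 * (2 * x * (m1 * p1))).
  { apply Rle_trans with (1 := V1). apply Rmult_le_compat_l; [lra|]. apply Rmult_le_compat_l; lra. }
  assert (T1 : Rabs (y * Vx) <= K2 * q0 * (K1 * (2 * x * (m1 * p1)))).
  { rewrite Rabs_mult. apply Rmult_le_compat; trivial; apply Rabs_pos. }
  assert (T2 : Rabs (2 * x * y1 * V) <= 2 * x * (K2 * q1) * (K1 * (m0 * p0))).
  { rewrite !Rabs_mult, (Rabs_pos_eq 2), (Rabs_pos_eq x) by lra.
    apply Rmult_le_compat; trivial; try apply Rabs_pos.
    - apply Rmult_le_pos; [lra|apply Rabs_pos].
    - apply Rmult_le_compat_l; lra. }
  assert (T3 : Rabs (x * (y * V)) <= x * (K2 * q0 * (K1 * (m0 * p0)))).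
  { rewrite !Rabs_mult, (Rabs_pos_eq x) by lra. apply Rmult_le_compat_l; [lra|].
    apply Rmult_le_compat; trivial; apply Rabs_pos. }
  eapply Rle_trans; [apply Rabs_triang|]. rewrite (Rabs_mult (1 + x ^ 2)), (Rabs_pos_eq (1 + x ^ 2)) by lra.
  rewrite (Rabs_mult (2 * a - 2 * d - 3)).
  apply Rle_trans with ((1 + x ^ 2) * (K2 * q0 * (K1 * (2 * x * (m1 * p1))) + 2 * x * (K2 * q1) * (K1 * (m0 * p0)))
     + Rabs (2 * a - 2 * d - 3) * (x * (K2 * q0 * (K1 * (m0 * p0))))).
  - apply Rplus_le_compat.
    + apply Rmult_le_compat_l; [lra|]. eapply Rle_trans; [apply Rabs_triang|]. rewrite Rabs_Ropp. lra.
    + apply Rmult_le_compat_l; lra.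
  - right. transitivity (K1 * K2 * x * (2 * m1 * (q0 * p1 * (1 + x ^ 2)) + 2 * m0 * (q1 * p0 * (1 + x ^ 2)) + Rabs (2 * a - 2 * d - 3) * m0 * (q0 * p0))).
    + ring.
    + rewrite W1, W2, W3. ring.
Qed.

(** The exponents of [1 + x^2] add up to [(c - 1/2) - (d + 1/2) - a = -1]. *)
Lemma kint_bound (a c d La Ld p : R) : 0 < a -> 0 < d -> c = a + d -> 1/2 < c -> 0 < p ->
  is_lim_seq (eta_ratio a c) La -> is_lim_seq (eta_ratio d c) Ld ->
  exists M, 0 <= M /\ forall r x, p <= r -> 0 < x -> Rabs (kint a c d r x) <= M * tail_weight x.
Proof.
  intros Ha Hd Hc Hc2 Hp HLa HLd.
  destruct (eta_bounds a c La ltac:(lra) HLa) as [K1 [HK1 B1]].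
  destruct (yfun_bounds d c Ld ltac:(lra) HLd) as [K2 [HK2 B2]].
  set (m0 := Rpower (Rmin 1 (p ^ 2)) (- a)). assert (Hm0 : 0 < m0) by apply exp_pos.
  exists (K1 * K2 * m0 * 2).
  assert (HKK : 0 < K1 * K2) by now apply Rmult_lt_0_compat.
  assert (HKM : 0 < K1 * K2 * m0) by now apply Rmult_lt_0_compat.
  split; [lra|]. intros r x Hr Hx.
  destruct (vker_bound a c K1 r x ltac:(lra) B1) as [V0 _].
  pose proof (Rpower_sum_sq_le p r x a ltac:(lra) ltac:(lra)) as S0. fold m0 in S0.
  assert (Hx2 : 0 < x ^ 2) by now apply pow_lt.
  destruct (B2 (x ^ 2) ltac:(lra)) as [Y0 _].
  pose proof (Rpower_x_le x (2 * c - 1) Hx ltac:(lra)) as X0.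
  pose proof (Rpower_le_tail_weight x (-1) Hx ltac:(lra)) as D0.
  unfold kint. rewrite !Rabs_mult. rewrite (Rabs_pos_eq (Rpower x (2 * c - 1))) by (left; apply exp_pos).
  apply Rle_trans with (Rpower (1 + x ^ 2) ((2 * c - 1) / 2) * (K2 * Rpower (1 + x ^ 2) (- (d + 1/2))) * (K1 * (m0 * Rpower (1 + x ^ 2) (- a)))).
  - apply Rmult_le_compat; try apply Rabs_pos.
    + apply Rmult_le_pos; [left; apply exp_pos|apply Rabs_pos].
    + apply Rmult_le_compat; trivial; [left; apply exp_pos|apply Rabs_pos].
    + apply Rle_trans with (1 := V0). apply Rmult_le_compat_l; lra.
  - transitivity (K1 * K2 * m0 * (Rpower (1 + x ^ 2) ((2 * c - 1) / 2) * Rpower (1 + x ^ 2) (- (d + 1/2)) * Rpower (1 + x ^ 2) (- a))).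
    { right; ring. }
    rewrite <- !Rpower_plus. replace ((2 * c - 1) / 2 + - (d + 1 / 2) + - a) with (-1) by (rewrite Hc; field).
    rewrite (Rmult_assoc _ 2). apply Rmult_le_compat_l; lra.
Qed.

Lemma eta_hyp_fun (a c : R) : 0 < c ->
  exists e2, hyp_fun c (2 * a + 1/2) ((a + 1/2) * a) (eta a c) (eta1 a c) e2.
Proof.
  intros Hc. destruct (pfaff_hyp_fun (a + 1/2) a c Hc) as [e2 H]. exists e2.
  replace (2 * a + 1/2) with (a + 1/2 + a) by ring. exact H.
Qed.

Lemma yfun_hyp_fun (d c : R) : 0 < c ->
  exists y2, hyp_fun c (2 * d + 3/2) ((d + 1/2) * (d + 1)) (yfun d c) (yfun1 d c) y2.
Proof.
  intros Hc. destruct (pfaff_hyp_fun (d + 1/2) (d + 1) c Hc) as [e2 H]. exists e2.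
  replace (2 * d + 3/2) with (d + 1/2 + (d + 1)) by field. exact H.
Qed.

Lemma continuous_sq_comp (f f1 : R -> R) (x : R) :
  (forall z, - (1/2) < z -> is_derive f z (f1 z)) -> continuous (fun x => f (x ^ 2)) x.
Proof.
  intros H. apply (continuous_comp (fun x => x ^ 2) f).
  - apply (ex_derive_continuous (K := R_AbsRing) (V := R_NormedModule)). auto_derive; trivial.
  - eapply is_derive_continuous. apply H. pose proof (pow2_ge_0 x). lra.
Qed.

Lemma continuity_2d_kint (a c d r x : R) : 0 < c -> 0 < r -> 0 < x -> continuity_2d_pt (kint a c d) r x.
Proof.
  intros Hc Hr Hx. destruct (eta_hyp_fun a c Hc) as [e2 He]. destruct (yfun_hyp_fun d c Hc) as [y2 Hy].
  pose proof (sq_ratio_ge0 x r Hr).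
  unfold kint. apply continuity_2d_pt_mult; [apply continuity_2d_pt_mult|].
  - now apply (continuity_2d_pt_snd (fun x => Rpower x (2 * c - 1))), continuous_Rpower.
  - apply (continuity_2d_pt_snd (fun x => yfun d c (x ^ 2))).
    apply continuous_sq_comp with (yfun1 d c). apply (hf_d1 _ _ _ _ _ _ Hy).
  - apply continuity_2d_vker; trivial. eapply is_derive_continuous. apply (hf_d1 _ _ _ _ _ _ He). lra.
Qed.

Lemma kint_pint (a c d La Ld r : R) : 0 < a -> 0 < d -> c = a + d -> 1/2 < c -> 0 < r ->
  is_lim_seq (eta_ratio a c) La -> is_lim_seq (eta_ratio d c) Ld -> exists l, is_pint (kint a c d r) l.
Proof.
  intros Ha Hd Hc Hc2 Hr HLa HLd.
  destruct (kint_bound a c d La Ld r Ha Hd Hc Hc2 Hr HLa HLd) as [M [HM HB]].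
  apply (dominated_ex_pint _ tail_weight _ _ _ M HM tail_weight_dominator).
  - intros x Hx. apply continuity_2d_pt_slice_r, continuity_2d_kint; lra.
  - intros x Hx. apply HB; lra.
Qed.

(** [(1 - r^2) * kappa r] is a limit of truncated integrals whose second derivatives are differences
    of fluxes and so tend to 0. The limit is affine, and the factor [1 - r^2] forces its zero at
    [r = 1]. *)
Lemma kint_affine (a c d La Ld : R) (kappa : R -> R) : 0 < a -> 0 < d -> c = a + d -> 1/2 < c ->
  is_lim_seq (eta_ratio a c) La -> is_lim_seq (eta_ratio d c) Ld ->
  (forall r, 0 < r -> is_pint (kint a c d r) (kappa r)) ->
  exists k, forall r, 0 < r -> (1 - r ^ 2) * kappa r = k * (1 - r).
Proof.
  intros Ha Hd Hc Hc2 HLa HLd Hk.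
  destruct (eta_hyp_fun a c ltac:(lra)) as [e2 He]. destruct (yfun_hyp_fun d c ltac:(lra)) as [y2 Hy].
  set (W := fun x => Rpower x (2 * c - 1) * yfun d c (x ^ 2)).
  set (h := fun r x => W x * ((1 - r ^ 2) * vker a (eta a c) r x)).
  set (h1 := fun r x => W x * (- (2 * r) * vker a (eta a c) r x + (1 - r ^ 2) * vker_r a (eta a c) (eta1 a c) r x)).
  set (h2 := fun r x => W x * ((1 - r ^ 2) * vker_rr a (eta a c) (eta1 a c) e2 r x
      - 4 * r * vker_r a (eta a c) (eta1 a c) r x - 2 * vker a (eta a c) r x)).
  set (fl := flux a c d (yfun d c) (yfun1 d c) (eta a c) (eta1 a c)).
  assert (Ce : forall r x, 0 < r -> continuous (eta a c) (x ^ 2 / r ^ 2)).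
  { intros r x Hr. pose proof (sq_ratio_ge0 x r Hr). eapply is_derive_continuous. apply (hf_d1 _ _ _ _ _ _ He). lra. }
  assert (Ce1 : forall r x, 0 < r -> continuous (eta1 a c) (x ^ 2 / r ^ 2)).
  { intros r x Hr. pose proof (sq_ratio_ge0 x r Hr). eapply is_derive_continuous. apply (hf_d2 _ _ _ _ _ _ He). lra. }
  assert (Ce2 : forall r x, 0 < r -> continuous e2 (x ^ 2 / r ^ 2)).
  { intros r x Hr. pose proof (sq_ratio_ge0 x r Hr). apply (hf_c2 _ _ _ _ _ _ He). lra. }
  assert (CW : forall r x, 0 < x -> continuity_2d_pt (fun _ x => W x) r x).
  { intros r x Hx. apply (continuity_2d_pt_snd W). apply (continuous_mult (K := R_AbsRing)).
    - now apply continuous_Rpower.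
    - apply continuous_sq_comp with (yfun1 d c). apply (hf_d1 _ _ _ _ _ _ Hy). }
  assert (Cr2 : forall r x, continuity_2d_pt (fun r _ => 1 - r ^ 2) r x).
  { intros r x. apply (continuity_2d_pt_fst (fun r => 1 - r ^ 2)).
    apply (ex_derive_continuous (K := R_AbsRing) (V := R_NormedModule)). auto_derive; trivial. }
  assert (Ch : forall r x, 0 < r -> 0 < x -> continuity_2d_pt h r x).
  { intros r x Hr Hx. apply continuity_2d_pt_mult; [now apply CW|].
    apply continuity_2d_pt_mult; [apply Cr2|]. apply continuity_2d_vker; auto. }
  assert (Ch1 : forall r x, 0 < r -> 0 < x -> continuity_2d_pt h1 r x).
  { intros r x Hr Hx. apply continuity_2d_pt_mult; [now apply CW|].
    apply continuity_2d_pt_plus; apply continuity_2d_pt_mult; try apply Cr2.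
    - continuity_2d_tac.
    - apply continuity_2d_vker; auto.
    - apply continuity_2d_vker_r; auto. }
  assert (Ch2 : forall r x, 0 < r -> 0 < x -> continuity_2d_pt h2 r x).
  { intros r x Hr Hx. apply continuity_2d_pt_mult; [now apply CW|].
    apply continuity_2d_pt_minus; [apply continuity_2d_pt_minus|]; apply continuity_2d_pt_mult; try apply Cr2.
    - apply continuity_2d_vker_rr; auto.
    - continuity_2d_tac.
    - apply continuity_2d_vker_r; auto.
    - continuity_2d_tac.
    - apply continuity_2d_vker; auto. }
  assert (Dh : forall r x, 0 < r -> is_derive (fun r => h r x) r (h1 r x)).
  { intros r x Hr. pose proof (sq_ratio_ge0 x r Hr). unfold h, h1. apply is_derive_const_mult_R. eapply is_derive_eq.
    - apply is_derive_mult_R.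
      + instantiate (1 := - (2 * r)). auto_derive; trivial. ring.
      + apply is_derive_vker_r; trivial. apply (hf_d1 _ _ _ _ _ _ He). lra.
    - reflexivity. }
  assert (Dh1 : forall r x, 0 < r -> is_derive (fun r => h1 r x) r (h2 r x)).
  { intros r x Hr. pose proof (sq_ratio_ge0 x r Hr). unfold h1, h2. apply is_derive_const_mult_R. eapply is_derive_eq.
    - apply is_derive_plus_R; apply is_derive_mult_R.
      + instantiate (1 := - 2). auto_derive; trivial. ring.
      + apply is_derive_vker_r; trivial. apply (hf_d1 _ _ _ _ _ _ He). lra.
      + instantiate (1 := - (2 * r)). auto_derive; trivial. ring.
      + apply (is_derive_vker_rr a r x (eta a c) (eta1 a c) e2); trivial.
        * apply (hf_d1 _ _ _ _ _ _ He). lra.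
        * apply (hf_d2 _ _ _ _ _ _ He). lra.
    - unfold vker_r. ring. }
  assert (En : forall n, 0 < / INR (S n) <= INR (S n)).
  { intros n. pose proof (pos_INR n). rewrite S_INR. split; [apply Rinv_0_lt_compat; lra|].
    apply Rmult_le_reg_l with (INR n + 1); [lra|]. rewrite Rinv_r by lra. nra. }
  pose proof (affine_limit
    (fun n r => truncated (h r) n) (fun n r => truncated (h1 r) n) (fun n r => truncated (h2 r) n)
    (fun r => (1 - r ^ 2) * kappa r)) as A. cbv beta in A.
  (* The second [r]-derivative is exact in [x], so only the flux at the two ends of the truncation
     interval is left. *)
  assert (R2 : forall n r, 0 < r -> truncated (h2 r) n = fl r (INR (S n)) - fl r (/ INR (S n))).
  { intros n r Hr. destruct (En n) as [E1 E2]. unfold truncated. apply is_RInt_unique.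
    apply (is_RInt_derive (V := R_CompleteNormedModule) (fl r) (h2 r)); intros x Hx;
    rewrite Rmin_left, Rmax_right in Hx by lra.
    - apply (is_derive_flux a c d r x (yfun d c) (yfun1 d c) y2 (eta a c) (eta1 a c) e2); trivial; lra.
    - apply continuity_2d_pt_slice_r, Ch2; lra. }
  (* The opposite of the slope between the nodes 1 and 2, the value at 1 being 0. *)
  exists (- ((1 - 2 ^ 2) * kappa 2)). intros r Hr.
  rewrite A; trivial; clear A.
  - ring.
  - intros n t Ht. destruct (En n) as [E1 E2]. unfold truncated.
    apply (is_derive_RInt_under h h1 _ _ 0 (t + 1) 0 (INR (S n) + 1)); try lra.
    + intros z u Hz Hu. apply Dh; lra.
    + intros z u Hz Hu. apply Ch1; lra.
    + intros z u Hz Hu. apply continuity_2d_pt_slice_r, Ch; lra.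
  - intros n t Ht. destruct (En n) as [E1 E2]. unfold truncated.
    apply (is_derive_RInt_under h1 h2 _ _ 0 (t + 1) 0 (INR (S n) + 1)); try lra.
    + intros z u Hz Hu. apply Dh1; lra.
    + intros z u Hz Hu. apply Ch2; lra.
    + intros z u Hz Hu. apply continuity_2d_pt_slice_r, Ch1; lra.
  - intros p s Hps. destruct (flux_bound a c d La Ld p Ha Hd Hc ltac:(lra) HLa HLd) as [M [HM HF]].
    exists (fun n => 2 * M * / INR (S n)). split.
    + replace (Finite 0) with (Rbar_mult (2 * M) 0) by (simpl; f_equal; ring).
      apply is_lim_seq_scal_l. apply (is_lim_seq_incr_1 (fun n => / INR n)).
      replace (Finite 0) with (Rbar_inv p_infty) by reflexivity.
      apply is_lim_seq_inv; [apply is_lim_seq_INR|discriminate].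
    + intros n t Ht. destruct (En n) as [E1 E2]. rewrite R2 by lra.
      set (X := INR (S n)) in *. assert (HX : 1 <= X) by (unfold X; rewrite S_INR; pose proof (pos_INR n); lra).
      assert (F1 : Rabs (fl t X) <= M * / X).
      { eapply Rle_trans; [apply HF; lra|]. apply Rmult_le_compat_l; trivial.
        pose proof (Rpower_x_le X (2 * c) ltac:(lra) ltac:(lra)) as Q.
        assert (Hp' : 0 < Rpower (1 + X ^ 2) (- c - 1/2)) by apply exp_pos.
        apply Rle_trans with (Rpower (1 + X ^ 2) (2 * c / 2) * Rpower (1 + X ^ 2) (- c - 1/2)); [apply Rmult_le_compat_r; lra|].
        rewrite <- Rpower_plus. replace (2 * c / 2 + (- c - 1/2)) with (- (1/2)) by field.
        rewrite Rpower_Ropp. apply Rinv_le_contravar; [lra|]. rewrite <- sqrt_Rpower by nra.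
        rewrite <- (sqrt_pow2 X) at 1 by lra. apply sqrt_le_1; nra. }
      assert (F2 : Rabs (fl t (/ X)) <= M * / X).
      { eapply Rle_trans; [apply HF; lra|]. apply Rmult_le_compat_l; trivial.
        assert (Hx2 : 0 < (/ X) ^ 2) by (apply pow_lt; lra).
        assert (Hp' : Rpower (1 + (/ X) ^ 2) (- c - 1/2) <= 1).
        { apply Rle_trans with (Rpower (1 + (/ X) ^ 2) 0); [apply Rle_Rpower; lra|]. rewrite Rpower_O; lra. }
        assert (Hp'' : 0 < Rpower (1 + (/ X) ^ 2) (- c - 1/2)) by apply exp_pos.
        assert (Hq : Rpower (/ X) (2 * c) <= / X).
        { replace (Rpower (/ X) (2 * c)) with (/ Rpower X (2 * c)).
          - apply Rinv_le_contravar; [lra|]. rewrite <- (Rpower_1 X) at 1 by lra. apply Rpower_le_base1; lra.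
          - unfold Rpower. rewrite ln_Rinv, <- exp_Ropp by lra. f_equal. ring. }
        assert (0 < Rpower (/ X) (2 * c)) by apply exp_pos. nra. }
      eapply Rle_trans; [apply Rabs_triang|]. rewrite Rabs_Ropp. lra.
  - intros t Ht.
    apply is_lim_seq_ext with (fun n => (1 - t ^ 2) * truncated (kint a c d t) n).
    + intros n. unfold truncated.
      rewrite <- (RInt_scal (V := R_CompleteNormedModule)).
      * apply RInt_ext. intros x Hx. unfold h, W, kint, scal; simpl; unfold mult; simpl. ring.
      * destruct (En n). apply ex_RInt_pos; try lra. intros x Hx. apply continuity_2d_pt_slice_r, continuity_2d_kint; lra.
    + apply (is_lim_seq_scal_l _ _ (Finite _)). apply is_lim_seq_truncated; [|now apply Hk].
      intros x Hx. apply continuity_2d_pt_slice_r, continuity_2d_kint; lra.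
Qed.

Lemma eta_pow_bound (a c K z : R) : 0 < a -> 0 < z -> 0 <= K ->
  Rabs (eta a c z) <= K * Rpower (1 + z) (- a) -> Rabs (Rpower z a * eta a c z) <= K.
Proof.
  intros Ha Hz HK HB. assert (0 < Rpower z a) by apply exp_pos.
  rewrite Rabs_mult, (Rabs_pos_eq (Rpower z a)) by lra. rewrite Rpower_Ropp in HB.
  assert (H2 : 0 < Rpower (1 + z) a) by apply exp_pos.
  assert (Rpower z a <= Rpower (1 + z) a) by (apply Rle_Rpower_l; lra).
  apply Rle_trans with (Rpower z a * (K * / Rpower (1 + z) a)); [apply Rmult_le_compat_l; lra|].
  apply Rmult_le_reg_r with (Rpower (1 + z) a); trivial.
  replace (Rpower z a * (K * / Rpower (1 + z) a) * Rpower (1 + z) a) with (K * Rpower z a) by (field; lra).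
  apply Rmult_le_compat_l; lra.
Qed.

(** By [yfun_eta], [etap1] is the derivative of [etap]; hence its integral over the half-line is the
    limit of [etap] at infinity. *)
Definition etap (d c x : R) : R := Rpower x (2 * d) * eta d c (x ^ 2).
Definition etap1 (d c x : R) : R := 2 * d * (Rpower x (2 * d - 1) * yfun d c (x ^ 2)).

Lemma is_derive_etap (d c L x : R) : 0 < d < c -> is_lim_seq (eta_ratio d c) L -> 0 < x ->
  is_derive (etap d c) x (etap1 d c x).
Proof.
  intros Hd HL Hx. destruct (eta_hyp_fun d c ltac:(lra)) as [e2 He].
  assert (Hx2 : 0 < x ^ 2) by now apply pow_lt.
  unfold etap, etap1. eapply is_derive_eq.
  - apply is_derive_mult_R; [now apply is_derive_Rpower|].
    apply (is_derive_comp_R (eta d c) (fun x => x ^ 2)).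
    + apply (hf_d1 _ _ _ _ _ _ He). lra.
    + instantiate (1 := 2 * x). auto_derive; trivial. ring.
  - rewrite (yfun_eta d c L) by (trivial; lra).
    replace (Rpower x (2 * d)) with (Rpower x (2 * d - 1) * x).
    2:{ rewrite <- (Rpower_1 x) at 2 by lra. rewrite <- Rpower_plus. f_equal. ring. }
    field. lra.
Qed.

Lemma continuous_etap1 (d c x : R) : 0 < d < c -> 0 < x -> continuous (etap1 d c) x.
Proof.
  intros Hd Hx. destruct (yfun_hyp_fun d c ltac:(lra)) as [y2 Hy].
  unfold etap1. apply (continuous_scal_r (V := R_NormedModule)). apply (continuous_mult (K := R_AbsRing)).
  - now apply continuous_Rpower.
  - apply continuous_sq_comp with (yfun1 d c). apply (hf_d1 _ _ _ _ _ _ Hy).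
Qed.

Lemma etap1_pint (d c L : R) : 0 < d < c -> is_lim_seq (eta_ratio d c) L -> is_pint (etap1 d c) L.
Proof.
  intros Hd HL. replace L with (L - 0) by ring.
  destruct (eta_bounds d c L Hd HL) as [K [HK HB]].
  apply (pint_derive (etap d c)).
  - intros x Hx. now apply is_derive_etap with L.
  - intros x Hx. now apply continuous_etap1.
  - apply filterlim_locally. intros eps.
    assert (He : 0 < eps / K) by (apply Rdiv_lt_0_compat; trivial; apply cond_pos).
    pose proof (Rpower_lim_zero (2 * d) ltac:(lra) (ball 0 (eps / K)) (locally_ball 0 (mkposreal _ He))) as Q.
    destruct (at_right_eps _ Q) as [r [Hr Hq]].
    exists (mkposreal _ Hr). intros x Hx Hx0.
    assert (Hxr : 0 < x < r).
    { split; trivial. unfold ball in Hx; simpl in Hx; unfold AbsRing_ball in Hx; simpl in Hx.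
      unfold abs, minus, plus, opp in Hx; simpl in Hx. rewrite Rabs_pos_eq in Hx; lra. }
    specialize (Hq x Hxr).
    unfold ball in *; simpl in *; unfold AbsRing_ball in *; simpl in *. unfold abs, minus, plus, opp in *; simpl in *.
    rewrite Ropp_0, Rplus_0_r in *. unfold etap.
    assert (Hp : 0 < Rpower x (2 * d)) by apply exp_pos.
    rewrite Rabs_pos_eq in Hq by lra.
    rewrite Rabs_mult, (Rabs_pos_eq (Rpower _ _)) by lra.
    destruct (HB (x ^ 2) (pow2_ge_0 x)) as [B _].
    assert (Rpower (1 + x ^ 2) (- d) <= 1).
    { apply Rle_trans with (Rpower (1 + x ^ 2) 0).
      - apply Rle_Rpower; [|lra]. assert (0 < x ^ 2) by (apply pow_lt; lra). lra.
      - rewrite Rpower_O; [lra|]. pose proof (pow2_ge_0 x). lra. }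
    assert (B' : Rabs (eta d c (x ^ 2)) <= K) by nra.
    apply Rle_lt_trans with (Rpower x (2 * d) * K); [apply Rmult_le_compat_l; lra|].
    replace (pos eps) with (eps / K * K) by (field; lra). apply Rmult_lt_compat_r; trivial.
  - intros P [eps HP]. destruct (eta_limit_pow d c L Hd HL eps (cond_pos eps)) as [Z [HZ HZe]].
    exists (Rmax 1 Z). intros x Hx. apply HP.
    pose proof (Rmax_l 1 Z). pose proof (Rmax_r 1 Z).
    specialize (HZe (x ^ 2) ltac:(nra)). unfold etap.
    replace (Rpower x (2 * d)) with (Rpower (x ^ 2) d); [exact HZe|].
    rewrite <- (Rpower_pow 2) by lra. rewrite Rpower_mult. f_equal.
Qed.

Lemma etap1_bound (d c L : R) : 0 < d < c -> is_lim_seq (eta_ratio d c) L ->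
  exists K, 0 < K /\ forall x, 0 < x -> Rabs (etap1 d c x) <= K * beta_weight (2 * d) x.
Proof.
  intros Hd HL. destruct (yfun_bounds d c L Hd HL) as [K [HK HB]].
  assert (H2 : 0 < Rpower 2 (d + 1/2)) by apply exp_pos.
  exists (2 * d * K * Rpower 2 (d + 1/2)). split.
  { repeat apply Rmult_lt_0_compat; lra. }
  intros x Hx. assert (Hx2 : 0 < x ^ 2) by now apply pow_lt.
  destruct (HB (x ^ 2) ltac:(lra)) as [B _]. unfold etap1, beta_weight.
  assert (Hp : 0 < Rpower x (2 * d - 1)) by apply exp_pos.
  rewrite !Rabs_mult, (Rabs_pos_eq (Rpower _ _)), (Rabs_pos_eq 2), (Rabs_pos_eq d) by lra.
  replace (2 * d * K * Rpower 2 (d + 1/2) * (Rpower x (2 * d - 1) * Rpower (1 + x) (- (2 * d) - 1))) with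
    (2 * d * (Rpower x (2 * d - 1) * (K * (Rpower 2 (d + 1/2) * Rpower (1 + x) (- (2 * d) - 1))))) by ring.
  apply Rmult_le_compat_l; [lra|]. apply Rmult_le_compat_l; [lra|].
  apply Rle_trans with (1 := B). apply Rmult_le_compat_l; [lra|].
  replace (Rpower (1 + x) (- (2 * d) - 1)) with (/ Rpower ((1 + x) ^ 2) (d + 1/2)).
  2:{ rewrite <- (Rpower_pow 2) by lra. rewrite Rpower_mult, <- Rpower_Ropp. f_equal. simpl. field. }
  rewrite Rpower_Ropp.
  assert (P1 : 0 < Rpower (1 + x ^ 2) (d + 1/2)) by apply exp_pos.
  assert (P2 : 0 < Rpower ((1 + x) ^ 2) (d + 1/2)) by apply exp_pos.
  assert (P3 : Rpower ((1 + x) ^ 2) (d + 1/2) <= Rpower 2 (d + 1/2) * Rpower (1 + x ^ 2) (d + 1/2)).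
  { rewrite Rpower_mult_distr by lra. apply Rle_Rpower_l; [lra|]. split; [apply pow_lt; lra|].
    pose proof (pow2_ge_0 (1 - x)). nra. }
  apply Rmult_le_reg_r with (Rpower (1 + x ^ 2) (d + 1/2)); trivial. rewrite Rinv_l by lra.
  apply Rmult_le_reg_r with (Rpower ((1 + x) ^ 2) (d + 1/2)); trivial.
  match goal with |- _ <= ?T => replace T with (Rpower 2 (d + 1/2) * Rpower (1 + x ^ 2) (d + 1/2)) by (field; lra) end. lra.
Qed.

(** As [r] tends to 0, [vker] at [(r, x)] tends to [La x^(-2a)], and [2 d] times the integrand tends
    to [La * etap1], whose integral is [La * Ld]. The convergence is not uniform near [x = 0], which
    is why the error bound carries a weight singular there. *)
Lemma kint_near_zero (a c d La Ld : R) (kappa : R -> R) : 0 < a -> 0 < d -> c = a + d -> 1/2 < c ->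
  is_lim_seq (eta_ratio a c) La -> is_lim_seq (eta_ratio d c) Ld ->
  (forall r, 0 < r -> is_pint (kint a c d r) (kappa r)) ->
  forall eps, 0 < eps -> exists r0, 0 < r0 /\ forall r, 0 < r < r0 -> Rabs (2 * d * kappa r - La * Ld) <= eps.
Proof.
  intros Ha Hd Hc Hc2 HLa HLd Hk eps Heps.
  destruct (eta_hyp_fun a c ltac:(lra)) as [e2 He].
  destruct (eta_bounds a c La ltac:(lra) HLa) as [K1 [HK1 B1]].
  destruct (etap1_bound d c Ld ltac:(lra) HLd) as [K2 [HK2 B2]].
  set (e' := eps * d / K2). assert (He' : 0 < e') by (apply Rdiv_lt_0_compat; nra).
  destruct (eta_limit_pow a c La ltac:(lra) HLa e' He') as [Z [HZ HZe]].
  set (B := K1 + Rabs La). assert (HB : 0 < B) by (unfold B; pose proof (Rabs_pos La); lra).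
  (* [G * Rpower r d] is the contribution of the singular part of the error; the choice of [r0]
     makes it at most [eps / 2]. *)
  set (G := B * Rpower Z (d / 2) * K2 / d).
  assert (HZp : 0 < Rpower Z (d / 2)) by apply exp_pos.
  assert (HG : 0 < G) by (unfold G; apply Rdiv_lt_0_compat; trivial; repeat apply Rmult_lt_0_compat; lra).
  exists (Rpower (eps / (2 * G)) (/ d)). split; [apply exp_pos|].
  intros r Hr.
  assert (Hrd : Rpower r d <= eps / (2 * G)).
  { apply Rle_trans with (Rpower (Rpower (eps / (2 * G)) (/ d)) d).
    - apply Rle_Rpower_l; lra.
    - rewrite Rpower_mult, Rinv_l, Rpower_1 by (try lra; apply Rdiv_lt_0_compat; lra). lra. }
  set (hh := fun s => Rpower s a * eta a c s).
  (* For [s <= Z] the crude bound [B] suffices because [(Z / s)^(d/2) >= 1]. At [s = x^2 / r^2] the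
     exponent [d / 2] produces [r^d x^(-d)], and the factor [x^(2d-1)] of the majorant absorbs
     [x^(-d)]. *)
  assert (Hhh : forall s, 0 < s -> Rabs (hh s - La) <= e' + B * Rpower (Z / s) (d / 2)).
  { intros s Hs. assert (0 < Rpower (Z / s) (d / 2)) by apply exp_pos.
    assert (0 < B * Rpower (Z / s) (d / 2)) by now apply Rmult_lt_0_compat.
    destruct (Rlt_dec Z s) as [H'|H'].
    - specialize (HZe s H'). unfold hh. lra.
    - assert (Hone : 1 <= Rpower (Z / s) (d / 2)).
      { rewrite <- (Rpower_O (Z / s)) by (apply Rdiv_lt_0_compat; lra). apply Rpower_le_base1; [|lra].
        apply Rmult_le_reg_r with s; trivial. unfold Rdiv. rewrite Rmult_assoc, Rinv_l; lra. }
      apply Rle_trans with B.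
      + unfold B. eapply Rle_trans; [apply Rabs_triang|]. rewrite Rabs_Ropp. apply Rplus_le_compat_r.
        apply eta_pow_bound; trivial; try lra. apply B1; lra.
      + nra. }
  assert (Eq : forall x, 0 < x -> 2 * d * kint a c d r x - La * etap1 d c x = (hh (x ^ 2 / r ^ 2) - La) * etap1 d c x).
  { intros x Hx. unfold kint, vker, hh, etap1.
    replace (Rpower (x ^ 2 / r ^ 2) a) with (Rpower x (2 * a) * Rpower r (-2 * a)).
    2:{ unfold Rdiv. rewrite <- Rpower_mult_distr; [|apply pow_lt; lra|apply Rinv_0_lt_compat, pow_lt; lra].
        f_equal.
        - rewrite <- (Rpower_pow 2 x) by lra. rewrite Rpower_mult. f_equal.
        - rewrite <- (Rpower_pow 2 r) by lra. rewrite <- Rpower_Ropp, Rpower_mult. f_equal. }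
    replace (Rpower x (2 * c - 1)) with (Rpower x (2 * d - 1) * Rpower x (2 * a)).
    2:{ rewrite <- Rpower_plus. f_equal. rewrite Hc. ring. }
    ring. }
  pose proof (pint_minus _ _ _ _ (pint_scal (2 * d) _ _ (Hk r ltac:(lra))) (pint_scal La _ _ (etap1_pint d c Ld ltac:(lra) HLd))) as Pm.
  pose proof (dominator_lin (e' * K2) (B * Rpower Z (d / 2) * Rpower r d * K2) _ _ _ _ _ _ _ _
    ltac:(apply Rmult_le_pos; lra)
    ltac:(assert (0 < Rpower r d) by apply exp_pos; repeat apply Rmult_le_pos; lra)
    (beta_weight_dominator (2 * d) ltac:(lra)) (beta_weight_dominator d Hd)) as Dm.
  replace eps with (1 * (eps / 2 + eps / 2 - 0)) by lra.
  apply Rle_trans with (1 * (e' * K2 * / (2 * d) + B * Rpower Z (d / 2) * Rpower r d * K2 * / d - (e' * K2 * 0 + B * Rpower Z (d / 2) * Rpower r d * K2 * 0))).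
  2:{ apply Rmult_le_compat_l; [lra|].
      replace (e' * K2 * / (2 * d)) with (eps / 2) by (unfold e'; field; lra).
      replace (B * Rpower Z (d / 2) * Rpower r d * K2 * / d) with (G * Rpower r d) by (unfold G; field; lra).
      assert (G * Rpower r d <= G * (eps / (2 * G))) by (apply Rmult_le_compat_l; lra).
      replace (G * (eps / (2 * G))) with (eps / 2) in * by (field; lra). lra. }
  refine (dominated_pint_le _ _ _ _ _ 1 _ ltac:(lra) Dm _ _ Pm).
  - intros x Hx. apply (continuous_minus (V := R_NormedModule)); apply (continuous_scal_r (V := R_NormedModule)).
    + apply continuity_2d_pt_slice_r, continuity_2d_kint; lra.
    + apply continuous_etap1; lra.
  - intros x Hx. rewrite Eq by trivial. rewrite Rabs_mult, Rmult_1_l.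
    assert (Hs : 0 < x ^ 2 / r ^ 2) by (apply Rdiv_lt_0_compat; apply pow_lt; lra).
    assert (HD : 0 < beta_weight (2 * d) x) by (unfold beta_weight; apply Rmult_lt_0_compat; apply exp_pos).
    apply Rle_trans with ((e' + B * Rpower (Z / (x ^ 2 / r ^ 2)) (d / 2)) * (K2 * beta_weight (2 * d) x)).
    { apply Rmult_le_compat; try apply Rabs_pos; auto. }
    rewrite Rmult_plus_distr_r. apply Rplus_le_compat; [right; ring|].
    replace (Z / (x ^ 2 / r ^ 2)) with (Z * (r ^ 2 * / x ^ 2)) by (field; lra).
    assert (0 < r ^ 2) by (apply pow_lt; lra). assert (0 < / x ^ 2) by (apply Rinv_0_lt_compat, pow_lt; lra).
    rewrite <- !Rpower_mult_distr by (try lra; now apply Rmult_lt_0_compat).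
    replace (Rpower (r ^ 2) (d / 2)) with (Rpower r d).
    2:{ rewrite <- (Rpower_pow 2 r) by lra. rewrite Rpower_mult. f_equal. simpl. field. }
    replace (Rpower (/ x ^ 2) (d / 2)) with (Rpower x (- d)).
    2:{ rewrite <- (Rpower_pow 2 x) by lra. rewrite <- Rpower_Ropp, Rpower_mult. f_equal. simpl. field. }
    replace (B * (Rpower Z (d / 2) * (Rpower r d * Rpower x (- d))) * (K2 * beta_weight (2 * d) x)) with
      (B * Rpower Z (d / 2) * Rpower r d * K2 * (Rpower x (- d) * beta_weight (2 * d) x)) by ring.
    apply Rmult_le_compat_l.
    { assert (0 < Rpower r d) by apply exp_pos. repeat apply Rmult_le_pos; lra. }
    unfold beta_weight. rewrite <- Rmult_assoc, <- Rpower_plus. replace (- d + (2 * d - 1)) with (d - 1) by ring.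
    apply Rmult_le_compat_l; [left; apply exp_pos|]. apply Rpower_le_base1; lra.
Qed.

(** Dividing by [1 - r^2] leaves [k / (1 + r)] away from [r = 1]. Continuity fills that point, and
    the limit at 0 identifies [k]. *)
Theorem kint_value (a c d La Ld r : R) : 0 < a -> 0 < d -> c = a + d -> 1/2 < c ->
  is_lim_seq (eta_ratio a c) La -> is_lim_seq (eta_ratio d c) Ld -> 0 < r ->
  is_pint (kint a c d r) (La * Ld / (2 * d) / (1 + r)).
Proof.
  intros Ha Hd Hc Hc2 HLa HLd Hr.
  set (kappa := fun r => RInt_gen (kint a c d r) (at_right 0) (Rbar_locally p_infty)).
  assert (Hk : forall r, 0 < r -> is_pint (kint a c d r) (kappa r)).
  { intros t Ht. destruct (kint_pint a c d La Ld t Ha Hd Hc Hc2 Ht HLa HLd) as [l Hl].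
    unfold kappa. apply (RInt_gen_correct (V := R_CompleteNormedModule)). now exists l. }
  destruct (kint_affine a c d La Ld kappa Ha Hd Hc Hc2 HLa HLd Hk) as [k Hkk].
  assert (Cont : continuous kappa 1).
  { destruct (kint_bound a c d La Ld (1/2) Ha Hd Hc Hc2 ltac:(lra) HLa HLd) as [M [HM HB]].
    apply (pint_continuous (kint a c d) kappa tail_weight _ _ _ M (1/2) 2 HM tail_weight_dominator); try lra.
    - intros t x Ht Hx. apply continuity_2d_kint; lra.
    - intros t x Ht Hx. apply HB; lra.
    - intros t Ht. apply Hk; lra. }
  assert (K1 : forall t, 0 < t -> t <> 1 -> kappa t = k / (1 + t)).
  { intros t Ht Hn. specialize (Hkk t Ht). apply Rmult_eq_reg_l with ((1 - t) * (1 + t)).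
    - replace ((1 - t) * (1 + t) * kappa t) with ((1 - t ^ 2) * kappa t) by ring. rewrite Hkk. field. lra.
    - apply Rmult_integral_contrapositive_currified; lra. }
  assert (K2 : kappa 1 = k / (1 + 1)).
  { apply (filterlim_locally_unique (F := at_right 1) kappa).
    - intros P HP. apply (filter_le_within (F := locally 1)). now apply Cont.
    - apply (filterlim_ext_loc (F := at_right 1) (fun t => k / (1 + t))).
      + exists (mkposreal _ Rlt_0_1). intros t _ Ht. symmetry. apply K1; lra.
      + intros P HP. apply (filter_le_within (F := locally 1)).
        assert (C2 : continuous (fun t => k / (1 + t)) 1).
        { apply (ex_derive_continuous (K := R_AbsRing) (V := R_NormedModule)). auto_derive. lra. }
        now apply C2. }
  assert (K3 : forall t, 0 < t -> kappa t = k / (1 + t)).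
  { intros t Ht. destruct (Req_dec t 1) as [->|Hn]; [exact K2|now apply K1]. }
  replace (La * Ld / (2 * d)) with k.
  { rewrite <- K3 by trivial. now apply Hk. }
  apply Rmult_eq_reg_l with (2 * d); [|lra]. replace (2 * d * (La * Ld / (2 * d))) with (La * Ld) by (field; lra).
  apply cond_eq. intros eps Heps.
  destruct (kint_near_zero a c d La Ld kappa Ha Hd Hc Hc2 HLa HLd Hk (eps / 4) ltac:(lra)) as [r0 [Hr0 Hn]].
  set (q := eps / (8 * (d * Rabs k + 1))).
  assert (Hdk : 0 <= d * Rabs k) by (apply Rmult_le_pos; [lra|apply Rabs_pos]).
  assert (Hq : 0 < q) by (apply Rdiv_lt_0_compat; lra).
  set (t := Rmin r0 q / 2). pose proof (Rmin_l r0 q). pose proof (Rmin_r r0 q).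
  assert (Ht : 0 < t < r0 /\ t < q) by (assert (0 < Rmin r0 q) by (now apply Rmin_glb_lt); unfold t; lra).
  specialize (Hn t ltac:(lra)). rewrite K3 in Hn by lra.
  assert (E : 2 * d * k - 2 * d * (k / (1 + t)) = 2 * (d * k) * (t / (1 + t))) by (field; lra).
  assert (E2 : Rabs (2 * d * k - 2 * d * (k / (1 + t))) <= eps / 4).
  { rewrite E, !Rabs_mult, (Rabs_pos_eq 2), (Rabs_pos_eq d), (Rabs_pos_eq (t / (1 + t))) by (try lra; apply Rdiv_le_0_compat; lra).
    assert (t / (1 + t) <= t).
    { apply Rmult_le_reg_r with (1 + t); [lra|]. unfold Rdiv. rewrite Rmult_assoc, Rinv_l by lra. nra. }
    apply Rle_trans with (2 * (d * Rabs k) * q).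
    - apply Rmult_le_compat_l; lra.
    - replace (eps / 4) with (2 * (d * Rabs k + 1) * q) by (unfold q; field; lra). apply Rmult_le_compat_r; lra. }
  replace (2 * d * k - La * Ld) with ((2 * d * k - 2 * d * (k / (1 + t))) + (2 * d * (k / (1 + t)) - La * Ld)) by ring.
  eapply Rle_lt_trans; [apply Rabs_triang|]. lra.
Qed.

Definition uker (c d p x : R) : R := Rpower p (- (2 * d + 1)) * yfun d c (x ^ 2 / p ^ 2).

Lemma uv_pint (a c d La Ld p q : R) : 0 < a -> 0 < d -> c = a + d -> 1/2 < c ->
  is_lim_seq (eta_ratio a c) La -> is_lim_seq (eta_ratio d c) Ld -> 0 < p -> 0 < q ->
  is_pint (fun x => Rpower x (2 * c - 1) * uker c d p x * vker a (eta a c) q x) (La * Ld / (2 * d) / (p + q)).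
Proof.
  intros Ha Hd Hc Hc2 HLa HLd Hp Hq.
  assert (Hr : 0 < q / p) by now apply Rdiv_lt_0_compat.
  pose proof (pint_scale (kint a c d (q / p)) p _ Hp
    ltac:(intros x Hx; apply continuity_2d_pt_slice_r, continuity_2d_kint; lra)
    (kint_value a c d La Ld (q / p) Ha Hd Hc Hc2 HLa HLd Hr)) as S.
  apply (pint_scal (/ p ^ 2)) in S.
  replace (/ p ^ 2 * (p * (La * Ld / (2 * d) / (1 + q / p)))) with (La * Ld / (2 * d) / (p + q)) in S by (field; lra).
  revert S. apply pint_ext. intros x Hx. unfold kint, uker, vker.
  replace ((x / p) ^ 2 / (q / p) ^ 2) with (x ^ 2 / q ^ 2) by (field; lra).
  replace ((x / p) ^ 2) with (x ^ 2 / p ^ 2) by (field; lra).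
  assert (Hip : 0 < / p) by now apply Rinv_0_lt_compat.
  assert (Inv : forall s, Rpower (/ p) s = Rpower p (- s)).
  { intros s. unfold Rpower. rewrite ln_Rinv by trivial. f_equal. ring. }
  unfold Rdiv at 1 3. rewrite <- !Rpower_mult_distr by trivial. rewrite !Inv.
  replace (/ p ^ 2) with (Rpower p (-2)).
  2:{ rewrite <- (Rpower_pow 2) by lra. rewrite <- Rpower_Ropp. f_equal. }
  replace (Rpower p (- (2 * d + 1))) with (Rpower p (-2) * Rpower p (- (2 * c - 1)) * Rpower p (- (-2 * a))).
  2:{ rewrite <- !Rpower_plus. f_equal. rewrite Hc. ring. }
  ring.
Qed.

(** * The Poisson-type integral *)

Lemma is_derive_cosh (x : R) : is_derive cosh x (sinh x).
Proof. apply is_derive_Reals, derivable_pt_lim_cosh. Qed.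

Lemma is_derive_sinh (x : R) : is_derive sinh x (cosh x).
Proof. apply is_derive_Reals, derivable_pt_lim_sinh. Qed.

Lemma cosh_sq (x : R) : cosh x ^ 2 - sinh x ^ 2 = 1.
Proof.
  unfold cosh, sinh. replace (((exp x + exp (- x)) / 2) ^ 2 - ((exp x - exp (- x)) / 2) ^ 2) with (exp x * exp (- x)) by field.
  rewrite <- exp_plus, Rplus_opp_r. apply exp_0.
Qed.

Lemma cosh_ge_1 (x : R) : 1 <= cosh x.
Proof.
  assert (0 < cosh x) by (unfold cosh; pose proof (exp_pos x); pose proof (exp_pos (- x)); lra).
  pose proof (cosh_sq x). pose proof (pow2_ge_0 (sinh x)). nra.
Qed.

Lemma sinh_abs_lt_cosh (x : R) : Rabs (sinh x) <= cosh x.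
Proof.
  unfold cosh, sinh. pose proof (exp_pos x). pose proof (exp_pos (- x)). apply Rabs_le. lra.
Qed.

Lemma cosh_ge_linear (x : R) : (1 + x) / 2 <= cosh x.
Proof. unfold cosh. pose proof (exp_ineq1_le x). pose proof (exp_pos (- x)). lra. Qed.

(** In the hyperbolic case this solves the wave equation in [(x, v)], in the trigonometric case it
    is harmonic. [pois1] and [pois2] are the [x]-derivatives simplified by [C^2 - sg S^2 = 1]. *)
Definition pois (S C : R -> R) (x v : R) : R := S x / (cosh v + C x).
Definition pois1 (S C : R -> R) (x v : R) : R := (1 + C x * cosh v) / (cosh v + C x) ^ 2.
Definition pois2 (S C : R -> R) (sg x v : R) : R := sg * S x * (cosh v ^ 2 - 2 - C x * cosh v) / (cosh v + C x) ^ 3.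

(* [(S, C, sg)] is [(sinh, cosh, 1)] or [(sin, cos, -1)], and [(s, k)] is the pair of the other kind. *)
Lemma dual_poisson (S C s k : R -> R) (sg m T M1 M2 lo hi x1 : R) :
  (forall x, is_derive S x (C x)) -> (forall x, is_derive C x (sg * S x)) ->
  (forall x, C x ^ 2 - sg * S x ^ 2 = 1) -> S 0 = 0 -> C 0 = 1 -> sg ^ 2 = 1 ->
  (forall x, is_derive s x (k x)) -> (forall x, is_derive k x (- sg * s x)) -> s 0 = 0 -> k 0 = 1 ->
  lo < 0 -> 0 < x1 < hi -> (forall x, lo < x < hi -> -1 < C x) -> 3 <= T -> 0 < m ->
  (forall x, 0 <= x <= x1 -> Rabs (S x) <= M1) -> (forall x, 0 <= x <= x1 -> Rabs (s (m * (x1 - x))) <= M2) ->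
  Rabs (m * RInt (fun v => cos (m * v) * pois S C x1 v) 0 T
        - RInt (fun v => cos (m * v) * / (cosh v + 1)) 0 T * s (m * x1)) <= x1 * (M2 * (M1 * (8 + 4 * m) / T)).
Proof.
  intros DS DC I S0 C0 Hsg Ds Dk s0 k0 Hlo Hx1 HC HT Hm HM1 HM2.
  assert (Pos : forall x v, lo < x < hi -> 0 < cosh v + C x).
  { intros x v Hx. pose proof (HC x Hx). pose proof (cosh_ge_1 v). lra. }
  assert (CS : forall x, continuous S x) by (intros x; eapply is_derive_continuous; apply DS).
  assert (CC : forall x, continuous C x) by (intros x; eapply is_derive_continuous; apply DC).
  assert (Cch : forall v, continuous cosh v) by (intros v; eapply is_derive_continuous; apply is_derive_cosh).
  assert (Ccos : forall v, continuous (fun v => cos (m * v)) v).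
  { intros v. apply (ex_derive_continuous (K := R_AbsRing) (V := R_NormedModule)). auto_derive; trivial. }
  assert (D1 : forall x v, lo < x < hi -> is_derive (fun x => pois S C x v) x (pois1 S C x v)).
  { intros x v Hx. specialize (Pos x v Hx). unfold pois, pois1. eapply is_derive_eq.
    - apply is_derive_div; [apply DS| |lra]. apply is_derive_plus_R; [apply is_derive_const|apply DC].
    - unfold zero; simpl. specialize (I x).
      replace (1 + C x * cosh v) with (C x ^ 2 - sg * S x ^ 2 + C x * cosh v) by lra. field. lra. }
  assert (D2 : forall x v, lo < x < hi -> is_derive (fun x => pois1 S C x v) x (pois2 S C sg x v)).
  { intros x v Hx. specialize (Pos x v Hx). unfold pois1, pois2. eapply is_derive_eq.
    - apply is_derive_div; [| |apply pow_nonzero; lra].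
      + apply is_derive_plus_R; [apply is_derive_const|]. apply is_derive_mult_R; [apply DC|apply is_derive_const].
      + apply (is_derive_pow (fun x => cosh v + C x) 2). apply is_derive_plus_R; [apply is_derive_const|apply DC].
    - unfold zero; simpl. field. lra. }
  assert (C2den : forall x v, lo < x < hi -> continuity_2d_pt (fun x v => cosh v + C x) x v).
  { intros x v Hx. apply continuity_2d_pt_plus; [now apply continuity_2d_pt_snd|now apply continuity_2d_pt_fst]. }
  assert (C2cos : forall x v, continuity_2d_pt (fun _ v => cos (m * v)) x v).
  { intros x v. apply (continuity_2d_pt_snd (fun v => cos (m * v))), Ccos. }
  assert (C2p : forall x v, lo < x < hi -> continuity_2d_pt (fun x v => cos (m * v) * pois S C x v) x v).
  { intros x v Hx. specialize (Pos x v Hx). unfold pois. apply continuity_2d_pt_mult; [apply C2cos|].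
    apply continuity_2d_pt_mult; [now apply continuity_2d_pt_fst|].
    apply continuity_2d_pt_inv; [now apply C2den|lra]. }
  assert (Cpow : forall n x v, lo < x < hi -> continuity_2d_pt (fun x v => (cosh v + C x) ^ n) x v).
  { intros n x v Hx. apply (continuity_2d_pt_comp1 (fun t => t ^ n) (fun x v => cosh v + C x)); [|now apply C2den].
    apply (ex_derive_continuous (K := R_AbsRing) (V := R_NormedModule)). auto_derive; trivial. }
  assert (C2p1 : forall x v, lo < x < hi -> continuity_2d_pt (fun x v => cos (m * v) * pois1 S C x v) x v).
  { intros x v Hx. specialize (Pos x v Hx). unfold pois1. apply continuity_2d_pt_mult; [apply C2cos|].
    apply continuity_2d_pt_mult.
    - apply continuity_2d_pt_plus; [apply continuity_2d_pt_const|].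
      apply continuity_2d_pt_mult; [now apply continuity_2d_pt_fst|now apply continuity_2d_pt_snd].
    - apply continuity_2d_pt_inv; [now apply Cpow|apply pow_nonzero; lra]. }
  assert (C2p2 : forall x v, lo < x < hi -> continuity_2d_pt (fun x v => cos (m * v) * pois2 S C sg x v) x v).
  { intros x v Hx. specialize (Pos x v Hx). unfold pois2. apply continuity_2d_pt_mult; [apply C2cos|].
    apply continuity_2d_pt_mult; [apply continuity_2d_pt_mult|].
    - apply continuity_2d_pt_mult; [apply continuity_2d_pt_const|now apply continuity_2d_pt_fst].
    - apply continuity_2d_pt_minus; [apply continuity_2d_pt_minus|].
      + apply (continuity_2d_pt_snd (fun v => cosh v ^ 2)).
        apply (ex_derive_continuous (K := R_AbsRing) (V := R_NormedModule)). auto_derive; trivial.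
      + apply continuity_2d_pt_const.
      + apply continuity_2d_pt_mult; [now apply continuity_2d_pt_fst|now apply continuity_2d_pt_snd].
    - apply continuity_2d_pt_inv; [now apply Cpow|apply pow_nonzero; lra]. }
  set (G := (fun x => RInt (fun v => cos (m * v) * pois S C x v) 0 T) : R -> R).
  set (G1 := (fun x => RInt (fun v => cos (m * v) * pois1 S C x v) 0 T) : R -> R).
  set (G2 := (fun x => RInt (fun v => cos (m * v) * pois2 S C sg x v) 0 T) : R -> R).
  assert (DG : forall x, lo < x < hi -> is_derive G x (G1 x)).
  { intros x Hx. apply (is_derive_RInt_under (fun x v => cos (m * v) * pois S C x v) (fun x v => cos (m * v) * pois1 S C x v) 0 T lo hi (-1) (T + 1)); try lra.
    - intros z t Hz Ht. apply is_derive_const_mult_R. now apply D1.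
    - intros z t Hz Ht. now apply C2p1.
    - intros z t Hz Ht. now apply (continuity_2d_pt_slice_r (fun x v => cos (m * v) * pois S C x v)), C2p. }
  assert (DG1 : forall x, lo < x < hi -> is_derive G1 x (G2 x)).
  { intros x Hx. apply (is_derive_RInt_under (fun x v => cos (m * v) * pois1 S C x v) (fun x v => cos (m * v) * pois2 S C sg x v) 0 T lo hi (-1) (T + 1)); try lra.
    - intros z t Hz Ht. apply is_derive_const_mult_R. now apply D2.
    - intros z t Hz Ht. now apply C2p2.
    - intros z t Hz Ht. now apply (continuity_2d_pt_slice_r (fun x v => cos (m * v) * pois1 S C x v)), C2p1. }
  (* Boundary term at [v = T] of two integrations by parts in [v]; at [v = 0] everything vanishes
     with [sinh] and [sin]. *)
  set (b := fun x => cos (m * T) * (- (S x * sinh T) / (cosh T + C x) ^ 2) + m * sin (m * T) * pois S C x T).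
  assert (EG2 : forall x, lo < x < hi -> G2 x + sg * m ^ 2 * G x = sg * b x).
  { intros x Hx.
    assert (E1 : ex_RInt (fun v => cos (m * v) * pois2 S C sg x v) 0 T).
    { apply (@ex_RInt_continuous R_CompleteNormedModule). intros v _.
      now apply (continuity_2d_pt_slice_r (fun x v => cos (m * v) * pois2 S C sg x v)), C2p2. }
    assert (E0 : ex_RInt (fun v => cos (m * v) * pois S C x v) 0 T).
    { apply (@ex_RInt_continuous R_CompleteNormedModule). intros v _.
      now apply (continuity_2d_pt_slice_r (fun x v => cos (m * v) * pois S C x v)), C2p. }
    unfold G2, G.
    assert (L : is_RInt (fun v => cos (m * v) * pois2 S C sg x v + sg * m ^ 2 * (cos (m * v) * pois S C x v)) 0 T
       (RInt (fun v => cos (m * v) * pois2 S C sg x v) 0 T + sg * m ^ 2 * RInt (fun v => cos (m * v) * pois S C x v) 0 T)).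
    { apply (is_RInt_plus (V := R_NormedModule)); [apply (RInt_correct (V := R_CompleteNormedModule)); exact E1|].
      apply (is_RInt_scal (V := R_NormedModule)), (RInt_correct (V := R_CompleteNormedModule)); exact E0. }
    rewrite <- (is_RInt_unique _ _ _ _ L). apply is_RInt_unique.
    set (F := fun v => sg * (cos (m * v) * (- (S x * sinh v) / (cosh v + C x) ^ 2) + m * sin (m * v) * pois S C x v)).
    replace (sg * b x) with (minus (F T) (F 0)).
    2:{ unfold minus, plus, opp; simpl. unfold F, b. rewrite sinh_0, Rmult_0_r, sin_0. unfold Rdiv. ring. }
    apply (is_RInt_derive (V := R_CompleteNormedModule) F).
    - intros v _. specialize (Pos x v Hx). unfold F, pois, pois2. eapply is_derive_eq.
      + apply is_derive_const_mult_R. apply is_derive_plus_R.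
        * apply is_derive_mult_R.
          { instantiate (1 := - m * sin (m * v)). auto_derive; trivial. ring. }
          { apply is_derive_div; [| |apply pow_nonzero; lra].
            - apply is_derive_opp_R, is_derive_const_mult_R, is_derive_sinh.
            - apply (is_derive_pow (fun v => cosh v + C x) 2). apply is_derive_plus_R; [apply is_derive_cosh|apply is_derive_const]. }
        * apply is_derive_mult_R.
          { instantiate (1 := m * (m * cos (m * v))). auto_derive; trivial. ring. }
          { apply is_derive_div; [apply is_derive_const| |lra].
            apply is_derive_plus_R; [apply is_derive_cosh|apply is_derive_const]. }
      + unfold zero; simpl.
        pose proof (cosh_sq v) as Hv.
        apply Rminus_diag_uniq.
        match goal with |- ?A - ?B = 0 => transitivity (sg * cos (m * v) * S x / (cosh v + C x) ^ 3 * (2 * (sinh v ^ 2 - cosh v ^ 2 + 1))) end.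
        * field. lra.
        * replace (sinh v ^ 2) with (cosh v ^ 2 - 1) by lra. ring.
    - intros v _. apply (continuous_plus (V := R_NormedModule)).
      + now apply (continuity_2d_pt_slice_r (fun x v => cos (m * v) * pois2 S C sg x v)), C2p2.
      + apply (continuous_scal_r (V := R_NormedModule)).
        now apply (continuity_2d_pt_slice_r (fun x v => cos (m * v) * pois S C x v)), C2p. }
  (* A decay [1 / T] is enough, so [cosh T] is compared with a linear function. [T >= 3] gives
     [cosh T >= 2], hence [cosh T + C x >= cosh T / 2]. *)
  assert (Bb : forall x, 0 <= x <= x1 -> Rabs (b x) <= M1 * (8 + 4 * m) / T).
  { intros x Hx. specialize (HM1 x Hx). specialize (HC x ltac:(lra)).
    assert (HM : 0 <= M1) by (apply Rle_trans with (2 := HM1); apply Rabs_pos).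
    pose proof (cosh_ge_linear T) as Hch. set (ch := cosh T) in *.
    assert (Hd : ch / 2 <= ch + C x) by lra.
    assert (Hch2 : 0 < ch) by lra.
    assert (Hinv : / (ch + C x) <= 2 / ch).
    { replace (2 / ch) with (/ (ch / 2)) by (field; lra). apply Rinv_le_contravar; lra. }
    assert (Hip : 0 < / (ch + C x)) by (apply Rinv_0_lt_compat; lra).
    assert (HiT : 2 / ch <= 4 / T).
    { unfold Rdiv. replace 4 with (2 * 2) by ring. rewrite Rmult_assoc. apply Rmult_le_compat_l; [lra|].
      replace (2 * / T) with (/ (T / 2)) by (field; lra). apply Rinv_le_contravar; lra. }
    unfold b, pois. fold ch. eapply Rle_trans; [apply Rabs_triang|].
    assert (B1 : Rabs (cos (m * T) * (- (S x * sinh T) / (ch + C x) ^ 2)) <= M1 * (8 / T)).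
    { rewrite Rabs_mult. replace (M1 * (8 / T)) with (1 * (M1 * (8 / T))) by ring.
      apply Rmult_le_compat; try apply Rabs_pos.
      - apply Rabs_le. destruct (COS_bound (m * T)). lra.
      - unfold Rdiv. rewrite Rabs_mult, Rabs_Ropp, Rabs_mult.
        assert (E : Rabs (/ (ch + C x) ^ 2) = / (ch + C x) * / (ch + C x)).
        { rewrite Rabs_pos_eq; [field; lra|]. left. apply Rinv_0_lt_compat, pow_lt. lra. }
        rewrite E.
        apply Rle_trans with (M1 * ch * (2 / ch * (4 / T))).
        + apply Rmult_le_compat.
          * apply Rmult_le_pos; apply Rabs_pos.
          * apply Rmult_le_pos; lra.
          * apply Rmult_le_compat; trivial; try apply Rabs_pos. apply sinh_abs_lt_cosh.
          * apply Rmult_le_compat; lra.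
        + right. field. lra. }
    assert (B2 : Rabs (m * sin (m * T) * (S x / (ch + C x))) <= M1 * (4 * m / T)).
    { rewrite !Rabs_mult, (Rabs_pos_eq m) by lra. unfold Rdiv. rewrite Rabs_mult, (Rabs_pos_eq (/ (ch + C x))) by lra.
      replace (M1 * (4 * m * / T)) with (m * 1 * (M1 * (4 * / T))) by ring.
      apply Rmult_le_compat.
      - apply Rmult_le_pos; [lra|apply Rabs_pos].
      - apply Rmult_le_pos; [apply Rabs_pos|lra].
      - apply Rmult_le_compat_l; [lra|]. apply Rabs_le. destruct (SIN_bound (m * T)). lra.
      - apply Rmult_le_compat; try lra. apply Rabs_pos. }
    replace (M1 * (8 + 4 * m) / T) with (M1 * (8 / T) + M1 * (4 * m / T)) by (field; lra). lra. }
  (* Variation of constants: [s (m (x1 - x))] solves the homogeneous equation, so [W'] contains only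
     the boundary term, while [W 0 = G1 0 * s (m x1)] and [W x1 = m * G x1]. *)
  set (W := fun x => G1 x * s (m * (x1 - x)) + m * G x * k (m * (x1 - x))).
  assert (DW : forall x, 0 <= x <= x1 -> is_derive W x (sg * b x * s (m * (x1 - x)))).
  { intros x Hx. unfold W. eapply is_derive_eq.
    - assert (Din : is_derive (fun x => m * (x1 - x)) x (- m)) by (auto_derive; trivial; ring).
      apply is_derive_plus_R; apply is_derive_mult_R.
      + apply DG1; lra.
      + apply (is_derive_comp_R s (fun x => m * (x1 - x))); [apply Ds|exact Din].
      + apply is_derive_const_mult_R, DG; lra.
      + apply (is_derive_comp_R k (fun x => m * (x1 - x))); [apply Dk|exact Din].
    - rewrite <- EG2 by lra. ring. }
  destruct (MVT_gen W 0 x1 (fun x => sg * b x * s (m * (x1 - x)))) as [xi [Hxi E]].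
  { intros x Hx. rewrite Rmin_left, Rmax_right in Hx by lra. apply DW; lra. }
  { intros x Hx. rewrite Rmin_left, Rmax_right in Hx by lra.
    apply continuity_pt_filterlim. eapply is_derive_continuous. apply DW; lra. }
  rewrite Rmin_left, Rmax_right in Hxi by lra.
  unfold W in E. rewrite Rminus_diag, Rmult_0_r, s0, k0, Rminus_0_r in E.
  assert (G00 : G 0 = 0).
  { unfold G. rewrite (RInt_ext _ (fun _ => 0)).
    - rewrite RInt_const. unfold scal; simpl; unfold mult; simpl. ring.
    - intros v _. unfold pois. rewrite S0. unfold Rdiv. rewrite Rmult_0_l. apply Rmult_0_r. }
  assert (G10 : G1 0 = RInt (fun v => cos (m * v) * / (cosh v + 1)) 0 T).
  { unfold G1. apply RInt_ext. intros v _. unfold pois1. rewrite C0. pose proof (cosh_ge_1 v).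
    match goal with |- ?A = ?B => change (@eq R A B) end. field. lra. }
  rewrite G00, G10 in E. fold (G x1).
  replace (m * G x1 - RInt (fun v => cos (m * v) * / (cosh v + 1)) 0 T * s (m * x1)) with (sg * b xi * s (m * (x1 - xi)) * (x1 - 0)) by lra.
  rewrite !Rabs_mult, (Rabs_pos_eq (x1 - 0)) by lra.
  assert (Hs1 : Rabs sg = 1).
  { pose proof (pow2_abs sg) as P. rewrite Hsg in P. pose proof (Rabs_pos sg). nra. }
  rewrite Hs1, Rminus_0_r, Rmult_1_l, Rmult_comm. apply Rmult_le_compat_l; [lra|].
  rewrite Rmult_comm. apply Rmult_le_compat; try apply Rabs_pos; auto.
Qed.

Lemma is_derive_sin_R (x : R) : is_derive sin x (cos x).
Proof. auto_derive; trivial. ring. Qed.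

Lemma is_derive_cos_R (x : R) : is_derive cos x (-1 * sin x).
Proof. auto_derive; trivial. ring. Qed.

Lemma cos_gt_m1 (x : R) : - PI < x < PI -> -1 < cos x.
Proof.
  intros Hx. replace x with (2 * (x / 2)) by field. rewrite cos_2a_cos.
  assert (0 < cos (x / 2)) by (apply cos_gt_0; lra). nra.
Qed.

Lemma sinh_incr (x y : R) : x <= y -> sinh x <= sinh y.
Proof.
  intros H. unfold sinh.
  assert (exp x <= exp y) by (destruct H as [H| ->]; [left; now apply exp_increasing|lra]).
  assert (exp (- y) <= exp (- x)) by (destruct H as [H| ->]; [left; apply exp_increasing; lra|lra]). lra.
Qed.

Lemma sinh_pos (x : R) : 0 < x -> 0 < sinh x.
Proof. intros H. unfold sinh. assert (exp (- x) < exp x) by (apply exp_increasing; lra). lra. Qed.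

(** At [x = 2 atan j] the half-angle formulas make the integrand rational in [exp v]. As [j] grows
    with [T] fixed the integral tends to [PI], so the kernel concentrates at [v = 0] with that
    mass. *)
Lemma pois_sin_cos_RInt (j T : R) : 0 < j -> 0 <= T ->
  is_RInt (pois sin cos (2 * atan j)) 0 T (2 * atan (j * ((exp T - 1) / (exp T + 1)))).
Proof.
  intros Hj HT.
  assert (Ea : sin (2 * atan j) = 2 * j / (1 + j ^ 2) /\ cos (2 * atan j) = (1 - j ^ 2) / (1 + j ^ 2)).
  { rewrite sin_2a, cos_2a_cos, sin_atan, cos_atan.
    assert (H : 0 < 1 + j²) by (unfold Rsqr; nra).
    pose proof (sqrt_sqrt (1 + j²) ltac:(lra)) as E. assert (0 < sqrt (1 + j²)) by now apply sqrt_lt_R0.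
    replace (1 + j ^ 2) with (sqrt (1 + j²) * sqrt (1 + j²)) by (rewrite E; unfold Rsqr; ring).
    split.
    - field. lra.
    - replace (1 - j ^ 2) with (2 - sqrt (1 + j²) * sqrt (1 + j²)) by (rewrite E; unfold Rsqr; ring). field. lra. }
  destruct Ea as [Es Ec].
  set (F := fun v => 2 * atan (j * ((exp v - 1) / (exp v + 1)))).
  replace (2 * atan (j * ((exp T - 1) / (exp T + 1)))) with (minus (F T) (F 0)).
  2:{ unfold minus, plus, opp; simpl. unfold F. rewrite exp_0.
      replace (j * ((1 - 1) / (1 + 1))) with 0 by field. rewrite atan_0. ring. }
  apply (is_RInt_derive (V := R_CompleteNormedModule) F).
  - intros v _. unfold F, pois. rewrite Es, Ec.
    pose proof (exp_pos v) as Hv. eapply is_derive_eq.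
    + apply is_derive_const_mult_R. apply (is_derive_comp_R atan (fun v => j * ((exp v - 1) / (exp v + 1)))).
      * apply is_derive_atan.
      * apply is_derive_const_mult_R. instantiate (1 := 2 * exp v / (exp v + 1) ^ 2).
        auto_derive; [lra|field; lra].
    + unfold cosh. rewrite exp_Ropp. unfold Rsqr.
      assert (0 < j ^ 2) by now apply pow_lt.
      assert (H1 : 0 < (exp v + 1) ^ 2 + (j * (exp v - 1)) ^ 2).
      { pose proof (pow2_ge_0 (j * (exp v - 1))). assert (0 < (exp v + 1) ^ 2) by (apply pow_lt; lra). lra. }
      field. repeat split; try lra; try nra.
  - intros v _. unfold pois. apply (ex_derive_continuous (K := R_AbsRing) (V := R_NormedModule)). auto_derive.
    repeat split; trivial.
    assert (- 1 < cos (2 * atan j)).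
    { apply cos_gt_m1. pose proof (atan_bound j). lra. }
    pose proof (cosh_ge_1 v). lra.
Qed.

(** Both sides are compared with [m^2 v^2 / 2]. The bound by [cosh v - 1] fits the uses: it is at
    most the denominator [cosh v + cos x], and for [v = ln (t / A)] it is rational in [t]. *)
Lemma one_minus_cos_le (m v : R) : Rabs (cos (m * v) - 1) <= m ^ 2 * (cosh v - 1).
Proof.
  assert (A : forall t, 0 <= t -> 1 - cos t <= t ^ 2 / 2).
  { intros t Ht.
    assert (D1 : forall t, 0 <= t -> sin t <= t).
    { intros u Hu.
      pose proof (derive_le0_decr (fun u => sin u - u) (fun u => cos u - 1) 0 u Hu) as H.
      cbv beta in H. rewrite sin_0 in H. enough (sin u - u <= 0 - 0) by lra. apply H.
      - intros x Hx. auto_derive; trivial; ring.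
      - intros x Hx. destruct (COS_bound x). lra. }
    pose proof (derive_le0_decr (fun u => 1 - cos u - u ^ 2 / 2) (fun u => sin u - u) 0 t Ht) as H.
    cbv beta in H. rewrite cos_0 in H. enough (1 - cos t - t ^ 2 / 2 <= 1 - 1 - 0 ^ 2 / 2) by lra. apply H.
    - intros x Hx. auto_derive; trivial; field.
    - intros x Hx. specialize (D1 x ltac:(lra)). lra. }
  assert (B : forall t, 0 <= t -> t ^ 2 / 2 <= cosh t - 1).
  { intros t Ht.
    assert (D1 : forall t, 0 <= t -> t <= sinh t).
    { intros u Hu.
      pose proof (derive_le0_decr (fun u => u - sinh u) (fun u => 1 - cosh u) 0 u Hu) as H.
      cbv beta in H. rewrite sinh_0 in H. enough (u - sinh u <= 0 - 0) by lra. apply H.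
      - intros x Hx. apply is_derive_minus_R; [apply is_derive_id_R|apply is_derive_sinh].
      - intros x Hx. pose proof (cosh_ge_1 x). lra. }
    pose proof (derive_le0_decr (fun u => u ^ 2 / 2 + 1 - cosh u) (fun u => u - sinh u) 0 t Ht) as H.
    cbv beta in H. rewrite cosh_0 in H. enough (t ^ 2 / 2 + 1 - cosh t <= 0 ^ 2 / 2 + 1 - 1) by lra. apply H.
    - intros x Hx. apply is_derive_minus_R; [|apply is_derive_cosh]. auto_derive; trivial; field.
    - intros x Hx. specialize (D1 x ltac:(lra)). lra. }
  assert (E1 : cos (m * v) = cos (Rabs (m * v))).
  { unfold Rabs. destruct (Rcase_abs (m * v)); trivial. now rewrite cos_neg. }
  assert (E2 : cosh v = cosh (Rabs v)).
  { unfold Rabs. destruct (Rcase_abs v); trivial. unfold cosh. rewrite Ropp_involutive. f_equal. ring. }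
  rewrite E1, E2. specialize (A (Rabs (m * v)) (Rabs_pos _)). specialize (B (Rabs v) (Rabs_pos _)).
  rewrite pow2_abs in A, B.
  rewrite Rabs_left1 by (destruct (COS_bound (Rabs (m * v))); lra).
  apply Rle_trans with (m ^ 2 * (v ^ 2 / 2)); [replace (m ^ 2 * (v ^ 2 / 2)) with ((m * v) ^ 2 / 2) by field; lra|].
  apply Rmult_le_compat_l; [apply pow2_ge_0|trivial].
Qed.

(** The [x]-derivative at 0 of the truncated Poisson integral, the same for both dual kernels: it is
    evaluated with the trigonometric one and then used with the hyperbolic one. *)
Definition sechint (m T : R) : R := RInt (fun v => cos (m * v) * / (cosh v + 1)) 0 T.

(** As [x] tends to [PI] the trigonometric kernel becomes an approximate identity of mass [PI] at
    [v = 0], where [cos (m v) = 1]. So [m G] tends to [m PI], while the dual solution predicts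
    [sechint m T * sinh (m PI)] up to [O(1 / T)]. *)
Lemma sechint_estimate (m T : R) : 0 < m -> 3 <= T ->
  Rabs (m * PI - sechint m T * sinh (m * PI)) <= PI * (sinh (m * PI) * (1 * (8 + 4 * m) / T)).
Proof.
  intros Hm HT. pose proof PI_RGT_0 as HPI.
  set (x := fun n => 2 * atan (INR (S n))).
  assert (Hx : forall n, 0 < x n < PI).
  { intros n. unfold x. pose proof (atan_bound (INR (S n))).
    assert (0 < atan (INR (S n))).
    { rewrite <- atan_0. apply atan_increasing. rewrite S_INR. pose proof (pos_INR n). lra. }
    lra. }
  assert (Linv : is_lim_seq (fun n => / INR (S n)) 0).
  { apply (is_lim_seq_incr_1 (fun n => / INR n)).
    replace (Finite 0) with (Rbar_inv p_infty) by reflexivity.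
    apply is_lim_seq_inv; [apply is_lim_seq_INR|discriminate]. }
  assert (Lat : forall k, 0 < k -> is_lim_seq (fun n => 2 * atan (INR (S n) * k)) PI).
  { intros k Hk. apply is_lim_seq_ext with (fun n => PI - 2 * atan (/ INR (S n) * / k)).
    - intros n. assert (0 < INR (S n)) by (rewrite S_INR; pose proof (pos_INR n); lra).
      rewrite <- Rinv_mult. rewrite atan_inv by now apply Rmult_lt_0_compat. field.
    - replace (Finite PI) with (Finite (PI - 2 * atan (0 * / k))) by (rewrite Rmult_0_l, atan_0; f_equal; ring).
      apply is_lim_seq_minus'; [apply is_lim_seq_const|].
      apply (is_lim_seq_scal_l _ 2 (Finite _)).
      assert (Hc : continuity_pt (fun y => atan (y * / k)) 0).
      { apply continuity_pt_filterlim. change (continuous (fun y => atan (y * / k)) 0).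
        apply (ex_derive_continuous (K := R_AbsRing) (V := R_NormedModule)). auto_derive; trivial. }
      exact (is_lim_seq_continuous _ _ 0 Hc Linv). }
  assert (Lx : is_lim_seq x PI).
  { apply is_lim_seq_ext with (fun n => 2 * atan (INR (S n) * 1)); [intros n; unfold x; now rewrite Rmult_1_r|].
    apply Lat. lra. }
  set (k := (exp T - 1) / (exp T + 1)).
  assert (Hk : 0 < k).
  { unfold k. assert (1 < exp T) by (rewrite <- exp_0; apply exp_increasing; lra). apply Rdiv_lt_0_compat; lra. }
  set (G := fun n => RInt (fun v => cos (m * v) * pois sin cos (x n) v) 0 T).
  assert (LG : is_lim_seq G PI).
  { apply is_lim_seq_ext with (fun n => 2 * atan (INR (S n) * k) + (G n - 2 * atan (INR (S n) * k))); [intros n; ring|].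
    replace (Finite PI) with (Finite (PI + 0)) by (f_equal; ring).
    apply is_lim_seq_plus'; [now apply Lat|].
    (* Replacing [cos (m v)] by 1 costs at most [m^2 T sin (x n)], because [cosh v - 1] cancels
       against the denominator; this vanishes as [x n] tends to [PI]. *)
    apply is_lim_seq_abs_0. apply is_lim_seq_le_le with (fun _ => 0) (fun n => m ^ 2 * T * sin (x n)).
    - intros n. split; [apply Rabs_pos|].
      assert (HI : 0 < INR (S n)) by (rewrite S_INR; pose proof (pos_INR n); lra).
      pose proof (pois_sin_cos_RInt (INR (S n)) T HI ltac:(lra)) as P0. fold k in P0. fold (x n) in P0.
      specialize (Hx n).
      assert (Hc : -1 < cos (x n)) by (apply cos_gt_m1; lra).
      assert (Hs : 0 < sin (x n)) by (apply sin_gt_0; lra).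
      assert (Cc : forall v, continuous (fun v => cos (m * v) * pois sin cos (x n) v) v).
      { intros v. unfold pois. apply (ex_derive_continuous (K := R_AbsRing) (V := R_NormedModule)). auto_derive.
        pose proof (cosh_ge_1 v). repeat split; trivial; lra. }
      assert (P1 : is_RInt (fun v => cos (m * v) * pois sin cos (x n) v) 0 T (G n)).
      { apply (RInt_correct (V := R_CompleteNormedModule)). apply (@ex_RInt_continuous R_CompleteNormedModule). intros v _. apply Cc. }
      pose proof (is_RInt_minus (V := R_NormedModule) _ _ _ _ _ _ P1 P0) as P2.
      assert (P3 : is_RInt (fun v => cos (m * v) * pois sin cos (x n) v - pois sin cos (x n) v) 0 T
        (G n - 2 * atan (INR (S n) * k))) by exact P2.
      rewrite <- (is_RInt_unique _ _ _ _ P3).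
      apply Rle_trans with ((T - 0) * (m ^ 2 * sin (x n))); [|right; ring].
      apply abs_RInt_le_const; [lra|now eexists; apply P3|].
      intros v Hv. unfold pois.
      pose proof (cosh_ge_1 v). pose proof (one_minus_cos_le m v) as Q.
      replace (cos (m * v) * (sin (x n) / (cosh v + cos (x n))) - sin (x n) / (cosh v + cos (x n))) with
        ((cos (m * v) - 1) * (sin (x n) / (cosh v + cos (x n)))) by ring.
      assert (Hd : 0 < cosh v + cos (x n)) by lra.
      rewrite Rabs_mult, (Rabs_pos_eq (sin (x n) / _)) by (apply Rdiv_le_0_compat; lra).
      apply Rle_trans with (m ^ 2 * (cosh v + cos (x n)) * (sin (x n) / (cosh v + cos (x n)))).
      + apply Rmult_le_compat_r; [apply Rdiv_le_0_compat; lra|]. apply Rle_trans with (1 := Q).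
        apply Rmult_le_compat_l; [apply pow2_ge_0|lra].
      + right. field. lra.
    - apply is_lim_seq_const.
    - replace (Finite 0) with (Finite (m ^ 2 * T * sin PI)) by (rewrite sin_PI; f_equal; ring).
      apply (is_lim_seq_scal_l _ _ (Finite _)).
      apply (is_lim_seq_continuous sin x PI); trivial. apply continuity_sin. }
  assert (LD : is_lim_seq (fun n => Rabs (m * G n - sechint m T * sinh (m * x n))) (Rabs (m * PI - sechint m T * sinh (m * PI)))).
  { apply (is_lim_seq_abs _ (Finite _)). apply is_lim_seq_minus'.
    - now apply (is_lim_seq_scal_l _ _ (Finite _)).
    - apply (is_lim_seq_scal_l _ _ (Finite _)).
      assert (Hc : continuity_pt (fun y => sinh (m * y)) PI).
      { apply continuity_pt_filterlim. change (continuous (fun y => sinh (m * y)) PI).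
        apply (ex_derive_continuous (K := R_AbsRing) (V := R_NormedModule)). auto_derive; trivial. }
      exact (is_lim_seq_continuous _ _ PI Hc Lx). }
  apply (is_lim_seq_le (fun n => Rabs (m * G n - sechint m T * sinh (m * x n))) (fun _ => PI * (sinh (m * PI) * (1 * (8 + 4 * m) / T))) (Finite _) (Finite _)); trivial.
  2: apply is_lim_seq_const.
  intros n. specialize (Hx n).
  assert (Hmp : 0 < sinh (m * PI)) by (apply sinh_pos, Rmult_lt_0_compat; lra).
  apply Rle_trans with (x n * (sinh (m * PI) * (1 * (8 + 4 * m) / T))).
  - apply (dual_poisson sin cos sinh cosh (-1) m T 1 (sinh (m * PI)) (- PI) PI (x n)); try lra.
    + apply is_derive_sin_R.
    + apply is_derive_cos_R.
    + intros y. pose proof (sin2_cos2 y). unfold Rsqr in *. lra.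
    + apply sin_0.
    + apply cos_0.
    + intros y. apply is_derive_sinh.
    + intros y. replace (- (-1) * sinh y) with (sinh y) by ring. apply is_derive_cosh.
    + apply sinh_0.
    + apply cosh_0.
    + apply cos_gt_m1.
    + intros y Hy. apply Rabs_le. destruct (SIN_bound y). lra.
    + intros y Hy. rewrite Rabs_pos_eq.
      * apply sinh_incr. apply Rmult_le_compat_l; lra.
      * rewrite <- sinh_0. apply sinh_incr. apply Rmult_le_pos; lra.
  - apply Rmult_le_compat_r; [|lra]. apply Rmult_le_pos; [lra|]. apply Rdiv_le_0_compat; lra.
Qed.

Lemma is_lim_seq_inv_nat (K : R) : is_lim_seq (fun n => K / INR n) 0.
Proof.
  replace (Finite 0) with (Rbar_mult K 0) by (simpl; f_equal; ring).
  apply is_lim_seq_scal_l. replace (Finite 0) with (Rbar_inv p_infty) by reflexivity.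
  apply is_lim_seq_inv; [apply is_lim_seq_INR|discriminate].
Qed.

Lemma sechint_limit (m : R) : 0 < m -> is_lim_seq (fun n => sechint m (INR n)) (PI * m / sinh (PI * m)).
Proof.
  intros Hm. pose proof PI_RGT_0.
  assert (Hs : 0 < sinh (PI * m)) by (apply sinh_pos, Rmult_lt_0_compat; lra).
  apply is_lim_seq_ext_loc with (fun n => PI * m / sinh (PI * m) - / sinh (PI * m) * (m * PI - sechint m (INR n) * sinh (m * PI))).
  { exists O. intros n _. rewrite (Rmult_comm m PI). field. lra. }
  replace (Finite (PI * m / sinh (PI * m))) with (Finite (PI * m / sinh (PI * m) - / sinh (PI * m) * 0)) by (f_equal; ring).
  apply is_lim_seq_minus'; [apply is_lim_seq_const|]. apply (is_lim_seq_scal_l _ _ (Finite _)).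
  apply is_lim_seq_abs_0. apply is_lim_seq_le_le_loc with (fun _ => 0) (fun n => PI * (sinh (m * PI) * (8 + 4 * m)) / INR n).
  - exists 3%nat. intros n Hn. split; [apply Rabs_pos|].
    apply le_INR in Hn. simpl in Hn. replace (1 + 1 + 1) with 3 in Hn by ring.
    eapply Rle_trans; [apply sechint_estimate; trivial|]. right. field. lra.
  - apply is_lim_seq_const.
  - apply is_lim_seq_inv_nat.
Qed.

(** In the hyperbolic case [m] times the integral differs from [sechint * sin (m u)] by [O(1 / T)],
    and the limit of [sechint] is known from the dual kernel. *)
Lemma poisson_limit_pos (m u : R) : 0 < m -> 0 < u ->
  is_lim_seq (fun n => RInt (fun v => cos (m * v) * (sinh u / (cosh v + cosh u))) 0 (INR n)) (PI * sin (m * u) / sinh (PI * m)).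
Proof.
  intros Hm Hu. pose proof PI_RGT_0.
  assert (Hs : 0 < sinh (PI * m)) by (apply sinh_pos, Rmult_lt_0_compat; lra).
  set (G := fun n => RInt (fun v => cos (m * v) * (sinh u / (cosh v + cosh u))) 0 (INR n)).
  apply is_lim_seq_ext with (fun n => / m * ((m * G n - sechint m (INR n) * sin (m * u)) + sechint m (INR n) * sin (m * u))).
  { intros n. unfold G. field. lra. }
  replace (Finite (PI * sin (m * u) / sinh (PI * m))) with (Finite (/ m * (0 + PI * m / sinh (PI * m) * sin (m * u)))) by (f_equal; field; lra).
  apply (is_lim_seq_scal_l _ _ (Finite _)). apply is_lim_seq_plus'.
  - apply is_lim_seq_abs_0. apply is_lim_seq_le_le_loc with (fun _ => 0) (fun n => u * (1 * (sinh u * (8 + 4 * m))) / INR n).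
    + exists 3%nat. intros n Hn. split; [apply Rabs_pos|].
      apply le_INR in Hn. simpl in Hn. replace (1 + 1 + 1) with 3 in Hn by ring.
      apply Rle_trans with (u * (1 * (sinh u * (8 + 4 * m) / INR n))); [|right; field; lra].
      apply (dual_poisson sinh cosh sin cos 1 m (INR n) (sinh u) 1 (-1) (u + 1) u); try lra.
      * apply is_derive_sinh.
      * intros y. rewrite Rmult_1_l. apply is_derive_cosh.
      * intros y. rewrite Rmult_1_l. apply cosh_sq.
      * apply sinh_0.
      * apply cosh_0.
      * apply is_derive_sin_R.
      * intros y. replace (-1 * sin y) with (- (1) * sin y) by ring. apply is_derive_cos_R.
      * apply sin_0.
      * apply cos_0.
      * intros y Hy. pose proof (cosh_ge_1 y). lra.
      * intros y Hy. rewrite Rabs_pos_eq; [apply sinh_incr; lra|]. rewrite <- sinh_0. apply sinh_incr; lra.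
      * intros y Hy. apply Rabs_le. destruct (SIN_bound (m * (u - y))). lra.
    + apply is_lim_seq_const.
    + apply is_lim_seq_inv_nat.
  - apply (is_lim_seq_scal_r _ _ (Finite _)). now apply sechint_limit.
Qed.

Lemma cosh_pos (v : R) : 0 < cosh v.
Proof. pose proof (cosh_ge_1 v). lra. Qed.

Lemma is_derive_cosh_Rpower (s v : R) : is_derive (fun v => Rpower (cosh v) s) v (s * sinh v / cosh v * Rpower (cosh v) s).
Proof.
  pose proof (cosh_pos v). eapply is_derive_eq.
  - apply (is_derive_comp_R (fun x => Rpower x s) cosh); [now apply is_derive_Rpower|apply is_derive_cosh].
  - unfold Rdiv. ring.
Qed.

(** * Cosine representation of the solutions *)

(** For [s = -2a] this is [vker] at [r = cosh v], taken as a function of [z = x^2], the variable of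
    the differential equation. *)
Definition wker (s : R) (f : R -> R) (z v : R) : R := Rpower (cosh v) s * f (z / cosh v ^ 2).

Definition wker_v (a : R) (e e1 : R -> R) (z v : R) : R :=
  Rpower (cosh v) (-2 * a) * (-2 * (sinh v / cosh v) * (a * e (z / cosh v ^ 2) + z / cosh v ^ 2 * e1 (z / cosh v ^ 2))).

Lemma wker_arg (z v : R) : - (1/2) < z -> - (1/2) < z / cosh v ^ 2.
Proof.
  intros Hz. pose proof (cosh_ge_1 v). assert (1 <= cosh v ^ 2) by nra.
  apply Rmult_lt_reg_r with (cosh v ^ 2); [lra|]. unfold Rdiv. rewrite (Rmult_assoc z), Rinv_l by lra. nra.
Qed.

Lemma is_derive_wker_z (s z v l : R) (f : R -> R) : is_derive f (z / cosh v ^ 2) l ->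
  is_derive (fun z => wker s f z v) z (Rpower (cosh v) s * (/ cosh v ^ 2 * l)).
Proof.
  intros H. pose proof (cosh_pos v). unfold wker. apply is_derive_const_mult_R.
  apply (is_derive_comp_R f (fun z => z / cosh v ^ 2)); trivial.
  auto_derive; trivial. field. lra.
Qed.

Lemma is_derive_ratio_v (z v : R) : is_derive (fun v => z / cosh v ^ 2) v (-2 * (sinh v / cosh v) * (z / cosh v ^ 2)).
Proof.
  pose proof (cosh_pos v). eapply is_derive_eq.
  - apply is_derive_div; [apply is_derive_const|apply (is_derive_pow cosh 2), is_derive_cosh|apply pow_nonzero; lra].
  - unfold zero; simpl. field. lra.
Qed.

Lemma is_derive_wker_v (a z v l : R) (e : R -> R) : is_derive e (z / cosh v ^ 2) l ->
  is_derive (wker (-2 * a) e z) v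
    (Rpower (cosh v) (-2 * a) * (-2 * (sinh v / cosh v) * (a * e (z / cosh v ^ 2) + z / cosh v ^ 2 * l))).
Proof.
  intros H. pose proof (cosh_pos v). unfold wker. eapply is_derive_eq.
  - apply is_derive_mult_R; [apply is_derive_cosh_Rpower|].
    apply (is_derive_comp_R e (fun v => z / cosh v ^ 2)); [exact H|apply is_derive_ratio_v].
  - cbv beta. field. lra.
Qed.

(* The hypergeometric operator with parameters [a + ib], [a - ib] acts on
   [cosh^(-2a) v * e (z / cosh^2 v)] as [(d^2/dv^2 + 4 b^2) / 4]. *)
Lemma is_derive_wker_boundary (a b c z v : R) (e e1 e2 : R -> R) : - (1/2) < z ->
  hyp_fun c (2 * a + 1/2) ((a + 1/2) * a) e e1 e2 ->
  is_derive (fun v => / 4 * (cos (2 * b * v) * wker_v a e e1 z v + 2 * b * sin (2 * b * v) * wker (-2 * a) e z v)) v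
   (cos (2 * b * v) * (z * (1 + z) * (Rpower (cosh v) (-2 * a) * (/ cosh v ^ 2 * (/ cosh v ^ 2 * e2 (z / cosh v ^ 2))))
      + (c + (2 * a + 1) * z) * (Rpower (cosh v) (-2 * a) * (/ cosh v ^ 2 * e1 (z / cosh v ^ 2)))
      + (a ^ 2 + b ^ 2) * wker (-2 * a) e z v)).
Proof.
  intros Hz [E1 E2 _ EE]. pose proof (wker_arg z v Hz) as Hs.
  specialize (E1 _ Hs). specialize (E2 _ Hs). specialize (EE _ Hs).
  pose proof (cosh_pos v) as Hq. pose proof (cosh_sq v) as Hcs.
  eapply is_derive_eq.
  - apply is_derive_const_mult_R, is_derive_plus_R; apply is_derive_mult_R.
    + instantiate (1 := - (2 * b) * sin (2 * b * v)). auto_derive; trivial. ring.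
    + unfold wker_v. apply is_derive_mult_R; [apply is_derive_cosh_Rpower|]. apply is_derive_mult_R.
      * apply is_derive_const_mult_R. apply is_derive_div; [apply is_derive_sinh|apply is_derive_cosh|lra].
      * apply is_derive_plus_R.
        { apply is_derive_const_mult_R. apply (is_derive_comp_R e (fun v => z / cosh v ^ 2)); [exact E1|apply is_derive_ratio_v]. }
        { apply is_derive_mult_R; [apply is_derive_ratio_v|].
          apply (is_derive_comp_R e1 (fun v => z / cosh v ^ 2)); [exact E2|apply is_derive_ratio_v]. }
    + instantiate (1 := 2 * b * (2 * b * cos (2 * b * v))). auto_derive; trivial. ring.
    + apply is_derive_wker_v. exact E1.
  - cbv beta. unfold wker, wker_v.
    set (q := cosh v) in *. set (sh := sinh v) in *. set (s := z / q ^ 2) in *.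
    set (CC := cos (2 * b * v)). set (SS := sin (2 * b * v)). set (P := Rpower q (-2 * a)).
    revert EE. generalize (e s) (e1 s) (e2 s). intros u u1 u2 EE.
    assert (Hzs : z = s * q ^ 2) by (unfold s; field; lra).
    apply Rminus_diag_uniq.
    (* The difference of the two sides is a multiple of the equation of [e] plus a multiple of
       [cosh^2 - sinh^2 - 1]. *)
    match goal with |- ?A - ?B = 0 => transitivity (- (CC * P * / q ^ 2 * (s * (1 + s) * u2 + (c + (2 * a + 1/2 + 1) * s) * u1 + (a + 1/2) * a * u))
       + CC * P * / q ^ 2 * (q ^ 2 - sh ^ 2 - 1) * (- (s ^ 2 * u2 + (2 * a + 3/2) * s * u1 + (a ^ 2 + a / 2) * u))) end.
    + rewrite Hzs. field. lra.
    + rewrite EE, Hcs. ring.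
Qed.

Definition RT (a c b T z : R) : R := RInt (fun v => cos (2 * b * v) * wker (-2 * a) (eta a c) z v) 0 T.

Lemma eta_0 (a c : R) : eta a c 0 = 1.
Proof. apply pfaff_0. Qed.

Lemma continuity_2d_wker (s z v : R) (f : R -> R) : continuous f (z / cosh v ^ 2) ->
  continuity_2d_pt (fun z v => wker s f z v) z v.
Proof.
  intros Hf. pose proof (cosh_pos v). unfold wker. apply continuity_2d_pt_mult.
  - apply (continuity_2d_pt_snd (fun v => Rpower (cosh v) s)). eapply is_derive_continuous, is_derive_cosh_Rpower.
  - apply (continuity_2d_pt_comp1 f (fun z v => z / cosh v ^ 2)); trivial.
    apply continuity_2d_pt_mult; [apply continuity_2d_pt_id1|]. apply continuity_2d_pt_inv; [|apply pow_nonzero; lra].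
    apply (continuity_2d_pt_snd (fun v => cosh v ^ 2)).
    apply (ex_derive_continuous (K := R_AbsRing) (V := R_NormedModule)). auto_derive; trivial.
Qed.

Lemma continuous_cos_mult (m v : R) : continuous (fun v => cos (m * v)) v.
Proof. apply (ex_derive_continuous (K := R_AbsRing) (V := R_NormedModule)). auto_derive; trivial. Qed.

Lemma wker_bound (a c K z v : R) : 0 < a -> 0 <= z -> 0 <= K ->
  (forall z, 0 <= z -> Rabs (eta a c z) <= K * Rpower (1 + z) (- a) /\ Rabs (eta1 a c z) <= K * Rpower (1 + z) (- a - 1)) ->
  Rabs (wker (-2 * a) (eta a c) z v) <= K * Rpower (cosh v ^ 2 + z) (- a) /\
  Rabs (wker_v a (eta a c) (eta1 a c) z v) <= K * (2 * a + 2) * Rpower (cosh v) (-2 * a).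
Proof.
  intros Ha Hz HK HB. pose proof (cosh_ge_1 v) as Hq. set (q := cosh v) in *.
  assert (Hs : 0 <= z / q ^ 2) by (apply Rdiv_le_0_compat; [lra|apply pow_lt; lra]).
  destruct (HB _ Hs) as [B0 B1].
  assert (HP : 0 < Rpower q (-2 * a)) by apply exp_pos.
  unfold wker, wker_v. fold q. set (s := z / q ^ 2) in *.
  assert (HR0 : Rpower (1 + s) (- a) <= 1).
  { apply Rle_trans with (Rpower (1 + s) 0); [apply Rpower_le_base1; lra|rewrite Rpower_O; lra]. }
  assert (HR0' : 0 < Rpower (1 + s) (- a)) by apply exp_pos.
  split.
  - rewrite Rabs_mult, (Rabs_pos_eq (Rpower q _)) by lra.
    apply Rle_trans with (Rpower q (-2 * a) * (K * Rpower (1 + s) (- a))); [apply Rmult_le_compat_l; lra|].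
    right. replace (Rpower (q ^ 2 + z) (- a)) with (Rpower q (-2 * a) * Rpower (1 + s) (- a)); [ring|].
    replace (Rpower q (-2 * a)) with (Rpower (q ^ 2) (- a)).
    + rewrite Rpower_mult_distr by (try apply pow_lt; lra). f_equal. unfold s. field. lra.
    + rewrite <- (Rpower_pow 2) by lra. rewrite Rpower_mult. f_equal. simpl. ring.
  - rewrite Rabs_mult, (Rabs_pos_eq (Rpower q _)) by lra.
    rewrite (Rmult_comm _ (Rpower q (-2 * a))). apply Rmult_le_compat_l; [lra|].
    rewrite Rabs_mult, Rabs_mult. rewrite (Rabs_left (-2)) by lra.
    assert (Hth : Rabs (sinh v / q) <= 1).
    { unfold Rdiv. rewrite Rabs_mult, (Rabs_pos_eq (/ q)) by (left; apply Rinv_0_lt_compat; lra).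
      apply Rmult_le_reg_r with q; [lra|]. rewrite Rmult_assoc, Rinv_l, Rmult_1_r, Rmult_1_l by lra.
      apply sinh_abs_lt_cosh. }
    assert (HR1 : s * Rpower (1 + s) (- a - 1) <= 1).
    { replace (- a - 1) with (- a + - (1)) by ring. rewrite Rpower_plus, (Rpower_Ropp _ 1), Rpower_1 by lra.
      assert (s * / (1 + s) <= 1).
      { apply Rmult_le_reg_r with (1 + s); [lra|]. rewrite Rmult_assoc, Rinv_l; lra. }
      assert (0 <= s * / (1 + s)) by (apply Rmult_le_pos; [trivial|left; apply Rinv_0_lt_compat; lra]). nra. }
    assert (HI : Rabs (a * eta a c s + s * eta1 a c s) <= K * (a + 1)).
    { eapply Rle_trans; [apply Rabs_triang|]. rewrite !Rabs_mult, (Rabs_pos_eq a), (Rabs_pos_eq s) by lra.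
      assert (a * Rabs (eta a c s) <= a * K).
      { apply Rmult_le_compat_l; [lra|]. apply Rle_trans with (1 := B0). nra. }
      assert (s * Rabs (eta1 a c s) <= K * (s * Rpower (1 + s) (- a - 1))).
      { apply Rle_trans with (s * (K * Rpower (1 + s) (- a - 1))); [apply Rmult_le_compat_l; lra|right; ring]. }
      assert (K * (s * Rpower (1 + s) (- a - 1)) <= K * 1) by (apply Rmult_le_compat_l; lra). lra. }
    pose proof (Rabs_pos (sinh v / q)). pose proof (Rabs_pos (a * eta a c s + s * eta1 a c s)).
    replace (K * (2 * a + 2)) with (- -2 * 1 * (K * (a + 1))) by ring.
    apply Rmult_le_compat; trivial; nra.
Qed.

(** [RT z - RT 0 * f z] vanishes at [z = 0] and satisfies the equation up to the boundary term at
    [v = T], of size [cosh(T)^(-2a)] uniformly in [z]. The energy inequality with residual bounds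
    it. *)
Lemma RT_estimate (a c b : R) (K : R) (T z : R) (f f1 f2 : R -> R) :
  0 < a < c -> 1/2 < c -> 0 <= b -> 0 <= z -> 0 <= T -> 0 <= K ->
  (forall z, 0 <= z -> Rabs (eta a c z) <= K * Rpower (1 + z) (- a) /\ Rabs (eta1 a c z) <= K * Rpower (1 + z) (- a - 1)) ->
  hyp_solution c (2 * a) (a ^ 2 + b ^ 2) f f1 f2 -> f 0 = 1 ->
  (a ^ 2 + b ^ 2) * (RT a c b T z - RT a c b T 0 * f z) ^ 2 <=
    (K * (a + 1 + b) * Rpower (cosh T) (-2 * a)) ^ 2 * z / (2 * c - 1).
Proof.
  intros Ha Hc Hb Hz HT HK HB Hf Hf0.
  destruct (eta_hyp_fun a c ltac:(lra)) as [e2 He].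
  set (w0 := fun z v => cos (2 * b * v) * wker (-2 * a) (eta a c) z v).
  set (w1 := fun z v => cos (2 * b * v) * (Rpower (cosh v) (-2 * a) * (/ cosh v ^ 2 * eta1 a c (z / cosh v ^ 2)))).
  set (w2 := fun z v => cos (2 * b * v) * (Rpower (cosh v) (-2 * a) * (/ cosh v ^ 2 * (/ cosh v ^ 2 * e2 (z / cosh v ^ 2))))).
  assert (C0 : forall z v, -(1/2) < z -> continuity_2d_pt w0 z v).
  { intros y v Hy. apply continuity_2d_pt_mult.
    - apply (continuity_2d_pt_snd (fun v => cos (2 * b * v))), continuous_cos_mult.
    - apply continuity_2d_wker. eapply is_derive_continuous. apply (hf_d1 _ _ _ _ _ _ He). now apply wker_arg. }
  assert (Cq : forall v, continuous (fun v => / cosh v ^ 2) v).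
  { intros v. pose proof (cosh_pos v). apply (ex_derive_continuous (K := R_AbsRing) (V := R_NormedModule)). auto_derive.
    apply Rmult_integral_contrapositive_currified; lra. }
  assert (C1 : forall z v, -(1/2) < z -> continuity_2d_pt w1 z v).
  { intros y v Hy. apply continuity_2d_pt_ext with (fun z v => cos (2 * b * v) * (/ cosh v ^ 2 * wker (-2 * a) (eta1 a c) z v)).
    { intros y' v'. unfold w1, wker. ring. }
    apply continuity_2d_pt_mult; [|apply continuity_2d_pt_mult].
    - apply (continuity_2d_pt_snd (fun v => cos (2 * b * v))), continuous_cos_mult.
    - apply (continuity_2d_pt_snd (fun v => / cosh v ^ 2)), Cq.
    - apply continuity_2d_wker. eapply is_derive_continuous. apply (hf_d2 _ _ _ _ _ _ He). now apply wker_arg. }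
  assert (C2 : forall z v, -(1/2) < z -> continuity_2d_pt w2 z v).
  { intros y v Hy. apply continuity_2d_pt_ext with (fun z v => cos (2 * b * v) * (/ cosh v ^ 2 * (/ cosh v ^ 2 * wker (-2 * a) e2 z v))).
    { intros y' v'. unfold w2, wker. ring. }
    apply continuity_2d_pt_mult; [|apply continuity_2d_pt_mult; [|apply continuity_2d_pt_mult]].
    - apply (continuity_2d_pt_snd (fun v => cos (2 * b * v))), continuous_cos_mult.
    - apply (continuity_2d_pt_snd (fun v => / cosh v ^ 2)), Cq.
    - apply (continuity_2d_pt_snd (fun v => / cosh v ^ 2)), Cq.
    - apply continuity_2d_wker. apply (hf_c2 _ _ _ _ _ _ He). now apply wker_arg. }
  assert (D0 : forall z v, -(1/2) < z -> is_derive (fun z => w0 z v) z (w1 z v)).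
  { intros y v Hy. apply is_derive_const_mult_R, is_derive_wker_z. apply (hf_d1 _ _ _ _ _ _ He). now apply wker_arg. }
  assert (D1 : forall z v, -(1/2) < z -> is_derive (fun z => w1 z v) z (w2 z v)).
  { intros y v Hy. unfold w1, w2. apply is_derive_const_mult_R, is_derive_const_mult_R, is_derive_const_mult_R.
    apply (is_derive_comp_R (eta1 a c) (fun z => z / cosh v ^ 2)).
    - apply (hf_d2 _ _ _ _ _ _ He). now apply wker_arg.
    - pose proof (cosh_pos v). auto_derive; trivial. field. lra. }
  set (R0 := (fun z => RInt (w0 z) 0 T) : R -> R).
  set (R1 := (fun z => RInt (w1 z) 0 T) : R -> R).
  set (R2 := (fun z => RInt (w2 z) 0 T) : R -> R).
  assert (DR0 : forall z, 0 <= z -> is_derive R0 z (R1 z)).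
  { intros y Hy. apply (is_derive_RInt_under w0 w1 0 T (-(1/2)) (y + 1) (-1) (T + 1)); try lra; intros u v Hu Hv.
    - now apply D0. - now apply C1. - now apply continuity_2d_pt_slice_r, C0. }
  assert (DR1 : forall z, 0 <= z -> is_derive R1 z (R2 z)).
  { intros y Hy. apply (is_derive_RInt_under w1 w2 0 T (-(1/2)) (y + 1) (-1) (T + 1)); try lra; intros u v Hu Hv.
    - now apply D1. - now apply C2. - now apply continuity_2d_pt_slice_r, C1. }
  (* Antiderivative in [v] of the hypergeometric operator applied to the integrand; it vanishes at
     [v = 0] through [sinh 0] and [sin 0]. *)
  set (bd := fun z v => / 4 * (cos (2 * b * v) * wker_v a (eta a c) (eta1 a c) z v + 2 * b * sin (2 * b * v) * wker (-2 * a) (eta a c) z v)).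
  assert (ER : forall z, 0 <= z -> z * (1 + z) * R2 z + (c + (2 * a + 1) * z) * R1 z + (a ^ 2 + b ^ 2) * R0 z = bd z T).
  { intros y Hy. assert (Ex : forall w, (forall z v, -(1/2) < z -> continuity_2d_pt w z v) -> is_RInt (w y) 0 T (RInt (w y) 0 T)).
    { intros w Hw. apply (RInt_correct (V := R_CompleteNormedModule)). apply (@ex_RInt_continuous R_CompleteNormedModule).
      intros v _. apply continuity_2d_pt_slice_r, Hw. lra. }
    pose proof (is_RInt_plus (V := R_NormedModule) _ _ _ _ _ _
      (is_RInt_plus (V := R_NormedModule) _ _ _ _ _ _
        (is_RInt_scal (V := R_NormedModule) _ _ _ (y * (1 + y)) _ (Ex w2 C2))
        (is_RInt_scal (V := R_NormedModule) _ _ _ (c + (2 * a + 1) * y) _ (Ex w1 C1)))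
      (is_RInt_scal (V := R_NormedModule) _ _ _ (a ^ 2 + b ^ 2) _ (Ex w0 C0))) as L.
    assert (L' : is_RInt (fun v => y * (1 + y) * w2 y v + (c + (2 * a + 1) * y) * w1 y v + (a ^ 2 + b ^ 2) * w0 y v) 0 T
      (y * (1 + y) * R2 y + (c + (2 * a + 1) * y) * R1 y + (a ^ 2 + b ^ 2) * R0 y)) by exact L.
    rewrite <- (is_RInt_unique _ _ _ _ L'). apply is_RInt_unique.
    replace (bd y T) with (minus (bd y T) (bd y 0)).
    2:{ unfold minus, plus, opp; simpl. unfold bd, wker_v. rewrite sinh_0, !Rmult_0_r, sin_0. unfold Rdiv. ring. }
    apply (is_RInt_derive (V := R_CompleteNormedModule) (bd y)).
    - intros v _. eapply is_derive_eq.
      + apply (is_derive_wker_boundary a b c y v (eta a c) (eta1 a c) e2); [lra|exact He].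
      + unfold w0, w1, w2. ring.
    - intros v _. apply (continuous_plus (V := R_NormedModule)); [apply (continuous_plus (V := R_NormedModule))|];
        apply (continuous_scal_r (V := R_NormedModule)); apply continuity_2d_pt_slice_r; [apply C2|apply C1|apply C0]; lra. }
  set (eps := K * (a + 1 + b) * Rpower (cosh T) (-2 * a)).
  assert (Beps : forall z, 0 <= z -> Rabs (bd z T) <= eps).
  { intros y Hy. destruct (wker_bound a c K y T ltac:(lra) Hy HK HB) as [B0 B1].
    assert (HP : 0 < Rpower (cosh T) (-2 * a)) by apply exp_pos.
    assert (B0' : Rabs (wker (-2 * a) (eta a c) y T) <= K * Rpower (cosh T) (-2 * a)).
    { apply Rle_trans with (1 := B0). apply Rmult_le_compat_l; trivial.
      pose proof (cosh_ge_1 T).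
      replace (Rpower (cosh T) (-2 * a)) with (Rpower (cosh T ^ 2) (- a)).
      - rewrite !Rpower_Ropp. apply Rinv_le_contravar; [apply exp_pos|]. apply Rle_Rpower_l; [lra|]. split; [apply pow_lt; lra|lra].
      - rewrite <- (Rpower_pow 2) by lra. rewrite Rpower_mult. f_equal. simpl. ring. }
    unfold bd, eps. rewrite Rabs_mult, (Rabs_pos_eq (/ 4)) by lra.
    assert (S1 : Rabs (cos (2 * b * T) * wker_v a (eta a c) (eta1 a c) y T) <= K * (2 * a + 2) * Rpower (cosh T) (-2 * a)).
    { rewrite Rabs_mult. rewrite <- (Rmult_1_l (K * _ * _)). apply Rmult_le_compat; trivial; try apply Rabs_pos.
      apply Rabs_le. destruct (COS_bound (2 * b * T)). lra. }
    assert (S2 : Rabs (2 * b * sin (2 * b * T) * wker (-2 * a) (eta a c) y T) <= 2 * b * (K * Rpower (cosh T) (-2 * a))).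
    { rewrite !Rabs_mult, (Rabs_pos_eq 2), (Rabs_pos_eq b) by lra.
      apply Rmult_le_compat; trivial; try apply Rabs_pos.
      - apply Rmult_le_pos; [lra|apply Rabs_pos].
      - apply Rle_trans with (2 * b * 1); [|lra]. apply Rmult_le_compat_l; [lra|].
        apply Rabs_le. destruct (SIN_bound (2 * b * T)). lra. }
    assert (S3 : Rabs (cos (2 * b * T) * wker_v a (eta a c) (eta1 a c) y T + 2 * b * sin (2 * b * T) * wker (-2 * a) (eta a c) y T)
       <= K * (2 * a + 2) * Rpower (cosh T) (-2 * a) + 2 * b * (K * Rpower (cosh T) (-2 * a))).
    { eapply Rle_trans; [apply Rabs_triang|]. lra. }
    assert (0 <= K * Rpower (cosh T) (-2 * a)) by (apply Rmult_le_pos; lra). nra. }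
  pose proof (hyp_energy c (2 * a) (a ^ 2 + b ^ 2) eps z
    (fun t => R0 t - R0 0 * f t) (fun t => R1 t - R0 0 * f1 t) (fun t => R2 t - R0 0 * f2 t) Hc ltac:(lra) Hz) as En.
  cbv beta in En. rewrite Hf0 in En.
  replace (R0 0 - R0 0 * 1) with 0 in En by ring. replace ((a ^ 2 + b ^ 2) * 0 ^ 2) with 0 in En by ring.
  rewrite Rplus_0_l in En. fold eps.
  change (RT a c b T z) with (R0 z). change (RT a c b T 0) with (R0 0).
  eapply Rle_trans; [|apply En].
  - assert (0 <= z * (1 + z) * (R1 z - R0 0 * f1 z) ^ 2) by (apply Rmult_sqr_ge_0; apply Rmult_le_pos; lra). lra.
  - intros t Ht. apply is_derive_minus_R; [apply DR0; lra|]. apply is_derive_const_mult_R. apply (hyp_d1 _ _ _ _ _ _ Hf); lra.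
  - intros t Ht. apply is_derive_minus_R; [apply DR1; lra|]. apply is_derive_const_mult_R. apply (hyp_d2 _ _ _ _ _ _ Hf); lra.
  - intros t Ht. pose proof (hyp_eq _ _ _ _ _ _ Hf t ltac:(lra)) as Ef. pose proof (ER t ltac:(lra)) as Er.
    replace (t * (1 + t) * (R2 t - R0 0 * f2 t) + (c + (2 * a + 1) * t) * (R1 t - R0 0 * f1 t) + (a ^ 2 + b ^ 2) * (R0 t - R0 0 * f t))
      with (bd t T - R0 0 * (t * (1 + t) * f2 t + (c + (2 * a + 1) * t) * f1 t + (a ^ 2 + b ^ 2) * f t)) by (rewrite <- Er; ring).
    rewrite Ef, Rmult_0_r, Rminus_0_r. apply Beps. lra.
Qed.

(** From [cosh v >= exp v / 2]. *)
Lemma cosh_Rpower_le_exp (e v : R) : 0 <= e -> Rpower (cosh v) (-2 * e) <= Rpower 2 (2 * e) * exp (-2 * e * v).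
Proof.
  intros He. unfold Rpower. rewrite <- exp_plus.
  assert (L : v - ln 2 <= ln (cosh v)).
  { rewrite <- (ln_exp (v - ln 2)). apply ln_le; [apply exp_pos|].
    unfold Rminus. rewrite exp_plus, exp_Ropp, exp_ln by lra. unfold cosh. pose proof (exp_pos (- v)). lra. }
  assert (E : -2 * e * ln (cosh v) <= 2 * e * ln 2 + -2 * e * v) by nra.
  destruct E as [E|E]; [left; now apply exp_increasing|rewrite E; lra].
Qed.

Lemma exp_decay_RInt (e T T' : R) : 0 < e -> T <= T' ->
  is_RInt (fun v => exp (-2 * e * v)) T T' ((exp (-2 * e * T) - exp (-2 * e * T')) / (2 * e)).
Proof.
  intros He HT.
  replace ((exp (-2 * e * T) - exp (-2 * e * T')) / (2 * e)) with (minus ((fun v => - exp (-2 * e * v) / (2 * e)) T') ((fun v => - exp (-2 * e * v) / (2 * e)) T)).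
  2:{ unfold minus, plus, opp; simpl. field. lra. }
  apply (is_RInt_derive (V := R_CompleteNormedModule) (fun v => - exp (-2 * e * v) / (2 * e))).
  - intros v _. auto_derive; trivial. field. lra.
  - intros v _. apply (ex_derive_continuous (K := R_AbsRing) (V := R_NormedModule)). auto_derive; trivial.
Qed.

Lemma cosh_tail (f : R -> R) (M e T T' : R) : 0 < e -> 0 <= M -> T <= T' ->
  (forall v, continuous f v) -> (forall v, Rabs (f v) <= M * Rpower (cosh v) (-2 * e)) ->
  Rabs (RInt f 0 T' - RInt f 0 T) <= M * (Rpower 2 (2 * e) / (2 * e)) * exp (-2 * e * T).
Proof.
  intros He HM HT Hf HB.
  assert (Ex : forall u v, ex_RInt f u v) by (intros u v; apply (@ex_RInt_continuous R_CompleteNormedModule); intros; apply Hf).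
  assert (E : RInt f 0 T' - RInt f 0 T = RInt f T T').
  { pose proof (RInt_Chasles (V := R_CompleteNormedModule) f 0 T T' (Ex _ _) (Ex _ _)) as C. unfold plus in C; simpl in C. lra. }
  rewrite E.
  assert (L : is_RInt (fun v => M * Rpower 2 (2 * e) * exp (-2 * e * v)) T T' (M * Rpower 2 (2 * e) * ((exp (-2 * e * T) - exp (-2 * e * T')) / (2 * e)))).
  { apply (is_RInt_scal (V := R_NormedModule)). now apply exp_decay_RInt. }
  apply Rle_trans with (M * Rpower 2 (2 * e) * ((exp (-2 * e * T) - exp (-2 * e * T')) / (2 * e))).
  - apply (norm_RInt_le (V := R_NormedModule) f (fun v => M * Rpower 2 (2 * e) * exp (-2 * e * v)) T T'); trivial.
    + intros v Hv. apply Rle_trans with (1 := HB v). rewrite Rmult_assoc. apply Rmult_le_compat_l; trivial.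
      apply cosh_Rpower_le_exp; lra.
    + apply (RInt_correct (V := R_CompleteNormedModule)), Ex.
  - assert (0 < exp (-2 * e * T')) by apply exp_pos. assert (0 < Rpower 2 (2 * e)) by apply exp_pos.
    replace (M * (Rpower 2 (2 * e) / (2 * e)) * exp (-2 * e * T)) with (M * Rpower 2 (2 * e) * (exp (-2 * e * T) / (2 * e))) by (field; lra).
    apply Rmult_le_compat_l; [apply Rmult_le_pos; lra|]. unfold Rdiv. apply Rmult_le_compat_r; [left; apply Rinv_0_lt_compat; lra|lra].
Qed.

Lemma exp_decay_lim (e : R) : 0 < e -> is_lim_seq (fun n => exp (-2 * e * INR n)) 0.
Proof.
  intros He. apply is_lim_seq_le_le_loc with (fun _ => 0) (fun n => / (2 * e) / INR n).
  - exists 1%nat. intros n Hn. apply le_INR in Hn. simpl in Hn. split; [left; apply exp_pos|].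
    replace (-2 * e * INR n) with (- (2 * e * INR n)) by ring. rewrite exp_Ropp.
    unfold Rdiv. rewrite <- Rinv_mult.
    assert (0 < 2 * e * INR n) by (apply Rmult_lt_0_compat; lra).
    apply Rinv_le_contravar; trivial. pose proof (exp_ineq1_le (2 * e * INR n)). lra.
  - apply is_lim_seq_const.
  - apply is_lim_seq_inv_nat.
Qed.

Lemma cosh_tail_ex_lim (f : R -> R) (M e : R) : 0 < e -> 0 <= M ->
  (forall v, continuous f v) -> (forall v, Rabs (f v) <= M * Rpower (cosh v) (-2 * e)) ->
  exists l : R, is_lim_seq (fun n => RInt f 0 (INR n)) l.
Proof.
  intros He HM Hf HB. apply ex_lim_seq_cauchy_corr. intros eps.
  assert (L : is_lim_seq (fun n => M * (Rpower 2 (2 * e) / (2 * e)) * exp (-2 * e * INR n)) 0).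
  { replace (Finite 0) with (Rbar_mult (M * (Rpower 2 (2 * e) / (2 * e))) 0) by (simpl; f_equal; ring).
    apply is_lim_seq_scal_l. now apply exp_decay_lim. }
  apply is_lim_seq_spec in L. destruct (L eps) as [N HN]. exists N.
  assert (G : forall n m, (N <= n)%nat -> (n <= m)%nat -> Rabs (RInt f 0 (INR m) - RInt f 0 (INR n)) < eps).
  { intros n m Hn Hm. apply le_INR in Hm. eapply Rle_lt_trans; [apply (cosh_tail f M e); trivial|].
    specialize (HN n Hn). rewrite Rminus_0_r in HN. apply Rle_lt_trans with (2 := HN). apply Rle_abs. }
  intros n m Hn Hm. destruct (Nat.le_ge_cases n m) as [H|H].
  - rewrite Rabs_minus_sym. now apply G.
  - now apply G.
Qed.

Lemma cosh_tail_lim (f : R -> R) (M e l T : R) : 0 < e -> 0 <= M ->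
  (forall v, continuous f v) -> (forall v, Rabs (f v) <= M * Rpower (cosh v) (-2 * e)) ->
  is_lim_seq (fun n => RInt f 0 (INR n)) l -> Rabs (l - RInt f 0 T) <= M * (Rpower 2 (2 * e) / (2 * e)) * exp (-2 * e * T).
Proof.
  intros He HM Hf HB Hl.
  assert (L : is_lim_seq (fun n => Rabs (RInt f 0 (INR n) - RInt f 0 T)) (Rabs (l - RInt f 0 T))).
  { apply (is_lim_seq_abs _ (Finite _)). apply is_lim_seq_minus'; [trivial|apply is_lim_seq_const]. }
  refine (is_lim_seq_le_loc _ (fun _ => M * (Rpower 2 (2 * e) / (2 * e)) * exp (-2 * e * T)) (Finite _) (Finite _) _ L (is_lim_seq_const _)).
  destruct (nfloor_ex (Rmax T 0) (Rmax_r _ _)) as [N [_ HN]].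
  exists (S N). intros n Hn. apply (cosh_tail f M e); trivial.
  apply le_INR in Hn. rewrite S_INR in Hn. pose proof (Rmax_l T 0). lra.
Qed.

(** The value of [RT] at [z = 0], where [eta] equals 1. *)
Definition betaT (a b T : R) : R := RInt (fun v => cos (2 * b * v) * Rpower (cosh v) (-2 * a)) 0 T.

Lemma betaT_integrand (a b : R) :
  (forall v, continuous (fun v => cos (2 * b * v) * Rpower (cosh v) (-2 * a)) v) /\
  (forall v, Rabs (cos (2 * b * v) * Rpower (cosh v) (-2 * a)) <= 1 * Rpower (cosh v) (-2 * a)).
Proof.
  split; intros v.
  - apply (continuous_mult (K := R_AbsRing)); [apply continuous_cos_mult|].
    eapply is_derive_continuous, is_derive_cosh_Rpower.
  - assert (0 < Rpower (cosh v) (-2 * a)) by apply exp_pos.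
    rewrite Rabs_mult, (Rabs_pos_eq (Rpower _ _)) by lra. apply Rmult_le_compat_r; [lra|].
    apply Rabs_le. destruct (COS_bound (2 * b * v)). lra.
Qed.

Lemma beta_ex (a b : R) : 0 < a -> exists l : R, is_lim_seq (fun n => betaT a b (INR n)) l.
Proof.
  intros Ha. destruct (betaT_integrand a b) as [H1 H2]. apply (cosh_tail_ex_lim _ 1 a); trivial; lra.
Qed.

(** The exponent of [(cosh^2 v + z)^(-a)] is split into [a - e], spent on decay in [z], and [e],
    spent on decay in [v]. A small [e] thus gives an integrable tail in [v] with almost no loss in
    [z]. *)
Lemma RT_integrand (a c b e K z : R) : 0 < e <= a -> a < c -> 0 <= z -> 0 <= K ->
  (forall z, 0 <= z -> Rabs (eta a c z) <= K * Rpower (1 + z) (- a) /\ Rabs (eta1 a c z) <= K * Rpower (1 + z) (- a - 1)) ->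
  (forall v, continuous (fun v => cos (2 * b * v) * wker (-2 * a) (eta a c) z v) v) /\
  (forall v, Rabs (cos (2 * b * v) * wker (-2 * a) (eta a c) z v) <= K * Rpower (1 + z) (e - a) * Rpower (cosh v) (-2 * e)).
Proof.
  intros He Hac Hz HK HB. destruct (eta_hyp_fun a c ltac:(lra)) as [e2 Hf]. split; intros v.
  - apply (continuous_mult (K := R_AbsRing)); [apply continuous_cos_mult|].
    apply (continuity_2d_pt_slice_r (fun z v => wker (-2 * a) (eta a c) z v)), continuity_2d_wker.
    eapply is_derive_continuous. apply (hf_d1 _ _ _ _ _ _ Hf). apply wker_arg. lra.
  - destruct (wker_bound a c K z v ltac:(lra) Hz HK HB) as [B _].
    rewrite Rabs_mult. apply Rle_trans with (1 * (K * Rpower (cosh v ^ 2 + z) (- a))).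
    + apply Rmult_le_compat; try apply Rabs_pos; trivial. apply Rabs_le. destruct (COS_bound (2 * b * v)). lra.
    + rewrite Rmult_1_l, Rmult_assoc. apply Rmult_le_compat_l; trivial.
      pose proof (cosh_ge_1 v). assert (Hq : 1 <= cosh v ^ 2) by nra.
      replace (- a) with (- (a - e) + - e) by ring. rewrite Rpower_plus.
      replace (Rpower (cosh v) (-2 * e)) with (Rpower (cosh v ^ 2) (- e)).
      2:{ rewrite <- (Rpower_pow 2) by lra. rewrite Rpower_mult. f_equal. simpl. ring. }
      replace (e - a) with (- (a - e)) by ring. rewrite !Rpower_Ropp.
      apply Rmult_le_compat; try (left; apply Rinv_0_lt_compat, exp_pos);
        (apply Rinv_le_contravar; [apply exp_pos|apply Rle_Rpower_l; lra]).
Qed.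

Lemma RT_limit (a c b K z beta : R) (f f1 f2 : R -> R) :
  0 < a < c -> 1/2 < c -> 0 <= b -> 0 <= z -> 0 <= K ->
  (forall z, 0 <= z -> Rabs (eta a c z) <= K * Rpower (1 + z) (- a) /\ Rabs (eta1 a c z) <= K * Rpower (1 + z) (- a - 1)) ->
  hyp_solution c (2 * a) (a ^ 2 + b ^ 2) f f1 f2 -> f 0 = 1 ->
  is_lim_seq (fun n => betaT a b (INR n)) beta ->
  is_lim_seq (fun n => RT a c b (INR n) z) (beta * f z).
Proof.
  intros Ha Hc Hb Hz HK HB Hf Hf0 Hbeta.
  assert (E0 : forall T, RT a c b T 0 = betaT a b T).
  { intros T. apply RInt_ext. intros v _. unfold wker. pose proof (cosh_pos v).
    replace (0 / cosh v ^ 2) with 0 by (field; lra). rewrite eta_0.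
    match goal with |- ?A = ?B => change (@eq R A B) end. ring. }
  apply is_lim_seq_ext with (fun n => (RT a c b (INR n) z - betaT a b (INR n) * f z) + betaT a b (INR n) * f z); [intros n; ring|].
  replace (Finite (beta * f z)) with (Finite (0 + beta * f z)) by (f_equal; ring).
  apply is_lim_seq_plus'; [|now apply (is_lim_seq_scal_r _ _ (Finite _))].
  set (P := a ^ 2 + b ^ 2). assert (HP : 0 < P) by (unfold P; nra).
  set (Cst := sqrt (z / (2 * c - 1) / P) * (K * (a + 1 + b) * (Rpower 2 (2 * a)))).
  apply is_lim_seq_abs_0. apply is_lim_seq_le_le with (fun _ => 0) (fun n => Cst * exp (-2 * a * INR n)).
  - intros n. split; [apply Rabs_pos|].
    pose proof (RT_estimate a c b K (INR n) z f f1 f2 Ha Hc Hb Hz (pos_INR n) HK HB Hf Hf0) as R.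
    fold P in R. rewrite E0 in R.
    set (D := RT a c b (INR n) z - betaT a b (INR n) * f z) in *.
    set (w := K * (a + 1 + b) * Rpower (cosh (INR n)) (-2 * a)) in *.
    assert (Hw : 0 <= w <= K * (a + 1 + b) * Rpower 2 (2 * a) * exp (-2 * a * INR n)).
    { unfold w. split.
      - apply Rmult_le_pos; [apply Rmult_le_pos; lra|left; apply exp_pos].
      - rewrite Rmult_assoc. rewrite (Rmult_assoc (K * (a + 1 + b))). rewrite <- Rmult_assoc. apply Rmult_le_compat_l; [apply Rmult_le_pos; lra|].
        apply cosh_Rpower_le_exp; lra. }
    assert (Hzc : 0 <= z / (2 * c - 1) / P) by (apply Rdiv_le_0_compat; trivial; apply Rdiv_le_0_compat; lra).
    apply Rle_trans with (sqrt (z / (2 * c - 1) / P) * w).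
    + rewrite <- (Rabs_pos_eq (sqrt _ * w)) by (apply Rmult_le_pos; [apply sqrt_pos|lra]).
      apply Rsqr_le_abs_0. unfold Rsqr.
      replace (sqrt (z / (2 * c - 1) / P) * w * (sqrt (z / (2 * c - 1) / P) * w)) with ((sqrt (z / (2 * c - 1) / P) * sqrt (z / (2 * c - 1) / P)) * w ^ 2) by ring.
      rewrite sqrt_sqrt by trivial. apply Rmult_le_reg_l with P; trivial.
      replace (P * (z / (2 * c - 1) / P * w ^ 2)) with (w ^ 2 * z / (2 * c - 1)) by (field; lra).
      replace (P * (D * D)) with (P * D ^ 2) by ring. exact R.
    + unfold Cst. rewrite Rmult_assoc. apply Rmult_le_compat_l; [apply sqrt_pos|]. lra.
  - apply is_lim_seq_const.
  - replace (Finite 0) with (Rbar_mult Cst 0) by (simpl; f_equal; ring).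
    apply is_lim_seq_scal_l. apply exp_decay_lim. lra.
Qed.

Lemma RT_tail (a c b K z beta e T : R) (f f1 f2 : R -> R) :
  0 < a < c -> 1/2 < c -> 0 <= b -> 0 <= z -> 0 <= K -> 0 < e <= a ->
  (forall z, 0 <= z -> Rabs (eta a c z) <= K * Rpower (1 + z) (- a) /\ Rabs (eta1 a c z) <= K * Rpower (1 + z) (- a - 1)) ->
  hyp_solution c (2 * a) (a ^ 2 + b ^ 2) f f1 f2 -> f 0 = 1 ->
  is_lim_seq (fun n => betaT a b (INR n)) beta ->
  Rabs (beta * f z - RT a c b T z) <= K * (Rpower 2 (2 * e) / (2 * e)) * exp (-2 * e * T) * Rpower (1 + z) (e - a).
Proof.
  intros Ha Hc Hb Hz HK He HB Hf Hf0 Hbeta.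
  destruct (RT_integrand a c b e K z He ltac:(lra) Hz HK HB) as [H1 H2].
  pose proof (RT_limit a c b K z beta f f1 f2 Ha Hc Hb Hz HK HB Hf Hf0 Hbeta) as L.
  eapply Rle_trans.
  - apply (cosh_tail_lim _ (K * Rpower (1 + z) (e - a)) e _ T); try lra; [|exact H1|exact H2|exact L].
    apply Rmult_le_pos; [trivial|left; apply exp_pos].
  - right. ring.
Qed.

(** Uniform in [p >= 1], the range of [cosh u]. The exponent [a - 1] meets the decay
    [(1 + x^2)^(-a)] of the modes and leaves [(1 + x^2)^(-1)]. *)
Lemma weight_uker (a c d Ld : R) : 0 < a -> 0 < d -> c = a + d -> 1/2 < c -> is_lim_seq (eta_ratio d c) Ld ->
  exists K, 0 < K /\ forall p x, 1 <= p -> 0 < x ->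
    Rabs (Rpower x (2 * c - 1) * uker c d p x) <= K * Rpower (1 + x ^ 2) (a - 1).
Proof.
  intros Ha Hd Hc Hc2 HLd. destruct (yfun_bounds d c Ld ltac:(lra) HLd) as [K [HK HB]].
  exists K. split; trivial. intros p x Hp Hx.
  destruct (HB _ (sq_ratio_ge0 x p ltac:(lra))) as [B _].
  assert (Hx2 : 0 < x ^ 2) by now apply pow_lt.
  pose proof (Rpower_x_le x (2 * c - 1) Hx ltac:(lra)) as X0.
  assert (HP : 0 < Rpower p (- (2 * d + 1))) by apply exp_pos.
  assert (HX : 0 < Rpower x (2 * c - 1)) by apply exp_pos.
  assert (U : Rabs (uker c d p x) <= K * Rpower (1 + x ^ 2) (- (d + 1/2))).
  { unfold uker. rewrite Rabs_mult, (Rabs_pos_eq (Rpower p _)) by lra.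
    apply Rle_trans with (Rpower p (- (2 * d + 1)) * (K * Rpower (1 + x ^ 2 / p ^ 2) (- (d + 1/2)))); [apply Rmult_le_compat_l; lra|].
    replace (- (2 * d + 1)) with (2 * - (d + 1/2)) by field.
    apply Rle_trans with (K * Rpower (p ^ 2 + x ^ 2) (- (d + 1/2))).
    - rewrite <- Rpower_sq_ratio by lra. right; ring.
    - apply Rmult_le_compat_l; [lra|]. rewrite !Rpower_Ropp. apply Rinv_le_contravar; [apply exp_pos|].
      apply Rle_Rpower_l; [lra|]. split; [lra|]. nra. }
  rewrite Rabs_mult, (Rabs_pos_eq (Rpower x _)) by lra.
  apply Rle_trans with (Rpower (1 + x ^ 2) ((2 * c - 1) / 2) * (K * Rpower (1 + x ^ 2) (- (d + 1/2)))).
  - apply Rmult_le_compat; trivial; [lra|apply Rabs_pos].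
  - right. transitivity (K * (Rpower (1 + x ^ 2) ((2 * c - 1) / 2) * Rpower (1 + x ^ 2) (- (d + 1/2)))); [ring|].
    rewrite <- Rpower_plus. do 2 f_equal. rewrite Hc. field.
Qed.

Lemma continuity_2d_uker (c d p x : R) : 0 < c -> 0 < p -> continuity_2d_pt (uker c d) p x.
Proof.
  intros Hc Hp. destruct (yfun_hyp_fun d c Hc) as [y2 Hy]. unfold uker. apply continuity_2d_pt_mult.
  - now apply (continuity_2d_pt_fst (fun p => Rpower p (- (2 * d + 1)))), continuous_Rpower.
  - apply continuity_2d_comp_ratio; trivial. eapply is_derive_continuous. apply (hf_d1 _ _ _ _ _ _ Hy).
    pose proof (sq_ratio_ge0 x p Hp). lra.
Qed.

Lemma continuous_weight_uker (c d p x : R) : 0 < c -> 0 < p -> 0 < x ->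
  continuous (fun x => Rpower x (2 * c - 1) * uker c d p x) x.
Proof.
  intros Hc Hp Hx. apply (continuous_mult (K := R_AbsRing)); [now apply continuous_Rpower|].
  now apply continuity_2d_pt_slice_r, continuity_2d_uker.
Qed.

Lemma solution_sq_continuous (c s P x : R) (f f1 f2 : R -> R) : hyp_solution c s P f f1 f2 -> continuous (fun x => f (x ^ 2)) x.
Proof.
  intros Hf. apply (continuous_comp (fun x => x ^ 2) f).
  - apply (ex_derive_continuous (K := R_AbsRing) (V := R_NormedModule)). auto_derive; trivial.
  - eapply is_derive_continuous. apply (hyp_d1 _ _ _ _ _ _ Hf). apply pow2_ge_0.
Qed.

Lemma uker_solution_pint (a c d Ld b Kf p : R) (f f1 f2 : R -> R) :
  0 < a -> 0 < d -> c = a + d -> 1/2 < c -> is_lim_seq (eta_ratio d c) Ld -> 1 <= p ->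
  hyp_solution c (2 * a) (a ^ 2 + b ^ 2) f f1 f2 ->
  0 <= Kf -> (forall z, 0 <= z -> Rabs (f z) <= Kf * Rpower (1 + z) (- a)) ->
  exists I, is_pint (fun x => Rpower x (2 * c - 1) * uker c d p x * f (x ^ 2)) I.
Proof.
  intros Ha Hd Hc Hc2 HLd Hp Hf HKf HB.
  destruct (weight_uker a c d Ld Ha Hd Hc Hc2 HLd) as [K [HK HU]].
  apply (dominated_ex_pint _ tail_weight _ _ _ (K * Kf * 2) ltac:(repeat apply Rmult_le_pos; lra) tail_weight_dominator).
  - intros x Hx. apply (continuous_mult (K := R_AbsRing)); [apply continuous_weight_uker; lra|].
    now apply (solution_sq_continuous _ _ _ _ _ _ _ Hf).
  - intros x Hx. rewrite Rabs_mult.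
    pose proof (Rpower_le_tail_weight x (-1) Hx ltac:(lra)) as D0.
    apply Rle_trans with (K * Rpower (1 + x ^ 2) (a - 1) * (Kf * Rpower (1 + x ^ 2) (- a))).
    + apply Rmult_le_compat; try apply Rabs_pos; [now apply HU|apply HB, pow2_ge_0].
    + transitivity (K * Kf * (Rpower (1 + x ^ 2) (a - 1) * Rpower (1 + x ^ 2) (- a))); [right; ring|].
      rewrite <- Rpower_plus. replace (a - 1 + - a) with (-1) by ring.
      rewrite (Rmult_assoc _ 2). apply Rmult_le_compat_l; [apply Rmult_le_pos; lra|lra].
Qed.

Lemma wker_vker (a z v x : R) (e : R -> R) : z = x ^ 2 -> wker (-2 * a) e z v = vker a e (cosh v) x.
Proof. intros ->. reflexivity. Qed.

(** With [v] cut at [T], Fubini involves a compact interval in [v], and the inner integral is the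
    elementary one of [uv_pint]. *)
Lemma uker_RT_pint (a c d La Ld b p T : R) :
  0 < a -> 0 < d -> c = a + d -> 1/2 < c -> is_lim_seq (eta_ratio a c) La -> is_lim_seq (eta_ratio d c) Ld -> 1 <= p ->
  0 <= T ->
  is_pint (fun x => Rpower x (2 * c - 1) * uker c d p x * RT a c b T (x ^ 2))
    (RInt (fun v => cos (2 * b * v) * (La * Ld / (2 * d) / (p + cosh v))) 0 T).
Proof.
  intros Ha Hd Hc Hc2 HLa HLd Hp HT.
  destruct (eta_hyp_fun a c ltac:(lra)) as [e2 He].
  destruct (weight_uker a c d Ld Ha Hd Hc Hc2 HLd) as [K [HK HU]].
  destruct (eta_bounds a c La ltac:(lra) HLa) as [K1 [HK1 HB]].
  set (F := fun x v => Rpower x (2 * c - 1) * uker c d p x * (cos (2 * b * v) * wker (-2 * a) (eta a c) (x ^ 2) v)).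
  assert (Cw : forall x v, 0 < x -> continuity_2d_pt (fun x v => wker (-2 * a) (eta a c) (x ^ 2) v) x v).
  { intros x v Hx. apply continuity_2d_pt_filterlim.
    assert (Cz : continuity_2d_pt (fun z v => wker (-2 * a) (eta a c) z v) (x ^ 2) v).
    { apply continuity_2d_wker. eapply is_derive_continuous. apply (hf_d1 _ _ _ _ _ _ He). apply wker_arg.
      pose proof (pow2_ge_0 x). lra. }
    intros P HP. apply continuity_2d_pt_filterlim in Cz.
    destruct (Cz P HP) as [dl Hdl].
    assert (Csq : continuous (fun x => x ^ 2) x).
    { apply (ex_derive_continuous (K := R_AbsRing) (V := R_NormedModule)). auto_derive; trivial. }
    destruct (Csq (ball (x ^ 2) dl) (locally_ball _ _)) as [d2 Hd2].
    assert (Hm : 0 < Rmin dl d2) by (apply Rmin_glb_lt; apply cond_pos).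
    exists (mkposreal _ Hm). intros [y w] [Hy Hw]. simpl in *.
    apply (Hdl (y ^ 2, w)). split; simpl.
    - apply Hd2. eapply ball_le; [|exact Hy]. apply Rmin_r.
    - eapply ball_le; [|exact Hw]. apply Rmin_l. }
  assert (CF : forall x v, 0 < x -> continuity_2d_pt F x v).
  { intros x v Hx. apply continuity_2d_pt_mult; [|apply continuity_2d_pt_mult].
    - apply (continuity_2d_pt_fst (fun x => Rpower x (2 * c - 1) * uker c d p x)). apply continuous_weight_uker; lra.
    - apply (continuity_2d_pt_snd (fun v => cos (2 * b * v))), continuous_cos_mult.
    - now apply Cw. }
  assert (Cl : forall v, continuous (fun v => cos (2 * b * v) * (La * Ld / (2 * d) / (p + cosh v))) v).
  { intros v. pose proof (cosh_pos v). apply (ex_derive_continuous (K := R_AbsRing) (V := R_NormedModule)). auto_derive.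
    repeat split; trivial; lra. }
  apply pint_ext with (fun x => RInt (F x) 0 T).
  { intros x Hx. unfold F, RT.
    apply (RInt_scal (V := R_CompleteNormedModule) (fun v => cos (2 * b * v) * wker (-2 * a) (eta a c) (x ^ 2) v)).
    apply (@ex_RInt_continuous R_CompleteNormedModule). intros v _.
    apply (continuous_mult (K := R_AbsRing)); [apply continuous_cos_mult|].
    now apply (continuity_2d_pt_slice_r (fun x v => wker (-2 * a) (eta a c) (x ^ 2) v)), Cw. }
  apply (pint_Fubini F _ tail_weight (fun x => - 2 / sqrt (1 + x)) (-2) 0 (K * K1 * 2) 0 T (-1) (T + 1)); try lra.
  - repeat apply Rmult_le_pos; lra.
  - apply tail_weight_dominator.
  - intros x t Hx _. now apply CF.
  - intros x t Hx _. unfold F. rewrite Rabs_mult.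
    pose proof (Rpower_le_tail_weight x (-1) Hx ltac:(lra)) as D0.
    pose proof (cosh_ge_1 t). assert (Hx2 : 0 < x ^ 2) by now apply pow_lt.
    assert (W : Rabs (cos (2 * b * t) * wker (-2 * a) (eta a c) (x ^ 2) t) <= K1 * Rpower (1 + x ^ 2) (- a)).
    { destruct (wker_bound a c K1 (x ^ 2) t Ha ltac:(lra) ltac:(lra) HB) as [B _].
      rewrite Rabs_mult. apply Rle_trans with (1 * (K1 * Rpower (cosh t ^ 2 + x ^ 2) (- a))).
      - apply Rmult_le_compat; try apply Rabs_pos; trivial. apply Rabs_le. destruct (COS_bound (2 * b * t)). lra.
      - rewrite Rmult_1_l. apply Rmult_le_compat_l; [lra|]. rewrite !Rpower_Ropp. apply Rinv_le_contravar; [apply exp_pos|].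
        apply Rle_Rpower_l; [lra|]. split; nra. }
    apply Rle_trans with (K * Rpower (1 + x ^ 2) (a - 1) * (K1 * Rpower (1 + x ^ 2) (- a))).
    + apply Rmult_le_compat; try apply Rabs_pos; trivial. now apply HU.
    + transitivity (K * K1 * (Rpower (1 + x ^ 2) (a - 1) * Rpower (1 + x ^ 2) (- a))); [right; ring|].
      rewrite <- Rpower_plus. replace (a - 1 + - a) with (-1) by ring.
      rewrite (Rmult_assoc _ 2). apply Rmult_le_compat_l; [apply Rmult_le_pos; lra|lra].
  - intros t Ht. pose proof (cosh_pos t).
    apply pint_ext with (fun x => cos (2 * b * t) * (Rpower x (2 * c - 1) * uker c d p x * vker a (eta a c) (cosh t) x)).
    + intros x Hx. unfold F. rewrite (wker_vker a (x ^ 2) t x) by reflexivity. ring.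
    + apply pint_scal. apply uv_pint; trivial. lra.
  - apply (@ex_RInt_continuous R_CompleteNormedModule). intros v _. apply Cl.
Qed.

(** Removes the cut: the remainder of [RT_tail] is integrable against the weight and decays
    exponentially in [T]. *)
Lemma uker_solution_value (a c d La Ld b p beta I : R) (f f1 f2 : R -> R) :
  0 < a -> 0 < d -> c = a + d -> 1/2 < c -> is_lim_seq (eta_ratio a c) La -> is_lim_seq (eta_ratio d c) Ld -> 1 <= p ->
  0 <= b -> hyp_solution c (2 * a) (a ^ 2 + b ^ 2) f f1 f2 -> f 0 = 1 ->
  is_lim_seq (fun n => betaT a b (INR n)) beta ->
  is_pint (fun x => Rpower x (2 * c - 1) * uker c d p x * f (x ^ 2)) I ->
  is_lim_seq (fun n => RInt (fun v => cos (2 * b * v) * (La * Ld / (2 * d) / (p + cosh v))) 0 (INR n)) (beta * I).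
Proof.
  intros Ha Hd Hc Hc2 HLa HLd Hp Hb Hf Hf0 Hbeta HI.
  destruct (weight_uker a c d Ld Ha Hd Hc Hc2 HLd) as [K [HK HU]].
  destruct (eta_bounds a c La ltac:(lra) HLa) as [K1 [HK1 HB]].
  (* [e <= a] is the room for splitting the exponent, and [e <= 1/4] makes [(1 + x^2)^(e-1)] fall
     under [tail_weight]. *)
  set (e := Rmin a (1/4)).
  assert (He : 0 < e <= a) by (unfold e; split; [apply Rmin_glb_lt; lra|apply Rmin_l]).
  assert (He4 : e <= 1/4) by apply Rmin_r.
  set (J := fun n => RInt (fun v => cos (2 * b * v) * (La * Ld / (2 * d) / (p + cosh v))) 0 (INR n)).
  set (C0 := K * (K1 * (Rpower 2 (2 * e) / (2 * e)))).
  assert (HC0 : 0 <= C0).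
  { unfold C0. assert (0 < Rpower 2 (2 * e)) by apply exp_pos.
    repeat apply Rmult_le_pos; try lra. left. apply Rinv_0_lt_compat. lra. }
  apply is_lim_seq_ext with (fun n => beta * I - (beta * I - J n)); [intros n; unfold J; ring|].
  replace (Finite (beta * I)) with (Finite (beta * I - 0)) by (f_equal; ring).
  apply is_lim_seq_minus'; [apply is_lim_seq_const|].
  apply is_lim_seq_abs_0. apply is_lim_seq_le_le with (fun _ => 0) (fun n => C0 * 2 * (0 - - 2) * exp (-2 * e * INR n)).
  - intros n. split; [apply Rabs_pos|].
    pose proof (pint_minus _ _ _ _ (pint_scal beta _ _ HI) (uker_RT_pint a c d La Ld b p (INR n) Ha Hd Hc Hc2 HLa HLd Hp (pos_INR n))) as D.
    fold (J n) in D. assert (HE : 0 < exp (-2 * e * INR n)) by apply exp_pos.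
    replace (C0 * 2 * (0 - -2) * exp (-2 * e * INR n)) with (C0 * exp (-2 * e * INR n) * 2 * (0 - -2)) by ring.
    refine (dominated_pint_le _ _ _ _ _ _ _ _ tail_weight_dominator _ _ D).
    + apply Rmult_le_pos; [apply Rmult_le_pos; lra|lra].
    + intros x Hx.
      assert (CW := continuous_weight_uker c d p x ltac:(lra) ltac:(lra) Hx).
      apply (continuous_minus (V := R_NormedModule)).
      * apply (continuous_scal_r (V := R_NormedModule)). apply (continuous_mult (K := R_AbsRing)); trivial.
        now apply (solution_sq_continuous _ _ _ _ _ _ _ Hf).
      * apply (continuous_mult (K := R_AbsRing)); trivial.
        destruct (eta_hyp_fun a c ltac:(lra)) as [e2 Hh].
        apply (continuous_comp (fun x => x ^ 2) (RT a c b (INR n))).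
        { apply (ex_derive_continuous (K := R_AbsRing) (V := R_NormedModule)). auto_derive; trivial. }
        pose proof (pow2_ge_0 x). pose proof (pos_INR n).
        apply (continuous_RInt_under (fun z v => cos (2 * b * v) * wker (-2 * a) (eta a c) z v) 0 (INR n) (-(1/2)) (x ^ 2 + 1) (-1) (INR n + 1)); try lra.
        intros z v Hz Hv. apply continuity_2d_pt_mult.
        { apply (continuity_2d_pt_snd (fun v => cos (2 * b * v))), continuous_cos_mult. }
        apply continuity_2d_wker. eapply is_derive_continuous. apply (hf_d1 _ _ _ _ _ _ Hh). apply wker_arg. lra.
    + intros x Hx. pose proof (pow2_ge_0 x) as Hx2.
      pose proof (RT_tail a c b K1 (x ^ 2) beta e (INR n) f f1 f2 ltac:(lra) Hc2 Hb Hx2 ltac:(lra) He HB Hf Hf0 Hbeta) as Tl.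
      pose proof (Rpower_le_tail_weight x (e - 1) Hx ltac:(lra)) as D0.
      replace (beta * (Rpower x (2 * c - 1) * uker c d p x * f (x ^ 2)) - Rpower x (2 * c - 1) * uker c d p x * RT a c b (INR n) (x ^ 2))
       with (Rpower x (2 * c - 1) * uker c d p x * (beta * f (x ^ 2) - RT a c b (INR n) (x ^ 2))) by ring.
      rewrite Rabs_mult. eapply Rle_trans.
      { apply Rmult_le_compat; [apply Rabs_pos|apply Rabs_pos|now apply HU|exact Tl]. }
      transitivity (C0 * exp (-2 * e * INR n) * (Rpower (1 + x ^ 2) (a - 1) * Rpower (1 + x ^ 2) (e - a))); [right; unfold C0; ring|].
      rewrite <- Rpower_plus. replace (a - 1 + (e - a)) with (e - 1) by ring.
      rewrite (Rmult_assoc _ 2). apply Rmult_le_compat_l; [apply Rmult_le_pos; lra|lra].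
  - apply is_lim_seq_const.
  - replace (Finite 0) with (Rbar_mult (C0 * 2 * (0 - -2)) 0) by (simpl; f_equal; ring).
    apply is_lim_seq_scal_l. apply exp_decay_lim. lra.
Qed.

(** Multiplication by [sinh u] turns [1 / (cosh u + cosh v)] into the Poisson-type kernel, whose
    cosine transform is known; two limits of the same sequence are then compared. *)
Theorem uker_solution_cosh (a c d La Ld b u beta I : R) (f f1 f2 : R -> R) :
  0 < a -> 0 < d -> c = a + d -> 1/2 < c -> is_lim_seq (eta_ratio a c) La -> is_lim_seq (eta_ratio d c) Ld -> 0 < u ->
  0 < b -> hyp_solution c (2 * a) (a ^ 2 + b ^ 2) f f1 f2 -> f 0 = 1 ->
  is_lim_seq (fun n => betaT a b (INR n)) beta ->
  is_pint (fun x => Rpower x (2 * c - 1) * uker c d (cosh u) x * f (x ^ 2)) I ->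
  beta * I * sinh u = La * Ld / (2 * d) * (PI * sin (2 * b * u) / sinh (PI * (2 * b))).
Proof.
  intros Ha Hd Hc Hc2 HLa HLd Hu Hb Hf Hf0 Hbeta HI.
  pose proof (uker_solution_value a c d La Ld b (cosh u) beta I f f1 f2 Ha Hd Hc Hc2 HLa HLd (cosh_ge_1 u) ltac:(lra) Hf Hf0 Hbeta HI) as L1.
  pose proof (poisson_limit_pos (2 * b) u ltac:(lra) Hu) as L2.
  apply (is_lim_seq_scal_r _ (sinh u) (Finite _)) in L1.
  apply (is_lim_seq_scal_l _ (La * Ld / (2 * d)) (Finite _)) in L2.
  apply is_lim_seq_ext with (v := fun n => La * Ld / (2 * d) * RInt (fun v => cos (2 * b * v) * (sinh u / (cosh v + cosh u))) 0 (INR n)) in L1.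
  - apply is_lim_seq_unique in L1. apply is_lim_seq_unique in L2. rewrite L1 in L2. now injection L2.
  - intros n. rewrite Rmult_comm.
    rewrite <- (RInt_scal (V := R_CompleteNormedModule) _ 0 (INR n) (sinh u)).
    + rewrite <- (RInt_scal (V := R_CompleteNormedModule) _ 0 (INR n) (La * Ld / (2 * d))).
      * apply RInt_ext. intros v _. unfold scal; simpl; unfold mult; simpl. pose proof (cosh_pos v). pose proof (cosh_pos u). field. lra.
      * apply (@ex_RInt_continuous R_CompleteNormedModule). intros v _. pose proof (cosh_pos v). pose proof (cosh_pos u).
        apply (ex_derive_continuous (K := R_AbsRing) (V := R_NormedModule)). auto_derive. repeat split; trivial; lra.
    + apply (@ex_RInt_continuous R_CompleteNormedModule). intros v _. pose proof (cosh_pos v). pose proof (cosh_pos u).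
      apply (ex_derive_continuous (K := R_AbsRing) (V := R_NormedModule)). auto_derive. repeat split; trivial; lra.
Qed.

(** * Gamma and beta integrals *)

Lemma pint_le (f g : R -> R) (l m : R) :
  (forall x, 0 < x -> continuous f x) -> (forall x, 0 < x -> continuous g x) ->
  (forall x, 0 < x -> f x <= g x) -> is_pint f l -> is_pint g m -> l <= m.
Proof.
  intros Cf Cg H Hl Hm.
  apply (is_lim_seq_le (truncated f) (truncated g) (Finite l) (Finite m)).
  - intros n. unfold truncated. pose proof (pos_INR n) as Hn.
    assert (H1 : 0 < / INR (S n)) by (apply Rinv_0_lt_compat; rewrite S_INR; lra).
    assert (H2 : / INR (S n) <= INR (S n)).
    { rewrite S_INR in *. apply Rmult_le_reg_l with (INR n + 1); [lra|]. rewrite Rinv_r by lra. nra. }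
    apply RInt_le; trivial.
    + apply ex_RInt_pos; trivial; lra.
    + apply ex_RInt_pos; trivial; lra.
    + intros x Hx. apply H. lra.
  - now apply is_lim_seq_truncated.
  - now apply is_lim_seq_truncated.
Qed.

(** With [h] equal to 1, [cos (b x)] or [sin (b x)] this is the integrand of Gamma at [a], or of the
    real or imaginary part of Gamma at [a + ib]; convergence and recurrence are proved once for all
    three. *)
Definition gint (a : R) (h : R -> R) (t : R) : R := Rpower t (a - 1) * exp (- t) * h (ln t).

Lemma continuous_gint (a t : R) (h : R -> R) : (forall x, continuous h x) -> 0 < t -> continuous (gint a h) t.
Proof.
  intros Hh Ht. unfold gint. apply (continuous_mult (K := R_AbsRing)).
  - apply (continuous_mult (K := R_AbsRing)); [now apply continuous_Rpower|].
    apply (ex_derive_continuous (K := R_AbsRing) (V := R_NormedModule)). auto_derive; trivial.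
  - apply (continuous_comp ln h); trivial.
    apply (ex_derive_continuous (K := R_AbsRing) (V := R_NormedModule)). auto_derive; trivial.
Qed.

(** [exp(-t) (1 + t)^s] is largest at [1 + t = s], where it equals the constant used. For
    [s = a + 1] it makes [beta_weight a] a majorant of the Gamma integrand. *)
Lemma exp_opp_le_Rpower (s : R) : 0 < s -> exists M, 0 < M /\ forall t, 0 <= t -> exp (- t) <= M * Rpower (1 + t) (- s).
Proof.
  intros Hs. exists (exp (1 - s + s * ln s)). split; [apply exp_pos|]. intros t Ht.
  unfold Rpower. rewrite <- exp_plus.
  assert (L : ln (1 + t) <= (1 + t) / s - 1 + ln s).
  { replace (1 + t) with ((1 + t) / s * s) at 1 by (field; lra).
    assert (0 < (1 + t) / s) by (apply Rdiv_lt_0_compat; lra).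
    rewrite ln_mult by lra.
    assert (ln ((1 + t) / s) <= (1 + t) / s - 1); [|lra].
    pose proof (exp_ineq1_le (ln ((1 + t) / s))) as X. rewrite exp_ln in X by lra. lra. }
  assert (E : - t <= 1 - s + s * ln s + - s * ln (1 + t)).
  { assert (s * ln (1 + t) <= s * ((1 + t) / s - 1 + ln s)) by (apply Rmult_le_compat_l; lra).
    replace (s * ((1 + t) / s - 1 + ln s)) with (1 + t - s + s * ln s) in * by (field; lra). lra. }
  destruct E as [E|E]; [left; now apply exp_increasing|rewrite <- E; lra].
Qed.

Lemma gint_pint (a : R) (h : R -> R) : 0 < a -> (forall x, continuous h x) -> (forall x, Rabs (h x) <= 1) ->
  exists l, is_pint (gint a h) l.
Proof.
  intros Ha Hh Hb. destruct (exp_opp_le_Rpower (a + 1) ltac:(lra)) as [M [HM HE]].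
  apply (dominated_ex_pint _ _ _ _ _ M ltac:(lra) (beta_weight_dominator a Ha)).
  - intros x Hx. now apply continuous_gint.
  - intros x Hx. unfold gint, beta_weight. assert (0 < Rpower x (a - 1)) by apply exp_pos.
    rewrite !Rabs_mult, (Rabs_pos_eq (Rpower x _)), (Rabs_pos_eq (exp _)) by (left; apply exp_pos).
    replace (M * (Rpower x (a - 1) * Rpower (1 + x) (- a - 1))) with (Rpower x (a - 1) * (M * Rpower (1 + x) (- a - 1)) * 1) by ring.
    specialize (HE x ltac:(lra)). replace (- (a + 1)) with (- a - 1) in HE by ring.
    apply Rmult_le_compat; try apply Rabs_pos; trivial.
    + apply Rmult_le_pos; [lra|left; apply exp_pos].
    + apply Rmult_le_compat_l; lra.
Qed.

Definition Gamma_re (a b : R) : R := RInt_gen (gint a (fun x => cos (b * x))) (at_right 0) (Rbar_locally p_infty).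
Definition Gamma_im (a b : R) : R := RInt_gen (gint a (fun x => sin (b * x))) (at_right 0) (Rbar_locally p_infty).

Lemma continuous_sin_mult (m v : R) : continuous (fun v => sin (m * v)) v.
Proof. apply (ex_derive_continuous (K := R_AbsRing) (V := R_NormedModule)). auto_derive; trivial. Qed.

Lemma Gamma_re_pint (a b : R) : 0 < a -> is_pint (gint a (fun x => cos (b * x))) (Gamma_re a b).
Proof.
  intros Ha. apply (RInt_gen_correct (V := R_CompleteNormedModule)).
  apply gint_pint; trivial; intros x; [apply continuous_cos_mult|].
  apply Rabs_le. destruct (COS_bound (b * x)). lra.
Qed.

Lemma Gamma_im_pint (a b : R) : 0 < a -> is_pint (gint a (fun x => sin (b * x))) (Gamma_im a b).
Proof.
  intros Ha. apply (RInt_gen_correct (V := R_CompleteNormedModule)).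
  apply gint_pint; trivial; intros x; [apply continuous_sin_mult|].
  apply Rabs_le. destruct (SIN_bound (b * x)). lra.
Qed.

Lemma RGamma_pint (a : R) : 0 < a -> is_pint (gint a (fun _ => 1)) (RGamma a).
Proof.
  intros Ha. destruct (gint_pint a (fun _ => 1) Ha) as [l Hl].
  - intros x. apply continuous_const.
  - intros x. rewrite Rabs_R1. lra.
  - assert (Hl' : is_pint (fun t => Rpower t (a - 1) * exp (- t)) l).
    { revert Hl. apply pint_ext. intros x Hx. unfold gint. ring. }
    unfold RGamma. rewrite (is_RInt_gen_unique (V := R_CompleteNormedModule) _ _ Hl'). exact Hl.
Qed.

Lemma RInt_gen_pair (f g : R -> R) (l m : R) : is_pint f l -> is_pint g m ->
  is_RInt_gen (V := C_R_NormedModule) (fun t => (f t, g t) : C) (at_right 0) (Rbar_locally p_infty) ((l, m) : C).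
Proof.
  intros Hf Hg P [eps HP].
  assert (Hf' := Hf (ball l eps) (locally_ball l eps)). assert (Hg' := Hg (ball m eps) (locally_ball m eps)).
  unfold filtermapi in *. generalize (filter_and (F := filter_prod (at_right 0) (Rbar_locally p_infty)) _ _ Hf' Hg'). apply filter_imp.
  intros ab [[y1 [I1 B1]] [y2 [I2 B2]]]. exists ((y1, y2) : C). split.
  - apply (is_RInt_fct_extend_pair (U := R_NormedModule) (V := R_NormedModule) (fun t => (f t, g t))); trivial.
  - apply HP. split; trivial.
Qed.

Lemma CGamma_eq (a b : R) : 0 < a -> CGamma (a, b) = (Gamma_re a b, Gamma_im a b).
Proof.
  intros Ha. unfold CGamma.
  apply (is_RInt_gen_unique (V := C_R_CompleteNormedModule)).
  apply (is_RInt_gen_ext (V := C_R_NormedModule) (fun t => (gint a (fun x => cos (b * x)) t, gint a (fun x => sin (b * x)) t) : C)).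
  - generalize filter_pos. apply filter_imp. intros [e X]; simpl; intros Hp x Hx.
    unfold cpow, gint, Rpower, Re, Im. apply injective_projections; simpl;
    replace (b + - 0) with b by ring; replace (a + - (1)) with (a - 1) by ring; ring.
  - apply RInt_gen_pair; [now apply Gamma_re_pint|now apply Gamma_im_pint].
Qed.

(** Integration by parts on [t^a exp(-t) h(ln t)], which vanishes at both ends; the functional
    equations of the Gamma integrals are instances. *)
Lemma gint_parts (a : R) (h h' : R -> R) : 0 < a -> (forall x, is_derive h x (h' x)) -> (forall x, continuous h' x) ->
  (forall x, Rabs (h x) <= 1) ->
  is_pint (fun t => a * gint a h t + gint a h' t - gint (a + 1) h t) 0.
Proof.
  intros Ha Dh Ch' Hb.
  assert (Ch : forall x, continuous h x) by (intros x; eapply is_derive_continuous; apply Dh).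
  enough (X : is_pint (fun t => a * gint a h t + gint a h' t - gint (a + 1) h t) (0 - 0)) by (now rewrite Rminus_0_r in X).
  apply (pint_derive (gint (a + 1) h)).
  - intros t Ht. unfold gint. eapply is_derive_eq.
    + apply is_derive_mult_R; [apply is_derive_mult_R|].
      * now apply is_derive_Rpower.
      * instantiate (1 := - exp (- t)). auto_derive; trivial. ring.
      * apply (is_derive_comp_R h ln); [apply Dh|]. instantiate (1 := / t). auto_derive; trivial. ring.
    + replace (a + 1 - 1) with a by ring. cbv beta.
      replace (Rpower t a) with (Rpower t (a - 1) * t).
      2:{ rewrite <- (Rpower_1 t) at 2 by lra. rewrite <- Rpower_plus. f_equal. ring. }
      field. lra.
  - intros t Ht. apply (continuous_minus (V := R_NormedModule)); [apply (continuous_plus (V := R_NormedModule))|].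
    + apply (continuous_scal_r (V := R_NormedModule)). now apply continuous_gint.
    + now apply continuous_gint.
    + now apply continuous_gint.
  - intros P [eps HP]. pose proof (Rpower_lim_zero a Ha (ball 0 eps) (locally_ball 0 eps)) as [d Hd].
    exists d. intros x Hx Hx0. apply HP. specialize (Hd x Hx Hx0).
    unfold ball in *; simpl in *; unfold AbsRing_ball in *; simpl in *. unfold abs, minus, plus, opp in *; simpl in *.
    rewrite Ropp_0, Rplus_0_r in *. apply Rle_lt_trans with (2 := Hd).
    unfold gint. replace (a + 1 - 1) with a by ring. rewrite !Rabs_mult.
    rewrite <- (Rmult_1_r (Rabs (Rpower x a))) at 2. rewrite Rmult_assoc. apply Rmult_le_compat_l; [apply Rabs_pos|].
    rewrite <- (Rmult_1_r 1). apply Rmult_le_compat; try apply Rabs_pos; trivial.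
    rewrite Rabs_pos_eq by (left; apply exp_pos). rewrite <- exp_0. left. apply exp_increasing. lra.
  - destruct (exp_opp_le_Rpower (a + 1) ltac:(lra)) as [M [HM HE]].
    intros P [eps HP]. exists (Rmax 1 (M / eps)). intros x Hx. apply HP.
    pose proof (Rmax_l 1 (M / eps)). pose proof (Rmax_r 1 (M / eps)). pose proof (cond_pos eps).
    unfold ball; simpl; unfold AbsRing_ball; simpl. unfold abs, minus, plus, opp; simpl.
    rewrite Ropp_0, Rplus_0_r. unfold gint. replace (a + 1 - 1) with a by ring. rewrite !Rabs_mult.
    rewrite (Rabs_pos_eq (Rpower x a)), (Rabs_pos_eq (exp _)) by (left; apply exp_pos).
    specialize (HE x ltac:(lra)).
    assert (P1 : Rpower x a <= Rpower (1 + x) a) by (apply Rle_Rpower_l; lra).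
    assert (P0 : 0 < Rpower x a) by apply exp_pos.
    apply Rle_lt_trans with (Rpower (1 + x) a * (M * Rpower (1 + x) (- (a + 1))) * 1).
    + apply Rmult_le_compat; try apply Rabs_pos; trivial.
      * apply Rmult_le_pos; [lra|left; apply exp_pos].
      * apply Rmult_le_compat; try lra. left; apply exp_pos.
    + replace (Rpower (1 + x) a * (M * Rpower (1 + x) (- (a + 1))) * 1) with (M * (Rpower (1 + x) a * Rpower (1 + x) (- (a + 1)))) by ring.
      rewrite <- Rpower_plus. replace (a + - (a + 1)) with (- (1)) by ring. rewrite Rpower_Ropp, Rpower_1 by lra.
      apply Rmult_lt_reg_r with (1 + x); [lra|]. rewrite Rmult_assoc, Rinv_l, Rmult_1_r by lra.
      assert (M / eps * eps < x * eps) by (apply Rmult_lt_compat_r; lra).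
      replace (M / eps * eps) with M in * by (field; lra). lra.
Qed.

Lemma RGamma_S (a : R) : 0 < a -> RGamma (a + 1) = a * RGamma a.
Proof.
  intros Ha. pose proof (gint_parts a (fun _ => 1) (fun _ => 0) Ha ltac:(intros; apply (is_derive_const (V := R_NormedModule)))
    ltac:(intros; apply continuous_const) ltac:(intros; cbv beta; rewrite Rabs_R1; lra)) as H.
  pose proof (pint_minus _ _ _ _ (pint_scal a _ _ (RGamma_pint a Ha)) (RGamma_pint (a + 1) ltac:(lra))) as H'.
  assert (E : a * RGamma a - RGamma (a + 1) = 0).
  { apply (pint_unique _ _ _ H'). revert H. apply pint_ext. intros x Hx. unfold gint. ring. }
  lra.
Qed.

Lemma Gamma_re_S (a b : R) : 0 < a -> Gamma_re (a + 1) b = a * Gamma_re a b - b * Gamma_im a b.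
Proof.
  intros Ha. pose proof (gint_parts a (fun x => cos (b * x)) (fun x => - b * sin (b * x)) Ha
    ltac:(intros x; auto_derive; trivial; ring)
    ltac:(intros x; apply (continuous_scal_r (V := R_NormedModule)); apply continuous_sin_mult)
    ltac:(intros x; apply Rabs_le; destruct (COS_bound (b * x)); lra)) as H.
  pose proof (pint_minus _ _ _ _ (pint_minus _ _ _ _ (pint_scal a _ _ (Gamma_re_pint a b Ha)) (pint_scal b _ _ (Gamma_im_pint a b Ha)))
    (Gamma_re_pint (a + 1) b ltac:(lra))) as H'.
  assert (E : a * Gamma_re a b - b * Gamma_im a b - Gamma_re (a + 1) b = 0).
  { apply (pint_unique _ _ _ H'). revert H. apply pint_ext. intros x Hx. unfold gint. ring. }
  lra.
Qed.

Lemma Gamma_im_S (a b : R) : 0 < a -> Gamma_im (a + 1) b = a * Gamma_im a b + b * Gamma_re a b.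
Proof.
  intros Ha. pose proof (gint_parts a (fun x => sin (b * x)) (fun x => b * cos (b * x)) Ha
    ltac:(intros x; auto_derive; trivial; ring)
    ltac:(intros x; apply (continuous_scal_r (V := R_NormedModule)); apply continuous_cos_mult)
    ltac:(intros x; apply Rabs_le; destruct (SIN_bound (b * x)); lra)) as H.
  pose proof (pint_minus _ _ _ _ (pint_plus _ _ _ _ (pint_scal a _ _ (Gamma_im_pint a b Ha)) (pint_scal b _ _ (Gamma_re_pint a b Ha)))
    (Gamma_im_pint (a + 1) b ltac:(lra))) as H'.
  assert (E : a * Gamma_im a b + b * Gamma_re a b - Gamma_im (a + 1) b = 0).
  { apply (pint_unique _ _ _ H'). revert H. apply pint_ext. intros x Hx. unfold gint. ring. }
  lra.
Qed.

Definition Gamma_norm2 (a b : R) : R := Gamma_re a b ^ 2 + Gamma_im a b ^ 2.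

Lemma Cmod_CGamma (a b : R) : 0 < a -> Cmod (CGamma (a, b)) ^ 2 = Gamma_norm2 a b.
Proof.
  intros Ha. rewrite CGamma_eq by trivial. unfold Cmod. simpl fst; simpl snd.
  assert (0 <= Gamma_re a b ^ 2 + Gamma_im a b ^ 2) by (pose proof (pow2_ge_0 (Gamma_re a b)); pose proof (pow2_ge_0 (Gamma_im a b)); lra).
  rewrite pow2_sqrt; trivial.
Qed.

Lemma Gamma_norm2_S (a b : R) : 0 < a -> Gamma_norm2 (a + 1) b = (a ^ 2 + b ^ 2) * Gamma_norm2 a b.
Proof. intros Ha. unfold Gamma_norm2. rewrite Gamma_re_S, Gamma_im_S by trivial. ring. Qed.

Lemma RGamma_pos (a : R) : 0 < a -> 0 < RGamma a.
Proof.
  intros Ha.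
  pose proof (RGamma_pint a Ha) as H.
  assert (Cg : forall x, 0 < x -> continuous (gint a (fun _ => 1)) x).
  { intros x Hx. apply continuous_gint; trivial. intros; apply continuous_const. }
  assert (Pos : forall x, 0 < x -> 0 < gint a (fun _ => 1) x).
  { intros x Hx. unfold gint. rewrite Rmult_1_r. apply Rmult_lt_0_compat; apply exp_pos. }
  assert (L : 0 < RInt (gint a (fun _ => 1)) 1 2).
  { apply RInt_gt_0; try lra.
    - intros x Hx. apply Pos; lra.
    - intros x Hx. apply Cg; lra. }
  apply Rlt_le_trans with (1 := L).
  apply (is_lim_seq_le_loc (fun _ => RInt (gint a (fun _ => 1)) 1 2) (truncated (gint a (fun _ => 1))) (Finite _) (Finite _)).
  - exists 1%nat. intros n Hn. apply le_INR in Hn. simpl in Hn. unfold truncated. rewrite S_INR.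
    assert (Hi : 0 < / (INR n + 1) <= 1).
    { split; [apply Rinv_0_lt_compat; lra|]. rewrite <- Rinv_1. apply Rinv_le_contravar; lra. }
    assert (E : forall u v, 0 < u -> 0 < v -> ex_RInt (gint a (fun _ => 1)) u v) by (intros; now apply ex_RInt_pos).
    rewrite <- (RInt_Chasles (V := R_CompleteNormedModule) _ (/ (INR n + 1)) 1 (INR n + 1)) by (apply E; lra).
    rewrite <- (RInt_Chasles (V := R_CompleteNormedModule) _ 1 2 (INR n + 1)) by (apply E; lra).
    unfold plus; simpl.
    assert (0 <= RInt (gint a (fun _ => 1)) (/ (INR n + 1)) 1).
    { apply RInt_ge_0; [lra|apply E; lra|]. intros x Hx. left. apply Pos. lra. }
    assert (0 <= RInt (gint a (fun _ => 1)) 2 (INR n + 1)).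
    { apply RInt_ge_0; [lra|apply E; lra|]. intros x Hx. left. apply Pos. lra. }
    lra.
  - apply is_lim_seq_const.
  - now apply is_lim_seq_truncated.
Qed.

(** With [p + iq] the value of Gamma at [a + ib], integrating [p cos (b ln t) + q sin (b ln t)]
    against the Gamma density gives [p^2 + q^2], while pointwise it is at most
    [sqrt (p^2 + q^2)]. *)
Lemma Gamma_norm2_le (a b : R) : 0 < a -> Gamma_norm2 a b <= RGamma a ^ 2.
Proof.
  intros Ha. set (N := Gamma_norm2 a b).
  assert (HN : 0 <= N) by (unfold N, Gamma_norm2; pose proof (pow2_ge_0 (Gamma_re a b)); pose proof (pow2_ge_0 (Gamma_im a b)); lra).
  pose proof (pint_plus _ _ _ _ (pint_scal (Gamma_re a b) _ _ (Gamma_re_pint a b Ha)) (pint_scal (Gamma_im a b) _ _ (Gamma_im_pint a b Ha))) as H1.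
  pose proof (pint_scal (sqrt N) _ _ (RGamma_pint a Ha)) as H2.
  assert (L : Gamma_re a b * Gamma_re a b + Gamma_im a b * Gamma_im a b <= sqrt N * RGamma a).
  { refine (pint_le _ _ _ _ _ _ _ H1 H2).
    - intros x Hx. apply (continuous_plus (V := R_NormedModule)); apply (continuous_scal_r (V := R_NormedModule));
        apply continuous_gint; trivial; intros; [apply continuous_cos_mult|apply continuous_sin_mult].
    - intros x Hx. apply (continuous_scal_r (V := R_NormedModule)), continuous_gint; trivial. intros; apply continuous_const.
    - intros x Hx. unfold gint. set (w := Rpower x (a - 1) * exp (- x)).
      assert (Hw : 0 < w) by (apply Rmult_lt_0_compat; apply exp_pos).
      replace (Gamma_re a b * (w * cos (b * ln x)) + Gamma_im a b * (w * sin (b * ln x))) with (w * (Gamma_re a b * cos (b * ln x) + Gamma_im a b * sin (b * ln x))) by ring.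
      replace (sqrt N * (w * 1)) with (w * sqrt N) by ring. apply Rmult_le_compat_l; [lra|].
      apply Rle_trans with (1 := Rle_abs _). rewrite <- (Rabs_pos_eq (sqrt N)) by apply sqrt_pos.
      apply Rsqr_le_abs_0. unfold Rsqr. rewrite sqrt_sqrt by trivial. unfold N, Gamma_norm2.
      pose proof (sin2_cos2 (b * ln x)) as T. unfold Rsqr in T.
      set (p := Gamma_re a b). set (q := Gamma_im a b). set (C := cos (b * ln x)) in *. set (S := sin (b * ln x)) in *.
      pose proof (pow2_ge_0 (p * S - q * C)).
      replace (p ^ 2 + q ^ 2) with ((p ^ 2 + q ^ 2) * (S * S + C * C)) by (rewrite T; ring). nra. }
  replace (Gamma_re a b * Gamma_re a b + Gamma_im a b * Gamma_im a b) with N in L by (unfold N, Gamma_norm2; ring).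
  pose proof (sqrt_sqrt N HN) as E. pose proof (sqrt_pos N) as P. pose proof (RGamma_pos a Ha) as G.
  assert (sqrt N <= RGamma a).
  { destruct P as [P|P]; [|rewrite <- P; lra]. apply Rmult_le_reg_l with (sqrt N); trivial. lra. }
  nra.
Qed.

(** The phase is measured from [ln A], around which the density [t^(A-1) exp(-t)] concentrates.
    Since [cosh (ln (t / A)) = (t/A + A/t) / 2], the error [b^2 (cosh - 1)] integrates exactly to
    Gamma values at [A - 1], [A], [A + 1]. *)
Lemma Gamma_norm2_ge (A b : R) : 1 < A -> RGamma A * (1 - b ^ 2 / (2 * (A - 1))) <= sqrt (Gamma_norm2 A b).
Proof.
  intros HA.
  assert (Ha : 0 < A) by lra.
  pose proof (RGamma_pint A Ha) as P0. pose proof (RGamma_pint (A + 1) ltac:(lra)) as P1.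
  pose proof (RGamma_pint (A - 1) ltac:(lra)) as Pm.
  set (th := b * ln A).
  pose proof (pint_plus _ _ _ _ (pint_scal (cos th) _ _ (Gamma_re_pint A b Ha)) (pint_scal (sin th) _ _ (Gamma_im_pint A b Ha))) as H1.
  pose proof (pint_minus _ _ _ _ (pint_scal (1 + b ^ 2) _ _ P0)
    (pint_plus _ _ _ _ (pint_scal (b ^ 2 / (2 * A)) _ _ P1) (pint_scal (b ^ 2 * A / 2) _ _ Pm))) as H2.
  assert (Em : RGamma A = (A - 1) * RGamma (A - 1)).
  { rewrite <- RGamma_S by lra. f_equal. ring. }
  assert (L : (1 + b ^ 2) * RGamma A - (b ^ 2 / (2 * A) * RGamma (A + 1) + b ^ 2 * A / 2 * RGamma (A - 1))
     <= cos th * Gamma_re A b + sin th * Gamma_im A b).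
  { refine (pint_le _ _ _ _ _ _ _ H2 H1).
    - intros x Hx. apply (continuous_minus (V := R_NormedModule)); [|apply (continuous_plus (V := R_NormedModule))];
        apply (continuous_scal_r (V := R_NormedModule)), continuous_gint; trivial; intros; apply continuous_const.
    - intros x Hx. apply (continuous_plus (V := R_NormedModule)); apply (continuous_scal_r (V := R_NormedModule));
        apply continuous_gint; trivial; intros; [apply continuous_cos_mult|apply continuous_sin_mult].
    - intros x Hx. unfold gint.
      replace (A - 1 - 1) with (A - 2) by ring. replace (A + 1 - 1) with A by ring.
      replace (Rpower x A) with (Rpower x (A - 2) * (x * x)).
      2:{ replace (x * x) with (Rpower x 2) by (change 2 with (INR 2); rewrite Rpower_pow by lra; simpl; ring).
          rewrite <- Rpower_plus. f_equal. ring. }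
      replace (Rpower x (A - 1)) with (Rpower x (A - 2) * x).
      2:{ rewrite <- (Rpower_1 x) at 2 by lra. rewrite <- Rpower_plus. f_equal. ring. }
      assert (Hw : 0 < Rpower x (A - 2) * exp (- x)) by (apply Rmult_lt_0_compat; apply exp_pos).
      pose proof (one_minus_cos_le b (ln x - ln A)) as Q.
      replace (b * (ln x - ln A)) with (b * ln x - th) in Q by (unfold th; ring).
      rewrite cos_minus in Q.
      assert (Ech : cosh (ln x - ln A) = (x / A + A / x) / 2).
      { unfold cosh. replace (ln x - ln A) with (ln (x / A)) by (unfold Rdiv; rewrite ln_mult, ln_Rinv; try lra; apply Rinv_0_lt_compat; lra).
        rewrite exp_Ropp, exp_ln by (apply Rdiv_lt_0_compat; lra). f_equal. f_equal. field. lra. }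
      rewrite Ech in Q. rewrite Rabs_minus_sym in Q.
      pose proof (Rle_trans _ _ _ (Rle_abs _) Q) as Q'.
      match goal with |- ?l <= ?r => replace l with (Rpower x (A - 2) * exp (- x) * (x * (1 - b ^ 2 * ((x / A + A / x) / 2 - 1)))) by (field; lra);
        replace r with (Rpower x (A - 2) * exp (- x) * (x * (cos (b * ln x) * cos th + sin (b * ln x) * sin th))) by ring end.
      apply Rmult_le_compat_l; [lra|]. apply Rmult_le_compat_l; lra. }
  rewrite RGamma_S in L by lra.
  assert (HN : 0 <= Gamma_norm2 A b) by (unfold Gamma_norm2; pose proof (pow2_ge_0 (Gamma_re A b)); pose proof (pow2_ge_0 (Gamma_im A b)); lra).
  apply Rle_trans with (cos th * Gamma_re A b + sin th * Gamma_im A b).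
  - apply Rle_trans with (2 := L). right. rewrite Em. field. lra.
  - apply Rle_trans with (1 := Rle_abs _). rewrite <- (Rabs_pos_eq (sqrt _)) by apply sqrt_pos.
    apply Rsqr_le_abs_0. unfold Rsqr. rewrite sqrt_sqrt by trivial. unfold Gamma_norm2.
    pose proof (sin2_cos2 th) as T. unfold Rsqr in T.
    set (p := Gamma_re A b). set (q := Gamma_im A b). set (C := cos th) in *. set (S := sin th) in *.
    pose proof (pow2_ge_0 (p * S - q * C)).
    replace (p ^ 2 + q ^ 2) with ((p ^ 2 + q ^ 2) * (S * S + C * C)) by (rewrite T; ring). nra.
Qed.

Lemma RGamma_poch (z : R) (n : nat) : 0 < z -> RGamma (z + INR n) = poch z n * RGamma z.
Proof.
  intros Hz. induction n as [|n IH]; [simpl; rewrite Rplus_0_r; ring|].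
  pose proof (pos_INR n). rewrite S_INR, <- Rplus_assoc, RGamma_S by lra. rewrite IH. simpl. ring.
Qed.

(* Both bounds integrate [1 + z (1 - 1/r) <= r^z <= 1 + z (r - 1)] with [r = t / A] against the Gamma density. *)
Lemma RGamma_shift_bounds (A z : R) : 1 < A -> 0 <= z <= 1 ->
  RGamma A * Rpower A z * (1 - z / (A - 1)) <= RGamma (A + z) <= RGamma A * Rpower A z.
Proof.
  intros HA Hz.
  pose proof (RGamma_pint A ltac:(lra)) as P0. pose proof (RGamma_pint (A + 1) ltac:(lra)) as P1.
  pose proof (RGamma_pint (A - 1) ltac:(lra)) as Pm. pose proof (RGamma_pint (A + z) ltac:(lra)) as Pz.
  assert (Em : RGamma A = (A - 1) * RGamma (A - 1)) by (rewrite <- RGamma_S by lra; f_equal; ring).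
  assert (E1 : RGamma (A + 1) = A * RGamma A) by (apply RGamma_S; lra).
  assert (Hp : 0 < Rpower A z) by apply exp_pos.
  pose proof (pint_scal (Rpower A z) _ _ (pint_minus _ _ _ _ (pint_scal (1 + z) _ _ P0) (pint_scal (z * A) _ _ Pm))) as H1.
  pose proof (pint_scal (Rpower A z) _ _ (pint_plus _ _ _ _ (pint_scal (1 - z) _ _ P0) (pint_scal (z / A) _ _ P1))) as H2.
  assert (Cg : forall s x, 0 < x -> continuous (gint s (fun _ => 1)) x).
  { intros s x Hx. apply continuous_gint; trivial. intros; apply continuous_const. }
  assert (W : forall x, 0 < x ->
    gint (A - 1) (fun _ => 1) x = / x * gint A (fun _ => 1) x /\ gint (A + 1) (fun _ => 1) x = x * gint A (fun _ => 1) x /\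
    gint (A + z) (fun _ => 1) x = Rpower A z * Rpower (x / A) z * gint A (fun _ => 1) x).
  { intros x Hx. unfold gint.
    replace (A - 1 - 1) with (- (1) + (A - 1)) by ring. replace (A + 1 - 1) with (1 + (A - 1)) by ring.
    replace (A + z - 1) with (z + (A - 1)) by ring. rewrite !Rpower_plus.
    rewrite (Rpower_Ropp x 1), Rpower_1 by trivial.
    replace (Rpower x z) with (Rpower A z * Rpower (x / A) z).
    2:{ rewrite Rpower_mult_distr by (try apply Rdiv_lt_0_compat; lra). f_equal. field. lra. }
    repeat split; ring. }
  assert (L1 : Rpower A z * ((1 + z) * RGamma A - z * A * RGamma (A - 1)) <= RGamma (A + z)).
  { refine (pint_le _ _ _ _ _ _ _ H1 Pz).
    - intros x Hx. apply (continuous_scal_r (V := R_NormedModule)), (continuous_minus (V := R_NormedModule));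
        apply (continuous_scal_r (V := R_NormedModule)); now apply Cg.
    - intros x Hx. now apply Cg.
    - intros x Hx. destruct (W x Hx) as [W1 [W2 W3]]. rewrite W1, W3.
      assert (G : 0 < gint A (fun _ => 1) x) by (unfold gint; rewrite Rmult_1_r; apply Rmult_lt_0_compat; apply exp_pos).
      assert (Hr : 0 < x / A) by (apply Rdiv_lt_0_compat; lra).
      assert (B : 1 + z * (1 - A / x) <= Rpower (x / A) z).
      { unfold Rpower. apply Rle_trans with (2 := exp_ineq1_le _).
        assert (1 - A / x <= ln (x / A)); [|nra].
        pose proof (exp_ineq1_le (- ln (x / A))) as X. rewrite exp_Ropp, exp_ln in X by trivial.
        replace (/ (x / A)) with (A / x) in X by (field; lra). lra. }
      replace (Rpower A z * ((1 + z) * gint A (fun _ => 1) x - z * A * (/ x * gint A (fun _ => 1) x)))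
        with (Rpower A z * (1 + z * (1 - A / x)) * gint A (fun _ => 1) x) by (field; lra).
      apply Rmult_le_compat_r; [lra|]. apply Rmult_le_compat_l; lra. }
  assert (L2 : RGamma (A + z) <= Rpower A z * ((1 - z) * RGamma A + z / A * RGamma (A + 1))).
  { refine (pint_le _ _ _ _ _ _ _ Pz H2).
    - intros x Hx. now apply Cg.
    - intros x Hx. apply (continuous_scal_r (V := R_NormedModule)), (continuous_plus (V := R_NormedModule));
        apply (continuous_scal_r (V := R_NormedModule)); now apply Cg.
    - intros x Hx. destruct (W x Hx) as [W1 [W2 W3]]. rewrite W2, W3.
      assert (G : 0 < gint A (fun _ => 1) x) by (unfold gint; rewrite Rmult_1_r; apply Rmult_lt_0_compat; apply exp_pos).
      assert (Hr : 0 < x / A) by (apply Rdiv_lt_0_compat; lra).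
      assert (B : Rpower (x / A) z <= 1 + z * (x / A - 1)).
      { set (r := x / A) in *. set (w := 1 + z * (r - 1)).
        assert (Hw : 0 < w) by (unfold w; destruct (Rle_dec z (1/2)); nra).
        assert (L : forall q, 0 < q -> ln q <= ln w + (q / w - 1)).
        { intros q Hq. assert (0 < q / w) by (apply Rdiv_lt_0_compat; lra).
          pose proof (exp_ineq1_le (ln (q / w))) as X. rewrite exp_ln in X by trivial.
          replace (ln q) with (ln (q / w) + ln w); [lra|]. rewrite <- ln_mult by lra. f_equal. field. lra. }
        pose proof (L r Hr) as Lr. pose proof (L 1 ltac:(lra)) as L1'. rewrite ln_1 in L1'.
        assert (E : z * ln r <= ln w).
        { assert (z * ln r + (1 - z) * 0 <= z * (ln w + (r / w - 1)) + (1 - z) * (ln w + (1 / w - 1))).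
          { apply Rplus_le_compat; apply Rmult_le_compat_l; lra. }
          replace (z * (ln w + (r / w - 1)) + (1 - z) * (ln w + (1 / w - 1))) with (ln w + (1 + z * (r - 1) - w) / w) in * by (field; lra).
          replace (1 + z * (r - 1) - w) with 0 in * by (unfold w; ring). unfold Rdiv in *. rewrite Rmult_0_l in *. lra. }
        unfold Rpower. rewrite <- (exp_ln w Hw). destruct E as [E|E]; [left; now apply exp_increasing|rewrite E; lra]. }
      replace (Rpower A z * ((1 - z) * gint A (fun _ => 1) x + z / A * (x * gint A (fun _ => 1) x)))
        with (Rpower A z * (1 + z * (x / A - 1)) * gint A (fun _ => 1) x) by (field; lra).
      apply Rmult_le_compat_r; [lra|]. apply Rmult_le_compat_l; lra. }
  split.
  - apply Rle_trans with (2 := L1). right. rewrite Em. field. lra.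
  - apply Rle_trans with (1 := L2). right. rewrite E1. field. lra.
Qed.

(** Gauss's product: [RGamma (INR n)] is [(n - 1)!] for [n >= 1], and by [RGamma_poch] the ratio
    equals [RGamma (z + n) / (RGamma z * RGamma n * n^z)]. *)
Definition gauss_ratio (z : R) (n : nat) : R := poch z n / (RGamma (INR n) * Rpower (INR n) z).

(** For [z <= 1] the shift bounds at [A = n] squeeze the ratio. A larger [z] is lowered by 1 at a
    time, each step costing a factor [1 + (z - 1) / n] that tends to 1. *)
Lemma gauss_ratio_limit (z : R) : 0 < z -> is_lim_seq (gauss_ratio z) (/ RGamma z).
Proof.
  assert (Main : forall k z, 0 < z <= INR (S k) -> is_lim_seq (gauss_ratio z) (/ RGamma z)).
  { intros k. induction k as [|k IH]; intros y Hy.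
    - simpl in Hy. pose proof (RGamma_pos y ltac:(lra)) as G.
      apply is_lim_seq_le_le_loc with (fun n => / RGamma y * (1 - y / (INR n - 1))) (fun _ => / RGamma y).
      + exists 2%nat. intros n Hn. apply le_INR in Hn. simpl in Hn. unfold gauss_ratio.
        destruct (RGamma_shift_bounds (INR n) y ltac:(lra) ltac:(lra)) as [L1 L2].
        rewrite Rplus_comm, RGamma_poch in L1, L2 by lra.
        assert (Q : 0 < RGamma (INR n) * Rpower (INR n) y) by (apply Rmult_lt_0_compat; [apply RGamma_pos; lra|apply exp_pos]).
        set (q := RGamma (INR n) * Rpower (INR n) y) in *.
        split; apply Rmult_le_reg_r with (q * RGamma y); try (apply Rmult_lt_0_compat; lra).
        * replace (/ RGamma y * (1 - y / (INR n - 1)) * (q * RGamma y)) with (q * (1 - y / (INR n - 1))) by (field; lra).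
          replace (poch y n / q * (q * RGamma y)) with (poch y n * RGamma y) by (field; lra). lra.
        * replace (/ RGamma y * (q * RGamma y)) with q by (field; lra).
          replace (poch y n / q * (q * RGamma y)) with (poch y n * RGamma y) by (field; lra). lra.
      + replace (Finite (/ RGamma y)) with (Rbar_mult (/ RGamma y) (1 - 0)) by (simpl; f_equal; ring).
        apply is_lim_seq_scal_l. apply is_lim_seq_minus'; [apply is_lim_seq_const|].
        apply (is_lim_seq_incr_1 (fun n => y / (INR n - 1))).
        apply is_lim_seq_ext with (fun n => y / INR n); [|apply is_lim_seq_inv_nat].
        intros n. rewrite S_INR. f_equal. ring.
      + apply is_lim_seq_const.
    - destruct (Rle_dec y (INR (S k))) as [Hk|Hk]; [apply IH; lra|].
      rewrite S_INR in Hy.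
      assert (H1 : 0 < y - 1) by (rewrite S_INR in Hk; pose proof (pos_INR k); lra).
      specialize (IH (y - 1) ltac:(lra)).
      assert (E : RGamma y = (y - 1) * RGamma (y - 1)) by (rewrite <- RGamma_S by lra; f_equal; ring).
      pose proof (RGamma_pos (y - 1) H1) as G.
      apply is_lim_seq_ext_loc with (fun n => / (y - 1) * (gauss_ratio (y - 1) n * (1 + (y - 1) / INR n))).
      + exists 1%nat. intros n Hn. apply le_INR in Hn. simpl in Hn. unfold gauss_ratio.
        assert (P : poch y n = poch (y - 1) n * (y - 1 + INR n) / (y - 1)).
        { assert (E' := poch_shift (y - 1) n). replace (y - 1 + 1) with y in E' by ring. simpl in E'. rewrite E'. field. lra. }
        rewrite P. replace (Rpower (INR n) y) with (Rpower (INR n) (y - 1) * INR n).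
        2:{ rewrite <- (Rpower_1 (INR n)) at 2 by lra. rewrite <- Rpower_plus. f_equal. ring. }
        pose proof (RGamma_pos (INR n) ltac:(lra)). assert (0 < Rpower (INR n) (y - 1)) by apply exp_pos.
        field. repeat split; lra.
      + replace (Finite (/ RGamma y)) with (Rbar_mult (/ (y - 1)) (/ RGamma (y - 1) * (1 + 0))).
        2:{ simpl. f_equal. rewrite E. field. split; lra. }
        apply is_lim_seq_scal_l. apply is_lim_seq_mult'; trivial.
        apply is_lim_seq_plus'; [apply is_lim_seq_const|apply is_lim_seq_inv_nat]. }
  intros Hz. destruct (nfloor_ex z ltac:(lra)) as [k [_ Hk]]. apply (Main k). rewrite S_INR. lra.
Qed.

(** The powers of [n] cancel because [(a + 1/2) + (c - a) = c + 1/2]. This supplies the limits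
    assumed by the kernel lemmas. *)
Lemma eta_ratio_limit (a c : R) : 0 < a < c ->
  is_lim_seq (eta_ratio a c) (RGamma c * RGamma (1/2) / (RGamma (a + 1/2) * RGamma (c - a))).
Proof.
  intros Ha.
  assert (G : forall x, 0 < x -> RGamma x <> 0) by (intros x Hx; pose proof (RGamma_pos x Hx); lra).
  apply is_lim_seq_ext_loc with (fun n => gauss_ratio (a + 1/2) n * gauss_ratio (c - a) n / (gauss_ratio c n * gauss_ratio (1/2) n)).
  - exists 1%nat. intros n Hn. apply le_INR in Hn. simpl in Hn. unfold gauss_ratio, eta_ratio.
    assert (P1 := poch_pos c n ltac:(lra)). assert (P2 := poch_pos (1/2) n ltac:(lra)).
    assert (E : Rpower (INR n) (a + 1/2) * Rpower (INR n) (c - a) = Rpower (INR n) c * Rpower (INR n) (1/2)).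
    { rewrite <- !Rpower_plus. f_equal. ring. }
    assert (Q1 : 0 < Rpower (INR n) (a + 1/2)) by apply exp_pos. assert (Q2 : 0 < Rpower (INR n) (c - a)) by apply exp_pos.
    assert (Q3 : 0 < Rpower (INR n) c) by apply exp_pos. assert (Q4 : 0 < Rpower (INR n) (1/2)) by apply exp_pos.
    assert (Q5 : 0 < RGamma (INR n)) by (apply RGamma_pos; lra).
    set (p1 := Rpower (INR n) (a + 1/2)) in *. set (p2 := Rpower (INR n) (c - a)) in *.
    set (p3 := Rpower (INR n) c) in *. set (p4 := Rpower (INR n) (1/2)) in *.
    match goal with |- ?l = ?r => replace l with (r * (p3 * p4 / (p1 * p2))) by (field; repeat split; lra) end.
    rewrite <- E. field. repeat split; lra.
  - replace (Finite _) with (Finite (/ RGamma (a + 1/2) * / RGamma (c - a) / (/ RGamma c * / RGamma (1/2)))).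
    2:{ f_equal. field. repeat split; apply G; lra. }
    apply is_lim_seq_div'.
    + apply is_lim_seq_mult'; apply gauss_ratio_limit; lra.
    + apply is_lim_seq_mult'; apply gauss_ratio_limit; lra.
    + apply Rmult_integral_contrapositive_currified; apply Rinv_neq_0_compat, G; lra.
Qed.

(** The even and odd factors of the product on the right are, up to factors 2, those of the two
    products on the left. *)
Lemma poch_duplication (z : R) (k : nat) : poch z k * poch (z + 1/2) k * 4 ^ k = poch (2 * z) (2 * k).
Proof.
  induction k as [|k IH]; [simpl; ring|].
  replace (2 * S k)%nat with (S (S (2 * k))) by lia.
  change (poch (2 * z) (S (S (2 * k)))) with (poch (2 * z) (2 * k) * (2 * z + INR (2 * k)) * (2 * z + INR (S (2 * k)))).
  rewrite <- IH, S_INR, mult_INR. simpl. field.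
Qed.

(** By [poch_duplication] the quotient [RGamma (2 z) / (4^z RGamma z RGamma (z + 1/2))] is the limit
    of a sequence [s] that does not involve [z], so it can be evaluated at [z = 1/2]. *)
Lemma RGamma_duplication (z : R) : 0 < z ->
  Rpower 4 z * (RGamma z * RGamma (z + 1/2)) = 2 * RGamma (1/2) * RGamma (2 * z).
Proof.
  assert (G : forall x, 0 < x -> RGamma x <> 0) by (intros x Hx; pose proof (RGamma_pos x Hx); lra).
  pose (s := fun k => RGamma (INR (2 * k)) / (4 ^ k * RGamma (INR k) ^ 2 * Rpower (INR k) (1/2))).
  assert (Main : forall z, 0 < z -> is_lim_seq s (RGamma (2 * z) / (Rpower 4 z * (RGamma z * RGamma (z + 1/2))))).
  { intros y Hy.
    assert (Q : 0 < Rpower 4 y) by apply exp_pos.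
    apply is_lim_seq_ext_loc with (fun k => / Rpower 4 y * (gauss_ratio y k * gauss_ratio (y + 1/2) k / gauss_ratio (2 * y) (2 * k))).
    - exists 1%nat. intros k Hk. apply le_INR in Hk. simpl in Hk. unfold gauss_ratio, s.
      rewrite <- poch_duplication.
      assert (P1 := poch_pos y k ltac:(lra)). assert (P2 := poch_pos (y + 1/2) k ltac:(lra)).
      assert (E : Rpower (INR (2 * k)) (2 * y) = Rpower 4 y * (Rpower (INR k) y * Rpower (INR k) y)).
      { assert (E2 : Rpower 2 2 = 4) by (change (Rpower 2 (INR 2) = 4); rewrite Rpower_pow by lra; simpl; ring).
        rewrite mult_INR, <- E2, Rpower_mult, <- Rpower_plus. change (INR 2) with 2.
        rewrite <- Rpower_mult_distr by lra. f_equal. f_equal. ring. }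
      rewrite E, Rpower_plus.
      assert (0 < Rpower (INR k) y) by apply exp_pos. assert (0 < Rpower (INR k) (1/2)) by apply exp_pos.
      assert (0 < RGamma (INR k)) by (apply RGamma_pos; lra). assert (0 < RGamma (INR (2 * k))) by (apply RGamma_pos; rewrite mult_INR; simpl; lra).
      assert (0 < 4 ^ k) by (apply pow_lt; lra).
      field. repeat split; lra.
    - replace (Finite _) with (Rbar_mult (/ Rpower 4 y) (/ RGamma y * / RGamma (y + 1/2) / (/ RGamma (2 * y)))).
      2:{ simpl. f_equal. field. repeat split; try (apply G; lra). lra. }
      apply is_lim_seq_scal_l. apply is_lim_seq_div'.
      + apply is_lim_seq_mult'; apply gauss_ratio_limit; lra.
      + apply (is_lim_seq_subseq (gauss_ratio (2 * y)) _ (fun k => (2 * k)%nat)); [|apply gauss_ratio_limit; lra].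
        apply eventually_subseq. intros k; lia.
      + apply Rinv_neq_0_compat, G; lra. }
  intros Hz.
  pose proof (is_lim_seq_unique _ _ (Main z Hz)) as E1. pose proof (is_lim_seq_unique _ _ (Main (1/2) ltac:(lra))) as E2.
  rewrite E1 in E2. injection E2 as E.
  replace (2 * (1/2)) with 1 in E by field. replace (1/2 + 1/2) with 1 in E by field.
  assert (F : Rpower 4 (1/2) = 2).
  { replace 4 with (2 * 2) by ring. rewrite <- Rpower_mult_distr, <- Rpower_plus by lra.
    replace (1/2 + 1/2) with 1 by field. apply Rpower_1; lra. }
  rewrite F in E.
  assert (G1 := G z Hz). assert (G2 := G (z + 1/2) ltac:(lra)). assert (G3 := G 1 ltac:(lra)). assert (G4 := G (1/2) ltac:(lra)).
  assert (Q : 0 < Rpower 4 z) by apply exp_pos.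
  set (g1 := RGamma z) in *. set (g2 := RGamma (z + 1/2)) in *. set (g3 := RGamma 1) in *. set (g4 := RGamma (1/2)) in *.
  set (g5 := RGamma (2 * z)) in *. set (w := Rpower 4 z) in *.
  replace (2 * g4 * g5) with (2 * g4 * (g5 / (w * (g1 * g2))) * (w * (g1 * g2))) by (field; repeat split; lra).
  rewrite E. field. split; lra.
Qed.

(** * The cosine integral of a power of cosh, and the modulus of Gamma *)

Definition beta (a b : R) : R := real (Lim_seq (fun n => betaT a b (INR n))).

Lemma beta_lim (a b : R) : 0 < a -> is_lim_seq (fun n => betaT a b (INR n)) (beta a b).
Proof.
  intros Ha. destruct (beta_ex a b Ha) as [l Hl]. unfold beta.
  now rewrite (is_lim_seq_unique _ _ Hl).
Qed.

Lemma cosh_Rpower_S (a v : R) : Rpower (cosh v) (-2 * (a + 1)) = / cosh v ^ 2 * Rpower (cosh v) (-2 * a).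
Proof.
  pose proof (cosh_pos v). replace (-2 * (a + 1)) with (- INR 2 + -2 * a) by (simpl; ring).
  now rewrite Rpower_plus, Rpower_Ropp, Rpower_pow by trivial.
Qed.

Lemma is_RInt_betaT (a b T : R) : is_RInt (fun v => cos (2 * b * v) * Rpower (cosh v) (-2 * a)) 0 T (betaT a b T).
Proof.
  apply (RInt_correct (V := R_CompleteNormedModule)), (ex_RInt_continuous (V := R_CompleteNormedModule)).
  intros z _. apply betaT_integrand.
Qed.

(** Two integrations by parts raise [a] by one. The right side is the boundary term at [T], which
    the power of [cosh T] sends to 0. *)
Lemma betaT_S (a b T : R) :
  4 * (a ^ 2 + b ^ 2) * betaT a b T - 2 * a * (2 * a + 1) * betaT (a + 1) b T =
  (-2 * a * cos (2 * b * T) * (sinh T / cosh T) + 2 * b * sin (2 * b * T)) * Rpower (cosh T) (-2 * a).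
Proof.
  pose (F := fun v => (-2 * a * cos (2 * b * v) * (sinh v / cosh v) + 2 * b * sin (2 * b * v)) * Rpower (cosh v) (-2 * a)).
  pose (f := fun v => 4 * (a ^ 2 + b ^ 2) * (cos (2 * b * v) * Rpower (cosh v) (-2 * a))
     - 2 * a * (2 * a + 1) * (cos (2 * b * v) * Rpower (cosh v) (-2 * (a + 1)))).
  assert (H1 : is_RInt f 0 T (4 * (a ^ 2 + b ^ 2) * betaT a b T - 2 * a * (2 * a + 1) * betaT (a + 1) b T)).
  { apply (is_RInt_minus (V := R_NormedModule)); apply (is_RInt_scal (V := R_NormedModule)); apply is_RInt_betaT. }
  assert (H2 : is_RInt f 0 T (F T - F 0)).
  { apply (is_RInt_derive (V := R_CompleteNormedModule) F).
    - intros v _. unfold F, f. pose proof (cosh_pos v) as Hc. eapply is_derive_eq.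
      + apply is_derive_mult_R; [|apply is_derive_cosh_Rpower].
        apply is_derive_plus_R.
        * apply is_derive_mult_R.
          -- instantiate (1 := 4 * a * b * sin (2 * b * v)). auto_derive; trivial. ring.
          -- apply is_derive_div; [apply is_derive_sinh|apply is_derive_cosh|lra].
        * instantiate (1 := 4 * b ^ 2 * cos (2 * b * v)). auto_derive; trivial. ring.
      + rewrite cosh_Rpower_S. pose proof (cosh_sq v) as Q.
        set (C := cosh v) in *. set (S := sinh v) in *. set (P := Rpower C (-2 * a)).
        set (c := cos (2 * b * v)). set (s := sin (2 * b * v)).
        assert (ES : S * S = C ^ 2 - 1) by lra.
        match goal with |- ?l = ?r =>
          replace l with (P / C ^ 2 * (c * (-2 * a * (C ^ 2 - S * S) + 4 * b ^ 2 * C ^ 2 + 4 * a ^ 2 * (S * S)))) by (field; lra);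
          replace r with (P / C ^ 2 * (c * (4 * (a ^ 2 + b ^ 2) * C ^ 2 - 2 * a * (2 * a + 1)))) by (field; lra) end.
        rewrite ES. ring.
    - intros v _. unfold f. apply (continuous_minus (V := R_NormedModule)); apply (continuous_scal_r (V := R_NormedModule)); apply betaT_integrand. }
  rewrite <- (is_RInt_unique (V := R_CompleteNormedModule) _ _ _ _ H1), (is_RInt_unique (V := R_CompleteNormedModule) _ _ _ _ H2).
  unfold F. rewrite sinh_0, Rmult_0_r, sin_0. unfold Rdiv. rewrite !Rmult_0_l, !Rmult_0_r. ring.
Qed.

Lemma beta_S (a b : R) : 0 < a -> (a ^ 2 + b ^ 2) * beta a b = a * (a + 1/2) * beta (a + 1) b.
Proof.
  intros Ha.
  assert (L1 : is_lim_seq (fun n => 4 * (a ^ 2 + b ^ 2) * betaT a b (INR n) - 2 * a * (2 * a + 1) * betaT (a + 1) b (INR n))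
    (4 * (a ^ 2 + b ^ 2) * beta a b - 2 * a * (2 * a + 1) * beta (a + 1) b)).
  { apply is_lim_seq_minus'.
    - apply (is_lim_seq_scal_l _ _ (Finite _)). now apply beta_lim.
    - apply (is_lim_seq_scal_l _ _ (Finite _)). apply beta_lim. lra. }
  set (K := (2 * a + 2 * Rabs b) * Rpower 2 (2 * a)).
  assert (L2 : is_lim_seq (fun n => 4 * (a ^ 2 + b ^ 2) * betaT a b (INR n) - 2 * a * (2 * a + 1) * betaT (a + 1) b (INR n)) 0).
  { apply is_lim_seq_abs_0. apply is_lim_seq_le_le with (fun _ => 0) (fun n => K * exp (-2 * a * INR n)).
    - intros n. split; [apply Rabs_pos|]. rewrite betaT_S, Rabs_mult, (Rabs_pos_eq (Rpower _ _)) by (left; apply exp_pos).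
      unfold K. rewrite (Rmult_assoc (2 * a + 2 * Rabs b)). pose proof (Rabs_pos b).
      apply Rmult_le_compat; [apply Rabs_pos|left; apply exp_pos| |apply cosh_Rpower_le_exp; lra].
      apply Rle_trans with (1 := Rabs_triang _ _). unfold Rdiv. rewrite !Rabs_mult.
      assert (Hc : Rabs (cos (2 * b * INR n)) <= 1) by (apply Rabs_le; destruct (COS_bound (2 * b * INR n)); lra).
      assert (Hs : Rabs (sin (2 * b * INR n)) <= 1) by (apply Rabs_le; destruct (SIN_bound (2 * b * INR n)); lra).
      assert (Ht : Rabs (sinh (INR n)) * Rabs (/ cosh (INR n)) <= 1).
      { pose proof (cosh_pos (INR n)). rewrite Rabs_inv, (Rabs_pos_eq (cosh _)) by lra.
        apply Rmult_le_reg_r with (cosh (INR n)); trivial. rewrite Rmult_assoc, Rinv_l by lra.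
        pose proof (sinh_abs_lt_cosh (INR n)). lra. }
      rewrite (Rabs_left (-2)), (Rabs_pos_eq a), (Rabs_pos_eq 2) by lra.
      pose proof (Rabs_pos (cos (2 * b * INR n))). pose proof (Rabs_pos (sin (2 * b * INR n))).
      apply Rplus_le_compat.
      + replace (2 * a) with (- -2 * a * 1 * 1) by ring. apply Rmult_le_compat; trivial.
        * apply Rmult_le_pos; lra.
        * apply Rmult_le_pos; apply Rabs_pos.
        * apply Rmult_le_compat_l; lra.
      + rewrite <- (Rmult_1_r (2 * Rabs b)). rewrite Rmult_1_r. nra.
    - apply is_lim_seq_const.
    - replace (Finite 0) with (Rbar_mult K 0) by (simpl; f_equal; ring).
      apply is_lim_seq_scal_l. now apply exp_decay_lim. }
  pose proof (is_lim_seq_unique _ _ L1) as E1. rewrite (is_lim_seq_unique _ _ L2) in E1. injection E1 as E1. lra.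
Qed.

Lemma beta_decr (a a' : R) : 0 < a <= a' -> beta a' 0 <= beta a 0.
Proof.
  intros Ha. refine (is_lim_seq_le _ _ (Finite _) (Finite _) _ (beta_lim a' 0 ltac:(lra)) (beta_lim a 0 ltac:(lra))).
  intros n. unfold betaT. apply RInt_le; [apply pos_INR| | |].
  - eexists; apply is_RInt_betaT.
  - eexists; apply is_RInt_betaT.
  - intros v _. rewrite Rmult_0_r, Rmult_0_l, cos_0, !Rmult_1_l. apply Rle_Rpower; [apply cosh_ge_1|lra].
Qed.

Lemma beta_le_0 (a b : R) : 0 < a -> beta a b <= beta a 0.
Proof.
  intros Ha. refine (is_lim_seq_le _ _ (Finite _) (Finite _) _ (beta_lim a b Ha) (beta_lim a 0 Ha)).
  intros n. unfold betaT. apply RInt_le; [apply pos_INR| | |].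
  - eexists; apply is_RInt_betaT.
  - eexists; apply is_RInt_betaT.
  - intros v _. rewrite Rmult_0_r, Rmult_0_l, cos_0. apply Rmult_le_compat_r; [left; apply exp_pos|]. apply COS_bound.
Qed.

(** [1 - cos (2 b v) <= 4 b^2 (cosh v - 1) <= 2 b^2 (cosh^2 v - 1)]. Multiplying the weight by
    [cosh^2 v] lowers [A] by one, and the recurrence at [b = 0] brings the result back to
    [beta A 0]. *)
Lemma beta_ge_0 (A b : R) : 1 < A -> beta A 0 * (1 - b ^ 2 / (A - 1)) <= beta A b.
Proof.
  intros HA.
  assert (E := beta_S (A - 1) 0 ltac:(lra)). replace (A - 1 + 1) with A in E by ring.
  assert (Em : beta (A - 1) 0 = (A - 1/2) / (A - 1) * beta A 0).
  { apply Rmult_eq_reg_l with ((A - 1) ^ 2); [|apply pow_nonzero; lra].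
    replace ((A - 1) ^ 2 * beta (A - 1) 0) with (((A - 1) ^ 2 + 0 ^ 2) * beta (A - 1) 0) by ring. rewrite E. field. lra. }
  apply Rle_trans with ((1 + 2 * b ^ 2) * beta A 0 - 2 * b ^ 2 * beta (A - 1) 0).
  { right. rewrite Em. field. lra. }
  assert (L1 : is_lim_seq (fun n => (1 + 2 * b ^ 2) * betaT A 0 (INR n) - 2 * b ^ 2 * betaT (A - 1) 0 (INR n))
     ((1 + 2 * b ^ 2) * beta A 0 - 2 * b ^ 2 * beta (A - 1) 0)).
  { apply is_lim_seq_minus'; apply (is_lim_seq_scal_l _ _ (Finite _)); apply beta_lim; lra. }
  refine (is_lim_seq_le _ _ (Finite _) (Finite _) _ L1 (beta_lim A b ltac:(lra))).
  intros n.
  refine (is_RInt_le _ _ 0 (INR n) _ _ (pos_INR n) _ (is_RInt_betaT A b (INR n)) _).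
  - apply (is_RInt_minus (V := R_NormedModule)); apply (is_RInt_scal (V := R_NormedModule)); apply is_RInt_betaT.
  - intros v _. unfold minus, plus, opp, scal; simpl. unfold mult; simpl. rewrite Rmult_0_r, Rmult_0_l, cos_0.
    pose proof (cosh_Rpower_S (A - 1) v) as ER. replace (A - 1 + 1) with A in ER by ring.
    pose proof (cosh_ge_1 v) as Hc.
    assert (ER' : Rpower (cosh v) (-2 * (A - 1)) = cosh v ^ 2 * Rpower (cosh v) (-2 * A)).
    { rewrite ER. field. lra. }
    rewrite ER'. assert (P : 0 < Rpower (cosh v) (-2 * A)) by apply exp_pos.
    pose proof (one_minus_cos_le (2 * b) v) as Q. rewrite Rabs_minus_sym in Q. pose proof (Rle_trans _ _ _ (Rle_abs _) Q) as Q'.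
    set (R := Rpower (cosh v) (-2 * A)) in *.
    apply Rle_trans with ((1 - 2 * b ^ 2 * (cosh v ^ 2 - 1)) * R); [right; ring|].
    apply Rmult_le_compat_r; [lra|].
    assert (b ^ 2 * (2 * (cosh v - 1)) <= b ^ 2 * (cosh v ^ 2 - 1)) by (apply Rmult_le_compat_l; [apply pow2_ge_0|nra]).
    nra.
Qed.

(** The integrand is the derivative of [tanh]. This value starts the evaluation at the positive
    integers. *)
Lemma beta_1 : beta 1 0 = 1.
Proof.
  assert (L : is_lim_seq (fun n => betaT 1 0 (INR n)) 1).
  { apply is_lim_seq_le_le with (fun n => 1 - 2 * exp (-2 * 1 * INR n)) (fun _ => 1).
    - intros n. assert (E : betaT 1 0 (INR n) = sinh (INR n) / cosh (INR n)).
      { unfold betaT. apply (is_RInt_unique (V := R_CompleteNormedModule)).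
        replace (sinh (INR n) / cosh (INR n)) with (minus (sinh (INR n) / cosh (INR n)) (sinh 0 / cosh 0))
          by (rewrite sinh_0; unfold minus, plus, opp; simpl; unfold Rdiv; ring).
        apply (is_RInt_derive (V := R_CompleteNormedModule) (fun v => sinh v / cosh v)).
        - intros v _. pose proof (cosh_pos v). eapply is_derive_eq.
          + apply is_derive_div; [apply is_derive_sinh|apply is_derive_cosh|lra].
          + rewrite Rmult_0_r, Rmult_0_l, cos_0. replace (-2 * 1) with (- INR 2) by (simpl; ring).
            rewrite Rpower_Ropp, Rpower_pow by trivial. pose proof (cosh_sq v).
            replace (cosh v * cosh v - sinh v * sinh v) with 1 by lra. field. lra.
        - intros v _. apply betaT_integrand. }
      rewrite E. pose proof (cosh_pos (INR n)) as Hc.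
      assert (Hp : 0 < exp (INR n)) by apply exp_pos. assert (Hm : 0 < exp (- INR n)) by apply exp_pos.
      assert (HH : exp (-2 * 1 * INR n) = exp (- INR n) * exp (- INR n)) by (rewrite <- exp_plus; f_equal; ring).
      assert (HI : exp (INR n) * exp (- INR n) = 1) by (rewrite <- exp_plus, Rplus_opp_r; apply exp_0).
      rewrite HH. split; apply Rmult_le_reg_r with (cosh (INR n)); trivial;
        replace (sinh (INR n) / cosh (INR n) * cosh (INR n)) with (sinh (INR n)) by (field; lra); unfold sinh, cosh.
      + set (p := exp (INR n)) in *. set (q := exp (- INR n)) in *.
        replace ((1 - 2 * (q * q)) * ((p + q) / 2)) with ((p + q) / 2 - q * (p * q) - q * q * q) by field. rewrite HI.
        assert (0 < q * q * q) by (repeat apply Rmult_lt_0_compat; trivial). lra.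
      + lra.
    - replace (Finite 1) with (Finite (1 - 2 * 0)) by (f_equal; ring).
      apply is_lim_seq_minus'; [apply is_lim_seq_const|].
      apply (is_lim_seq_scal_l _ _ (Finite _)). apply exp_decay_lim. lra.
    - apply is_lim_seq_const. }
  unfold beta. now rewrite (is_lim_seq_unique _ _ L).
Qed.

Lemma RGamma_1 : RGamma 1 = 1.
Proof.
  apply (pint_unique _ _ _ (RGamma_pint 1 Rlt_0_1)).
  apply pint_ext with (fun t => exp (- t)).
  { intros x Hx. unfold gint. rewrite Rminus_diag, Rpower_O by trivial. ring. }
  replace 1 with (0 - -1) by ring.
  apply (pint_derive (fun t => - exp (- t))).
  - intros x _. auto_derive; trivial. ring.
  - intros x _. apply (ex_derive_continuous (K := R_AbsRing) (V := R_NormedModule)). auto_derive; trivial.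
  - apply (filterlim_filter_le_1 (F := locally 0)).
    + apply filter_le_within.
    + replace (-1) with (- exp (- 0)) by (rewrite Ropp_0, exp_0; ring).
      apply (ex_derive_continuous (K := R_AbsRing) (V := R_NormedModule) (fun t => - exp (- t))). auto_derive; trivial.
  - intros P [eps HP]. exists (/ eps). intros x Hx. apply HP.
    pose proof (cond_pos eps) as He. assert (H0 : 0 < / eps) by now apply Rinv_0_lt_compat.
    unfold ball; simpl; unfold AbsRing_ball; simpl. unfold abs, minus, plus, opp; simpl.
    rewrite Ropp_0, Rplus_0_r, Rabs_Ropp, Rabs_pos_eq by (left; apply exp_pos). rewrite exp_Ropp.
    rewrite <- (Rinv_inv eps). apply Rinv_lt_contravar.
    + apply Rmult_lt_0_compat; trivial. apply exp_pos.
    + pose proof (exp_ineq1_le x). lra.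
Qed.

Lemma beta_RGamma_S (a : R) : 0 < a ->
  beta (a + 1) 0 * RGamma (a + 1 + 1/2) / RGamma (a + 1) = beta a 0 * RGamma (a + 1/2) / RGamma a.
Proof.
  intros Ha. pose proof (beta_S a 0 Ha) as E. pose proof (RGamma_pos a Ha) as G.
  replace (a + 1 + 1/2) with (a + 1/2 + 1) by ring. rewrite !RGamma_S by lra.
  replace (beta a 0) with (beta (a + 1) 0 * (a + 1/2) / a).
  - field. split; lra.
  - apply Rmult_eq_reg_l with (a ^ 2); [|apply pow_nonzero; lra].
    replace (a ^ 2 * beta a 0) with ((a ^ 2 + 0 ^ 2) * beta a 0) by ring. rewrite E. field. lra.
Qed.

Lemma beta_RGamma_iter (a : R) (n : nat) : 0 < a ->
  beta (a + INR n) 0 * RGamma (a + INR n + 1/2) / RGamma (a + INR n) = beta a 0 * RGamma (a + 1/2) / RGamma a.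
Proof.
  intros Ha. induction n as [|n IH]; [simpl; now rewrite !Rplus_0_r|].
  rewrite <- IH, S_INR, <- Rplus_assoc. apply beta_RGamma_S. pose proof (pos_INR n). lra.
Qed.

Lemma RGamma_gauss (z : R) (n : nat) : 0 < z -> (1 <= n)%nat ->
  RGamma (z + INR n) = gauss_ratio z n * RGamma z * (RGamma (INR n) * Rpower (INR n) z).
Proof.
  intros Hz Hn. apply le_INR in Hn. simpl in Hn. rewrite RGamma_poch by trivial. unfold gauss_ratio.
  pose proof (RGamma_pos (INR n) ltac:(lra)). assert (0 < Rpower (INR n) z) by apply exp_pos. field. split; lra.
Qed.

Lemma gauss_ratio_pos (z : R) (n : nat) : 0 < z -> (1 <= n)%nat -> 0 < gauss_ratio z n.
Proof.
  intros Hz Hn. apply le_INR in Hn. simpl in Hn. unfold gauss_ratio. apply Rdiv_lt_0_compat.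
  - now apply poch_pos.
  - apply Rmult_lt_0_compat; [apply RGamma_pos; lra|apply exp_pos].
Qed.

(** The quotient [q] has period 1 and equals [RGamma (1/2) / 2] at positive integers. Elsewhere, in
    the manner of Bohr and Mollerup, the monotonicity of [beta] in [a] squeezes it between integer
    values far out, where Gauss's limit controls the Gamma factors. *)
Lemma beta_RGamma (a : R) : 0 < a -> beta a 0 = RGamma a * RGamma (1/2) / (2 * RGamma (a + 1/2)).
Proof.
  assert (G : forall x, 0 < x -> 0 < RGamma x) by apply RGamma_pos.
  pose (q := fun a => beta a 0 * RGamma (a + 1/2) / RGamma a).
  assert (Q1 : q 1 = RGamma (1/2) / 2).
  { unfold q. rewrite beta_1, RGamma_1. replace (1 + 1/2) with (1/2 + 1) by ring. rewrite RGamma_S by lra. field. }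
  assert (QN : forall n, (1 <= n)%nat -> q (INR n) = RGamma (1/2) / 2).
  { intros n Hn. destruct n as [|n]; [lia|]. rewrite S_INR, Rplus_comm. unfold q. rewrite beta_RGamma_iter by lra. exact Q1. }
  assert (Main : forall k a, 0 < a <= INR (S k) -> q a = RGamma (1/2) / 2).
  { intros k. induction k as [|k IH]; intros y Hy.
    - simpl in Hy.
      (* [U n] compares the Gamma quotient at [y + n] with the one at [n]; the powers of [n] cancel
         and the limit is 1. *)
      pose (U := fun n => gauss_ratio (y + 1/2) n * RGamma (y + 1/2) / (gauss_ratio y n * RGamma y * (gauss_ratio (1/2) n * RGamma (1/2)))).
      assert (LU : is_lim_seq U 1).
      { unfold U.
        assert (L : forall z, 0 < z -> is_lim_seq (fun n => gauss_ratio z n * RGamma z) 1).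
        { intros z Hz. specialize (G z Hz). replace (Finite 1) with (Rbar_mult (/ RGamma z) (RGamma z)) by (simpl; f_equal; field; lra).
          apply is_lim_seq_scal_r. now apply gauss_ratio_limit. }
        replace (Finite 1) with (Finite (1 / (1 * 1))) by (f_equal; field).
        apply is_lim_seq_div'; [apply L; lra| |lra]. apply is_lim_seq_mult'; apply L; lra. }
      assert (E : forall n, (1 <= n)%nat -> RGamma (INR n) * RGamma (y + INR n + 1/2) / (RGamma (INR n + 1/2) * RGamma (y + INR n)) = U n).
      { intros n Hn. replace (y + INR n + 1/2) with (y + 1/2 + INR n) by ring. rewrite (Rplus_comm (INR n)).
        rewrite !RGamma_gauss by (trivial; lra). rewrite Rpower_plus. unfold U.
        pose proof (gauss_ratio_pos y n ltac:(lra) Hn). pose proof (gauss_ratio_pos (1/2) n ltac:(lra) Hn).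
        pose proof (G y ltac:(lra)). pose proof (G (1/2) ltac:(lra)). apply le_INR in Hn. simpl in Hn. pose proof (G (INR n) ltac:(lra)).
        assert (0 < Rpower (INR n) y) by apply exp_pos. assert (0 < Rpower (INR n) (1/2)) by apply exp_pos.
        field. repeat split; lra. }
      assert (B : forall n, (1 <= n)%nat -> RGamma (1/2) / 2 * (U n * (INR n / (INR n + 1/2))) <= q y <= RGamma (1/2) / 2 * U n).
      { intros n Hn. rewrite <- (E n Hn). pose proof (QN n Hn) as Qa. pose proof (QN (S n) ltac:(lia)) as Qb.
        apply le_INR in Hn. simpl in Hn. rewrite S_INR in Qb. unfold q in Qa, Qb.
        unfold q. rewrite <- (beta_RGamma_iter y n) by lra.
        pose proof (G (INR n) ltac:(lra)) as G1. pose proof (G (INR n + 1/2) ltac:(lra)) as G2.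
        pose proof (G (y + INR n) ltac:(lra)) as G3. pose proof (G (y + INR n + 1/2) ltac:(lra)) as G4.
        replace (INR n + 1 + 1/2) with (INR n + 1/2 + 1) in Qb by ring. rewrite !RGamma_S in Qb by lra.
        pose proof (beta_decr (INR n) (y + INR n) ltac:(lra)) as D1. pose proof (beta_decr (y + INR n) (INR n + 1) ltac:(lra)) as D2.
        set (g1 := RGamma (INR n)) in *. set (g2 := RGamma (INR n + 1/2)) in *. set (g3 := RGamma (y + INR n)) in *.
        set (g4 := RGamma (y + INR n + 1/2)) in *.
        assert (P : 0 < g4 / g3) by now apply Rdiv_lt_0_compat.
        replace (beta (y + INR n) 0 * g4 / g3) with (beta (y + INR n) 0 * (g4 / g3)) by (field; lra).
        split.
        - rewrite <- Qb.
          match goal with |- ?l <= _ => replace l with (beta (INR n + 1) 0 * (g4 / g3)) by (field; repeat split; lra) end.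
          apply Rmult_le_compat_r; lra.
        - rewrite <- Qa.
          match goal with |- _ <= ?l => replace l with (beta (INR n) 0 * (g4 / g3)) by (field; repeat split; lra) end.
          apply Rmult_le_compat_r; lra. }
      assert (Lw : is_lim_seq (fun n => INR n / (INR n + 1/2)) 1).
      { apply is_lim_seq_ext_loc with (fun n => / (1 + 1/2 / INR n)).
        - exists 1%nat. intros n Hn. apply le_INR in Hn. simpl in Hn. field. lra.
        - replace (Finite 1) with (Rbar_inv (Finite (1 + 0))) by (simpl; f_equal; field).
          apply (is_lim_seq_inv _ (Finite (1 + 0))); [|intros X; apply (f_equal real) in X; simpl in X; lra].
          apply is_lim_seq_plus'; [apply is_lim_seq_const|apply is_lim_seq_inv_nat]. }
      assert (Lq : is_lim_seq (fun _ : nat => q y) (RGamma (1/2) / 2)).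
      { apply is_lim_seq_le_le_loc with (fun n => RGamma (1/2) / 2 * (U n * (INR n / (INR n + 1/2)))) (fun n => RGamma (1/2) / 2 * U n).
        - exists 1%nat. exact B.
        - replace (Finite (RGamma (1/2) / 2)) with (Rbar_mult (RGamma (1/2) / 2) (1 * 1)) by (simpl; f_equal; field).
          apply is_lim_seq_scal_l. now apply is_lim_seq_mult'.
        - replace (Finite (RGamma (1/2) / 2)) with (Rbar_mult (RGamma (1/2) / 2) 1) by (simpl; f_equal; field).
          now apply is_lim_seq_scal_l. }
      pose proof (is_lim_seq_unique _ _ Lq) as X. rewrite Lim_seq_const in X. now injection X.
    - destruct (Rle_dec y (INR (S k))) as [Hk|Hk]; [apply IH; lra|].
      rewrite S_INR in Hy.
      assert (H1 : 0 < y - 1) by (rewrite S_INR in Hk; pose proof (pos_INR k); lra).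
      rewrite <- (IH (y - 1)) by lra. unfold q. rewrite <- (beta_RGamma_S (y - 1)) by lra. now replace (y - 1 + 1) with y by ring. }
  intros Ha. destruct (nfloor_ex a ltac:(lra)) as [k [_ Hk]].
  specialize (Main k a ltac:(rewrite S_INR; lra)). unfold q in Main.
  pose proof (G a Ha). pose proof (G (a + 1/2) ltac:(lra)).
  replace (beta a 0) with (beta a 0 * RGamma (a + 1/2) / RGamma a * (RGamma a / RGamma (a + 1/2))) by (field; split; lra).
  rewrite Main. field. lra.
Qed.

Lemma squeeze_one (f : R -> R) (a K : R) : 0 <= K -> (forall A, 1 < A -> 1 - K / (A - 1) <= f A <= 1) ->
  0 < a -> is_lim_seq (fun n => f (a + INR n)) 1.
Proof.
  intros HK H Ha.
  apply is_lim_seq_le_le_loc with (fun n => 1 - K / (INR n - 1)) (fun _ => 1).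
  - exists 2%nat. intros n Hn. apply le_INR in Hn. simpl in Hn. destruct (H (a + INR n) ltac:(lra)) as [H1 H2].
    split; trivial. apply Rle_trans with (2 := H1).
    assert (K / (a + INR n - 1) <= K / (INR n - 1)); [|lra].
    apply Rmult_le_compat_l; trivial. apply Rinv_le_contravar; lra.
  - replace (Finite 1) with (Finite (1 - 0)) by (f_equal; ring).
    apply is_lim_seq_minus'; [apply is_lim_seq_const|].
    apply (is_lim_seq_incr_1 (fun n => K / (INR n - 1))).
    apply is_lim_seq_ext with (fun n => K / INR n); [|apply is_lim_seq_inv_nat].
    intros n. rewrite S_INR. f_equal. ring.
  - apply is_lim_seq_const.
Qed.

Lemma beta_0_pos (a : R) : 0 < a -> 0 < beta a 0.
Proof.
  intros Ha. rewrite beta_RGamma by trivial. apply Rdiv_lt_0_compat.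
  - apply Rmult_lt_0_compat; apply RGamma_pos; lra.
  - apply Rmult_lt_0_compat; [lra|]. apply RGamma_pos; lra.
Qed.

(* The two quotients satisfy the same first order recurrence in [a] and both tend to 1 along [a + n]. *)
Lemma Gamma_norm2_beta (a b : R) : 0 < a ->
  0 < Gamma_norm2 a b / RGamma a ^ 2 /\ Gamma_norm2 a b / RGamma a ^ 2 = beta a b / beta a 0.
Proof.
  intros Ha.
  pose (x := fun a => Gamma_norm2 a b / RGamma a ^ 2). pose (y := fun a => beta a b / beta a 0).
  assert (Hx0 : forall A, 0 < A -> 0 <= x A <= 1).
  { intros A HA. pose proof (RGamma_pos A HA). pose proof (Gamma_norm2_le A b HA).
    assert (0 <= Gamma_norm2 A b) by (unfold Gamma_norm2; pose proof (pow2_ge_0 (Gamma_re A b)); pose proof (pow2_ge_0 (Gamma_im A b)); lra).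
    assert (0 < RGamma A ^ 2) by (now apply pow_lt). unfold x. split.
    - apply Rmult_le_pos; [lra|]. left. now apply Rinv_0_lt_compat.
    - apply Rmult_le_reg_r with (RGamma A ^ 2); trivial. unfold Rdiv. rewrite Rmult_assoc, Rinv_l by lra. lra. }
  assert (Lx : is_lim_seq (fun n => x (a + INR n)) 1).
  { apply squeeze_one with (b ^ 2); trivial; [apply pow2_ge_0|]. intros A HA. split; [|apply Hx0; lra].
    pose proof (Gamma_norm2_ge A b HA) as L. pose proof (RGamma_pos A ltac:(lra)) as G.
    replace (b ^ 2 / (A - 1)) with (2 * (b ^ 2 / (2 * (A - 1)))) by (field; lra). set (t := b ^ 2 / (2 * (A - 1))) in *.
    destruct (Rle_dec t 1) as [Ht|Ht]; [|pose proof (Hx0 A ltac:(lra)); lra].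
    assert (HN : 0 <= Gamma_norm2 A b) by (unfold Gamma_norm2; pose proof (pow2_ge_0 (Gamma_re A b)); pose proof (pow2_ge_0 (Gamma_im A b)); lra).
    apply Rle_trans with ((1 - t) ^ 2); [nra|].
    apply Rmult_le_reg_r with (RGamma A ^ 2); [now apply pow_lt|]. unfold x, Rdiv.
    rewrite (Rmult_assoc (Gamma_norm2 A b)), Rinv_l, Rmult_1_r by (apply pow_nonzero; lra).
    rewrite <- (pow2_sqrt (Gamma_norm2 A b)) by trivial. rewrite <- Rpow_mult_distr. rewrite Rmult_comm.
    apply pow_incr. split; [apply Rmult_le_pos; lra|trivial]. }
  assert (Ly : is_lim_seq (fun n => y (a + INR n)) 1).
  { apply squeeze_one with (b ^ 2); trivial; [apply pow2_ge_0|]. intros A HA.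
    pose proof (beta_0_pos A ltac:(lra)) as P. pose proof (beta_ge_0 A b HA). pose proof (beta_le_0 A b ltac:(lra)).
    unfold y. split; apply Rmult_le_reg_r with (beta A 0); trivial; unfold Rdiv at 2 || unfold Rdiv;
      rewrite ?(Rmult_assoc (beta A b)), Rinv_l by lra; lra. }
  assert (Sx : forall A, 0 < A -> x (A + 1) = (A ^ 2 + b ^ 2) / A ^ 2 * x A).
  { intros A HA. unfold x. rewrite Gamma_norm2_S, RGamma_S by trivial. pose proof (RGamma_pos A HA). field. split; lra. }
  assert (Sy : forall A, 0 < A -> y (A + 1) = (A ^ 2 + b ^ 2) / A ^ 2 * y A).
  { intros A HA. pose proof (beta_S A b HA) as E. pose proof (beta_S A 0 HA) as E0.
    pose proof (beta_0_pos A HA) as P. pose proof (beta_0_pos (A + 1) ltac:(lra)) as P1.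
    assert (Eb : beta (A + 1) b = (A ^ 2 + b ^ 2) * beta A b / (A * (A + 1/2))) by (rewrite E; field; lra).
    assert (E0' : beta (A + 1) 0 = A ^ 2 * beta A 0 / (A * (A + 1/2))).
    { replace (A ^ 2) with (A ^ 2 + 0 ^ 2) by ring. rewrite E0. field; lra. }
    unfold y. rewrite Eb, E0'. field. repeat split; lra. }
  (* Cross-multiplied, so that no quotient is divided by before it is known to be non-zero. The
     second clause excludes [x a = 0], which would contradict the limit 1. *)
  assert (Iter : forall n, x a * y (a + INR n) = y a * x (a + INR n) /\ (x a = 0 -> x (a + INR n) = 0)).
  { intros n. induction n as [|n [IH1 IH2]].
    - simpl. rewrite Rplus_0_r. split; [ring|trivial].
    - pose proof (pos_INR n). rewrite S_INR, <- Rplus_assoc, Sx, Sy by lra. split.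
      + transitivity ((((a + INR n) ^ 2 + b ^ 2) / (a + INR n) ^ 2) * (x a * y (a + INR n))); [ring|]. rewrite IH1. ring.
      + intros X. rewrite IH2 by trivial. ring. }
  fold (x a). fold (y a). split.
  - destruct (Hx0 a Ha) as [[H|H] _]; trivial. exfalso.
    assert (L0 : is_lim_seq (fun _ : nat => 0) 1).
    { apply is_lim_seq_ext with (2 := Lx). intros n. now apply Iter. }
    apply is_lim_seq_unique in L0. rewrite Lim_seq_const in L0. injection L0. lra.
  - assert (L1 : is_lim_seq (fun n => x a * y (a + INR n)) (x a * 1)) by (now apply (is_lim_seq_scal_l _ _ (Finite 1))).
    assert (L2 : is_lim_seq (fun n => x a * y (a + INR n)) (y a * 1)).
    { apply is_lim_seq_ext with (fun n => y a * x (a + INR n)); [intros n; symmetry; apply Iter|].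
      now apply (is_lim_seq_scal_l _ _ (Finite 1)). }
    apply is_lim_seq_unique in L1. apply is_lim_seq_unique in L2. rewrite L1 in L2. injection L2. lra.
Qed.

Lemma Gamma_norm2_pos (a b : R) : 0 < a -> 0 < Gamma_norm2 a b.
Proof.
  intros Ha. destruct (Gamma_norm2_beta a b Ha) as [H _]. pose proof (RGamma_pos a Ha).
  replace (Gamma_norm2 a b) with (Gamma_norm2 a b / RGamma a ^ 2 * RGamma a ^ 2) by (field; lra).
  apply Rmult_lt_0_compat; trivial. now apply pow_lt.
Qed.

Lemma beta_pos (a b : R) : 0 < a -> 0 < beta a b.
Proof.
  intros Ha. destruct (Gamma_norm2_beta a b Ha) as [H E]. pose proof (beta_0_pos a Ha). rewrite E in H.
  replace (beta a b) with (beta a b / beta a 0 * beta a 0) by (field; lra). now apply Rmult_lt_0_compat.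
Qed.

(** The dependence on [b] cancels, since [Gamma_norm2 a b / beta a b] is free of [b] by
    [Gamma_norm2_beta]; duplication at [d] then removes [RGamma (d + 1/2)]. *)
Lemma kernel_constant (a b c d : R) : 0 < a -> 0 < d -> c = a + d ->
  RGamma c * RGamma (1/2) / (RGamma (a + 1/2) * RGamma (c - a)) * (RGamma c * RGamma (1/2) / (RGamma (d + 1/2) * RGamma (c - d)))
   / (2 * d) * (Gamma_norm2 a b / beta a b) = Rpower 4 d * RGamma c ^ 2 / RGamma (2 * d + 1).
Proof.
  intros Ha Hd ->. replace (a + d - a) with d by ring. replace (a + d - d) with a by ring.
  pose proof (RGamma_pos a Ha). pose proof (RGamma_pos d Hd). pose proof (RGamma_pos (1/2) ltac:(lra)).
  pose proof (RGamma_pos (a + 1/2) ltac:(lra)). pose proof (RGamma_pos (d + 1/2) ltac:(lra)). pose proof (RGamma_pos (2 * d) ltac:(lra)).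
  rewrite (RGamma_S (2 * d)) by lra.
  pose proof (RGamma_duplication d Hd) as D.
  destruct (Gamma_norm2_beta a b Ha) as [_ E]. pose proof (beta_pos a b Ha) as Pb. pose proof (beta_0_pos a Ha) as P0.
  assert (E1 : Gamma_norm2 a b / beta a b = 2 * RGamma a * RGamma (a + 1/2) / RGamma (1/2)).
  { replace (Gamma_norm2 a b / beta a b) with (Gamma_norm2 a b / RGamma a ^ 2 * RGamma a ^ 2 / beta a b) by (field; split; lra).
    rewrite E, beta_RGamma by trivial. field. repeat split; try lra. }
  rewrite E1.
  replace (Rpower 4 d) with (2 * RGamma (1/2) * RGamma (2 * d) / (RGamma d * RGamma (d + 1/2))) by (rewrite <- D; field; split; lra).
  field. repeat split; lra.
Qed.

(** * Exponential decay of the modulus of Gamma along vertical lines *)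

Definition Lam (b s : R) : R := s * ln (1 + b ^ 2 / s ^ 2) + 2 * b * atan (s / b).

Lemma is_derive_Lam (b s : R) : 0 < b -> 0 < s -> is_derive (Lam b) s (ln (1 + b ^ 2 / s ^ 2)).
Proof.
  intros Hb Hs. unfold Lam.
  assert (0 < b ^ 2 / s ^ 2) by (apply Rdiv_lt_0_compat; now apply pow_lt).
  auto_derive.
  - repeat split; try lra; try nra. simpl in *. lra.
  - set (w := ln (1 + b ^ 2 / s ^ 2)). unfold Rdiv in w.
    replace (ln (1 + b * (b * 1) * / (s * (s * 1)))) with w by (unfold w; simpl; reflexivity).
    clearbody w. field. repeat split; nra.
Qed.

(* [Lam b] interpolates the logarithm of the product of the [1 + b^2 / (a + k)^2] given by the recurrence of [Gamma_norm2]. *)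
Lemma Lam_step (b s : R) : 0 < b -> 0 < s -> Lam b (s + 1) - Lam b s <= ln (1 + b ^ 2 / s ^ 2).
Proof.
  intros Hb Hs.
  destruct (MVT_gen (Lam b) s (s + 1) (fun s => ln (1 + b ^ 2 / s ^ 2))) as [x [Hx E]].
  - intros x Hx. rewrite Rmin_left in Hx by lra. apply is_derive_Lam; lra.
  - intros x Hx. rewrite Rmin_left in Hx by lra. apply continuity_pt_filterlim.
    eapply is_derive_continuous. apply is_derive_Lam; lra.
  - rewrite Rmin_left, Rmax_right in Hx by lra. rewrite E. replace (s + 1 - s) with 1 by ring. rewrite Rmult_1_r.
    assert (0 < b ^ 2) by now apply pow_lt. assert (0 < s ^ 2) by now apply pow_lt.
    assert (s ^ 2 <= x ^ 2) by (apply pow_incr; lra).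
    apply ln_le.
    + assert (0 < b ^ 2 / x ^ 2) by (apply Rdiv_lt_0_compat; lra). lra.
    + apply Rplus_le_compat_l. apply Rmult_le_compat_l; [lra|]. apply Rinv_le_contravar; lra.
Qed.

(** Iterating the recurrence gives a product of the factors [1 / (1 + b^2 / (a + k)^2)], which
    [Lam_step] compares with an integral; the quotient left over at [a + n] is at most 1. *)
Lemma Gamma_norm2_Lam (a b : R) (n : nat) : 0 < a -> 0 < b -> Gamma_norm2 a b <= RGamma a ^ 2 * exp (Lam b a - Lam b (a + INR n)).
Proof.
  intros Ha Hb.
  assert (H : Gamma_norm2 a b / RGamma a ^ 2 <= exp (Lam b a - Lam b (a + INR n)) * (Gamma_norm2 (a + INR n) b / RGamma (a + INR n) ^ 2)).
  { induction n as [|n IH].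
    - simpl INR. rewrite Rplus_0_r, Rminus_diag, exp_0. lra.
    - apply Rle_trans with (1 := IH). pose proof (pos_INR n).
      rewrite S_INR, <- Rplus_assoc. set (s := a + INR n) in *. assert (Hs : 0 < s) by (unfold s; lra).
      rewrite Gamma_norm2_S, RGamma_S by trivial. pose proof (RGamma_pos s Hs) as G. pose proof (Gamma_norm2_pos s b Hs) as N.
      replace ((s ^ 2 + b ^ 2) * Gamma_norm2 s b / (s * RGamma s) ^ 2) with ((1 + b ^ 2 / s ^ 2) * (Gamma_norm2 s b / RGamma s ^ 2)) by (field; split; lra).
      rewrite <- Rmult_assoc. apply Rmult_le_compat_r.
      + left. apply Rdiv_lt_0_compat; trivial. now apply pow_lt.
      + assert (0 < b ^ 2 / s ^ 2) by (apply Rdiv_lt_0_compat; now apply pow_lt).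
        rewrite <- (exp_ln (1 + b ^ 2 / s ^ 2)) by lra. rewrite <- exp_plus.
        pose proof (Lam_step b s Hb Hs) as [L|L]; [left; apply exp_increasing; lra|right; f_equal; lra]. }
  pose proof (RGamma_pos a Ha) as G. pose proof (pos_INR n).
  pose proof (RGamma_pos (a + INR n) ltac:(lra)) as Gn. pose proof (Gamma_norm2_le (a + INR n) b ltac:(lra)) as Ln.
  replace (Gamma_norm2 a b) with (RGamma a ^ 2 * (Gamma_norm2 a b / RGamma a ^ 2)) by (field; lra).
  apply Rmult_le_compat_l; [left; now apply pow_lt|]. apply Rle_trans with (1 := H).
  rewrite <- (Rmult_1_r (exp _)) at 2. apply Rmult_le_compat_l; [left; apply exp_pos|].
  apply Rmult_le_reg_r with (RGamma (a + INR n) ^ 2); [now apply pow_lt|].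
  unfold Rdiv. rewrite Rmult_assoc, Rinv_l by (apply pow_nonzero; lra). lra.
Qed.

Lemma atan_le (x : R) : 0 <= x -> atan x <= x.
Proof.
  intros Hx. pose proof (derive_le0_decr (fun x => atan x - x) (fun x => / (1 + x ^ 2) - 1) 0 x Hx) as H.
  cbv beta in H. rewrite atan_0 in H. enough (atan x - x <= 0 - 0) by lra. apply H.
  - intros y Hy. auto_derive; trivial. simpl. field. nra.
  - intros y Hy. assert (/ (1 + y ^ 2) <= / 1); [apply Rinv_le_contravar; nra|]. rewrite Rinv_1 in *. lra.
Qed.

(** Let [n] tend to infinity in [Gamma_norm2_Lam]: dropping its non-negative logarithmic term,
    [Lam b (a + n)] is at least [2 b atan ((a + n) / b)], which tends to [PI b]. The other term
    [exp (Lam b a)] grows only like a power of [b]. *)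
Lemma Gamma_norm2_exp (a b : R) : 0 < a -> 0 < b ->
  Gamma_norm2 a b <= RGamma a ^ 2 * exp (2 * a) * Rpower (1 + b ^ 2 / a ^ 2) a * exp (- PI * b).
Proof.
  intros Ha Hb. pose proof (RGamma_pos a Ha) as G.
  assert (L : forall s, 0 < s -> 2 * b * atan (s / b) <= Lam b s).
  { intros s Hs. unfold Lam. assert (0 < b ^ 2 / s ^ 2) by (apply Rdiv_lt_0_compat; now apply pow_lt).
    assert (0 <= ln (1 + b ^ 2 / s ^ 2)) by (rewrite <- ln_1; apply ln_le; lra). nra. }
  assert (L0 : Lam b a <= a * ln (1 + b ^ 2 / a ^ 2) + 2 * a).
  { unfold Lam. pose proof (atan_le (a / b) ltac:(left; now apply Rdiv_lt_0_compat)).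
    assert (2 * b * atan (a / b) <= 2 * b * (a / b)) by (apply Rmult_le_compat_l; lra).
    replace (2 * b * (a / b)) with (2 * a) in * by (field; lra). lra. }
  assert (Lim : is_lim_seq (fun n => 2 * b * atan ((a + INR n) / b)) (PI * b)).
  { replace (Finite (PI * b)) with (Rbar_mult (2 * b) (PI / 2)) by (simpl; f_equal; field).
    apply is_lim_seq_scal_l.
    apply is_lim_seq_le_le_loc with (fun n => PI / 2 - b / INR n) (fun _ => PI / 2).
    - exists 1%nat. intros n Hn. apply le_INR in Hn. simpl in Hn.
      assert (P : 0 < (a + INR n) / b) by (apply Rdiv_lt_0_compat; lra).
      split; [|left; apply atan_bound].
      pose proof (atan_inv ((a + INR n) / b) P) as I.
      assert (Q : atan (/ ((a + INR n) / b)) <= / ((a + INR n) / b)) by (apply atan_le; left; now apply Rinv_0_lt_compat).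
      replace (/ ((a + INR n) / b)) with (b / (a + INR n)) in * by (field; lra).
      assert (b / (a + INR n) <= b / INR n); [|lra]. apply Rmult_le_compat_l; [lra|]. apply Rinv_le_contravar; lra.
    - replace (Finite (PI / 2)) with (Finite (PI / 2 - 0)) by (f_equal; ring).
      apply is_lim_seq_minus'; [apply is_lim_seq_const|apply is_lim_seq_inv_nat].
    - apply is_lim_seq_const. }
  apply (is_lim_seq_le (fun _ => Gamma_norm2 a b) (fun n => RGamma a ^ 2 * exp (a * ln (1 + b ^ 2 / a ^ 2) + 2 * a - 2 * b * atan ((a + INR n) / b))) (Finite _) (Finite _)).
  - intros n. apply Rle_trans with (1 := Gamma_norm2_Lam a b n Ha Hb). apply Rmult_le_compat_l; [left; now apply pow_lt|].
    pose proof (pos_INR n). pose proof (L (a + INR n) ltac:(lra)).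
    destruct (Rle_lt_or_eq_dec (Lam b a - Lam b (a + INR n)) (a * ln (1 + b ^ 2 / a ^ 2) + 2 * a - 2 * b * atan ((a + INR n) / b)) ltac:(lra)) as [X|X].
    + left. now apply exp_increasing.
    + rewrite X. lra.
  - apply is_lim_seq_const.
  - replace (Finite _) with (Rbar_mult (RGamma a ^ 2) (exp (a * ln (1 + b ^ 2 / a ^ 2) + 2 * a - PI * b))).
    2:{ simpl. f_equal. unfold Rpower. replace (- PI * b) with (- (PI * b)) by ring. unfold Rminus. rewrite !exp_plus. ring. }
    apply is_lim_seq_scal_l. apply is_lim_seq_continuous.
    + apply continuity_pt_filterlim. apply continuous_exp.
    + apply is_lim_seq_minus'; [apply is_lim_seq_const|exact Lim].
Qed.

(** Since [2 delta < PI], the surplus [exp (-(PI - 2 delta) b)] outweighs the power of [b]. At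
    [b = m/2] the bound becomes [K exp (-delta m)], which matches the weight in the hypothesis on
    the coefficients. *)
Lemma Gamma_norm2_decay (a delta : R) : 0 < a -> delta < PI / 2 ->
  exists K, 0 < K /\ forall b, 0 < b -> Gamma_norm2 a b <= K * exp (- (2 * delta) * b).
Proof.
  intros Ha Hd. set (eps := (PI - 2 * delta) / (2 * a)).
  assert (He : 0 < eps) by (apply Rdiv_lt_0_compat; lra).
  (* [th] makes [1 + b / a <= exp (eps b) / th] true also when [eps * a < 1]. *)
  pose (th := Rmin 1 (eps * a)). assert (Hth : 0 < th <= 1).
  { unfold th. split; [apply Rmin_glb_lt; [lra|now apply Rmult_lt_0_compat]|apply Rmin_l]. }
  exists (RGamma a ^ 2 * exp (2 * a) * Rpower (/ th) (2 * a)).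
  assert (HG : 0 < RGamma a ^ 2 * exp (2 * a)).
  { apply Rmult_lt_0_compat; [apply pow_lt; now apply RGamma_pos|apply exp_pos]. }
  split; [apply Rmult_lt_0_compat; [exact HG|apply exp_pos]|].
  intros b Hb. apply Rle_trans with (1 := Gamma_norm2_exp a b Ha Hb).
  rewrite 2!(Rmult_assoc (RGamma a ^ 2 * exp (2 * a))). apply Rmult_le_compat_l; [lra|].
  assert (P0 : 0 < b / a) by now apply Rdiv_lt_0_compat.
  assert (Q : 1 + b / a <= / th * exp (eps * b)).
  { apply Rmult_le_reg_l with th; [lra|]. rewrite <- Rmult_assoc, Rinv_r, Rmult_1_l by lra.
    pose proof (exp_ineq1_le (eps * b)).
    assert (th * (b / a) <= eps * a * (b / a)) by (apply Rmult_le_compat_r; [lra|apply Rmin_r]).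
    replace (eps * a * (b / a)) with (eps * b) in * by (field; lra). lra. }
  assert (B1 : Rpower (1 + b ^ 2 / a ^ 2) a <= Rpower (/ th) (2 * a) * exp ((PI - 2 * delta) * b)).
  { apply Rle_trans with (Rpower ((/ th * exp (eps * b)) ^ 2) a).
    - apply Rle_Rpower_l; [lra|]. split.
      + assert (0 < b ^ 2 / a ^ 2) by (apply Rdiv_lt_0_compat; now apply pow_lt). lra.
      + apply Rle_trans with ((1 + b / a) ^ 2); [|apply pow_incr; lra].
        replace ((1 + b / a) ^ 2) with (1 + b ^ 2 / a ^ 2 + 2 * (b / a)) by (field; lra). lra.
    - right. assert (Hi : 0 < / th) by (apply Rinv_0_lt_compat; lra).
      rewrite <- (Rpower_pow 2) by (apply Rmult_lt_0_compat; [trivial|apply exp_pos]). rewrite Rpower_mult. change (INR 2) with 2.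
      rewrite <- Rpower_mult_distr by (trivial; apply exp_pos). f_equal.
      unfold Rpower. rewrite ln_exp. f_equal. unfold eps. field. lra. }
  apply Rle_trans with (Rpower (/ th) (2 * a) * exp ((PI - 2 * delta) * b) * exp (- PI * b)).
  - apply Rmult_le_compat_r; [left; apply exp_pos|exact B1].
  - right. rewrite Rmult_assoc, <- exp_plus. f_equal. f_equal. ring.
Qed.

(** * Integration of the series *)

Lemma series_remainder (a b : nat -> R) (N : nat) : (forall k, Rabs (a k) <= b k) -> ex_series b ->
  ex_series a /\ Rabs (Series a - sum_n a N) <= Series b - sum_n b N.
Proof.
  intros H Hb.
  assert (Ea : forall n, ex_series (fun k => Rabs (a (n + k)%nat))).
  { intros n. apply (ex_series_le (K := R_AbsRing) (V := R_CompleteNormedModule) _ (fun k => b (n + k)%nat)).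
    - intros k. unfold norm; simpl. unfold abs; simpl. rewrite Rabs_Rabsolu. apply H.
    - now apply (ex_series_incr_n (V := R_NormedModule)). }
  assert (E0 : ex_series a) by (apply (ex_series_Rabs a), (Ea 0%nat)).
  split; trivial.
  rewrite (Series_incr_n a (S N)), (Series_incr_n b (S N)) by (trivial; lia). simpl pred. rewrite !sum_n_Reals.
  replace (sum_f_R0 a N + Series (fun k => a (S N + k)%nat) - sum_f_R0 a N) with (Series (fun k => a (S N + k)%nat)) by ring.
  replace (sum_f_R0 b N + Series (fun k => b (S N + k)%nat) - sum_f_R0 b N) with (Series (fun k => b (S N + k)%nat)) by ring.
  apply Rle_trans with (1 := Series_Rabs _ (Ea (S N))). apply Series_le.
  - intros k. split; [apply Rabs_pos|apply H].
  - now apply (ex_series_incr_n (V := R_NormedModule) b).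
Qed.

Lemma remainder_lim (b : nat -> R) (eps : R) : ex_series b -> 0 < eps -> exists N, forall n, (N <= n)%nat -> Series b - sum_n b n < eps.
Proof.
  intros Hb He. pose proof (Series_correct _ Hb) as L.
  assert (L' : is_lim_seq (sum_n b) (Series b)) by exact L.
  apply is_lim_seq_spec in L'. destruct (L' (mkposreal eps He)) as [N HN]. exists N. intros n Hn.
  specialize (HN n Hn). simpl in HN. apply Rabs_lt_between in HN. lra.
Qed.

Lemma continuous_sum_n (f : nat -> R -> R) (N : nat) (x : R) : (forall k, continuous (f k) x) -> continuous (fun x => sum_n (fun k => f k x) N) x.
Proof.
  intros H. induction N as [|N IH].
  - apply continuous_ext with (f 0%nat); [intros y; now rewrite sum_O|apply H].
  - apply continuous_ext with (fun x => plus (sum_n (fun k => f k x) N) (f (S N) x)); [intros y; now rewrite sum_Sn|].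
    now apply (continuous_plus (V := R_NormedModule)).
Qed.

(** The errors are expressed by the remainder of the fixed series of [Rabs (u k)], so they are
    uniform in any variable on which [v] may depend. *)
Lemma weighted_series_bound (u : nat -> R) (v : nat -> R) (B : R) (N : nat) :
  (forall k, Rabs (v k) <= B) -> ex_series (fun k => Rabs (u k)) ->
  ex_series (fun k => u k * v k) /\ Rabs (Series (fun k => u k * v k) - sum_n (fun k => u k * v k) N)
    <= B * (Series (fun k => Rabs (u k)) - sum_n (fun k => Rabs (u k)) N) /\
  Rabs (Series (fun k => u k * v k)) <= B * Series (fun k => Rabs (u k)).
Proof.
  intros HB Hu.
  assert (Hk : forall k, Rabs (u k * v k) <= B * Rabs (u k)).
  { intros k. rewrite Rabs_mult, Rmult_comm. apply Rmult_le_compat_r; [apply Rabs_pos|apply HB]. }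
  assert (Hs : ex_series (fun k => B * Rabs (u k))) by now apply (ex_series_scal (V := R_NormedModule) B).
  destruct (series_remainder _ (fun k => B * Rabs (u k)) N Hk Hs) as [E L]. split; trivial.
  rewrite Series_scal_l in L.
  assert (Es : forall n, sum_n (fun k => B * Rabs (u k)) n = B * sum_n (fun k => Rabs (u k)) n).
  { intros n. apply (sum_n_mult_l (K := R_AbsRing) B). }
  split; [rewrite Es in L; lra|].
  rewrite <- Series_scal_l.
  assert (Ea : ex_series (fun k => Rabs (u k * v k))).
  { apply (ex_series_le (K := R_AbsRing) (V := R_CompleteNormedModule) _ (fun k => B * Rabs (u k))); trivial.
    intros k. unfold norm; simpl. unfold abs; simpl. rewrite Rabs_Rabsolu. apply Hk. }
  apply Rle_trans with (1 := Series_Rabs _ Ea). apply Series_le; trivial. intros k. split; [apply Rabs_pos|apply Hk].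
Qed.

(** Uniform convergence by the Weierstrass majorant [B * Rabs (u k)]. *)
Lemma continuous_weighted_series (u : nat -> R) (phi : nat -> R -> R) (B x : R) :
  (forall k, continuous (phi k) x) -> (forall k y, Rabs (phi k y) <= B) -> ex_series (fun k => Rabs (u k)) ->
  continuous (fun x => Series (fun k => u k * phi k x)) x.
Proof.
  intros Hc HB Hu.
  assert (HB0 : 0 <= B) by (apply Rle_trans with (2 := HB 0%nat 0); apply Rabs_pos).
  apply continuity_pt_filterlim. intros eps Heps.
  destruct (remainder_lim _ (eps / (3 * (B + 1))) Hu ltac:(apply Rdiv_lt_0_compat; lra)) as [N HN].
  specialize (HN N (Nat.le_refl N)).
  assert (T : forall y, Rabs (Series (fun k => u k * phi k y) - sum_n (fun k => u k * phi k y) N) < eps / 3).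
  { intros y. destruct (weighted_series_bound u (fun k => phi k y) B N (fun k => HB k y) Hu) as [_ [L _]].
    apply Rle_lt_trans with (1 := L).
    replace (eps / 3) with ((B + 1) * (eps / (3 * (B + 1)))) by (field; lra).
    assert (0 < eps / (3 * (B + 1))) by (apply Rdiv_lt_0_compat; lra). nra. }
  assert (Cs : continuous (fun x => sum_n (fun k => u k * phi k x) N) x).
  { apply continuous_sum_n. intros k. apply (continuous_scal_r (V := R_NormedModule)). apply Hc. }
  apply continuity_pt_filterlim in Cs. destruct (Cs (eps / 3) ltac:(lra)) as [dl [Hdl Hd]].
  exists dl. split; trivial. intros y Hy. specialize (Hd y Hy). unfold R_dist in *; simpl in *. unfold R_dist in *.
  pose proof (T x) as T1. pose proof (T y) as T2. apply Rabs_lt_between in T1. apply Rabs_lt_between in T2. apply Rabs_lt_between in Hd.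
  apply Rabs_lt_between. lra.
Qed.

Lemma pint_sum_n (W : R -> R) (u lam : nat -> R) (phi : nat -> R -> R) (N : nat) :
  (forall k, is_pint (fun x => W x * phi k x) (lam k)) ->
  is_pint (fun x => W x * sum_n (fun k => u k * phi k x) N) (sum_n (fun k => u k * lam k) N).
Proof.
  intros H. assert (T : forall k, is_pint (fun x => W x * (u k * phi k x)) (u k * lam k)).
  { intros k. generalize (pint_scal (u k) _ _ (H k)). apply pint_ext. intros x _. ring. }
  induction N as [|N IH].
  - rewrite sum_O. generalize (T 0%nat). apply pint_ext. intros x _. now rewrite sum_O.
  - rewrite sum_Sn. generalize (pint_plus _ _ _ _ IH (T (S N))). apply pint_ext.
    intros x _. rewrite sum_Sn. unfold plus; simpl. ring.
Qed.

(** The tail of the series is at most [M g] times the remainder of the series of [Rabs (u k)];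
    integrated, it is that remainder times [M (h1 - h0)] and tends to 0. *)
Lemma weighted_series_pint (W : R -> R) (u lam : nat -> R) (phi : nat -> R -> R) (B M : R) (g H : R -> R) (h0 h1 : R) :
  0 <= M -> dominator g H h0 h1 -> (forall x, 0 < x -> continuous W x) ->
  (forall k x, continuous (phi k) x) -> (forall k x, Rabs (phi k x) <= B) ->
  (forall k x, 0 < x -> Rabs (W x * phi k x) <= M * g x) -> ex_series (fun k => Rabs (u k)) ->
  (forall k, is_pint (fun x => W x * phi k x) (lam k)) ->
  (forall x, 0 < x -> Rabs (W x * Series (fun k => u k * phi k x)) <= M * Series (fun k => Rabs (u k)) * g x) /\
  exists l, is_pint (fun x => W x * Series (fun k => u k * phi k x)) l /\ is_series (fun k => u k * lam k) l.
Proof.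
  intros HM D CW Cp HB HWB Hu Hl.
  set (U := Series (fun k => Rabs (u k))).
  assert (HU : 0 <= U).
  { destruct (weighted_series_bound u (fun _ => 0) 1 0) as [_ [_ L]]; trivial; [intros; rewrite Rabs_R0; lra|].
    fold U in L. pose proof (Rle_trans _ _ _ (Rabs_pos _) L). lra. }
  assert (Wm : forall x, 0 < x -> forall N,
     Rabs (W x * Series (fun k => u k * phi k x)) <= M * U * g x /\
     Rabs (W x * Series (fun k => u k * phi k x) - W x * sum_n (fun k => u k * phi k x) N)
      <= M * (U - sum_n (fun k => Rabs (u k)) N) * g x).
  { intros x Hx N.
    destruct (weighted_series_bound u (fun k => W x * phi k x) (M * g x) N (fun k => HWB k x Hx) Hu) as [_ [L1 L2]].
    fold U in L1, L2.
    assert (E1 : Series (fun k => u k * (W x * phi k x)) = W x * Series (fun k => u k * phi k x)).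
    { rewrite <- Series_scal_l. apply Series_ext. intros k. ring. }
    assert (E2 : sum_n (fun k => u k * (W x * phi k x)) N = W x * sum_n (fun k => u k * phi k x) N).
    { transitivity (sum_n (fun k => mult (W x) (u k * phi k x)) N); [apply sum_n_ext; intros k; unfold mult; simpl; ring|].
      apply (sum_n_mult_l (K := R_AbsRing)). }
    rewrite E1, E2 in L1. rewrite E1 in L2. split; lra. }
  split; [intros x Hx; apply (Wm x Hx 0%nat)|].
  assert (Cf : forall x, 0 < x -> continuous (fun x => W x * Series (fun k => u k * phi k x)) x).
  { intros x Hx. apply (continuous_mult (K := R_AbsRing)); [now apply CW|].
    now apply (continuous_weighted_series u phi B). }
  destruct (dominated_ex_pint _ g H h0 h1 (M * U) ltac:(now apply Rmult_le_pos) D Cf (fun x Hx => proj1 (Wm x Hx 0%nat))) as [l Hl0].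
  exists l. split; trivial.
  change (is_lim_seq (sum_n (fun k => u k * lam k)) l).
  assert (Hpos : forall n, 0 <= U - sum_n (fun k => Rabs (u k)) n).
  { intros n. destruct (weighted_series_bound u (fun _ => 0) 1 n) as [_ [L _]]; trivial; [intros; rewrite Rabs_R0; lra|].
    fold U in L. pose proof (Rle_trans _ _ _ (Rabs_pos _) L). lra. }
  assert (Hh : 0 <= h1 - h0).
  { pose proof (dominator_between g H h0 h1 1 D). lra. }
  assert (Err : forall n, Rabs (sum_n (fun k => u k * lam k) n - l) <= M * (h1 - h0) * (U - sum_n (fun k => Rabs (u k)) n)).
  { intros n. rewrite Rabs_minus_sym.
    replace (M * (h1 - h0) * (U - sum_n (fun k => Rabs (u k)) n)) with (M * (U - sum_n (fun k => Rabs (u k)) n) * (h1 - h0)) by ring.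
    refine (dominated_pint_le _ g H h0 h1 _ _ _ D _ _ (pint_minus _ _ _ _ Hl0 (pint_sum_n W u lam phi n Hl))).
    - apply Rmult_le_pos; trivial.
    - intros x Hx. apply (continuous_minus (V := R_NormedModule)); [now apply Cf|].
      apply (continuous_mult (K := R_AbsRing)); [now apply CW|]. apply continuous_sum_n.
      intros k. apply (continuous_scal_r (V := R_NormedModule)). apply Cp.
    - intros x Hx. apply (Wm x Hx n). }
  apply is_lim_seq_spec. intros eps.
  assert (He : 0 < eps / (M * (h1 - h0) + 1)).
  { apply Rdiv_lt_0_compat; [apply cond_pos|]. assert (0 <= M * (h1 - h0)) by now apply Rmult_le_pos. lra. }
  destruct (remainder_lim _ _ Hu He) as [N HN]. exists N. intros n Hn. specialize (HN n Hn). fold U in HN.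
  apply Rle_lt_trans with (1 := Err n). specialize (Hpos n).
  assert (P : 0 <= M * (h1 - h0)) by now apply Rmult_le_pos.
  replace (pos eps) with ((M * (h1 - h0) + 1) * (eps / (M * (h1 - h0) + 1))) by (field; lra). nra.
Qed.

(** * Orthogonality *)

Lemma sin_nat_PI (n : nat) : sin (INR n * PI) = 0.
Proof. apply sin_eq_0_1. exists (Z.of_nat n). now rewrite <- INR_IZR_INZ. Qed.

Lemma sin_int_PI (z : Z) : sin (IZR z * PI) = 0.
Proof. apply sin_eq_0_1. now exists z. Qed.

Lemma sin_orthogonal (n m : nat) : (1 <= n)%nat -> (1 <= m)%nat ->
  is_RInt (fun u => sin (INR n * u) * sin (INR m * u)) (- PI) PI (if Nat.eqb n m then PI else 0).
Proof.
  intros Hn Hm. apply le_INR in Hn as Hn'. apply le_INR in Hm as Hm'. simpl in Hn', Hm'.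
  assert (Cont : forall u, continuous (fun u => sin (INR n * u) * sin (INR m * u)) u).
  { intros u. apply (ex_derive_continuous (K := R_AbsRing) (V := R_NormedModule)). auto_derive; trivial. }
  destruct (Nat.eqb_spec n m) as [E|E].
  - subst m. pose (F := fun u => u / 2 - sin (2 * INR n * u) / (4 * INR n)).
    replace PI with (minus (F PI) (F (- PI))) at 3.
    + apply (is_RInt_derive (V := R_CompleteNormedModule) F); [|intros; apply Cont].
      intros u _. unfold F. auto_derive; [trivial|].
      pose proof (cos_2a (INR n * u)) as C. pose proof (sin2_cos2 (INR n * u)) as T. unfold Rsqr in T.
      replace (2 * INR n * u) with (2 * (INR n * u)) by ring. rewrite C.
      replace (cos (INR n * u) * cos (INR n * u)) with (1 - sin (INR n * u) * sin (INR n * u)) by lra. field. lra.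
    + unfold F, minus, plus, opp; simpl.
      replace (2 * INR n * - PI) with (- (INR (2 * n) * PI)) by (rewrite mult_INR; simpl; ring).
      replace (2 * INR n * PI) with (INR (2 * n) * PI) by (rewrite mult_INR; simpl; ring).
      rewrite sin_neg, sin_nat_PI. field. lra.
  - assert (Hd : INR n - INR m <> 0) by (intros X; apply E, INR_eq; lra).
    pose (F := fun u => sin ((INR n - INR m) * u) / (2 * (INR n - INR m)) - sin ((INR n + INR m) * u) / (2 * (INR n + INR m))).
    replace 0 with (minus (F PI) (F (- PI))).
    + apply (is_RInt_derive (V := R_CompleteNormedModule) F); [|intros; apply Cont].
      intros u _. unfold F. auto_derive; [trivial|].
      unfold Rminus in *. rewrite !Rmult_plus_distr_r, Ropp_mult_distr_l_reverse, !cos_plus, cos_neg, sin_neg. field. split; lra.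
    + unfold F, minus, plus, opp; simpl.
      rewrite !Ropp_mult_distr_r_reverse, !sin_neg.
      replace (INR n - INR m) with (IZR (Z.of_nat n - Z.of_nat m)) in * by (rewrite minus_IZR, <- !INR_IZR_INZ; ring).
      rewrite sin_int_PI. rewrite <- plus_INR, sin_nat_PI, plus_INR. field. split; trivial. lra.
Qed.

(** Real form of [Phi] in which [tanh u / cosh^(2d) u] is regrouped as [sinh u * cosh^(-2d-1) u],
    the power of [cosh] being part of [uker]. *)
Definition phi_kernel (c d : R) (n : nat) (x : R) : R :=
  RInt (fun u => sin (INR n * u) * sinh u * uker c d (cosh u) x) (- PI) PI.

Lemma continuity_2d_phi_kernel (c d x u : R) (n : nat) : 0 < c ->
  continuity_2d_pt (fun x u => sin (INR n * u) * sinh u * uker c d (cosh u) x) x u.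
Proof.
  intros Hc. apply continuity_2d_pt_mult.
  - apply (continuity_2d_pt_snd (fun u => sin (INR n * u) * sinh u)).
    apply (ex_derive_continuous (K := R_AbsRing) (V := R_NormedModule)). unfold sinh. auto_derive; trivial.
  - unfold uker. destruct (yfun_hyp_fun d c Hc) as [y2 Hy]. pose proof (cosh_pos u) as Hu.
    apply continuity_2d_pt_mult.
    + apply (continuity_2d_pt_snd (fun u => Rpower (cosh u) (- (2 * d + 1)))).
      eapply is_derive_continuous, is_derive_cosh_Rpower.
    + apply (continuity_2d_pt_comp1 (yfun d c) (fun x u => x ^ 2 / cosh u ^ 2)).
      * eapply is_derive_continuous. apply (hf_d1 _ _ _ _ _ _ Hy). pose proof (sq_ratio_ge0 x (cosh u) Hu). lra.
      * unfold Rdiv. apply continuity_2d_pt_mult.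
        -- apply (continuity_2d_pt_fst (fun x => x ^ 2)).
           apply (ex_derive_continuous (K := R_AbsRing) (V := R_NormedModule)). auto_derive; trivial.
        -- apply (continuity_2d_pt_snd (fun u => / cosh u ^ 2)).
           apply (ex_derive_continuous (K := R_AbsRing) (V := R_NormedModule)). unfold cosh in *. auto_derive.
           apply Rgt_not_eq. apply (Rmult_lt_0_compat _ _ Hu). rewrite Rmult_1_r. exact Hu.
Qed.

Lemma continuous_phi_integrand (c d x u : R) (n : nat) : 0 < c ->
  continuous (fun u => sin (INR n * u) * sinh u * uker c d (cosh u) x) u.
Proof.
  intros Hc. apply (continuity_2d_pt_slice_r (fun x u => sin (INR n * u) * sinh u * uker c d (cosh u) x)).
  now apply continuity_2d_phi_kernel.
Qed.

Lemma Phi_eq (a c x : R) (n : nat) : 0 < c -> Phi a c n x = RtoC (phi_kernel c (c - a) n x).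
Proof.
  intros Hc. set (d := c - a). unfold Phi. apply (is_RInt_unique (V := C_R_CompleteNormedModule)).
  apply (is_RInt_ext (V := C_R_NormedModule) (fun u => RtoC (sin (INR n * u) * sinh u * uker c d (cosh u) x))).
  - intros u _. pose proof (cosh_pos u) as Hu.
    replace (- x ^ 2 / cosh u ^ 2) with (- (x ^ 2 / cosh u ^ 2)) by (field; lra).
    change (F21 (RtoC (c - a + 1/2)) (RtoC (c - a + 1)) (RtoC c) (- (x ^ 2 / cosh u ^ 2)))
      with (HF (RtoC (d + 1/2)) (RtoC (d + 1)) c (x ^ 2 / cosh u ^ 2)).
    pose proof (sq_ratio_ge0 x (cosh u) Hu).
    rewrite HF_RtoC by lra. fold (yfun d c). rewrite <- RtoC_mult. f_equal.
    unfold uker, tanh. fold d. rewrite Rpower_Ropp, Rpower_plus, Rpower_1 by trivial.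
    assert (0 < Rpower (cosh u) (2 * d)) by apply exp_pos. field. split; lra.
  - unfold RtoC. apply (is_RInt_fct_extend_pair (U := R_NormedModule) (V := R_NormedModule)); simpl.
    + apply (RInt_correct (V := R_CompleteNormedModule)), (ex_RInt_continuous (V := R_CompleteNormedModule)).
      intros u _. now apply continuous_phi_integrand.
    + pose proof (is_RInt_const (V := R_NormedModule) (- PI) PI 0) as Z. rewrite (scal_zero_r (V := R_NormedModule)) in Z. exact Z.
Qed.

Lemma cosh_le_exp (u L : R) : Rabs u <= L -> cosh u <= exp L.
Proof.
  intros H. apply Rabs_le_between in H.
  assert (E : forall t, t <= L -> exp t <= exp L) by (intros t [Ht|Ht]; [left; now apply exp_increasing|rewrite Ht; lra]).
  unfold cosh. pose proof (E u ltac:(lra)). pose proof (E (- u) ltac:(lra)). lra.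
Qed.

(** Stated up to [PI + 1] because the Fubini lemma asks for an open neighbourhood of [[-PI, PI]]. *)
Lemma phi_integrand_bound (a c d Ld : R) (n : nat) : 0 < a -> 0 < d -> c = a + d -> 1/2 < c -> is_lim_seq (eta_ratio d c) Ld ->
  exists K, 0 < K /\ forall u x, Rabs u <= PI + 1 -> 0 < x ->
    Rabs (Rpower x (2 * c - 1) * (sin (INR n * u) * sinh u * uker c d (cosh u) x)) <= K * Rpower (1 + x ^ 2) (a - 1).
Proof.
  intros Ha Hd Hc Hc2 HLd. destruct (weight_uker a c d Ld Ha Hd Hc Hc2 HLd) as [K [HK HU]].
  exists (exp (PI + 1) * K). split; [apply Rmult_lt_0_compat; trivial; apply exp_pos|]. intros u x Hu Hx.
  replace (Rpower x (2 * c - 1) * (sin (INR n * u) * sinh u * uker c d (cosh u) x))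
    with (sin (INR n * u) * sinh u * (Rpower x (2 * c - 1) * uker c d (cosh u) x)) by ring.
  rewrite Rabs_mult, Rmult_assoc. apply Rmult_le_compat; try apply Rabs_pos; [|apply HU; trivial; apply cosh_ge_1].
  rewrite Rabs_mult. rewrite <- (Rmult_1_l (exp _)). apply Rmult_le_compat; try apply Rabs_pos.
  - apply Rabs_le. destruct (SIN_bound (INR n * u)). lra.
  - apply Rle_trans with (1 := sinh_abs_lt_cosh u). now apply cosh_le_exp.
Qed.

Lemma phi_kernel_bound (a c d Ld : R) (n : nat) : 0 < a -> 0 < d -> c = a + d -> 1/2 < c -> is_lim_seq (eta_ratio d c) Ld ->
  exists K, 0 < K /\ forall x, 0 < x -> Rabs (Rpower x (2 * c - 1) * phi_kernel c d n x) <= K * Rpower (1 + x ^ 2) (a - 1).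
Proof.
  intros Ha Hd Hc Hc2 HLd. destruct (phi_integrand_bound a c d Ld n Ha Hd Hc Hc2 HLd) as [K [HK HB]].
  pose proof PI_RGT_0 as HPI.
  exists (K * (2 * PI)). split; [apply Rmult_lt_0_compat; lra|]. intros x Hx. unfold phi_kernel.
  assert (E : ex_RInt (fun u => sin (INR n * u) * sinh u * uker c d (cosh u) x) (- PI) PI).
  { apply (ex_RInt_continuous (V := R_CompleteNormedModule)). intros u _. apply continuous_phi_integrand. lra. }
  rewrite <- (RInt_scal (V := R_CompleteNormedModule) _ _ _ _ E).
  replace (K * (2 * PI) * Rpower (1 + x ^ 2) (a - 1)) with (K * Rpower (1 + x ^ 2) (a - 1) * (PI - - PI)) by ring.
  apply RInt_abs_le_const; [lra| |].
  - intros u _. apply (continuous_scal_r (V := R_NormedModule)). apply continuous_phi_integrand. lra.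
  - intros u Hu. apply HB; trivial. apply Rabs_le. lra.
Qed.

Lemma continuous_phi_kernel (c d x : R) (n : nat) : 0 < c -> 0 < x -> continuous (phi_kernel c d n) x.
Proof.
  intros Hc Hx. pose proof PI_RGT_0. unfold phi_kernel.
  apply (continuous_RInt_under (fun x u => sin (INR n * u) * sinh u * uker c d (cosh u) x) (- PI) PI 0 (x + 1) (- PI - 1) (PI + 1)); try lra.
  intros z u _ _. now apply continuity_2d_phi_kernel.
Qed.

(** Extends [uker_solution_cosh] to all [u]: the integral depends on [u] through [cosh u] only, so
    both sides are odd in [u]. *)
Lemma uker_solution_cosh_all (a c d La Ld b u beta I : R) (f f1 f2 : R -> R) :
  0 < a -> 0 < d -> c = a + d -> 1/2 < c -> is_lim_seq (eta_ratio a c) La -> is_lim_seq (eta_ratio d c) Ld ->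
  0 < b -> hyp_solution c (2 * a) (a ^ 2 + b ^ 2) f f1 f2 -> f 0 = 1 ->
  is_lim_seq (fun n => betaT a b (INR n)) beta ->
  is_pint (fun x => Rpower x (2 * c - 1) * uker c d (cosh u) x * f (x ^ 2)) I ->
  beta * I * sinh u = La * Ld / (2 * d) * (PI * sin (2 * b * u) / sinh (PI * (2 * b))).
Proof.
  intros Ha Hd Hc Hc2 HLa HLd Hb Hf Hf0 Hbeta HI.
  destruct (Rtotal_order u 0) as [Hu|[Hu|Hu]].
  - assert (Ec : cosh (- u) = cosh u) by (unfold cosh; rewrite Ropp_involutive; field).
    assert (Es : sinh (- u) = - sinh u) by (unfold sinh; rewrite Ropp_involutive; field).
    rewrite <- Ec in HI.
    pose proof (uker_solution_cosh a c d La Ld b (- u) beta I f f1 f2 Ha Hd Hc Hc2 HLa HLd ltac:(lra) Hb Hf Hf0 Hbeta HI) as E.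
    rewrite Es, (Ropp_mult_distr_r_reverse (2 * b)), sin_neg in E. unfold Rdiv in *.
    enough (- (beta * I * sinh u) = - (La * Ld * / (2 * d) * (PI * sin (2 * b * u) * / sinh (PI * (2 * b))))) by lra. rewrite Ropp_mult_distr_r, E. ring.
  - subst u. rewrite sinh_0, Rmult_0_r, Rmult_0_r, sin_0. unfold Rdiv. ring.
  - now apply (uker_solution_cosh a c d La Ld b u beta I f f1 f2).
Qed.

(** Fubini moves the [x]-integral inside, where [sinh u] times it is a multiple of [sin (m u)]. The
    factor [sinh u] present in the kernel is exactly what is required, and orthogonality of the
    sines remains. *)
Lemma phi_kernel_solution (a c d La Ld Kf beta : R) (n m : nat) (f f1 f2 : R -> R) :
  0 < a -> 0 < d -> c = a + d -> 1/2 < c -> is_lim_seq (eta_ratio a c) La -> is_lim_seq (eta_ratio d c) Ld ->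
  (1 <= n)%nat -> (1 <= m)%nat -> hyp_solution c (2 * a) (a ^ 2 + (INR m / 2) ^ 2) f f1 f2 -> f 0 = 1 ->
  is_lim_seq (fun k => betaT a (INR m / 2) (INR k)) beta -> 0 < beta ->
  0 <= Kf -> (forall z, 0 <= z -> Rabs (f z) <= Kf * Rpower (1 + z) (- a)) ->
  is_pint (fun x => Rpower x (2 * c - 1) * phi_kernel c d n x * f (x ^ 2))
    (La * Ld / (2 * d) * PI / (beta * sinh (PI * INR m)) * if Nat.eqb n m then PI else 0).
Proof.
  intros Ha Hd Hc Hc2 HLa HLd Hn Hm Hf Hf0 Hbeta Hb0 HKf HB.
  pose proof PI_RGT_0 as HPI.
  assert (Hm' : 1 <= INR m) by (apply le_INR in Hm; simpl in Hm; lra).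
  assert (Hs : 0 < sinh (PI * INR m)) by (apply sinh_pos, Rmult_lt_0_compat; lra).
  set (C0 := La * Ld / (2 * d) * PI / (beta * sinh (PI * INR m))).
  pose (l := fun u => C0 * (sin (INR n * u) * sin (INR m * u))).
  destruct (phi_integrand_bound a c d Ld n Ha Hd Hc Hc2 HLd) as [K [HK HI]].
  assert (Hl : is_RInt l (- PI) PI (C0 * if Nat.eqb n m then PI else 0)).
  { apply (is_RInt_scal (V := R_NormedModule)). now apply sin_orthogonal. }
  rewrite <- (is_RInt_unique (V := R_CompleteNormedModule) _ _ _ _ Hl).
  pose (G := fun x u => Rpower x (2 * c - 1) * (sin (INR n * u) * sinh u * uker c d (cosh u) x) * f (x ^ 2)).
  apply pint_ext with (fun x => RInt (G x) (- PI) PI).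
  { intros x Hx. unfold G, phi_kernel.
    assert (E : ex_RInt (fun u => sin (INR n * u) * sinh u * uker c d (cosh u) x) (- PI) PI).
    { apply (ex_RInt_continuous (V := R_CompleteNormedModule)). intros u _. apply continuous_phi_integrand. lra. }
    transitivity (Rpower x (2 * c - 1) * f (x ^ 2) * RInt (fun u => sin (INR n * u) * sinh u * uker c d (cosh u) x) (- PI) PI); [|ring].
    rewrite <- (RInt_scal (V := R_CompleteNormedModule) _ _ _ _ E). apply RInt_ext. intros u _.
    unfold scal; simpl; unfold mult; simpl. ring. }
  apply (pint_Fubini G l tail_weight _ _ _ (K * Kf * 2) (- PI) PI (- PI - 1) (PI + 1) ltac:(repeat apply Rmult_le_pos; lra) tail_weight_dominator); try lra.
  - intros x u Hx Hu. unfold G. apply continuity_2d_pt_mult; [apply continuity_2d_pt_mult|].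
    + now apply (continuity_2d_pt_fst (fun x => Rpower x (2 * c - 1))), continuous_Rpower.
    + apply continuity_2d_phi_kernel. lra.
    + apply (continuity_2d_pt_fst (fun x => f (x ^ 2))). apply (solution_sq_continuous _ _ _ _ _ _ _ Hf).
  - intros x u Hx Hu. unfold G. rewrite Rabs_mult.
    pose proof (Rpower_le_tail_weight x (-1) Hx ltac:(lra)) as D0.
    apply Rle_trans with (K * Rpower (1 + x ^ 2) (a - 1) * (Kf * Rpower (1 + x ^ 2) (- a))).
    + apply Rmult_le_compat; try apply Rabs_pos; [|apply HB, pow2_ge_0]. apply HI; trivial. apply Rabs_le; lra.
    + transitivity (K * Kf * (Rpower (1 + x ^ 2) (a - 1) * Rpower (1 + x ^ 2) (- a))); [right; ring|].
      rewrite <- Rpower_plus. replace (a - 1 + - a) with (-1) by ring.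
      rewrite (Rmult_assoc _ 2). apply Rmult_le_compat_l; [apply Rmult_le_pos; lra|lra].
  - intros u Hu.
    destruct (uker_solution_pint a c d Ld (INR m / 2) Kf (cosh u) f f1 f2 Ha Hd Hc Hc2 HLd (cosh_ge_1 u) Hf HKf HB) as [I Iu].
    pose proof (uker_solution_cosh_all a c d La Ld (INR m / 2) u beta I f f1 f2 Ha Hd Hc Hc2 HLa HLd ltac:(lra) Hf Hf0 Hbeta Iu) as E.
    replace (2 * (INR m / 2)) with (INR m) in E by field.
    replace (l u) with (sin (INR n * u) * sinh u * I).
    + generalize (pint_scal (sin (INR n * u) * sinh u) _ _ Iu). apply pint_ext. intros x _. unfold G. ring.
    + unfold l, C0. replace (sin (INR n * u) * sinh u * I) with (sin (INR n * u) * (beta * I * sinh u) / beta) by (field; lra).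
      rewrite E. field. repeat split; lra.
  - eexists; exact Hl.
Qed.

(** The real part loses nothing for [z >= 0], since [HF_real] applies to these conjugate parameters
    (see [mode_eq]). *)
Definition mode (a c : R) (m : nat) (z : R) : R := Re (HF (a, INR m / 2) (a, - (INR m / 2)) c z).

Lemma mode_params (a b : R) : Cplus (a, b) (a, - b) = RtoC (2 * a) /\ Cmult (a, b) (a, - b) = RtoC (a ^ 2 + b ^ 2).
Proof. split; apply injective_projections; simpl; ring. Qed.

Lemma mode_solution (a c : R) (m : nat) : 0 < c ->
  exists f1 f2, hyp_solution c (2 * a) (a ^ 2 + (INR m / 2) ^ 2) (mode a c m) f1 f2.
Proof.
  intros Hc. destruct (mode_params a (INR m / 2)) as [E1 E2].
  destruct (HF_solution _ _ c _ _ Hc E1 E2) as [H _]. do 2 eexists. exact H.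
Qed.

Lemma mode_0 (a c : R) (m : nat) : mode a c m 0 = 1.
Proof. unfold mode. now rewrite HF_0. Qed.

Lemma mode_eq (a c x : R) (m : nat) : 0 < a -> 1/2 < c ->
  F21 (a, INR m / 2) (a, - (INR m / 2)) (RtoC c) (- (x ^ 2)) = RtoC (mode a c m (x ^ 2)).
Proof.
  intros Ha Hc. destruct (mode_params a (INR m / 2)) as [E1 E2].
  apply (HF_real _ _ c _ _ (x ^ 2) Hc E1 E2); [lra| |apply pow2_ge_0].
  pose proof (pow2_ge_0 (INR m / 2)). nra.
Qed.

Lemma fser_eq (an : nat -> C) (a c x : R) : 0 < a -> 1/2 < c ->
  fser an a c x = (Series (fun k => Re (an (S k)) * mode a c (S k) (x ^ 2)), Series (fun k => Im (an (S k)) * mode a c (S k) (x ^ 2))).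
Proof.
  intros Ha Hc. unfold fser, CSeries. apply injective_projections; cbv [fst snd];
    apply Series_ext; intros k; rewrite mode_eq by trivial; unfold Re, Im; simpl; ring.
Qed.

(** By [Gamma_norm2_decay] at [b = m/2], the squared modulus of Gamma times [exp (delta m)] is
    bounded by [K], so each [Cmod (an m)] is at most [K] times the corresponding term of the
    hypothesis. *)
Lemma coefficients_summable (a delta : R) (an : nat -> C) : 0 < a -> 0 <= delta < PI / 2 ->
  ex_series (fun m => Cmod (an (S m)) * exp (- delta * INR (S m)) / (Cmod (CGamma (a, INR (S m) / 2))) ^ 2) ->
  ex_series (fun m => Cmod (an (S m))).
Proof.
  intros Ha Hd Hs. destruct (Gamma_norm2_decay a delta Ha ltac:(lra)) as [K [HK HG]].
  apply (ex_series_le (K := R_AbsRing) (V := R_CompleteNormedModule) _ (fun m => K * (Cmod (an (S m)) * exp (- delta * INR (S m)) / (Cmod (CGamma (a, INR (S m) / 2))) ^ 2))).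
  - intros m. rewrite Cmod_CGamma by trivial. pose proof (pos_INR m) as Hm.
    assert (Hb : 0 < INR (S m) / 2) by (rewrite S_INR; lra). specialize (HG _ Hb).
    replace (- (2 * delta) * (INR (S m) / 2)) with (- delta * INR (S m)) in HG by field.
    pose proof (Gamma_norm2_pos a (INR (S m) / 2) Ha) as P.
    apply Rle_trans with (Cmod (an (S m))); [right; apply Rabs_pos_eq, Cmod_ge_0|].
    match goal with |- _ <= K * (?A * ?B / ?N) => apply Rmult_le_reg_r with N; trivial; replace (K * (A * B / N) * N) with (A * (K * B)) by (field; lra) end.
    apply Rmult_le_compat_l; [apply Cmod_ge_0|exact HG].
  - now apply (ex_series_scal (V := R_NormedModule) K).
Qed.

Lemma is_series_single (u : nat -> R) (n : nat) (l : R) : (forall k, k <> n -> u k = 0) -> is_series u l -> l = u n.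
Proof.
  intros Hu Hl.
  assert (E : forall k, (n <= k)%nat -> sum_n u k = u n).
  { assert (Z : forall k, (k < n)%nat -> sum_n u k = 0).
    { intros k. induction k as [|k IH]; intros Hk; [rewrite sum_O; apply Hu; lia|].
      rewrite sum_Sn, IH, Hu by lia. apply Rplus_0_r. }
    intros k Hk. induction Hk as [|k Hk IH].
    - destruct n as [|n]; [apply sum_O|]. rewrite sum_Sn, Z by lia. unfold plus; simpl. ring.
    - rewrite sum_Sn, IH, (Hu (S k)) by lia. apply Rplus_0_r. }
  assert (L : is_lim_seq (sum_n u) (u n)).
  { apply is_lim_seq_ext_loc with (fun _ => u n); [|apply is_lim_seq_const]. exists n. intros k Hk. now rewrite E. }
  assert (L' : is_lim_seq (sum_n u) l) by exact Hl.
  apply is_lim_seq_unique in L. apply is_lim_seq_unique in L'. rewrite L in L'. now injection L'.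
Qed.

Lemma Cmod_le_abs (p q : R) : Cmod (p, q) <= Rabs p + Rabs q.
Proof.
  unfold Cmod; simpl fst; simpl snd. pose proof (Rabs_pos p). pose proof (Rabs_pos q).
  rewrite <- (sqrt_pow2 (Rabs p + Rabs q)) by lra. apply sqrt_le_1_alt.
  rewrite <- (pow2_abs p), <- (pow2_abs q). nra.
Qed.

Theorem theorem1 (a c : R) (an : nat -> C) :
  0 < a ->
  Rmax (1/2) (2 * a - 1/2) < c -> c < 2 * a + 1/2 ->
  (c = 1/2 -> 0 < a < 1/2) ->
  (exists delta : R, 0 <= delta < PI / 2 /\
     ex_series (fun m => Cmod (an (S m)) * exp (- delta * INR (S m))
                         / (Cmod (CGamma (a, INR (S m) / 2))) ^ 2)) ->
  forall n : nat, (1 <= n)%nat ->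
    let g := fun x : R =>
      Cmult (RtoC (Rpower x (2 * c - 1))) (Cmult (Phi a c n x) (fser an a c x)) in
    ex_RInt_gen (fun x => Cmod (g x)) (at_right 0) (Rbar_locally p_infty) /\
    ex_RInt_gen (V := C_R_CompleteNormedModule) g (at_right 0) (Rbar_locally p_infty) /\
    an n = Cmult
      (RtoC (Rpower 4 (a - c) / PI ^ 2 * RGamma (2 * (c - a) + 1)
             * (Cmod (CGamma (a, INR n / 2)) / RGamma c) ^ 2
             * sinh (PI * INR n)))
      (RInt_gen (V := C_R_CompleteNormedModule) g (at_right 0) (Rbar_locally p_infty)).
Proof.
  intros Ha Hmax Hc2 _ [delta [Hdelta Hsum]] n Hn g.
  (* Adding [c > 1/2] and [c > 2 a - 1/2] gives [c > a], that is [d > 0]. *)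
  pose proof (Rmax_l (1/2) (2 * a - 1/2)). pose proof (Rmax_r (1/2) (2 * a - 1/2)).
  assert (Hc : 1/2 < c) by lra.
  set (d := c - a). assert (Hd : 0 < d) by (unfold d; lra). assert (Ecd : c = a + d) by (unfold d; ring).
  pose proof (eta_ratio_limit a c ltac:(lra)) as HLa. pose proof (eta_ratio_limit d c ltac:(lra)) as HLd.
  set (La := RGamma c * RGamma (1/2) / (RGamma (a + 1/2) * RGamma (c - a))) in HLa.
  set (Ld := RGamma c * RGamma (1/2) / (RGamma (d + 1/2) * RGamma (c - d))) in HLd.
  destruct (hyp_solution_decay a c Ha Hc) as [K [HK HF]].
  assert (Bm : forall m z, (1 <= m)%nat -> 0 <= z -> Rabs (mode a c m z) <= K * Rpower (1 + z) (- a)).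
  { intros m z Hm Hz. apply le_INR in Hm. simpl in Hm. destruct (mode_solution a c m ltac:(lra)) as [f1 [f2 Hf]].
    apply (HF (INR m / 2) _ f1 f2); trivial; [lra|apply mode_0]. }
  destruct (phi_kernel_bound a c d Ld n Ha Hd Ecd Hc HLd) as [Kp [HKp HP]].
  pose (W := fun x => Rpower x (2 * c - 1) * phi_kernel c d n x).
  (* Index [k] stands for the mode [k + 1], so the only non-zero value is at [k = pred n]. *)
  pose (lam := fun k => La * Ld / (2 * d) * PI / (beta a (INR (S k) / 2) * sinh (PI * INR (S k))) * if Nat.eqb n (S k) then PI else 0).
  assert (Hlam : forall k, is_pint (fun x => W x * mode a c (S k) (x ^ 2)) (lam k)).
  { intros k. destruct (mode_solution a c (S k) ltac:(lra)) as [f1 [f2 Hf]].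
    apply (phi_kernel_solution a c d La Ld K (beta a (INR (S k) / 2)) n (S k) _ f1 f2); trivial; try lia; try lra.
    - apply mode_0.
    - now apply beta_lim.
    - now apply beta_pos.
    - intros z Hz. apply Bm; trivial; lia. }
  assert (CW : forall x, 0 < x -> continuous W x).
  { intros x Hx. apply (continuous_mult (K := R_AbsRing)); [now apply continuous_Rpower|]. apply continuous_phi_kernel; lra. }
  assert (Cm : forall k x, continuous (fun x => mode a c (S k) (x ^ 2)) x).
  { intros k x. destruct (mode_solution a c (S k) ltac:(lra)) as [f1 [f2 Hf]]. apply (solution_sq_continuous _ _ _ _ _ _ _ Hf). }
  assert (Bk : forall k x, Rabs (mode a c (S k) (x ^ 2)) <= K).
  { intros k x. pose proof (pow2_ge_0 x). apply Rle_trans with (1 := Bm (S k) (x ^ 2) ltac:(lia) ltac:(lra)).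
    rewrite <- (Rmult_1_r K) at 2. apply Rmult_le_compat_l; [lra|].
    apply Rle_trans with (Rpower (1 + x ^ 2) 0); [apply Rpower_le_base1; lra|rewrite Rpower_O; lra]. }
  assert (BW : forall k x, 0 < x -> Rabs (W x * mode a c (S k) (x ^ 2)) <= Kp * K * 2 * tail_weight x).
  { intros k x Hx. rewrite Rabs_mult.
    pose proof (Rpower_le_tail_weight x (-1) Hx ltac:(lra)) as D0.
    apply Rle_trans with (Kp * Rpower (1 + x ^ 2) (a - 1) * (K * Rpower (1 + x ^ 2) (- a))).
    - apply Rmult_le_compat; try apply Rabs_pos; [now apply HP|]. apply Bm; [lia|apply pow2_ge_0].
    - transitivity (Kp * K * (Rpower (1 + x ^ 2) (a - 1) * Rpower (1 + x ^ 2) (- a))); [right; ring|].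
      rewrite <- Rpower_plus. replace (a - 1 + - a) with (-1) by ring.
      rewrite (Rmult_assoc _ 2). apply Rmult_le_compat_l; [apply Rmult_le_pos; lra|lra]. }
  assert (HM : 0 <= Kp * K * 2) by (repeat apply Rmult_le_pos; lra).
  pose proof (coefficients_summable a delta an Ha Hdelta Hsum) as Hcs.
  (* Stated for real coefficients dominated by [Cmod (an (S k))], in order to be applied to real and
     imaginary parts. *)
  assert (Part : forall u : nat -> R, (forall k, Rabs (u k) <= Cmod (an (S k))) ->
     (exists M, 0 <= M /\ forall x, 0 < x -> Rabs (W x * Series (fun k => u k * mode a c (S k) (x ^ 2))) <= M * tail_weight x) /\
     (forall x, 0 < x -> continuous (fun x => W x * Series (fun k => u k * mode a c (S k) (x ^ 2))) x) /\
     is_pint (fun x => W x * Series (fun k => u k * mode a c (S k) (x ^ 2))) (u (pred n) * lam (pred n))).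
  { intros u Hu.
    assert (Eu : ex_series (fun k => Rabs (u k))).
    { apply (ex_series_le (K := R_AbsRing) (V := R_CompleteNormedModule) _ (fun k => Cmod (an (S k)))); trivial.
      intros k. unfold norm; simpl. unfold abs; simpl. rewrite Rabs_Rabsolu. apply Hu. }
    destruct (weighted_series_pint W u lam (fun k x => mode a c (S k) (x ^ 2)) K (Kp * K * 2) tail_weight _ _ _ HM tail_weight_dominator CW Cm Bk BW Eu Hlam)
      as [B [l [Hl Hs]]].
    split; [|split].
    - exists (Kp * K * 2 * Series (fun k => Rabs (u k))). split; trivial. apply Rmult_le_pos; trivial.
      apply Rle_trans with (2 := Series_Rabs u Eu). apply Rabs_pos.
    - intros x Hx. apply (continuous_mult (K := R_AbsRing)); [now apply CW|].
      now apply (continuous_weighted_series u (fun k x => mode a c (S k) (x ^ 2)) K).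
    - apply (is_series_single _ (pred n)) in Hs; [now rewrite <- Hs|].
      intros k Hk. unfold lam. destruct (Nat.eqb_spec n (S k)); [subst n; now elim Hk|ring]. }
  destruct (Part (fun k => Re (an (S k))) ltac:(intros k; apply re_le_Cmod)) as [[M1 [HM1 B1]] [C1 I1]].
  destruct (Part (fun k => Im (an (S k))) ltac:(intros k; apply Rle_trans with (2 := Rmax_Cmod _); apply Rmax_r)) as [[M2 [HM2 B2]] [C2 I2]].
  assert (Eg : forall x, g x = (W x * Series (fun k => Re (an (S k)) * mode a c (S k) (x ^ 2)), W x * Series (fun k => Im (an (S k)) * mode a c (S k) (x ^ 2)))).
  { intros x. unfold g. rewrite Phi_eq by lra. rewrite fser_eq by trivial. fold d. unfold W.
    apply injective_projections; simpl; ring. }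
  replace (S (pred n)) with n in I1, I2 by lia.
  assert (Ig : is_RInt_gen (V := C_R_NormedModule) g (at_right 0) (Rbar_locally p_infty) ((Re (an n) * lam (pred n), Im (an n) * lam (pred n)) : C)).
  { refine (is_RInt_gen_ext (V := C_R_NormedModule) _ _ _ _ (RInt_gen_pair _ _ _ _ I1 I2)).
    apply filter_forall. intros ab x _. now rewrite Eg. }
  split; [|split].
  (* Absolute convergence: the modulus is at most the sum of the absolute values of the two
     components, each bounded by a multiple of [tail_weight]. *)
  - destruct (dominated_ex_pint (fun x => Cmod (g x)) tail_weight _ _ _ (M1 + M2) ltac:(lra) tail_weight_dominator) as [l Hl].
    + intros x Hx. apply continuous_ext with (fun x => Cmod (W x * Series (fun k => Re (an (S k)) * mode a c (S k) (x ^ 2)), W x * Series (fun k => Im (an (S k)) * mode a c (S k) (x ^ 2)))).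
      { intros y. now rewrite Eg. }
      unfold Cmod; simpl fst; simpl snd. apply continuous_sqrt_comp.
      apply (continuous_plus (V := R_NormedModule)).
      * apply (continuous_comp _ (fun t => t ^ 2)); [now apply C1|].
        apply (ex_derive_continuous (K := R_AbsRing) (V := R_NormedModule)). auto_derive; trivial.
      * apply (continuous_comp _ (fun t => t ^ 2)); [now apply C2|].
        apply (ex_derive_continuous (K := R_AbsRing) (V := R_NormedModule)). auto_derive; trivial.
    + intros x Hx. rewrite Rabs_pos_eq by apply Cmod_ge_0. rewrite Eg.
      apply Rle_trans with (1 := Cmod_le_abs _ _). rewrite Rmult_plus_distr_r. apply Rplus_le_compat; [now apply B1|now apply B2].
    + now exists l.
  - eexists. exact Ig.
  - rewrite (is_RInt_gen_unique (V := C_R_CompleteNormedModule) _ _ Ig).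
    (* The constant of the theorem is the reciprocal of the surviving [lam]. One factor [PI] comes
       from the Poisson limit and one from the norm of the sine; [kernel_constant] accounts for the
       Gamma factors. *)
    assert (EL : Rpower 4 (a - c) / PI ^ 2 * RGamma (2 * d + 1) * (Cmod (CGamma (a, INR n / 2)) / RGamma c) ^ 2 * sinh (PI * INR n) * lam (pred n) = 1).
    { unfold lam. replace (S (pred n)) with n by lia. rewrite Nat.eqb_refl.
      pose proof (kernel_constant a (INR n / 2) c d Ha Hd Ecd) as KC. fold La in KC. fold Ld in KC.
      pose proof (RGamma_pos c ltac:(lra)) as HGc.
      replace ((Cmod (CGamma (a, INR n / 2)) / RGamma c) ^ 2) with (Cmod (CGamma (a, INR n / 2)) ^ 2 / RGamma c ^ 2) by (field; lra).
      rewrite Cmod_CGamma by trivial. fold d.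
      replace (a - c) with (- d) by (unfold d; ring). rewrite Rpower_Ropp.
      apply le_INR in Hn. simpl in Hn. pose proof PI_RGT_0.
      assert (0 < sinh (PI * INR n)) by (apply sinh_pos, Rmult_lt_0_compat; lra).
      assert (0 < Rpower 4 d) by apply exp_pos. pose proof (beta_pos a (INR n / 2) Ha).
      pose proof (RGamma_pos (2 * d + 1) ltac:(lra)).
      match goal with |- ?l = 1 => replace l with (/ Rpower 4 d * RGamma (2 * d + 1) / RGamma c ^ 2 * (La * Ld / (2 * d) * (Gamma_norm2 a (INR n / 2) / beta a (INR n / 2)))) by (field; repeat split; lra) end.
      rewrite KC. field. repeat split; lra. }
    match type of EL with ?k * _ = 1 => set (kk := k) in * end.
    clearbody kk. set (l0 := lam (pred n)) in *. clearbody l0.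
    apply injective_projections; simpl.
    + transitivity (fst (an n) * (kk * l0)); [rewrite EL; ring|unfold Re, Im; ring].
    + transitivity (snd (an n) * (kk * l0)); [rewrite EL; ring|unfold Re, Im; ring].
Qed.
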